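(* Let $n\ge 1$, $\lambda>0$, let $K$ be a closed subgroup of $U(n)$, $G=G_0\rtimes K$ the associated Heisenberg motion group, $\rho$ a unitary irreducible representation of $K$ on a finite-dimensional Hilbert space $V$ associated with the coadjoint orbit $o(\phi_0)$ of $K$, and let $\pi$ be the corresponding generic unitary representation of $G$ on $\mathcal H=\mathcal H_0\otimes V$. Let $W$ be the linear map, defined on trace-class operators on $\mathcal H$, with $W(A_0\otimes A_1)(z,\phi)=W_0(A_0)(z)\,w_1(A_1)(\phi)$. Then $W$ is a Stratonovich-Weyl correspondence for the triple $(G,\pi,\mathbb C^n\times o(\phi_0))$, where $\mathbb C^n\times o(\phi_0)$ carries the $G$-invariant measure $\mu_\lambda\otimes\nu$. That is, $W$ is a linear isomorphism onto its image (a vector space of functions on $\mathbb C^n\times o(\phi_0)$) and, for all trace-class operators $A,B$ on $\mathcal H$, all $g\in G$ and all $(z,\phi)\in\mathbb C^n\times o(\phi_0)$: (1) $W(A^* )=\overline{W(A)}$; (2) $W(\pi(g)A\pi(g)^{-1})(z,\phi)=W(A)(g^{-1}\cdot(z,\phi))$; (3) $\int_{\mathbb C^n\times o(\phi_0)}W(A)\,W(B)\,d(\mu_\lambda\otimes\nu)=\operatorname{Tr}(AB)$.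
   Context: Notation: for $z,w\in\mathbb C^n$, $zw:=\sum_k z_kw_k$ and $|z|^2=z\bar z$; $\omega(z,z')=\frac i2(z\bar z'-\bar z z')$. Inner products are linear in the first variable. Groups. $G_0=\mathbb C^n\times\mathbb R$ is the Heisenberg group with $(z,c)\cdot(z',c')=(z+z',c+c'+\frac12\omega(z,z'))$. For a closed subgroup $K\subset U(n)$ with Lie algebra $\mathfrak k$, the Heisenberg motion group $G=G_0\rtimes K$ consists of triples $(z,c,k)$ with $(z,c,k)\cdot(z',c',k')=(z+kz',c+c'+\frac12\omega(z,kz'),kk')$. Fock space. $d\mu_\lambda(z)=(2\pi\lambda)^{-n}dx\,dy$ for $z=x+iy$. $\mathcal H_0$ is the Hilbert space of holomorphic $f:\mathbb C^n\to\mathbb C$ with $\int|f(z)|^2e^{-|z|^2/2\lambda}d\mu_\lambda(z)<\infty$. $\mathcal H$ is the Hilbert space of holomorphic $f:\mathbb C^n\to V$ with $\int\|f(z)\|_V^2e^{-|z|^2/2\lambda}d\mu_\lambda(z)<\infty$; $\mathcal H=\mathcal H_0\otimes V$. The representation $\pi$ of $G$ on $\mathcal H$ is, for $g=(z_0,c_0,k)$, $$(\pi(g)f)(z)=\exp\left(i\lambda c_0+\tfrac i2\bar z_0z-\tfrac\lambda4|z_0|^2\right)\rho(k)f(k^{-1}(z+i\lambda z_0)).$$ Map $W_0$. For $z\in\mathbb C^n$ let $(\Omega_0(z)f)(w)=2^n\exp\left(\tfrac1\lambda(w\bar z-|z|^2)\right)f(2z-w)$ on $\mathcal H_0$. For $A_0$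 trace-class on $\mathcal H_0$, $W_0(A_0)(z):=\operatorname{Tr}(A_0\Omega_0(z))$. Berezin calculus on $o(\phi_0)$. $o(\phi_0)\subset\mathfrak k^*$ is the orbit of $\phi_0$ under the coadjoint action $\mathrm{Ad}^*$ of $K$. That $\rho$ is associated with $o(\phi_0)$ means that there is a unit vector $e_0\in V$ (a highest weight vector when $K$ is connected) with $\langle\phi_0,A\rangle=-i\langle d\rho(A)e_0,e_0\rangle$ for $A\in\mathfrak k$ and such that the stabilizer of $\phi_0$ in $K$ is the stabilizer of the line $\mathbb Ce_0$. The Berezin symbol of $A_1\in\operatorname{End}(V)$ is the function $s_1(A_1)(\mathrm{Ad}^*(k)\phi_0)=\langle A_1\rho(k)e_0,\rho(k)e_0\rangle$ on $o(\phi_0)$. Standing (known) properties: $s_1$ is linear and injective, $s_1(\mathrm{id}_V)=1$, $s_1(A_1^* )=\overline{s_1(A_1)}$, and $s_1(A_1)(\mathrm{Ad}^*(k)\phi)=s_1(\rho(k)^{-1}A_1\rho(k))(\phi)$. Map $w_1$. Fix a nonzero $K$-invariant (finite, positive) measure $\nu$ on $o(\phi_0)$. Regard $Sy(o(\phi_0))=s_1(\operatorname{End}(V))$ as a subspace of $L^2(o(\phi_0),\nu)$ and equip $\operatorname{End}(V)$ with the Hilbert-Schmidt inner product. Then $w_1=s_1(s_1^*s_1)^{-1/2}:\operatorname{End}(V)\to Sy(o(\phi_0))$ is the unitary part of the polar decomposition of $s_1$. Map $W$. $(A_0\otimes A_1)(f_0\otimes v)=A_0f_0\otimes A_1v$;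 since $\dim V<\infty$, every trace-class operator on $\mathcal H$ is a finite sum of operators $A_0\otimes A_1$ with $A_0$ trace-class on $\mathcal H_0$ and $A_1\in\operatorname{End}(V)$, and $W$ is extended linearly from such products. Action of $G$ on $\mathbb C^n\times o(\phi_0)$: $(z_0,c_0,k)\cdot(z,\phi)=(kz-i\lambda z_0,\mathrm{Ad}^*(k)\phi)$. *)

(* Defs.v *)
From HB Require Import structures.
From mathcomp Require Import all_boot all_order all_algebra.
From mathcomp Require Import sesquilinear spectral.
From mathcomp Require Import complex.
From mathcomp Require Import all_classical all_reals all_analysis.

Set Implicit Arguments.
Unset Strict Implicit.
Unset Printing Implicit Defensive.

Import Order.TTheory GRing.Theory Num.Theory.
Import numFieldNormedType.Exports.

Local Open Scope classical_set_scope.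
Local Open Scope ring_scope.
Local Open Scope complex_scope.

(* [Re] and [Im] are the [R]-valued projections of [R[i]]. *)
Local Notation Re := complex.Re.
Local Notation Im := complex.Im.

(* The field [R[i]] with the topology and norm given by its modulus. *)
Set Warnings "-redundant-canonical-projection,-HB.no-new-instance".
HB.instance Definition _ (R : realType) := NormedModule.copy R[i] (R[i])^o.
HB.instance Definition _ (R : realType) := Pointed.copy R[i] (R[i])^o.

Section ComplexAnalysis.
Context (R : realType).
Local Notation C := R[i].

Definition cexp (z : C) : C := (expR (Re z))%:C * (cos (Im z) +i* sin (Im z)).

(* Derivative at [t] of a complex-valued function of a real variable. *)
Definition cderive (f : R -> C) (t : R) : C :=
  derive1 (fun s => Re (f s)) t +i* derive1 (fun s => Im (f s)) t.

Definition cintegrable {d} {T : measurableType d} (mu : {measure set T -> \bar R})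
    (f : T -> C) : Prop :=
  mu.-integrable [set: T] (fun x => (Re (f x))%:E) /\
  mu.-integrable [set: T] (fun x => (Im (f x))%:E).

Definition cintegral {d} {T : measurableType d} (mu : {measure set T -> \bar R})
    (f : T -> C) : C :=
  Rintegral mu [set: T] (fun x => Re (f x)) +i*
  Rintegral mu [set: T] (fun x => Im (f x)).

End ComplexAnalysis.

(* A Hilbert space is given by a subspace [D] of an ambient complex vector
   space and a form [dot] that is an inner product on [D]. An operator is a map
   of the ambient space of which only the restriction to [D] matters. *)
Section Operators.
Context (R : realType) (E : lmodType R[i]).
Variables (D : set E) (dot : E -> E -> R[i]).

Definition is_operator (A : E -> E) : Prop :=
  (forall f, D f -> D (A f)) /\
  (forall (a : R[i]) f g, D f -> D g -> A (a *: f + g) = a *: A f + A g).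

Definition bounded_operator (A : E -> E) : Prop :=
  is_operator A /\
  exists M : R, forall f, D f -> Re (dot (A f) (A f)) <= M * Re (dot f f).

(* Infinite-dimensional separable case. *)
Definition orthonormal_basis (e : nat -> E) : Prop :=
  [/\ forall k, D (e k),
      forall j k, dot (e j) (e k) = (j == k)%:R
    & forall f, D f -> (forall k, dot f (e k) = 0) -> f = 0].

(* [S] is a positive square root of [T]; on [R[i]], [0 <= x] says that [x] is a
   nonnegative real number. *)
Definition is_sqrt_op (T S : E -> E) : Prop :=
  [/\ is_operator S,
      forall f, D f -> 0 <= dot (S f) f
    & forall f, D f -> S (S f) = T f].

Definition sqrt_op (T : E -> E) : E -> E := xget (fun=> 0) (is_sqrt_op T).

Definition inv_op (A : E -> E) : E -> E := 'pinv_(fun=> 0) D A.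

Definition is_trace (A : E -> E) (t : R[i]) : Prop :=
  forall e, orthonormal_basis e ->
    series (fun k => dot (A (e k)) (e k)) @ \oo --> t.

Definition trace_op (A : E -> E) : R[i] := xget 0 (is_trace A).

End Operators.

Section Adjoint.
Context (R : realType) (E1 E2 : lmodType R[i]).
Variables (D1 : set E1) (dot1 : E1 -> E1 -> R[i]).
Variables (D2 : set E2) (dot2 : E2 -> E2 -> R[i]).

Definition is_adjoint (A : E1 -> E2) (B : E2 -> E1) : Prop :=
  (forall g, D2 g -> D1 (B g)) /\
  (forall f g, D1 f -> D2 g -> dot2 (A f) g = dot1 f (B g)).

Definition adjoint (A : E1 -> E2) : E2 -> E1 := xget (fun=> 0) (is_adjoint A).

End Adjoint.

Section TraceClass.
Context (R : realType) (E : lmodType R[i]).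
Variables (D : set E) (dot : E -> E -> R[i]).

(* [|A| = (A^* A)^(1/2)] has finite trace. *)
Definition trace_class (A : E -> E) : Prop :=
  bounded_operator D dot A /\
  exists (B S : E -> E) (e : nat -> E),
    [/\ is_adjoint D dot D dot A B,
        is_sqrt_op D dot (B \o A) S,
        orthonormal_basis D dot e
      & cvgn (series (fun k => Re (dot (S (e k)) (e k))))].

End TraceClass.

(* The definition of a Stratonovich-Weyl correspondence for [(G, pi, M)]: [G]
   is a subset of the type [gT], with inversion [inv]; the Hilbert space of [pi]
   is [(D, dot)]; [G] acts on [M] by [act]. Operators are compared on [D]. *)
Record stratonovich_weyl (R : realType) (E : lmodType R[i]) (D : set E)
    (dot : E -> E -> R[i]) (gT : Type) (G : set gT) (inv : gT -> gT)
    (pi : gT -> E -> E) (d : measure_display) (M : measurableType d)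
    (act : gT -> M -> M) (mu : {measure set M -> \bar R})
    (W : (E -> E) -> M -> R[i]) : Prop := StratonovichWeyl {
  sw_invariant : forall g (X : set M), G g -> measurable X ->
    measurable (act g @^-1` X) /\ mu (act g @^-1` X) = mu X;
  sw_linear : forall (a : R[i]) A B, trace_class D dot A -> trace_class D dot B ->
    W (a *: A + B) = a *: W A + W B;
  sw_injective : forall A B, trace_class D dot A -> trace_class D dot B ->
    W A = W B -> forall f, D f -> A f = B f;
  sw_adjoint : forall A, trace_class D dot A -> forall m,
    W (adjoint D dot D dot A) m = Num.conj (W A m);
  sw_covariant : forall g A, G g -> trace_class D dot A -> forall m,
    W (pi g \o A \o inv_op D (pi g)) m = W A (act (inv g) m);
  sw_trace : forall A B, trace_class D dot A -> trace_class D dot B ->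
    cintegrable mu (fun m => W A m * W B m) /\
    cintegral mu (fun m => W A m * W B m) = trace_op D dot (A \o B)
}.

Section ComplexSpace.
Context (R : realType) (n : nat).
Local Notation C := R[i].

Definition cdot (z w : 'cV[C]_n) : C := \sum_k z k 0 * w k 0.
Definition zbar (z : 'cV[C]_n) : 'cV[C]_n := map_mx Num.conj z.
Definition sqnorm (z : 'cV[C]_n) : R := Re (cdot z (zbar z)).

Definition omega (z w : 'cV[C]_n) : R :=
  Re ('i / 2%:R * (cdot z (zbar w) - cdot (zbar z) w)).

Definition real_coords (z : 'cV[C]_n) : n.-tuple (R * R) :=
  [tuple (Re (z k 0), Im (z k 0)) | k < n].
Definition of_real_coords (t : n.-tuple (R * R)) : 'cV[C]_n :=
  \col_k ((tnth t k).1 +i* (tnth t k).2).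

Lemma of_real_coordsK : cancel of_real_coords real_coords.
Proof.
move=> t; apply: eq_from_tnth => k.
by rewrite tnth_mktuple mxE; case: (tnth t k).
Qed.

(* [C^n] with its Borel sets, the ones of [(R * R)^n]. *)
Definition Cn : Type :=
  g_sigma_algebra_preimageType
    (real_coords : 'cV[C]_n -> n.-tuple (measurableTypeR R * measurableTypeR R)).

End ComplexSpace.

Section LebesgueMeasure.
Context (R : realType).
Local Notation C := R[i].
Local Notation R2 := (measurableTypeR R * measurableTypeR R)%type.
Local Notation leb := (@lebesgue_measure R).

Definition tuple_cons (n : nat)
    (p : n.-tuple R2 * measurableTypeR R * measurableTypeR R) : n.+1.-tuple R2 :=
  [tuple of (p.1.2, p.2) :: p.1.1].

Lemma measurable_tuple_cons n : measurable_fun [set: _] (@tuple_cons n).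
Proof.
apply: measurable_cons; last exact: measurableT_comp.
by apply/measurable_fun_pair => //=; exact: measurableT_comp.
Qed.

Lemma measurable_of_real_coords n :
  measurable_fun [set: n.-tuple R2] (@of_real_coords R n : _ -> Cn R n).
Proof.
move=> _ A [B mB <-]; rewrite !setTI -comp_preimage.
rewrite (_ : _ \o _ = idfun) ?preimage_id//.
by apply/funext => t; exact: of_real_coordsK.
Qed.

Definition pushforward_measure d1 d2 (T1 : measurableType d1)
    (T2 : measurableType d2) (m : {measure set T1 -> \bar R}) (f : T1 -> T2)
    (mf : measurable_fun [set: T1] f) : {measure set T2 -> \bar R} :=
  @measure_function_pushforward__canonical__measure_function_Measure
    _ _ _ _ R m f mf.

(* Lebesgue measure of [(R * R)^n]. *)
Fixpoint lebesgue_tuple (n : nat) : {measure set (n.-tuple R2) -> \bar R} :=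
  if n is n'.+1 then
    pushforward_measure (lebesgue_tuple n' \x leb \x leb)%E
      (@measurable_tuple_cons n')
  else \d_([tuple] : 0.-tuple R2).

Definition lebesgue_Cn (n : nat) : {measure set (Cn R n) -> \bar R} :=
  pushforward_measure (lebesgue_tuple n) (@measurable_of_real_coords n).

Lemma fock_const_ge0 (n : nat) (lam : {posnum R}) :
  0 <= (2%:R * pi * lam%:num) ^- n :> R.
Proof. by rewrite invr_ge0 exprn_ge0// !mulr_ge0// pi_ge0. Qed.

(* [d mu_lambda = (2 pi lambda)^(-n) dx dy] *)
Definition fock_measure (n : nat) (lam : {posnum R}) :
    {measure set (Cn R n) -> \bar R} :=
  mscale (NngNum (fock_const_ge0 n lam)) (lebesgue_Cn n).

End LebesgueMeasure.

Section FockSpace.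
Context (R : realType) (n : nat) (lam : {posnum R}) (V : lmodType R[i]).
Local Notation C := R[i].
Variable dotV : V -> V -> C.

Definition gauss (z : 'cV[C]_n) : R := expR (- (sqnorm z / (2%:R * lam%:num))).

(* [dotV] is meant to be an inner product on a finite-dimensional [V], so that
   holomorphy can be tested on the functions [<f(z), v>]. *)
Definition holomorphic (f : 'cV[C]_n -> V) : Prop :=
  forall v z, differentiable (fun z => dotV (f z) v) z.

Definition fock : set ('cV[C]_n -> V) :=
  [set f | holomorphic f /\
     (\int[fock_measure n lam]_z (Re (dotV (f z) (f z)) * gauss z)%:E < +oo)%E].

Definition fock_dot (f g : 'cV[C]_n -> V) : C :=
  cintegral (fock_measure n lam) (fun z => dotV (f z) (g z) * (gauss z)%:C).

End FockSpace.

Section ScalarFock.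
Context (R : realType) (n : nat) (lam : {posnum R}).
Local Notation C := R[i].

Definition dotC (a b : C^o) : C := a * Num.conj b.

(* The Hilbert space [H_0]. *)
Definition fock0 : set ('cV[C]_n -> C^o) := fock lam dotC.
Definition fock0_dot : ('cV[C]_n -> C^o) -> ('cV[C]_n -> C^o) -> C :=
  fock_dot lam dotC.

Definition Omega0 (z : 'cV[C]_n) (f : 'cV[C]_n -> C^o) : 'cV[C]_n -> C^o :=
  fun w => 2%:R ^+ n *
    cexp ((lam%:num^-1)%:C * (cdot w (zbar z) - (sqnorm z)%:C)) *
    f (2%:R *: z - w).

Definition W0 (A0 : ('cV[C]_n -> C^o) -> 'cV[C]_n -> C^o) (z : 'cV[C]_n) : C :=
  trace_op fock0 fock0_dot (A0 \o Omega0 z).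

End ScalarFock.


Record unitary_subgroup (R : realType) (n : nat) := UnitarySubgroup {
  usub :> 'M[R[i]]_n -> Prop;
  usub_unitary : forall k, usub k -> k \is unitarymx;
  usub1 : usub 1%:M;
  usubM : forall k l, usub k -> usub l -> usub (k *m l);
  usubV : forall k, usub k -> usub (invmx k);
  usub_closed : closed (usub : set 'M[R[i]]_n)
}.

Section LieGroup.
Context (R : realType) (n : nat) (K : unitary_subgroup R n).
Local Notation C := R[i].

Definition expm (X : 'M[C]_n) : 'M[C]_n :=
  limn (series (fun j => (j`!%:R)^-1 *: X ^+ j)).

(* The Lie algebra of [K]. *)
Definition lie : set 'M[C]_n := [set X | forall t : R, K (expm (t%:C *: X))].

(* Linear forms on [lie] are represented by their extensions by [0]. *)
Definition lie_dual : set ('M[C]_n -> R) :=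
  [set phi |
    (forall (t : R) X Y, lie X -> lie Y -> phi (t%:C *: X + Y) = t * phi X + phi Y) /\
    (forall X, ~ lie X -> phi X = 0)].

(* [Ad^*(k) phi = phi \o Ad(k^-1)] *)
Definition coad (k : 'M[C]_n) (phi : 'M[C]_n -> R) : 'M[C]_n -> R :=
  fun X => phi (invmx k *m X *m k).

Definition orbit (phi0 : 'M[C]_n -> R) : set ('M[C]_n -> R) :=
  [set phi | exists2 k, K k & phi = coad k phi0].

Definition orbit_space (phi0 : 'M[C]_n -> R) : Type := set_type (orbit phi0).

End LieGroup.

Section OrbitSpace.
Context (R : realType) (n : nat) (K : unitary_subgroup R n).
Variable phi0 : 'M[R[i]]_n -> R.
Local Notation orb := (orbit_space K phi0).

Lemma orbit_base : phi0 \in orbit K phi0.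
Proof.
apply/mem_set; exists 1%:M; first exact: usub1.
by apply/funext => X; rewrite /coad invmx1 mul1mx mulmx1.
Qed.

HB.instance Definition _ := SubChoice.on orb.
HB.instance Definition _ := isPointed.Build orb (exist _ phi0 orbit_base).

(* The Borel sets of the orbit are generated by the coordinate functions
   [phi |-> phi X]; only the [X] in the finite-dimensional space [lie K] matter
   as [phi X = 0] for the other ones. *)
Definition orbit_cylinders : set (set orb) :=
  [set A | exists X (B : set (measurableTypeR R)),
     measurable B /\ A = [set phi : orb | B (val phi X)]].

Let orbit_measurableC (A : set orb) :
  <<s orbit_cylinders >> A -> <<s orbit_cylinders >> (~` A).
Proof. by move=> sA; rewrite -setTD; exact: sigma_algebraCD. Qed.

HB.instance Definition _ :=
  @isMeasurable.Build (sigma_display orbit_cylinders) orb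
    <<s orbit_cylinders >> (@sigma_algebra0 _ setT orbit_cylinders)
    orbit_measurableC (@sigma_algebra_bigcup _ setT orbit_cylinders).

(* [Ad^*(k)] on the orbit, for [k] in [K] *)
Definition coad_orbit (k : 'M[R[i]]_n) (phi : orb) : orb :=
  insubd phi (coad k (val phi)).

Lemma val_coad_orbit k (phi : orb) : K k ->
  val (coad_orbit k phi) = coad k (val phi).
Proof.
move=> Kk; rewrite insubdK//; apply/mem_set.
have [l Kl ->] := set_mem (valP phi); exists (k *m l); first exact: usubM.
have [Uk Ul] : k \is unitarymx /\ l \is unitarymx.
  by split; apply: (@usub_unitary _ _ K).
apply/funext => X; rewrite /coad !invmx_unitary ?mul_unitarymx//.
by rewrite trmx_mul map_mxM !mulmxA.
Qed.

End OrbitSpace.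

Section Representation.
Context (R : realType) (n : nat) (K : unitary_subgroup R n).
Context (V : vectType R[i]) (dotV : {dot V for Num.conj}).
Local Notation C := R[i].
Variable rho : 'M[C]_n -> 'End(V).

Definition unitary_irrep : Prop :=
  [/\ rho 1%:M = \1%VF /\
        (forall k l, K k -> K l -> rho (k *m l) = (rho k \o rho l)%VF),
      forall k u v, K k -> dotV (rho k u) (rho k v) = dotV u v,
      forall u v, {within usub K, continuous (fun k => dotV (rho k u) v)},
      (fullv : {vspace V}) != 0%VS
    & forall U : {vspace V}, (forall k, K k -> (rho k @: U <= U)%VS) ->
        U = 0%VS \/ U = fullv].

(* The differential of [rho], computed coordinatewise. *)
Definition drho (X : 'M[C]_n) (u : V) : V :=
  \sum_i cderive
    (fun t => coord (vbasis fullv) i (rho (expm (t%:C *: X)) u)) 0 *: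
    (vbasis fullv)`_i.

Variables (phi0 : 'M[C]_n -> R) (e0 : V).

Definition associated : Prop :=
  [/\ dotV e0 e0 = 1,
      forall X, lie K X -> (phi0 X)%:C = - 'i * dotV (drho X e0) e0
    & forall k, K k ->
        (coad k phi0 = phi0 <-> exists c : C, rho k e0 = c *: e0)].

Local Notation orb := (orbit_space K phi0).

(* [s_1(A) (Ad^*(k) phi0) = <A rho(k) e0, rho(k) e0>]; by the condition on
   stabilizers, the choice of [k] in [K] does not matter. *)
Definition berezin (A : 'End(V)) (phi : orb) : C :=
  let k := xget 1%:M [set k | K k /\ val phi = coad k phi0] in
  dotV (A (rho k e0)) (rho k e0).

Definition adjV (A : 'End(V)) : 'End(V) :=
  xget 0 [set B : 'End(V) | forall u v, dotV (A u) v = dotV u (B v)].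

Definition traceV (A : 'End(V)) : C :=
  \tr (passmx.mxof (vbasis fullv) (vbasis fullv) A).

(* The Hilbert-Schmidt inner product *)
Definition hs_dot (A B : 'End(V)) : C := traceV (A \o adjV B)%VF.

Variable nu : {measure set orb -> \bar R}.

Definition L2_dot (f g : orb -> C) : C :=
  cintegral nu (fun phi => f phi * Num.conj (g phi)).

(* [s_1^* s_1], where [s_1] maps [End(V)] to [Sy = range s_1]. *)
Definition berezin_gram : 'End(V) -> 'End(V) :=
  adjoint [set: 'End(V)] hs_dot (range berezin) L2_dot berezin \o berezin.

(* [w_1 = s_1 (s_1^* s_1)^(-1/2)] *)
Definition w1 : 'End(V) -> orb -> C :=
  berezin \o inv_op [set: 'End(V)] (sqrt_op [set: 'End(V)] hs_dot berezin_gram).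

End Representation.

Section MotionGroup.
Context (R : realType) (n : nat).
Local Notation C := R[i].

Record motion := Motion { mz : 'cV[C]_n; mc : R; mk : 'M[C]_n }.

Definition motion_mul (g h : motion) : motion :=
  Motion (mz g + mk g *m mz h) (mc g + mc h + omega (mz g) (mk g *m mz h) / 2%:R)
    (mk g *m mk h).

Definition motion_one : motion := Motion 0 0 1%:M.

Definition motion_inv (g : motion) : motion :=
  Motion (- (invmx (mk g) *m mz g)) (- mc g) (invmx (mk g)).

(* The Heisenberg motion group of [K]. *)
Definition motion_group (K : unitary_subgroup R n) : set motion :=
  [set g | K (mk g)].

Lemma motion_mulgV (K : unitary_subgroup R n) g :
  motion_group K g -> motion_mul g (motion_inv g) = motion_one.
Proof.
case: g => z c k /= Kk; have uk := unitarymx_unit (usub_unitary Kk).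
rewrite /motion_mul /= mulmxN mulmxA mulmxV// mul1mx subrr; congr Motion.
rewrite subrr add0r (_ : omega z (- z) = 0) ?mul0r// /omega.
rewrite (_ : _ - _ = 0) ?mulr0//; apply/eqP; rewrite subr_eq0; apply/eqP.
by apply: eq_bigr => i _; rewrite !mxE rmorphN mulrN mulrN mulrC.
Qed.

End MotionGroup.

Section MotionRepresentation.
Context (R : realType) (n : nat) (lam : {posnum R}) (K : unitary_subgroup R n).
Context (V : vectType R[i]) (dotV : {dot V for Num.conj}).
Local Notation C := R[i].
Variable rho : 'M[C]_n -> 'End(V).
Local Notation lamC := ((lam%:num)%:C).

(* The Hilbert space [H = H_0 (x) V]. *)
Definition fockV : set ('cV[C]_n -> V) := fock lam dotV.
Definition fockV_dot : ('cV[C]_n -> V) -> ('cV[C]_n -> V) -> C :=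
  fock_dot lam dotV.

Definition motion_rep (g : motion R n) (f : 'cV[C]_n -> V) : 'cV[C]_n -> V :=
  fun z =>
    cexp ('i * lamC * (mc g)%:C + 'i / 2%:R * cdot (zbar (mz g)) z
          - lamC / 4%:R * (sqnorm (mz g))%:C) *:
    rho (mk g) (f (invmx (mk g) *m (z + ('i * lamC) *: mz g))).

Variable phi0 : 'M[C]_n -> R.
Local Notation phase_space := (Cn R n * orbit_space K phi0)%type.

Definition motion_act (g : motion R n) (p : phase_space) : phase_space :=
  ((mk g *m p.1 - ('i * lamC) *: mz g : 'cV[C]_n), coad_orbit (mk g) p.2).

(* [A = A0 (x) A1] *)
Definition is_tensor (A0 : ('cV[C]_n -> C^o) -> 'cV[C]_n -> C^o) (A1 : 'End(V))
    (A : ('cV[C]_n -> V) -> 'cV[C]_n -> V) : Prop :=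
  forall f0 v, fock0 lam f0 ->
    A (fun z => f0 z *: v) = (fun z => A0 f0 z *: A1 v).

Variables (e0 : V) (nu : {measure set (orbit_space K phi0) -> \bar R}).

(* [W] is linear on trace-class operators and
   [W (A0 (x) A1) (z, phi) = W0 A0 z * w1 A1 phi]. *)
Definition is_weyl_map
    (W : (('cV[C]_n -> V) -> 'cV[C]_n -> V) -> phase_space -> C) : Prop :=
  (forall (a : C) A B, trace_class fockV fockV_dot A ->
     trace_class fockV fockV_dot B -> W (a *: A + B) = a *: W A + W B) /\
  (forall A0 A1 A, trace_class (fock0 (n := n) lam) (fock0_dot lam) A0 ->
     trace_class fockV fockV_dot A -> is_tensor A0 A1 A ->
     forall z phi, W A (z, phi) = W0 lam A0 z * w1 dotV rho e0 nu A1 phi).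

End MotionRepresentation.

(* Main.v *)
(** Moyal's identity [\int <Om(z) v, u> <Om(z) v', u'> dmu = <v, u'> <v', u>]
    is the reproducing property of Gaussians when [u, v, u', v'] are coherent
    states, since then the integrand is holomorphic in one pair of variables and
    antiholomorphic in the other up to a Gaussian weight; it extends to the whole
    Fock space because coherent states span it. The singular expansion of a
    trace-class operator turns it into the trace formula for [W0]; covariance of
    [W0] reduces to conjugating [Om(z)] by the operators of the representation.

    Once the symbol map [s1] is bounded and injective into [L^2(nu)], [w1] is an
    isometry, and uniqueness of the positive square root of [s1^* s1] makes it
    commute with whatever [s1^* s1] commutes with: conjugation by [rho(k)] and
    the adjoint. Berezin symbols are measurable because they are continuous on
    the compact group [K] and factor through finitely many of the inequalities
    [phi X < q] up to arbitrarily small error; continuity of [k |-> Ad^*(k) phi0]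
    comes from the differentiability of the continuous one-parameter groups
    [rho(exp(t X))]. Matrix coefficients over a basis of [V] reduce a trace-class
    operator on [H0 (x) V] to the scalar and finite-dimensional cases. *)
Require Import Defs.
From HB Require Import structures.
From mathcomp Require Import all_boot all_order all_algebra.
From mathcomp Require Import sesquilinear spectral complex ring lra.
From mathcomp Require Import all_classical all_reals all_analysis.
From mathcomp.analysis Require Import measurable_realfun.

Set Implicit Arguments.
Unset Strict Implicit.
Unset Printing Implicit Defensive.

Import Order.TTheory GRing.Theory Num.Theory.
Import numFieldNormedType.Exports.

Local Open Scope classical_set_scope.
Local Open Scope ring_scope.

Local Notation Re := complex.Re.
Local Notation Im := complex.Im.
Local Notation "x %:C" := (real_complex _ x) : ring_scope.
Local Notation "z ^*" := (Num.conj z) : ring_scope.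

(** * Complex numbers, limits and series *)

(** Two obstacles shape the proof. [trace_class] speaks of [|A|] along a single basis, from which
    neither stability under sums nor independence of the trace from the basis can be read.
    Orthonormalising that basis for the form [<|A| f, g>] gives vectors [x_k] with
    [A = sum_k <., |A| x_k> A x_k], both families being square summable; all traces are computed
    from this expansion. The other obstacle is that operators and symbols are everywhere defined
    functions, not classes: every [L2] limit must come with a pointwise limit, and operators agree
    on the Hilbert space only. The reproducing property itself rests on rotations: averaging
    [h(exp(it) z)] over [t] leaves the Gaussian integral unchanged and, by Cauchy's theorem on each
    complex line, turns the integrand into [h 0]. Moyal's identity on coherent states is this
    property in the Fock space of parameter [lam / 4], because the product of two coherent symbols
    carries the weight [exp(-2|z|^2 / lam)]. *)

Section ComplexModulus.
Context {R : realType}.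
Local Notation C := R[i].
Implicit Types (z w : C) (a b : R).

Lemma Cext z w : Re z = Re w -> Im z = Im w -> z = w.
Proof. by case: z w => [a b] [c d] /= -> ->. Qed.

Lemma ReD z w : Re (z + w) = Re z + Re w. Proof. by case: z w => ? ? []. Qed.
Lemma ImD z w : Im (z + w) = Im z + Im w. Proof. by case: z w => ? ? []. Qed.
Lemma ReN z : Re (- z) = - Re z. Proof. by case: z. Qed.
Lemma ImN z : Im (- z) = - Im z. Proof. by case: z. Qed.
Lemma ReB z w : Re (z - w) = Re z - Re w. Proof. by rewrite ReD ReN. Qed.
Lemma ImB z w : Im (z - w) = Im z - Im w. Proof. by rewrite ImD ImN. Qed.
Lemma ReM z w : Re (z * w) = Re z * Re w - Im z * Im w.
Proof. by case: z w => ? ? []. Qed.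
Lemma ImM z w : Im (z * w) = Re z * Im w + Im z * Re w.
Proof. by case: z w => ? ? []. Qed.
Lemma ReJ z : Re z^* = Re z. Proof. by case: z. Qed.
Lemma ImJ z : Im z^* = - Im z. Proof. by case: z. Qed.
Lemma CJD z w : (z + w)^* = z^* + w^*. Proof. by rewrite rmorphD. Qed.
Lemma CJN z : (- z)^* = - z^*. Proof. by rewrite rmorphN. Qed.
Lemma CJM z w : (z * w)^* = z^* * w^*. Proof. by rewrite rmorphM. Qed.
Lemma CJ0 : 0^* = 0 :> C. Proof. by rewrite rmorph0. Qed.
Lemma CJ1 : 1^* = 1 :> C. Proof. by rewrite rmorph1. Qed.
Lemma CJK z : (z^*)^* = z. Proof. exact: conjCK. Qed.
Lemma CJ_sum I (r : seq I) (P : pred I) (F : I -> C) :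
  (\sum_(i <- r | P i) F i)^* = \sum_(i <- r | P i) (F i)^*.
Proof. by rewrite rmorph_sum. Qed.
Lemma Re_sum I (r : seq I) (P : pred I) (F : I -> C) :
  Re (\sum_(i <- r | P i) F i) = \sum_(i <- r | P i) Re (F i).
Proof. by elim/big_rec2 : _ => // i x y _ <-; rewrite ReD. Qed.
Lemma Im_sum I (r : seq I) (P : pred I) (F : I -> C) :
  Im (\sum_(i <- r | P i) F i) = \sum_(i <- r | P i) Im (F i).
Proof. by elim/big_rec2 : _ => // i x y _ <-; rewrite ImD. Qed.
Lemma ReMC a z : Re (a%:C * z) = a * Re z.
Proof. by rewrite ReM /= mul0r subr0. Qed.
Lemma ImMC a z : Im (a%:C * z) = a * Im z.
Proof. by rewrite ImM /= mul0r addr0. Qed.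
Lemma CRD a b : (a + b)%:C = a%:C + b%:C. Proof. by apply: Cext; rewrite /= ?addr0. Qed.
Lemma CRM a b : (a * b)%:C = a%:C * b%:C.
Proof. by apply: Cext; rewrite /= ?mul0r ?mulr0 ?subr0 ?addr0. Qed.
Lemma CRN a : (- a)%:C = - a%:C. Proof. by apply: Cext; rewrite /= ?oppr0. Qed.
Lemma CR0 : 0%:C = 0 :> C. Proof. by []. Qed.
Lemma CR1 : 1%:C = 1 :> C. Proof. by []. Qed.
Lemma CRJ a : (a%:C)^* = a%:C. Proof. by apply: Cext; rewrite /= ?oppr0. Qed.
Lemma CR_sum I (r : seq I) (P : pred I) (F : I -> R) :
  (\sum_(i <- r | P i) F i)%:C = \sum_(i <- r | P i) (F i)%:C :> C.
Proof. by elim/big_rec2 : _ => // i x y _ <-; rewrite CRD. Qed.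
Lemma CRnat (m : nat) : (m%:R)%:C = m%:R :> C.
Proof. by elim: m => // m IH; rewrite -!natr1 CRD IH. Qed.

Lemma ge0_CRe z : 0 <= z -> z = (Re z)%:C.
Proof. by case: z => a b; rewrite lecE /= => /andP[/eqP -> _]. Qed.
Lemma ge0C z : (0 <= z) = (Im z == 0) && (0 <= Re z).
Proof. by rewrite lecE /= . Qed.

(** The norm of [R[i]] takes its values in [R[i]]; this is the same modulus with values in [R],
    which keeps all estimates in an ordered real field. *)
Definition cab z : R := Num.sqrt (Re z ^+ 2 + Im z ^+ 2).

Lemma cabE z : `|z| = (cab z)%:C. Proof. exact: normc_def. Qed.
Lemma cab_ge0 z : 0 <= cab z. Proof. exact: sqrtr_ge0. Qed.
Hint Resolve cab_ge0 : core.
Lemma cab_sqr z : cab z ^+ 2 = Re z ^+ 2 + Im z ^+ 2.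
Proof. by rewrite sqr_sqrtr// addr_ge0// sqr_ge0. Qed.
Lemma cabM z w : cab (z * w) = cab z * cab w.
Proof. by apply: complexI; rewrite CRM -!cabE normrM. Qed.
Lemma cabD z w : cab (z + w) <= cab z + cab w.
Proof. by rewrite -lecR CRD -!cabE ler_normD. Qed.
Lemma cabN z : cab (- z) = cab z.
Proof. by apply: complexI; rewrite -!cabE normrN. Qed.
Lemma cabB z w : cab (z - w) <= cab z + cab w.
Proof. by rewrite (le_trans (cabD _ _))// cabN. Qed.
Lemma cabJ z : cab z^* = cab z.
Proof. by rewrite /cab ReJ ImJ sqrrN. Qed.
Lemma cab0 : cab 0 = 0. Proof. by rewrite /cab /= expr0n addr0 sqrtr0. Qed.
Lemma cab1 : cab 1 = 1.
Proof. by rewrite /cab /= expr0n expr1n addr0 sqrtr1. Qed.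
Lemma cab_eq0 z : (cab z == 0) = (z == 0).
Proof.
rewrite -[RHS]normr_eq0 cabE.
by apply/eqP/eqP => [->//|]; move/complexI.
Qed.
Lemma cab_real a : cab a%:C = `|a|.
Proof. by rewrite /cab /= expr0n addr0 sqrtr_sqr. Qed.
Lemma cab_Re z : `|Re z| <= cab z.
Proof. by rewrite -sqrtr_sqr ler_wsqrtr// lerDl sqr_ge0. Qed.
Lemma cab_Im z : `|Im z| <= cab z.
Proof. by rewrite -sqrtr_sqr ler_wsqrtr// lerDr sqr_ge0. Qed.
Lemma cab_le z : cab z <= `|Re z| + `|Im z|.
Proof.
rewrite -(@ler_pXn2r _ 2)// ?nnegrE// ?addr_ge0// cab_sqr.
rewrite sqrrD -!normrX (ger0_norm (sqr_ge0 (Re z))) (ger0_norm (sqr_ge0 (Im z))).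
by have := mulrn_wge0 2 (mulr_ge0 (normr_ge0 (Re z)) (normr_ge0 (Im z))); lra.
Qed.
Lemma cab_sum I (r : seq I) (P : pred I) (F : I -> C) :
  cab (\sum_(i <- r | P i) F i) <= \sum_(i <- r | P i) cab (F i).
Proof.
elim/big_rec2 : _ => [|i x y _ h]; first by rewrite cab0.
by rewrite (le_trans (cabD _ _))// lerD2l.
Qed.
Lemma cabX z k : cab (z ^+ k) = cab z ^+ k.
Proof. by elim: k => [|k IH]; rewrite ?expr0 ?cab1// !exprS cabM IH. Qed.
Lemma cab_distC z w : cab (z - w) = cab (w - z).
Proof. by rewrite -cabN opprB. Qed.
Lemma mulJ_cab z : z * z^* = (cab z ^+ 2)%:C.
Proof.
apply: Cext; rewrite ?ReM ?ImM ReJ ImJ ?cab_sqr /=; first by ring.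
by ring.
Qed.

(** Replaces a limit in [R[i]], whose radii are elements of [R[i]], by a real limit, to which
    squeezing and real arithmetic apply. *)
Lemma cvgCP (T : Type) (F : set_system T) {FF : Filter F} (u : T -> C) (l : C) :
  u @ F --> l <-> (fun x => cab (u x - l)) @ F --> (0 : R).
Proof.
split.
  move=> /cvgrPdist_le h; apply/cvgr0Pnorm_le => e e0.
  have e0' : 0 < e%:C :> C by rewrite -CR0 ltcR.
  move: (h _ e0'); apply: filterS => x.
  by rewrite cabE lecR ger0_norm// cab_distC.
move=> /cvgr0Pnorm_le h; apply/cvgrPdist_le => e e0.
have e0' : 0 < Re e by move: (e0); rewrite ltcE /= => /andP[].
move: (h _ e0'); apply: filterS => x.
rewrite cabE ger0_norm// cab_distC => H.
by rewrite (ge0_CRe (ltW e0)) lecR.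
Qed.

Lemma cvgC_ReIm (T : Type) (F : set_system T) {FF : Filter F} (u : T -> C) (l : C) :
  u @ F --> l <-> ((fun x => Re (u x)) @ F --> Re l /\ (fun x => Im (u x)) @ F --> Im l).
Proof.
split.
  move=> /cvgCP /cvgr0Pnorm_le h; split; apply/cvgrPdist_le => e /h; apply: filterS => x.
    by rewrite ger0_norm// => /(le_trans _); apply; rewrite -normrN opprB -ReB cab_Re.
  by rewrite ger0_norm// => /(le_trans _); apply; rewrite -normrN opprB -ImB cab_Im.
move=> [h1 h2]; apply/cvgCP.
have -> : 0 = `|Re l - Re l| + `|Im l - Im l| :> R by rewrite !subrr normr0 addr0.
apply: (@squeeze_cvgr _ _ _ _ (fun=> 0) (fun x => `|Re (u x) - Re l| + `|Im (u x) - Im l|)).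
- by apply: nearW => x; rewrite cab_ge0 -ReB -ImB cab_le.
- by rewrite !subrr normr0 addr0; exact: cvg_cst.
- by apply: cvgD; apply: cvg_norm; apply: cvgB => //; exact: cvg_cst.
Qed.

Lemma cvgJ (T : Type) (F : set_system T) {FF : Filter F} (u : T -> C) (l : C) :
  u @ F --> l -> (fun x => (u x)^*) @ F --> l^*.
Proof.
move=> /cvgCP h; apply/cvgCP; apply: cvg_trans h; apply: near_eq_cvg.
by apply: nearW => x /=; rewrite -rmorphB cabJ.
Qed.

Lemma cvg_cab (T : Type) (F : set_system T) {FF : Filter F} (u : T -> C) (l : C) :
  u @ F --> l -> (fun x => cab (u x)) @ F --> cab l.
Proof.
move=> /cvgCP /cvgr0Pnorm_le h; apply/cvgrPdist_le => e /h; apply: filterS => x.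
rewrite ger0_norm//; apply: le_trans.
have := cabD (u x - l) l; have := cabD (l - u x) (u x).
by rewrite !subrK (cab_distC l) ler_norml => h1 h2; apply/andP; split; lra.
Qed.

Lemma cvg_cabn (u : nat -> C) (l : C) : u @ \oo --> l ->
  (fun n => cab (u n)) @ \oo --> cab l.
Proof. exact: cvg_cab. Qed.

Lemma cvgJn (u : nat -> C) (l : C) : u @ \oo --> l -> (fun n => (u n)^*) @ \oo --> l^*.
Proof. exact: cvgJ. Qed.

Lemma cvg0C_le (T : Type) (F : set_system T) {FF : Filter F} (u : T -> C) (l : C)
    (b : T -> R) :
  (forall x, cab (u x - l) <= b x) -> b @ F --> (0 : R) -> u @ F --> l.
Proof.
move=> h hb; apply/cvgCP; apply: (@squeeze_cvgr _ _ _ _ (fun=> 0) b) => //.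
  by apply: nearW => x; rewrite h cab_ge0.
exact: cvg_cst.
Qed.

End ComplexModulus.
#[global] Hint Extern 0 (is_true (0 <= cab _)) => solve [exact: cab_ge0] : core.

(** * Absolutely convergent series and dominated convergence *)

Section Series.
Context {R : realType}.
Local Notation C := R[i].

Lemma ccauchy_cvg (u : nat -> C) :
  (forall e : R, 0 < e -> exists N, forall m n, (N <= m)%N -> (N <= n)%N ->
     cab (u m - u n) <= e) -> exists l : C, u @ \oo --> l.
Proof.
move=> h.
have key (v : nat -> R) : (forall m n, `|v m - v n| <= cab (u m - u n)) ->
    cvg (v @ \oo).
  move=> hv; apply/cauchy_cvgP/cauchy_exP => e e0.
  have e20 : 0 < e / 2 by rewrite divr_gt0.
  have [N hN] := h _ e20; exists (v N); exists N => // n /= Nn.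
  rewrite /ball/= (le_lt_trans (hv _ _))// (le_lt_trans (hN _ _ _ _))//.
  by rewrite ltr_pdivrMr// mulr_natr mulr2n ltrDl.
exists (Complex (limn (fun n => Re (u n))) (limn (fun n => Im (u n)))).
apply/cvgC_ReIm; split => /=; apply: key => m n.
  by rewrite -ReB cab_Re.
by rewrite -ImB cab_Im.
Qed.

Lemma series_le_cvg (a b : nat -> R) : (forall k, 0 <= a k) -> (forall k, a k <= b k) ->
  cvgn (series b) -> cvgn (series a).
Proof.
move=> a0 ab cb; apply: (series_le_cvg a0 _ ab cb) => k.
by rewrite (le_trans (a0 k)).
Qed.

Lemma abs_cvgC (a : nat -> C) : cvgn (series (fun k => cab (a k))) ->
  exists l : C, series a @ \oo --> l.
Proof.
move=> ca.
have key (v : nat -> R) : (forall k, `|v k| <= cab (a k)) -> cvgn (series v).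
  move=> hv; apply: normed_cvg => /=.
  by apply: series_le_cvg ca => // k; rewrite normr_ge0.
exists (Complex (limn (series (fun n => Re (a n)))) (limn (series (fun n => Im (a n))))).
apply/cvgC_ReIm; split => /=.
  rewrite (_ : (fun _ => _) = series (fun n => Re (a n))).
    by apply: key => k; exact: cab_Re.
  by apply/funext => n; rewrite /series/= Re_sum.
rewrite (_ : (fun _ => _) = series (fun n => Im (a n))).
  by apply: key => k; exact: cab_Im.
by apply/funext => n; rewrite /series/= Im_sum.
Qed.

Lemma series_bound (a : nat -> R) (M : R) : (forall k, 0 <= a k) ->
  (forall n, \sum_(0 <= k < n) a k <= M) -> cvgn (series a).
Proof.
move=> a0 aM; apply: nondecreasing_is_cvgn.
  by apply/nondecreasing_seqP => n; rewrite /series/= big_nat_recr//= lerDl.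
by exists M => _ [n _ <-]; exact: aM.
Qed.

Lemma series_le_lim (a : nat -> R) n : (forall k, 0 <= a k) -> cvgn (series a) ->
  \sum_(0 <= k < n) a k <= limn (series a).
Proof.
move=> a0 ca; apply: (@nondecreasing_cvgn_le _ (series a)) => //.
by apply/nondecreasing_seqP => m; rewrite /series/= big_nat_recr//= lerDl.
Qed.

Lemma series_tail (b : nat -> R) (e : R) : (forall k, 0 <= b k) -> cvgn (series b) ->
  0 < e -> exists K, forall n, \sum_(K <= k < n) b k <= e.
Proof.
move=> b0 cb e0; have /cvgrPdist_le/(_ _ e0)[K _ hK] := cb.
exists K => n; have [nK|Kn] := leqP n K; first by rewrite big_geq// ltW.
have /= := hK K (leqnn _); apply: le_trans.
apply: le_trans (ler_norm _).
rewrite lerBrDl (le_trans _ (series_le_lim n b0 cb))//.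
by rewrite /series/= -(big_cat_nat (leq0n K) (ltnW Kn)).
Qed.

Lemma cvg_ext (T : topologicalType) (u v : nat -> T) (l : T) : u =1 v ->
  u @ \oo --> l -> v @ \oo --> l.
Proof. by move=> /funext ->. Qed.

Lemma cvg_sum0 (f : nat -> nat -> R) K : (forall k, f^~ k @ \oo --> (0 : R)) ->
  (fun N => \sum_(0 <= k < K) f N k) @ \oo --> (0 : R).
Proof.
move=> f0; elim: K => [|K IH].
  under eq_fun do rewrite big_geq//.
  exact: cvg_cst.
have h : (fun N => \sum_(0 <= k < K) f N k + f N K) @ \oo --> (0 + 0 : R).
  exact: cvgD IH (f0 K).
rewrite addr0 in h; apply: cvg_ext h => N.
by rewrite big_nat_recr.
Qed.

(** Dominated convergence for series: beyond [K] the majorant controls both tails, and the first [K]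
    terms converge one by one. Existence of the common limit [t] is part of the conclusion. *)
Lemma tannery (a : nat -> nat -> C) (b : nat -> C) (M : nat -> R) (s : nat -> C) :
  cvgn (series M) -> (forall N k, cab (a N k) <= M k) ->
  (forall k, a^~ k @ \oo --> b k) -> (forall N, series (a N) @ \oo --> s N) ->
  exists t : C, series b @ \oo --> t /\ s @ \oo --> t.
Proof.
move=> cM aM ab sa.
have M0 k : 0 <= M k by exact: le_trans (cab_ge0 _) (aM 0%N k).
have bM k : cab (b k) <= M k.
  have /cvg_cab h := ab k.
  by rewrite -(cvg_lim _ h)//; apply: limr_le; [apply/cvg_ex; eexists; exact: h|exact: nearW].
have [t bt] : exists l : C, series b @ \oo --> l.
  by apply: abs_cvgC; apply: series_le_cvg cM.
exists t; split => //; apply/cvgCP/cvgr0Pnorm_le => e e0.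
have e40 : 0 < e / 4 by rewrite divr_gt0.
have [K hK] := series_tail M0 cM e40.
have : (fun N => \sum_(0 <= k < K) cab (a N k - b k)) @ \oo --> (0 : R).
  apply: (@cvg_sum0 (fun N k => cab (a N k - b k))) => k.
  by have /cvgCP := ab k.
move=> /cvgr0Pnorm_le/(_ _ e40); apply: filterS => N hN.
rewrite ger0_norm//; rewrite ger0_norm ?sumr_ge0// in hN.
have h1 : (fun n => cab (series (a N) n - series b n)) @ \oo --> cab (s N - t).
  exact: cvg_cab (cvgB (sa N) bt).
rewrite -(cvg_lim _ h1)//; apply: limr_le.
  by apply/cvg_ex; eexists; exact: h1.
exists K => // n /= Kn.
rewrite /series /= -sumrB (le_trans (cab_sum _ _ _))//.
rewrite (big_cat_nat (leq0n K) Kn)/=.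
have : \sum_(K <= k < n) cab (a N k - b k) <= e / 4 + e / 4.
  rewrite (le_trans _ (lerD (hK n) (hK n)))// -big_split/=.
  by apply: ler_sum => k _; rewrite (le_trans (cabB _ _))// lerD.
by move=> h2; lra.
Qed.

End Series.

(** * Hilbert spaces and trace-class operators *)

Section PreHilbert.
Context {R : realType} {E : lmodType R[i]}.
Local Notation C := R[i].

(** Only semi-definite: the form [<S f, g>] of a positive operator and the [L2] form on functions
    are instances. *)
Record prehilbert (D : set E) (dot : E -> E -> C) : Prop := PreHilbert {
  ph0 : D 0;
  phL : forall (a : C) f g, D f -> D g -> D (a *: f + g);
  ph_lin : forall (a : C) f g h, D f -> D g -> D h ->
    dot (a *: f + g) h = a * dot f h + dot g h;
  ph_sym : forall f g, D f -> D g -> dot g f = (dot f g)^*;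
  ph_ge0 : forall f, D f -> 0 <= dot f f }.

Definition nsqd (dot : E -> E -> C) f : R := Re (dot f f).
Definition nrmd (dot : E -> E -> C) f : R := Num.sqrt (nsqd dot f).

Lemma nrm_ge0 dot f : 0 <= nrmd dot f. Proof. exact: sqrtr_ge0. Qed.

Section Basic.
Context {D : set E} {dot : E -> E -> C} (H : prehilbert D dot).
Local Notation "'[ f , g ]" := (dot f g) (format "''[' f ,  g ]").
Local Notation nsq := (nsqd dot).
Local Notation nrm := (nrmd dot).

Lemma phZ a f : D f -> D (a *: f).
Proof. by move=> Df; rewrite -[_ *: _]addr0; apply: (phL H) => //; exact: (ph0 H). Qed.
Lemma phD f g : D f -> D g -> D (f + g).
Proof. by move=> Df Dg; rewrite -[f]scale1r; apply: (phL H). Qed.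
Lemma phN f : D f -> D (- f).
Proof. by move=> Df; rewrite -scaleN1r; apply: phZ. Qed.
Lemma phB f g : D f -> D g -> D (f - g).
Proof. by move=> Df Dg; apply: phD => //; apply: phN. Qed.
Lemma ph_sum I (r : seq I) (P : pred I) (F : I -> E) : (forall i, P i -> D (F i)) ->
  D (\sum_(i <- r | P i) F i).
Proof.
by move=> h; elim/big_rec : _ => [|i x Pi Dx]; [exact: (ph0 H)|apply: phD => //; apply: h].
Qed.

Lemma dot0l h : D h -> '[0, h] = 0.
Proof.
move=> Dh; have := ph_lin H (-1) (ph0 H) (ph0 H) Dh.
by rewrite scaler0 addr0 mulN1r addNr.
Qed.
Lemma dotZl a f h : D f -> D h -> '[a *: f, h] = a * '[f, h].
Proof.
by move=> Df Dh; have := ph_lin H a Df (ph0 H) Dh; rewrite addr0 dot0l// addr0.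
Qed.
Lemma dotDl f g h : D f -> D g -> D h -> '[f + g, h] = '[f, h] + '[g, h].
Proof. by move=> Df Dg Dh; have := ph_lin H 1 Df Dg Dh; rewrite scale1r mul1r. Qed.
Lemma dotNl f h : D f -> D h -> '[- f, h] = - '[f, h].
Proof. by move=> Df Dh; rewrite -scaleN1r dotZl// mulN1r. Qed.
Lemma dotBl f g h : D f -> D g -> D h -> '[f - g, h] = '[f, h] - '[g, h].
Proof. by move=> Df Dg Dh; rewrite dotDl// ?dotNl//; exact: phN. Qed.
Lemma dot_suml I (r : seq I) (P : pred I) (F : I -> E) h : (forall i, P i -> D (F i)) ->
  D h -> '[\sum_(i <- r | P i) F i, h] = \sum_(i <- r | P i) '[F i, h].
Proof.
move=> DF Dh.
suff [] : D (\sum_(i <- r | P i) F i) /\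
    '[\sum_(i <- r | P i) F i, h] = \sum_(i <- r | P i) '[F i, h] by [].
elim/big_rec2 : _ => [|i x y Pi [Dx e]]; first by rewrite dot0l//; split => //; exact: (ph0 H).
by split; [apply: phD => //; exact: DF|rewrite dotDl ?e//; exact: DF].
Qed.
Lemma dot0r h : D h -> '[h, 0] = 0.
Proof. by move=> Dh; rewrite (ph_sym H)// ?dot0l ?CJ0//; exact: (ph0 H). Qed.
Lemma dotZr a f h : D f -> D h -> '[h, a *: f] = a^* * '[h, f].
Proof.
by move=> Df Dh; rewrite (ph_sym H)// ?dotZl ?CJM -?(ph_sym H)//; exact: phZ.
Qed.
Lemma dotDr f g h : D f -> D g -> D h -> '[h, f + g] = '[h, f] + '[h, g].
Proof.
move=> Df Dg Dh; rewrite (ph_sym H)// ?dotDl ?CJD -?(ph_sym H)//.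
exact: phD.
Qed.
Lemma dotNr f h : D f -> D h -> '[h, - f] = - '[h, f].
Proof. by move=> Df Dh; rewrite (ph_sym H)// ?dotNl ?CJN -?(ph_sym H)//; exact: phN. Qed.
Lemma dotBr f g h : D f -> D g -> D h -> '[h, f - g] = '[h, f] - '[h, g].
Proof. by move=> Df Dg Dh; rewrite dotDr// ?dotNr//; exact: phN. Qed.
Lemma dot_sumr I (r : seq I) (P : pred I) (F : I -> E) h : (forall i, P i -> D (F i)) ->
  D h -> '[h, \sum_(i <- r | P i) F i] = \sum_(i <- r | P i) '[h, F i].
Proof.
move=> DF Dh; rewrite (ph_sym H)//; last exact: ph_sum.
rewrite dot_suml// CJ_sum; apply: eq_bigr => i Pi.
by rewrite -(ph_sym H)//; exact: DF.
Qed.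

Lemma dot_nsq f : D f -> '[f, f] = (nsq f)%:C.
Proof. by move=> Df; apply: ge0_CRe; exact: (ph_ge0 H). Qed.
Lemma nsq_ge0 f : D f -> 0 <= nsq f.
Proof. by move=> Df; have := ph_ge0 H Df; rewrite dot_nsq// lecR. Qed.
Lemma nrm_sqr f : D f -> nrm f ^+ 2 = nsq f.
Proof. by move=> Df; rewrite sqr_sqrtr// nsq_ge0. Qed.
Lemma nsqZ a f : D f -> nsq (a *: f) = cab a ^+ 2 * nsq f.
Proof.
move=> Df; rewrite /nsqd dotZl ?dotZr//; last exact: phZ.
by rewrite mulrA mulJ_cab ReMC.
Qed.
Lemma nsqD f g : D f -> D g -> nsq (f + g) = nsq f + nsq g + Re '[f, g] *+ 2.
Proof.
move=> Df Dg; rewrite /nsqd dotDl ?dotDr//; last exact: phD.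
by rewrite !ReD [X in Re X + _ + _ = _]dot_nsq// (ph_sym H Df Dg) ReJ; ring.
Qed.
Lemma nsqN f : D f -> nsq (- f) = nsq f.
Proof. by move=> Df; rewrite -scaleN1r nsqZ// cabN cab1 expr1n mul1r. Qed.
Lemma nsqB f g : D f -> D g -> nsq (f - g) = nsq f + nsq g - Re '[f, g] *+ 2.
Proof.
by move=> Df Dg; rewrite nsqD ?nsqN ?dotNr ?ReN ?mulNrn//; exact: phN.
Qed.
Lemma nsq0 : nsq 0 = 0. Proof. by rewrite /nsqd dot0l//; exact: (ph0 H). Qed.
Lemma nrm0 : nrm 0 = 0. Proof. by rewrite /nrmd nsq0 sqrtr0. Qed.
Lemma nrmZ a f : D f -> nrm (a *: f) = cab a * nrm f.
Proof.
by move=> Df; rewrite /nrmd nsqZ// sqrtrM ?sqr_ge0// sqrtr_sqr ger0_norm.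
Qed.
Lemma nrmN f : D f -> nrm (- f) = nrm f.
Proof. by move=> Df; rewrite /nrmd nsqN. Qed.

Lemma CS2 f g : D f -> D g -> cab '[f, g] ^+ 2 <= nsq f * nsq g.
Proof.
move=> Df Dg; pose a := '[f, g].
have key (x y : E) (t : R) : D x -> D y ->
    0 <= t ^+ 2 * nsq x + cab '[x, y] ^+ 2 * nsq y - (t * cab '[x, y] ^+ 2) *+ 2.
  move=> Dx Dy; have := @nsq_ge0 (t%:C *: x - '[x, y] *: y) (phB (phZ _ Dx) (phZ _ Dy)).
  rewrite nsqB ?nsqZ ?cab_real ?real_normK ?num_real//; try exact: phZ.
  rewrite dotZl// ?dotZr//; last exact: phZ.
  by rewrite ReMC [X in Re X]mulrC mulJ_cab.
have sym : cab '[g, f] = cab '[f, g] by rewrite (ph_sym H Df Dg) cabJ.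
have [h|h] := ltrP 0 (nsq g).
  have := key f g (nsq g) Df Dg.
  rewrite (_ : _ - _ = nsq g * (nsq f * nsq g - cab '[f, g] ^+ 2)); last by ring.
  by rewrite pmulr_rge0// subr_ge0.
(* In this degenerate case [key g f] with [t = nsq f + 1] reads [0 <= X (nsq f) - 2 X (nsq f + 1)],
   which forces [X = 0]. *)
have g0 : nsq g = 0 by apply/eqP; rewrite eq_le h nsq_ge0.
have := key f g (nsq f + 1) Df Dg; have := nsq_ge0 Df.
rewrite g0 !mulr0 addr0 => f0.
have := key g f (nsq f + 1) Dg Df; rewrite g0 sym.
set X := cab _ ^+ 2; have X0 : 0 <= X by rewrite sqr_ge0.
by have := mulr_ge0 X0 f0; rewrite mulr0 add0r => h0 h1 h2; lra.
Qed.

Lemma CS f g : D f -> D g -> cab '[f, g] <= nrm f * nrm g.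
Proof.
move=> Df Dg; rewrite -(@ler_pXn2r _ 2)// ?nnegrE ?mulr_ge0 ?nrm_ge0//.
by rewrite exprMn !nrm_sqr// CS2.
Qed.

Lemma nrmD f g : D f -> D g -> nrm (f + g) <= nrm f + nrm g.
Proof.
move=> Df Dg; rewrite -(@ler_pXn2r _ 2)// ?nnegrE ?addr_ge0 ?nrm_ge0//.
rewrite nrm_sqr ?nsqD//; last exact: phD.
rewrite sqrrD !nrm_sqr// addrAC lerD2r lerD2l lerMn2r/=.
by rewrite (le_trans (ler_norm _))// (le_trans (cab_Re _))// CS.
Qed.
Lemma nsq_eq0_dotl f g : D f -> D g -> nsq f = 0 -> '[f, g] = 0.
Proof.
move=> Df Dg f0; have := CS2 Df Dg; rewrite f0 mul0r => h.
by apply/eqP; rewrite -cab_eq0 -sqrf_eq0 eq_le h sqr_ge0.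
Qed.

(** An orthonormal family in which null vectors are allowed; [c i] tells whether [q i] is a unit
    vector. Gram-Schmidt on dependent vectors produces this, and Bessel's inequality survives. *)
Definition qorthon (q : nat -> E) (c : pred nat) :=
  forall i j, '[q i, q j] = ((i == j) && c i)%:R.

Lemma qorthon_proj q c f n : (forall k, D (q k)) -> qorthon q c -> D f ->
  nsq (\sum_(0 <= k < n) '[f, q k] *: q k) = \sum_(0 <= k < n) cab '[f, q k] ^+ 2 /\
  '[f, \sum_(0 <= k < n) '[f, q k] *: q k] = (\sum_(0 <= k < n) cab '[f, q k] ^+ 2)%:C.
Proof.
move=> Dq oq Df.
have Dp (h : E) : D (\sum_(0 <= k < n) '[f, q k] *: q k).
  by apply: ph_sum => i _; exact: phZ.
have h : '[f, \sum_(0 <= k < n) '[f, q k] *: q k] = (\sum_(0 <= k < n) cab '[f, q k] ^+ 2)%:C.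
  rewrite dot_sumr//; last by move=> i _; exact: phZ.
  by rewrite CR_sum; apply: eq_bigr => k _; rewrite dotZr// mulrC mulJ_cab.
split => //; rewrite /nsqd dot_suml//; [|by move=> i _; exact: phZ|exact: Dp].
transitivity (Re ((\sum_(0 <= k < n) cab '[f, q k] ^+ 2)%:C : C)) => //; congr Re.
rewrite CR_sum; apply: eq_big_nat => k /andP[_ kn]; rewrite dotZl//; last exact: Dp.
rewrite dot_sumr//; last by move=> i _; exact: phZ.
rewrite (bigD1_seq k) ?iota_uniq ?mem_index_iota//= big1 ?addr0.
  rewrite dotZr// oq eqxx/= mulrA mulJ_cab.
  case: (boolP (c k)) => ck; first by rewrite mulr1.
  suff -> : '[f, q k] = 0 by rewrite cab0 expr0n mul0r.
  rewrite (ph_sym H)// nsq_eq0_dotl ?CJ0//.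
  by rewrite /nsqd oq (negbTE ck) andbF.
by move=> i ik; rewrite dotZr// oq eq_sym (negbTE ik) mulr0.
Qed.

Lemma nsq_sub_proj q c f n : (forall k, D (q k)) -> qorthon q c -> D f ->
  nsq (f - \sum_(0 <= k < n) '[f, q k] *: q k) =
  nsq f - \sum_(0 <= k < n) cab '[f, q k] ^+ 2.
Proof.
move=> Dq oq Df; have [h1 h2] := qorthon_proj n Dq oq Df.
rewrite nsqB//; last by apply: ph_sum => i _; exact: phZ.
by rewrite h1 h2/=; ring.
Qed.

Lemma bessel q c f n : (forall k, D (q k)) -> qorthon q c -> D f ->
  \sum_(0 <= k < n) cab '[f, q k] ^+ 2 <= nsq f.
Proof.
move=> Dq oq Df; rewrite -subr_ge0 -(nsq_sub_proj _ Dq oq)// nsq_ge0//.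
by apply: phB => //; apply: ph_sum => i _; exact: phZ.
Qed.

Section GramSchmidt.
Variables (y : nat -> E).

Definition gs_normalize r := if nsq r == 0 then 0 else ((nrm r)^-1)%:C *: r.
(** The table of the first [n] vectors: recursion on tables stands for the strong recursion of
    Gram-Schmidt. *)
Fixpoint gs_upto n : nat -> E :=
  if n is n'.+1 then fun j => if j == n' then
    gs_normalize (y n' - \sum_(0 <= i < n') '[y n', gs_upto n' i] *: gs_upto n' i)
    else gs_upto n' j
  else fun=> 0.
Definition gs k := gs_upto k.+1 k.
Let res k := y k - \sum_(0 <= i < k) '[y k, gs i] *: gs i.

Lemma gs_uptoE n j : (j < n)%N -> gs_upto n j = gs j.
Proof.
elim: n => // n IH; rewrite ltnS leq_eqVlt => /orP[/eqP -> //|jn].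
by rewrite /= ltn_eqF// IH.
Qed.

Lemma gsE k : gs k = gs_normalize (res k).
Proof.
rewrite /gs /= eqxx; congr (gs_normalize (_ - _)).
by apply: eq_big_nat => i /andP[_ ik]; rewrite gs_uptoE.
Qed.

(** The subspace [P] is later the range of an operator, to choose preimages of the new vectors, or
    the span of coherent states. *)
Lemma gs_in (P : set E) : P 0 -> (forall a f g, P f -> P g -> P (a *: f + g)) ->
  (forall k, P (y k)) -> forall k, P (gs k).
Proof.
move=> P0 PL Py.
have PZ a f : P f -> P (a *: f) by move=> Pf; rewrite -[_ *: _]addr0; exact/PL.
have PD f g : P f -> P g -> P (f + g) by move=> Pf Pg; rewrite -[f]scale1r; exact/PL.
suff h n k : (k < n)%N -> P (gs k) by move=> k; apply: (h k.+1).
elim: n k => // n IH k; rewrite ltnS leq_eqVlt => /orP[/eqP ->|kn]; last exact: IH.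
rewrite gsE /gs_normalize; case: ifP => // _; apply/PZ; apply/PD => //.
rewrite -scaleN1r; apply/PZ; rewrite big_seq.
elim/big_rec : _ => // i x; rewrite mem_index_iota => /andP[_ ik] Px.
by apply/PD => //; apply/PZ; exact: IH.
Qed.

Hypothesis Dy : forall k, D (y k).

Lemma gs_D k : D (gs k).
Proof. by apply: gs_in => //; [exact: (ph0 H)|exact: (phL H)]. Qed.

Let Dres k : D (res k).
Proof. by apply: phB => //; apply: ph_sum => i _; apply: phZ; exact: gs_D. Qed.

Definition gs_nz k := nsq (res k) != 0.

Lemma gs_nsq k : '[gs k, gs k] = (gs_nz k)%:R.
Proof.
rewrite gsE /gs_normalize /gs_nz; case: ifPn => [_|h]; first by rewrite dot0l//; exact: (ph0 H).
rewrite dot_nsq ?nsqZ//; last exact: phZ.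
rewrite cab_real -nrm_sqr// -exprMn ger0_norm ?invr_ge0 ?nrm_ge0//.
rewrite mulVf ?expr1n// sqrtr_eq0 -ltNge lt0r h nsq_ge0//.
Qed.

Lemma gs_qorthon : qorthon gs gs_nz.
Proof.
suff h n i k : (k < n)%N -> (i < k)%N -> '[gs k, gs i] = 0.
  move=> i j; have [ij|ji|<-] := ltngtP i j; rewrite /= ?gs_nsq//.
    by rewrite (ph_sym H (gs_D j) (gs_D i)) (h j.+1)// CJ0.
  by rewrite (h i.+1).
elim: n i k => // n IH i k; rewrite ltnS leq_eqVlt => /orP[/eqP ->|kn]; last exact: IH.
move=> iN; rewrite gsE /gs_normalize; case: ifPn => [_|_]; first by rewrite dot0l//; exact: gs_D.
rewrite dotZl//; last exact: gs_D.
apply/eqP; rewrite mulf_eq0; apply/orP; right; apply/eqP.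
rewrite dotBl//; last 2 first.
- by apply: ph_sum => j _; apply: phZ; exact: gs_D.
- exact: gs_D.
rewrite dot_suml; last 2 first.
- by move=> j _; apply: phZ; exact: gs_D.
- exact: gs_D.
rewrite (bigD1_seq i) ?iota_uniq ?mem_index_iota//= big1_seq ?addr0.
  rewrite dotZl ?gs_nsq; try exact: gs_D.
  case: (boolP (gs_nz i)) => ck; first by rewrite mulr1 subrr.
  by rewrite gsE /gs_normalize -/(gs_nz i); move: ck; rewrite /gs_nz negbK => ->; rewrite dot0r// mul0r subrr.
move=> j; rewrite mem_index_iota => /andP[ji /andP[_ jn]].
rewrite dotZl; try exact: gs_D.
have [ij|ij|e] := ltngtP i j; last by rewrite e eqxx in ji.
  by rewrite (IH i j)// mulr0.
by rewrite (ph_sym H (gs_D i) (gs_D j)) (IH j i)// CJ0 mulr0.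
Qed.

(** The form may be degenerate, so the input is recovered only up to a null vector. *)
Lemma gs_span k : nsq (y k - \sum_(0 <= i < k.+1) '[y k, gs i] *: gs i) = 0.
Proof.
rewrite big_nat_recr//= opprD addrA -/(res k).
have -> : '[y k, gs k] = '[res k, gs k].
  rewrite /res dotBl//; last 2 first.
  - by apply: ph_sum => j _; apply: phZ; exact: gs_D.
  - exact: gs_D.
  rewrite dot_suml; last 2 first.
  - by move=> j _; apply: phZ; exact: gs_D.
  - exact: gs_D.
  rewrite big1_seq ?subr0// => j; rewrite mem_index_iota => /andP[_ /andP[_ jk]].
  by rewrite dotZl ?gs_qorthon ?ltn_eqF// ?mulr0//; exact: gs_D.
rewrite gsE /gs_normalize; case: ifPn => [/eqP h|h]; first by rewrite scaler0 subr0.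
rewrite dotZr// scalerA dot_nsq// CRJ -!CRM (_ : _ * _ = 1) ?CR1 ?scale1r ?subrr ?nsq0//.
rewrite -nrm_sqr// expr2 mulrAC -mulrA mulrA; set x := nrm _.
have x0 : x != 0 by rewrite sqrtr_eq0 -ltNge lt0r h nsq_ge0.
by field.
Qed.

Lemma gs_dot_gt k j : (k < j)%N -> '[y k, gs j] = 0.
Proof.
move=> kj; have Dr : D (y k - \sum_(0 <= i < k.+1) '[y k, gs i] *: gs i).
  by apply: phB => //; apply: ph_sum => i _; apply: phZ; exact: gs_D.
have := nsq_eq0_dotl Dr (gs_D j) (gs_span k).
rewrite dotBl//; last 2 first.
- by apply: ph_sum => i _; apply: phZ; exact: gs_D.
- exact: gs_D.
rewrite dot_suml; last 2 first.
- by move=> i _; apply: phZ; exact: gs_D.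
- exact: gs_D.
rewrite big1_seq ?subr0// => i; rewrite mem_index_iota => /andP[_ /andP[_ ik]].
rewrite dotZl; [|exact: gs_D|exact: gs_D].
by rewrite gs_qorthon [_ == _]ltn_eqF ?mulr0//; exact: leq_trans kj.
Qed.

Lemma gs_span_lt k n : (k < n)%N ->
  nsq (y k - \sum_(0 <= i < n) '[y k, gs i] *: gs i) = 0.
Proof.
move=> kn; rewrite (big_cat_nat (leq0n k.+1) kn)/= [X in _ - (_ + X)]big1_seq ?addr0 ?gs_span//.
move=> i; rewrite mem_index_iota => /andP[_ /andP[ki _]].
by rewrite gs_dot_gt// scale0r.
Qed.

End GramSchmidt.

End Basic.
End PreHilbert.

Section CvgAux.
Context {R : realType}.
Local Notation C := R[i].

Lemma cvg_uniqueC (u : nat -> C) (a b : C) : u @ \oo --> a -> u @ \oo --> b -> a = b.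
Proof. by move=> ha hb; apply: (cvg_unique _ ha hb); exact: norm_hausdorff. Qed.

Lemma cvg_sumC (A : numFieldType) (V : normedModType A) (f : nat -> nat -> V) (l : nat -> V) K : (forall k, f^~ k @ \oo --> l k) ->
  (fun N => \sum_(0 <= k < K) f N k) @ \oo --> \sum_(0 <= k < K) l k.
Proof.
move=> f0; elim: K => [|K IH].
  rewrite big_geq//; apply: cvg_ext (@cvg_cst _ 0 _ \oo _) => N.
  by rewrite big_geq.
have h : (fun N => \sum_(0 <= k < K) f N k + f N K) @ \oo -->
    \sum_(0 <= k < K) l k + l K by exact: cvgD IH (f0 K).
have -> : \sum_(0 <= k < K.+1) l k = \sum_(0 <= k < K) l k + l K by rewrite big_nat_recr.
by apply: (@cvg_ext _ _ _ _ _ h) => N; rewrite big_nat_recr.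
Qed.

Lemma cvg_sum_seq (A : numFieldType) (V : normedModType A) (I : Type) (s : seq I) (f : nat -> I -> V) (l : I -> V) :
  (forall k, f^~ k @ \oo --> l k) ->
  (fun N => \sum_(k <- s) f N k) @ \oo --> \sum_(k <- s) l k.
Proof.
move=> f0; elim: s => [|i s IH].
  rewrite big_nil; apply: cvg_ext (@cvg_cst _ 0 _ \oo _) => N.
  by rewrite big_nil.
have h : (fun N => f N i + \sum_(k <- s) f N k) @ \oo -->
    l i + \sum_(k <- s) l k by exact: cvgD (f0 i) IH.
have -> : \sum_(k <- i :: s) l k = l i + \sum_(k <- s) l k by rewrite big_cons.
by apply: (@cvg_ext _ _ _ _ _ h) => N; rewrite big_cons.
Qed.

Lemma squeeze0 (a b : nat -> R) : (forall n, 0 <= a n <= b n) ->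
  b @ \oo --> (0 : R) -> a @ \oo --> (0 : R).
Proof.
move=> h hb; apply: (@squeeze_cvgr _ _ _ _ (fun=> 0) b) => //; first exact: nearW.
exact: cvg_cst.
Qed.

Lemma cvgMlC (f : nat -> C) (l c : C) : f @ \oo --> l -> (fun n => c * f n) @ \oo --> c * l.
Proof.
move=> fl; have h : (fun=> c) @ \oo --> c by exact: cvg_cst.
exact: cvgM h fl.
Qed.

End CvgAux.

(** * Complete spaces, Parseval's identity and nuclear operators *)

Section Hilbert.
Context {R : realType} {E : lmodType R[i]}.
Local Notation C := R[i].

Record hilbert (D : set E) (dot : E -> E -> C) : Prop := Hilbert {
  hb_pre : prehilbert D dot;
  hb_def : forall f, D f -> nsqd dot f = 0 -> f = 0;
  hb_cplt : forall u : nat -> E, (forall n, D (u n)) ->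
    (forall e : R, 0 < e -> exists N, forall m n, (N <= m)%N -> (N <= n)%N ->
       nsqd dot (u m - u n) <= e) ->
    exists2 f, D f & (fun n => nsqd dot (u n - f)) @ \oo --> (0 : R) }.

Section PreBasis.
Context {D : set E} {dot : E -> E -> C} (P : prehilbert D dot).
Local Notation "'[ f , g ]" := (dot f g) (format "''[' f ,  g ]").
Local Notation nsq := (nsqd dot).
Local Notation nrm := (nrmd dot).

Lemma ncvg_dot (u : nat -> E) f g : (forall n, D (u n)) -> D f -> D g ->
  (fun n => nsq (u n - f)) @ \oo --> (0 : R) -> (fun n => '[u n, g]) @ \oo --> '[f, g].
Proof.
move=> Du Df Dg h; apply: (@cvg0C_le _ _ _ _ _ _ (fun n => nrm (u n - f) * nrm g)) => [n|].
  by rewrite -(dotBl P)// (CS P)//; exact: (phB P).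
rewrite -[0](mul0r (nrm g)); apply: cvgMl; rewrite -[X in _ --> X]sqrtr0.
by apply: continuous_cvg => //; exact: sqrt_continuous.
Qed.

Lemma ncvg_dotr (u : nat -> E) f g : (forall n, D (u n)) -> D f -> D g ->
  (fun n => nsq (u n - f)) @ \oo --> (0 : R) -> (fun n => '[g, u n]) @ \oo --> '[g, f].
Proof.
move=> Du Df Dg h; have := ncvg_dot Du Df Dg h.
move=> /cvgJ; rewrite -(ph_sym P)//; apply: cvg_ext => n.
by rewrite -(ph_sym P).
Qed.

End PreBasis.

Section Basis.
Context {D : set E} {dot : E -> E -> C} (H : hilbert D dot).
Local Notation "'[ f , g ]" := (dot f g) (format "''[' f ,  g ]").
Local Notation nsq := (nsqd dot).
Local Notation nrm := (nrmd dot).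
Let P := hb_pre H.
Variable e : nat -> E.
Hypothesis oe : orthonormal_basis D dot e.

Lemma onbD k : D (e k). Proof. by case: oe. Qed.
Lemma onbE j k : '[e j, e k] = (j == k)%:R. Proof. by case: oe. Qed.
Local Hint Resolve onbD : core.

Definition onbproj n f := \sum_(0 <= k < n) '[f, e k] *: e k.

Lemma onb_qorthon : qorthon (dot := dot) e xpredT.
Proof. by move=> i j; rewrite onbE andbT. Qed.

Lemma onbproj_D n f : D (onbproj n f).
Proof. by apply: (ph_sum P) => k _; exact: (phZ P). Qed.
Local Hint Resolve onbproj_D : core.

Lemma dot_onbproj n f g : D f -> D g ->
  '[onbproj n f, g] = \sum_(0 <= k < n) '[f, e k] * '[e k, g].
Proof.
move=> Df Dg; rewrite (dot_suml P)//; last by move=> k _; exact: (phZ P).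
by apply: eq_bigr => k _; rewrite (dotZl P).
Qed.

Lemma dot_onbproj_e n f k : D f -> (k < n)%N -> '[onbproj n f, e k] = '[f, e k].
Proof.
move=> Df kn; rewrite dot_onbproj// (bigD1_seq k) ?iota_uniq ?mem_index_iota//=.
rewrite onbE eqxx mulr1 big1 ?addr0// => j jk.
by rewrite onbE (negbTE jk) mulr0.
Qed.

Lemma nsq_onbproj n f : D f -> nsq (onbproj n f) = \sum_(0 <= k < n) cab '[f, e k] ^+ 2.
Proof. by move=> Df; have [] := qorthon_proj P n onbD onb_qorthon Df. Qed.

Lemma nsq_onbprojB m n f : D f -> (n <= m)%N ->
  nsq (onbproj m f - onbproj n f) =
  \sum_(0 <= k < m) cab '[f, e k] ^+ 2 - \sum_(0 <= k < n) cab '[f, e k] ^+ 2.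
Proof.
move=> Df nm; rewrite (nsqB P)// !nsq_onbproj//.
have -> : '[onbproj m f, onbproj n f] = (\sum_(0 <= k < n) cab '[f, e k] ^+ 2)%:C.
  rewrite (dot_sumr P)//; last by move=> k _; exact: (phZ P).
  rewrite CR_sum; apply: eq_big_nat => k /andP[_ kn].
  by rewrite (dotZr P)// dot_onbproj_e ?(leq_trans kn)// mulrC mulJ_cab.
by rewrite /=; ring.
Qed.

Lemma bessel_onb f n : D f -> \sum_(0 <= k < n) cab '[f, e k] ^+ 2 <= nsq f.
Proof. by move=> Df; exact: (bessel P n onbD onb_qorthon Df). Qed.

(** By Bessel the projections are Cauchy; their limit has the same coefficients as [f], hence equals
    [f] by totality. *)
Lemma onb_cvg f : D f -> (fun n => nsq (onbproj n f - f)) @ \oo --> (0 : R).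
Proof.
move=> Df; have cs : cvgn (series (fun k => cab '[f, e k] ^+ 2)).
  by apply: (@series_bound _ _ (nsq f)) => [k|n]; rewrite ?sqr_ge0// bessel_onb.
have [//||g Dg hg] := hb_cplt H (u := onbproj^~ f).
  move=> d d0; have [N hN] := series_tail (fun k => sqr_ge0 (cab '[f, e k])) cs d0.
  have key m n : (N <= n)%N -> (n <= m)%N -> nsq (onbproj m f - onbproj n f) <= d.
    move=> Nn nm; rewrite nsq_onbprojB// (big_cat_nat (leq0n n) nm)/=.
    rewrite addrAC subrr add0r (le_trans _ (hN m))// (big_cat_nat Nn nm)/= lerDr.
    by apply: sumr_ge0 => k _; rewrite sqr_ge0.
  exists N => m n Nm Nn; have [nm|mn] := leqP n m; first exact: key.
  rewrite -(nsqN P (phB P (onbproj_D m f) (onbproj_D n f))) opprB.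
  exact: key Nm (ltnW mn).
suff fg : f = g by move: hg; rewrite -fg.
have [_ _ tot] := oe.
apply/eqP; rewrite -subr_eq0; apply/eqP; apply: tot; first exact: (phB P).
move=> k; rewrite (dotBl P)//; apply/eqP; rewrite subr_eq0; apply/eqP.
apply: (@cvg_uniqueC _ (fun n => '[onbproj n f, e k])); last exact: (ncvg_dot P).
apply: cvg_near_cst; exists k.+1 => // n /= kn.
by rewrite dot_onbproj_e.
Qed.

Lemma parseval f g : D f -> D g ->
  series (fun k => '[f, e k] * '[e k, g]) @ \oo --> '[f, g].
Proof.
move=> Df Dg; have := ncvg_dot P (onbproj_D ^~ f) Df Dg (onb_cvg Df).
by apply: cvg_ext => n; rewrite dot_onbproj.
Qed.

Lemma parseval_nsq f : D f -> series (fun k => cab '[f, e k] ^+ 2) @ \oo --> nsq f.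
Proof.
move=> Df; have /cvgC_ReIm[+ _] := parseval Df Df; apply: cvg_ext => n.
rewrite /series/= Re_sum; apply: eq_bigr => k _.
by rewrite (ph_sym P Df (onbD k)) mulJ_cab.
Qed.

Lemma nrm_onbproj n f : D f -> nrm (onbproj n f) <= nrm f.
Proof. by move=> Df; rewrite ler_wsqrtr// nsq_onbproj// bessel_onb. Qed.

End Basis.
Arguments onbproj : clear implicits.

Section Nuclear.
Context {D : set E} {dot : E -> E -> C} (H : hilbert D dot).
Local Notation "'[ f , g ]" := (dot f g) (format "''[' f ,  g ]").
Local Notation nsq := (nsqd dot).
Local Notation nrm := (nrmd dot).
Let P := hb_pre H.

(** The expansion [T = sum_k <., u_k> v_k] in the weak sense. It is the singular expansion with each
    singular value shared between the two families, so that both are square summable. *)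
Record nuclear (T : E -> E) (u v : nat -> E) : Prop := Nuclear {
  nuc_u : forall k, D (u k);
  nuc_v : forall k, D (v k);
  nuc_cu : cvgn (series (fun k => nsq (u k)));
  nuc_cv : cvgn (series (fun k => nsq (v k)));
  nuc_dot : forall f g, D f -> D g ->
    series (fun k => '[f, u k] * '[v k, g]) @ \oo --> '[T f, g] }.

Lemma nrmM_cvg u v : (forall k, D (u k)) -> (forall k, D (v k)) ->
  cvgn (series (fun k => nsq (u k))) -> cvgn (series (fun k => nsq (v k))) ->
  cvgn (series (fun k => nrm (u k) * nrm (v k))).
Proof.
move=> Du Dv cu cv.
apply: (@series_le_cvg _ _ (fun k => nsq (u k) + nsq (v k))) => [k|k|].
- by rewrite mulr_ge0 ?nrm_ge0.
- rewrite -!(nrm_sqr P)//; have := sqr_ge0 (nrm (u k) - nrm (v k)).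
  have := nrm_ge0 dot (u k); have := nrm_ge0 dot (v k).
  by move=> *; nra.
- rewrite (_ : series _ = series (fun k => nsq (u k)) + series (fun k => nsq (v k))).
    exact: is_cvgD.
  by apply/funext => n; rewrite /series/= big_split.
Qed.

Lemma nuc_tr_ex u v : (forall k, D (u k)) -> (forall k, D (v k)) ->
  cvgn (series (fun k => nsq (u k))) -> cvgn (series (fun k => nsq (v k))) ->
  exists t : C, series (fun k => '[v k, u k]) @ \oo --> t.
Proof.
move=> Du Dv cu cv; apply: abs_cvgC.
apply: series_le_cvg (nrmM_cvg Dv Du cv cu) => // k.
exact: (CS P).
Qed.

(** Along any basis the trace is [sum_k <v_k, u_k>]: [tannery] exchanges the sum over the basis with
    the sum over [k], the domination being [|<P_N v_k, u_k>| <= |v_k| |u_k|] for the projections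
    [P_N]. *)
Lemma nuclear_trace T u v t : nuclear T u v ->
  series (fun k => '[v k, u k]) @ \oo --> t -> is_trace D dot T t.
Proof.
move=> [Du Dv cu cv hT] ht e oe.
have De := onbD oe.
have [|||t' [h1 h2]] := @tannery _
  (fun N k => \sum_(0 <= j < N) ('[e j, u k] * '[v k, e j]))
  (fun k => '[v k, u k]) (fun k => nrm (v k) * nrm (u k))
  (series (fun k => '[T (e k), e k])) (nrmM_cvg Dv Du cv cu).
- move=> N k; have -> : \sum_(0 <= j < N) '[e j, u k] * '[v k, e j] = '[onbproj dot e N (v k), u k].
    by rewrite (dot_onbproj H oe)//; apply: eq_bigr => j _; rewrite mulrC.
  rewrite (le_trans (CS P _ _))//; first exact: onbproj_D.
  by rewrite ler_wpM2r ?nrm_ge0// (nrm_onbproj H oe).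
- move=> k; apply: cvg_ext (parseval H oe (Dv k) (Du k)) => N.
  by apply: eq_bigr => j _; rewrite mulrC.
- move=> N; have := cvg_sumC (K := N) (fun j => hT _ _ (De j) (De j)).
  apply: cvg_ext => n; rewrite /series/= exchange_big/=.
  by apply: eq_bigr.
by rewrite (cvg_uniqueC ht h1).
Qed.

Lemma trace_opE e T t : orthonormal_basis D dot e -> is_trace D dot T t ->
  trace_op D dot T = t.
Proof.
move=> oe ht; have : is_trace D dot T (trace_op D dot T) by apply: (xgetPex 0); exists t.
by move=> /(_ _ oe) h; exact: cvg_uniqueC h (ht _ oe).
Qed.

(** Polarisation: the imaginary part of [<S x, x>] vanishes at [f + g] and at [f + i g], which gives
    the two real equations of hermitian symmetry. *)
Lemma pos_herm S : is_operator D S -> (forall f, D f -> 0 <= '[S f, f]) ->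
  forall f g, D f -> D g -> '[S g, f] = '[S f, g]^*.
Proof.
move=> [DS linS] pS f g Df Dg.
have SD x y : D x -> D y -> S (x + y) = S x + S y.
  by move=> Dx Dy; have := linS 1 x y Dx Dy; rewrite !scale1r.
have S0 : S 0 = 0.
  by have := linS (-1) _ _ (ph0 P) (ph0 P); rewrite scaler0 addr0 scaleN1r addNr.
have SZ a x : D x -> S (a *: x) = a *: S x.
  by move=> Dx; have := linS a x 0 Dx (ph0 P); rewrite S0 !addr0.
have q x y : D x -> D y -> Im ('[S x, y] + '[S y, x]) = 0.
  move=> Dx Dy; have := pS _ (phD P Dx Dy); have := pS _ Dx; have := pS _ Dy.
  rewrite SD// (dotDl P) ?(dotDr P)//; try exact: DS; try exact: (phD P).
  rewrite !ge0C => /andP[/eqP h1 _] /andP[/eqP h2 _] /andP[/eqP].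
  rewrite !ImD h1 h2 => h3 _.
  by rewrite -h3; ring.
have h1 := q f g Df Dg.
have := q f ('i *: g)%C Df (phZ P _ Dg).
rewrite SZ// (dotZl P) ?(dotZr P)//; try exact: DS.
rewrite ImD in h1; rewrite ImD !ImM ReJ ImJ /= => h2.
apply: Cext; rewrite ?ReJ ?ImJ.
  by move: h2; rewrite !(mul0r, oppr0, add0r, addr0, mulN1r, mul1r); lra.
by lra.
Qed.

(** With [S = |A|], the basis [e] is orthonormalised for the form [s f g = <S f, g>] into [x_k];
    then [u_k = S x_k] and [v_k = A x_k]. By Parseval for [e] and Bessel for [s], the sum of the
    [|u_k|^2] is at most the trace of [S], and [|A x| = |S x|] transfers the bound to [v]. *)
Lemma trace_class_nuclear A : trace_class D dot A -> exists u v, nuclear A u v.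
Proof.
move=> [[[DA linA] [M bA]] [B [S [e [[DB adjB] [oS pS sqS] oe cS]]]]].
have [DS linS] := oS; have De := onbD oe.
have hS := pos_herm oS pS.
pose s f g := '[S f, g].
have Ps : prehilbert D s.
  split; [exact: (ph0 P)|exact: (phL P)| |by move=> f g Df Dg; exact: hS|by []].
  by move=> a f g h Df Dg Dh; rewrite /s linS// (ph_lin P)//; exact: DS.
have nA x : D x -> nsq (A x) = nsq (S x).
  move=> Dx; rewrite /nsqd adjB//; last exact: DA.
  have -> : B (A x) = S (S x) by rewrite sqS.
  by rewrite (ph_sym P (DS _ (DS _ Dx)) Dx) hS//; [rewrite CJK|exact: DS].
have AB x y : D x -> D y -> A (x - y) = A x - A y.
  by move=> Dx Dy; have := linA (-1) y x Dy Dx; rewrite !scaleN1r addrC [RHS]addrC.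
pose x := gs (dot := s) e; pose c := gs_nz (dot := s) e.
have Dx k : D (x k) by exact: gs_D.
have ox : qorthon (dot := s) x c by exact: (gs_qorthon Ps De).
pose u k := S (x k); pose v k := A (x k).
have Du k : D (u k) by exact: DS.
have Dv k : D (v k) by exact: DA.
have sxE f k : D f -> '[f, u k] = s f (x k).
  by move=> Df; rewrite (ph_sym P (Du k) Df) /u -hS.
have cu : cvgn (series (fun k => nsq (u k))).
  apply: (@series_bound _ _ (limn (series (fun k => Re '[S (e k), e k])))) => [k|n].
    exact: (nsq_ge0 P).
  have h := cvg_sumC (K := n) (fun j => parseval_nsq H oe (Du j)).
  rewrite -(cvg_lim _ h)//; apply: limr_le.
    by apply/cvg_ex; eexists; exact: h.
  apply: nearW => K; rewrite exchange_big/=.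
  apply: le_trans (series_le_lim K _ cS); last first.
    by move=> k; have := pS _ (De k); rewrite ge0C => /andP[].
  apply: ler_sum => k _; apply: le_trans (bessel Ps n Dx ox (De k)).
  apply: ler_sum => j _; rewrite -sxE//.
  by rewrite (ph_sym P (De k) (Du j)) cabJ.
have cv : cvgn (series (fun k => nsq (v k))).
  by under [X in series X]eq_fun do rewrite nA//.
(* The residue of [e k] in Gram-Schmidt is null for [s], hence killed by [S], hence by [A] since
   [|A x| = |S x|]. *)
have Ae k : A (e k) = \sum_(0 <= j < k.+1) '[e k, u j] *: v j.
  pose y := \sum_(0 <= j < k.+1) '[e k, u j] *: x j.
  have Dy : D y by apply: (ph_sum P) => j _; exact: (phZ P).
  have := gs_span Ps De k.
  rewrite -[X in e k - X](_ : y = _); last first.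
    by apply: eq_bigr => j _; rewrite sxE.
  have Dr : D (e k - y) by exact: (phB P).
  move=> r0; have : nsq (S (e k - y)) = 0.
    rewrite /nsqd -/(s _ _) (nsq_eq0_dotl Ps)//; last exact: DS.
  rewrite -nA// => /(hb_def H (DA _ Dr)); rewrite AB// => /eqP.
  rewrite subr_eq0 => /eqP ->; rewrite /y.
  have A0 : A 0 = 0.
    by have := linA (-1) _ _ (ph0 P) (ph0 P); rewrite scaler0 addr0 scaleN1r addNr.
  suff [] : D (\sum_(0 <= j < k.+1) '[e k, u j] *: x j) /\
    A (\sum_(0 <= j < k.+1) '[e k, u j] *: x j) =
      \sum_(0 <= j < k.+1) '[e k, u j] *: v j by [].
  elim/big_rec2 : _ => [|i z w _ [Dz e1]]; first by split => //; exact: (ph0 P).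
  by split; [exact: (phL P)|rewrite linA// e1].
have su j k : (k < j)%N -> '[e k, u j] = 0.
  by move=> kj; rewrite sxE// /s -/(s _ _) (gs_dot_gt Ps De).
exists u, v; split => // f g Df Dg.
have Dp n : D (onbproj dot e n f) by exact: (onbproj_D H oe).
have [||||t' [h1 h2]] := @tannery _
  (fun N k => '[onbproj dot e N f, u k] * '[v k, g])
  (fun k => '[f, u k] * '[v k, g]) (fun k => nrm f * nrm g * (nrm (u k) * nrm (v k)))
  (fun N => '[A (onbproj dot e N f), g]).
- apply: is_cvg_seriesZ; exact: nrmM_cvg.
- move=> N k; rewrite cabM mulrACA [X in _ <= X](_ : _ = (nrm f * nrm (u k)) * (nrm (v k) * nrm g)); last by ring.
  rewrite ler_pM//; last exact: (CS P).
  by rewrite (le_trans (CS P _ _))// ler_wpM2r ?nrm_ge0// (nrm_onbproj H oe).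
- move=> k; apply: cvgMl; apply: (ncvg_dot P) => //; exact: (onb_cvg H oe).
(* On a combination of the first [N] basis vectors the series is finite, because [<e_k, u_j> = 0]
   for [j > k]. *)
- move=> N; apply: cvg_near_cst; exists N => // K /= NK.
  have -> : A (onbproj dot e N f) = \sum_(0 <= k < N) '[f, e k] *: A (e k).
    have A0 : A 0 = 0.
      by have := linA (-1) _ _ (ph0 P) (ph0 P); rewrite scaler0 addr0 scaleN1r addNr.
    suff [] : D (onbproj dot e N f) /\
      A (onbproj dot e N f) = \sum_(0 <= k < N) '[f, e k] *: A (e k) by [].
    rewrite /onbproj; elim/big_rec2 : _ => [|i z w _ [Dz e1]]; first by split => //; exact: (ph0 P).
    by split; [exact: (phL P)|rewrite linA// e1].
  rewrite (dot_suml P)//; last by move=> i _; apply: (phZ P); exact: DA.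
  rewrite /series/=.
  under eq_bigr do rewrite (dot_onbproj H oe)// mulr_suml.
  rewrite exchange_big/=; apply: eq_big_nat => k /andP[_ kN].
  rewrite (dotZl P)//; last exact: DA.
  rewrite Ae (dot_suml P)//; last by move=> i _; exact: (phZ P).
  rewrite mulr_sumr [LHS](big_cat_nat (leq0n k.+1))/=; last exact: leq_trans NK.
  rewrite [X in _ + X]big1_seq ?addr0; last first.
    move=> i; rewrite mem_index_iota => /andP[_ /andP[ki _]].
    by rewrite su// mulr0 mul0r.
  by apply: eq_bigr => i _; rewrite (dotZl P)// mulrA.
suff -> : '[A f, g] = t' by exact: h1.
apply: (@cvg_uniqueC _ (fun N => '[A (onbproj dot e N f), g])); last exact: h2.
apply: (ncvg_dot P); [by move=> n; exact: DA|exact: DA|by []|].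
have := onb_cvg H oe Df => h.
have h' : (fun n => M * nsq (onbproj dot e n f - f)) @ \oo --> M * 0 by exact: cvgMr.
rewrite mulr0 in h'.
apply: squeeze0 h' => n; rewrite (nsq_ge0 P)/=; last by apply: (phB P); exact: DA.
by rewrite -AB// bA//; exact: (phB P).
Qed.

End Nuclear.
End Hilbert.
Arguments onbproj {R E} dot e n f.

(** * Square roots of positive operators *)

Section NormConvergence.
Context {R : realType} {E : lmodType R[i]}.
Local Notation C := R[i].
Context {D : set E} {dot : E -> E -> C} (H : hilbert D dot).
Local Notation "'[ f , g ]" := (dot f g) (format "''[' f ,  g ]").
Local Notation nsq := (nsqd dot).
Local Notation nrm := (nrmd dot).
Let P := hb_pre H.

Definition ncvg (u : nat -> E) f := (fun n => nrm (u n - f)) @ \oo --> (0 : R).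

Lemma nsq_ncvg (u : nat -> E) f : (fun n => nsq (u n - f)) @ \oo --> (0 : R) -> ncvg u f.
Proof.
move=> h; rewrite /ncvg -[X in _ --> X]sqrtr0.
by apply: continuous_cvg => //; exact: sqrt_continuous.
Qed.

Lemma ncvg_nsq (u : nat -> E) f : (forall n, D (u n)) -> D f ->
  ncvg u f -> (fun n => nsq (u n - f)) @ \oo --> (0 : R).
Proof.
move=> Du Df h; have h2 : (fun n => nrm (u n - f) * nrm (u n - f)) @ \oo --> (0 * 0 : R).
  exact: (cvgM h h).
rewrite mulr0 in h2; apply: cvg_ext h2 => n.
by rewrite -expr2 (nrm_sqr P)//; exact: (phB P).
Qed.

Lemma ncvg_dotl (u : nat -> E) f g : (forall n, D (u n)) -> D f -> D g ->
  ncvg u f -> (fun n => '[u n, g]) @ \oo --> '[f, g].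
Proof. by move=> Du Df Dg /(ncvg_nsq Du Df); exact: (ncvg_dot P). Qed.

Lemma ncvg_unique (u : nat -> E) f g : (forall n, D (u n)) -> D f -> D g ->
  ncvg u f -> ncvg u g -> f = g.
Proof.
move=> Du Df Dg uf ug; apply/eqP; rewrite -subr_eq0; apply/eqP.
have Dfg : D (f - g) by exact: (phB P).
apply: (hb_def H) => //; rewrite /nsqd (dotBl P)//.
suff -> : '[f, f - g] = '[g, f - g] by rewrite subrr.
apply: (@cvg_uniqueC _ (fun n => '[u n, f - g])).
  exact: (ncvg_dotl Du Df Dfg uf).
exact: (ncvg_dotl Du Dg Dfg ug).
Qed.

Lemma ncvgL (u v : nat -> E) (a : C) f g : (forall n, D (u n)) -> (forall n, D (v n)) ->
  D f -> D g -> ncvg u f -> ncvg v g -> ncvg (fun n => a *: u n + v n) (a *: f + g).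
Proof.
move=> Du Dv Df Dg uf vg.
have h : (fun n => cab a * nrm (u n - f) + nrm (v n - g)) @ \oo --> (cab a * 0 + 0 : R).
  by apply: cvgD => //; exact: cvgMr.
rewrite mulr0 addr0 in h; apply: squeeze0 h => n; rewrite nrm_ge0/=.
rewrite opprD addrACA -scalerBr -(nrmZ P); last exact: (phB P).
by apply: (nrmD P); [apply: (phZ P)|]; exact: (phB P).
Qed.

Lemma ncvg_bounded (A : E -> E) (M : R) (u : nat -> E) f : is_operator D A ->
  (forall f, D f -> nrm (A f) <= M * nrm f) -> (forall n, D (u n)) -> D f ->
  ncvg u f -> ncvg (fun n => A (u n)) (A f).
Proof.
move=> [DA lA] bA Du Df uf.
have h : (fun n => M * nrm (u n - f)) @ \oo --> (M * 0 : R) by exact: cvgMr.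
rewrite mulr0 in h; apply: squeeze0 h => n; rewrite nrm_ge0/=.
have -> : A (u n) - A f = A (u n - f).
  by have := lA (-1) f (u n) Df (Du n); rewrite !scaleN1r addrC [RHS]addrC.
by apply: bA; exact: (phB P).
Qed.

Lemma ncvg_cauchy (u : nat -> E) (t : nat -> R) : (forall n, D (u n)) -> cvgn t ->
  (forall m n, (n <= m)%N -> nrm (u m - u n) <= t m - t n) ->
  exists2 f, D f & ncvg u f.
Proof.
move=> Du ct h; have [//||f Df hf] := hb_cplt H (u := u); last first.
  by exists f => //; exact: nsq_ncvg.
move=> e e0; have se : 0 < Num.sqrt e by rewrite sqrtr_gt0.
have /cvg_cauchy/cauchy_ballP/(_ _ se) := ct.
move=> [[A B] /= [[N1 _ hA] [N2 _ hB]] hAB].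
exists (maxn N1 N2) => m n; rewrite !geq_max => /andP[N1m N2m] /andP[N1n N2n].
rewrite -(nrm_sqr P); last exact: (phB P).
rewrite -(sqr_sqrtr (ltW e0)) ler_pXn2r// ?nnegrE ?nrm_ge0 ?sqrtr_ge0//.
have key (i j : nat) : (N1 <= i)%N -> (N2 <= j)%N -> `|t i - t j| <= Num.sqrt e.
  by move=> Ni Nj; apply/ltW; apply: (hAB (t i, t j)); split; [exact: hA|exact: hB].
have [nm|mn] := leqP n m.
  by rewrite (le_trans (h _ _ nm))// (le_trans (ler_norm _))// key.
rewrite -(nrmN P (phB P (Du m) (Du n))) opprB (le_trans (h _ _ (ltnW mn)))//.
by rewrite (le_trans (ler_norm _))// key.
Qed.

Lemma nrm_ncvg_le (u : nat -> E) f (M : R) : (forall n, D (u n)) -> D f -> ncvg u f ->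
  (forall n, nrm (u n) <= M) -> nrm f <= M.
Proof.
move=> Du Df uf uM.
have h : (fun n => nrm (u n - f) + M) @ \oo --> (0 + M : R).
  by apply: cvgD uf _; exact: cvg_cst.
rewrite add0r in h; rewrite -(cvg_lim _ h)//; apply: limr_ge.
  by apply/cvg_ex; eexists; exact: h.
apply: nearW => n; rewrite -[X in nrm X <= _](subrK (u n)).
rewrite (le_trans (nrmD P _ _))//; first exact: (phB P).
rewrite lerD// -(nrmN P); last exact: (phB P).
by rewrite opprB.
Qed.

End NormConvergence.

Section SquareRoot.
Context {R : realType} {E : lmodType R[i]}.
Local Notation C := R[i].
Context {D : set E} {dot : E -> E -> C} (H : hilbert D dot).
Local Notation "'[ f , g ]" := (dot f g) (format "''[' f ,  g ]").
Local Notation nsq := (nsqd dot).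
Local Notation nrm := (nrmd dot).
Local Notation ncvg := (@ncvg R E dot).
Let P := hb_pre H.

(** The scalar case [X = 1] of the iteration [sqrt_iter] below. It increases within [[0, 1]] and
    dominates the operator iterates and their differences. *)
Fixpoint sqrt_iter_bound (n : nat) : R :=
  if n is n'.+1 then (1 + sqrt_iter_bound n' ^+ 2) / 2 else 0.
Local Notation t := sqrt_iter_bound.

Lemma sqrt_iter_bound01 n : 0 <= t n <= 1.
Proof. by elim: n => [|n /andP[h1 h2]] /=; [lra|nra]. Qed.

Lemma sqrt_iter_bound_nd n : t n <= t n.+1.
Proof. rewrite [X in _ <= X]/=; have := sqr_ge0 (1 - t n).
by move: (t n) => x; lra.
Qed.

Lemma sqrt_iter_bound_cvg : cvgn t.
Proof.
apply: nondecreasing_is_cvgn; first by apply/nondecreasing_seqP; exact: sqrt_iter_bound_nd.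
by exists 1 => _ [n _ <-]; have /andP[] := sqrt_iter_bound01 n.
Qed.

Lemma opB A f g : is_operator D A -> D f -> D g -> A (f - g) = A f - A g.
Proof.
by move=> [_ lA] Df Dg; have := lA (-1) g f Dg Df; rewrite !scaleN1r addrC [RHS]addrC.
Qed.
Lemma op0 A : is_operator D A -> A 0 = 0.
Proof.
by move=> [_ lA]; have := lA (-1) _ _ (ph0 P) (ph0 P); rewrite scaler0 addr0 scaleN1r addNr.
Qed.
Lemma opZ A a f : is_operator D A -> D f -> A (a *: f) = a *: A f.
Proof.
by move=> oA Df; have := oA.2 a f 0 Df (ph0 P); rewrite (op0 oA) !addr0.
Qed.
Lemma opD A f g : is_operator D A -> D f -> D g -> A (f + g) = A f + A g.
Proof. by move=> [_ lA] Df Dg; have := lA 1 f g Df Dg; rewrite !scale1r. Qed.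
Lemma op_sum A I (r : seq I) (Q : pred I) (F : I -> E) : is_operator D A ->
  (forall i, Q i -> D (F i)) ->
  A (\sum_(i <- r | Q i) F i) = \sum_(i <- r | Q i) A (F i).
Proof.
move=> oA DF.
suff [] : D (\sum_(i <- r | Q i) F i) /\
  A (\sum_(i <- r | Q i) F i) = \sum_(i <- r | Q i) A (F i) by [].
elim/big_rec2 : _ => [|i x y Qi [Dy e]]; first by rewrite op0//; split => //; exact: (ph0 P).
by split; [apply: (phD P) => //; exact: DF|rewrite opD ?e//; exact: DF].
Qed.

Section Iteration.
(* [X] plays the role of [1 - T / M]; the iterates increase to [1 - sqrt X]. *)
Variable X : E -> E.
Hypothesis oX : is_operator D X.
Hypothesis nX : forall f, D f -> nrm (X f) <= nrm f.

Fixpoint sqrt_iter (n : nat) (f : E) : E :=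
  if n is n'.+1 then 2^-1 *: (X f + sqrt_iter n' (sqrt_iter n' f)) else 0.
Local Notation Y := sqrt_iter.

Lemma sqrt_iterD n f : D f -> D (Y n f).
Proof.
elim: n f => [|n IH] f Df /=; first exact: (ph0 P).
by apply: (phZ P); apply: (phD P); [exact: oX.1|exact/IH/IH].
Qed.

Lemma sqrt_iter_op n : is_operator D (Y n).
Proof.
split; first exact: sqrt_iterD.
elim: n => [|n IH] a f g Df Dg /=; first by rewrite scaler0 addr0.
rewrite oX.2// IH// IH; try exact: sqrt_iterD.
by rewrite !scalerDr !scalerA (mulrC a) addrACA.
Qed.

Lemma sqrt_iter_comm Z : is_operator D Z -> (forall f, D f -> Z (X f) = X (Z f)) ->
  forall n f, D f -> Z (Y n f) = Y n (Z f).
Proof.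
move=> oZ ZX; elim=> [|n IH] f Df /=; first exact: op0.
rewrite opZ//; last by apply: (phD P); [exact: oX.1|exact/sqrt_iterD/sqrt_iterD].
rewrite opD// ?ZX ?IH//; try exact: sqrt_iterD.
  exact: oX.1.
exact/sqrt_iterD/sqrt_iterD.
Qed.

Lemma sqrt_iter_commY m n f : D f -> Y m (Y n f) = Y n (Y m f).
Proof.
apply: sqrt_iter_comm; first exact: sqrt_iter_op.
by move=> g Dg; rewrite (sqrt_iter_comm oX).
Qed.

Lemma cab_half : cab (2^-1 : C) = 2^-1.
Proof.
have -> : (2^-1 : C) = (2^-1)%:C by rewrite fmorphV; congr (_^-1); rewrite -CRnat.
by rewrite cab_real ger0_norm// invr_ge0.
Qed.

Lemma sqrt_iter_nrm n f : D f -> nrm (Y n f) <= t n * nrm f.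
Proof.
elim: n f => [|n IH] f Df; first by rewrite /= (nrm0 P) mul0r.
have DY := sqrt_iterD n; rewrite /= (nrmZ P); last by apply: (phD P); [exact: oX.1|exact/DY/DY].
rewrite cab_half mulrC ler_pdivrMr// (le_trans (nrmD P _ _))//; [exact: oX.1|exact/DY/DY|].
have h1 := IH _ (DY _ Df); have h2 := IH _ Df; have h3 := nX Df.
have /andP[t0 t1] := sqrt_iter_bound01 n.
have h4 : t n * nrm (Y n f) <= t n * (t n * nrm f) by rewrite ler_wpM2l.
by rewrite [X in _ <= X](_ : _ = nrm f + t n * (t n * nrm f)); [lra|field].
Qed.

Lemma sqrt_iter_nrm1 n f : D f -> nrm (Y n f) <= nrm f.
Proof.
move=> Df; rewrite (le_trans (sqrt_iter_nrm n Df))// ler_piMl ?nrm_ge0//.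
by have /andP[] := sqrt_iter_bound01 n.
Qed.

(** The iterates commute, being polynomials in [X], so [Y_(m+1) - Y_(n+1) = (Y_m + Y_n)(Y_m - Y_n) /
    2]; the bounds [t] satisfy the same identity, and induction compares the two. *)
Lemma sqrt_iter_cauchy m n f : D f -> (n <= m)%N -> nrm (Y m f - Y n f) <= (t m - t n) * nrm f.
Proof.
elim: n m f => [|n IH] [|m] f Df // nm.
- by rewrite /= subrr (nrm0 P) subrr mul0r.
- by rewrite [Y 0 f]/= [t 0]/= !subr0 sqrt_iter_nrm.
have DY k g : D g -> D (Y k g) by exact: sqrt_iterD.
have DB g : D g -> D (Y m g - Y n g) by move=> Dg; apply: (phB P); exact: DY.
have -> : Y m.+1 f - Y n.+1 f = 2^-1 *: (Y m (Y m f - Y n f) + Y n (Y m f - Y n f)).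
  rewrite /= -scalerBr; congr (_ *: _); rewrite !(opB (sqrt_iter_op _))//; try exact: DY.
  rewrite (sqrt_iter_commY m n)// opprD addrACA subrr add0r.
  by rewrite addrA subrK.
rewrite (nrmZ P); last by apply: (phD P); apply/DY; exact: DB.
rewrite cab_half mulrC ler_pdivrMr//.
rewrite (le_trans (nrmD P (DY _ _ (DB _ Df)) (DY _ _ (DB _ Df))))//.
have h := IH m f Df nm.
have /andP[tm0 _] := sqrt_iter_bound01 m; have /andP[tn0 _] := sqrt_iter_bound01 n.
have h1 := sqrt_iter_nrm m (DB _ Df); have h2 := sqrt_iter_nrm n (DB _ Df).
have h3 : (t m + t n) * nrm (Y m f - Y n f) <= (t m + t n) * ((t m - t n) * nrm f).
  by rewrite ler_wpM2l// addr_ge0.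
rewrite [X in _ <= X](_ : _ = (t m + t n) * ((t m - t n) * nrm f)); first by lra.
by rewrite /=; field.
Qed.

Lemma sqrt_iter_lim f : D f -> exists2 g, D g & ncvg (Y ^~ f) g.
Proof.
move=> Df; apply: (@ncvg_cauchy _ _ _ _ H _ (fun n => t n * nrm f)).
- by move=> n; exact: sqrt_iterD.
- apply: is_cvgMl; exact: sqrt_iter_bound_cvg.
- by move=> m n nm; rewrite -mulrBl sqrt_iter_cauchy.
Qed.

Definition sqrt_lim (f : E) : E := xget 0 [set g | D g /\ ncvg (Y ^~ f) g].
Local Notation L := sqrt_lim.

Lemma sqrt_limP f : D f -> D (L f) /\ ncvg (Y ^~ f) (L f).
Proof. by move=> /sqrt_iter_lim[g Dg h]; apply: (@xgetPex _ 0 [set g | D g /\ ncvg (Y ^~ f) g]); exists g. Qed.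

Lemma sqrt_lim_op : is_operator D L.
Proof.
split=> [f /sqrt_limP[]//|a f g Df Dg].
have [Df' hf] := sqrt_limP Df; have [Dg' hg] := sqrt_limP Dg.
have [Dfg' hfg] := sqrt_limP (phL P a Df Dg).
have DY k g' : D g' -> D (Y k g') by exact: sqrt_iterD.
apply: (ncvg_unique H _ _ _ hfg) => //; first by move=> n; apply/DY; exact: (phL P).
  exact: (phL P).
have h := ncvgL H a (fun n => DY n _ Df) (fun n => DY n _ Dg) Df' Dg' hf hg.
apply: cvg_ext h => n.
by rewrite (sqrt_iter_op n).2.
Qed.

Lemma sqrt_lim_nrm f : D f -> nrm (L f) <= nrm f.
Proof.
move=> Df; have [Df' hf] := sqrt_limP Df.
apply: (nrm_ncvg_le H _ Df' hf) => n; first exact: sqrt_iterD.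
exact: sqrt_iter_nrm1.
Qed.

Lemma sqrt_lim_comm Z (M : R) : is_operator D Z ->
  (forall f, D f -> nrm (Z f) <= M * nrm f) -> (forall f, D f -> Z (X f) = X (Z f)) ->
  forall f, D f -> Z (L f) = L (Z f).
Proof.
move=> oZ bZ ZX f Df; have [Df' hf] := sqrt_limP Df.
have [DZ' hZ] := sqrt_limP (oZ.1 _ Df).
have DY k g' : D g' -> D (Y k g') by exact: sqrt_iterD.
have h := ncvg_bounded H oZ bZ (fun n => DY n _ Df) Df' hf.
apply: (ncvg_unique H _ _ _ _ hZ) => //; [by move=> n; apply/DY; exact: oZ.1|exact: oZ.1|].
by apply: cvg_ext h => n; rewrite (sqrt_iter_comm oZ ZX).
Qed.

(** The limit of the recursion. It reads [(1 - L)^2 = 1 - X], which makes [1 - L] a square root of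
    [1 - X]. *)
Lemma sqrt_lim_eq f : D f -> L f = 2^-1 *: (X f + L (L f)).
Proof.
move=> Df; have [Df' hf] := sqrt_limP Df; have [DL hL] := sqrt_limP Df'.
have DY k g' : D g' -> D (Y k g') by exact: sqrt_iterD.
have DX := oX.1.
apply: (@ncvg_unique _ _ _ _ H (fun n => Y n.+1 f)).
- by move=> n; exact: DY.
- by [].
- by apply: (phZ P); apply: (phD P); [exact: DX|].
- have := hf; rewrite /ncvg -(cvg_shiftS (fun n => nrm (Y n f - L f))); exact.
have h1 : (fun n => nrm (Y n f - L f) + nrm (Y n (L f) - L (L f))) @ \oo --> (0 + 0 : R).
  exact: cvgD hf hL.
rewrite addr0 in h1; apply: squeeze0 h1 => n; rewrite nrm_ge0/=.
rewrite -scalerBr opprD addrACA subrr add0r (nrmZ P); last first.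
  by apply: (phB P) => //; exact/DY/DY.
rewrite cab_half.
have -> : Y n (Y n f) - L (L f) = Y n (Y n f - L f) + (Y n (L f) - L (L f)).
  by rewrite (opB (sqrt_iter_op _))// ?addrA ?subrK//; exact: DY.
have D1 : D (Y n f - L f) by apply: (phB P) => //; exact: DY.
have D2 : D (Y n (L f) - L (L f)) by apply: (phB P) => //; exact: DY.
have h2 := nrmD P (DY n _ D1) D2; have h3 := sqrt_iter_nrm1 n D1.
by have := nrm_ge0 dot (Y n f - L f); have := nrm_ge0 dot (Y n (L f) - L (L f)); lra.
Qed.

Hypothesis hX : forall f g, D f -> D g -> '[X f, g] = '[f, X g].

Lemma sqrt_iter_herm n f g : D f -> D g -> '[Y n f, g] = '[f, Y n g].
Proof.
elim: n f g => [|n IH] f g Df Dg /=; first by rewrite (dot0l P)// (dot0r P).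
have DY h : D h -> D (Y n h) by exact: sqrt_iterD.
have DX := oX.1; have DXY h : D h -> D (X h + Y n (Y n h)).
  by move=> Dh; apply: (phD P); [exact: DX|exact/DY/DY].
rewrite (dotZl P _ (DXY _ Df) Dg) (dotZr P _ (DXY _ Dg) Df).
rewrite (dotDl P (DX _ Df) (DY _ (DY _ Df)) Dg) (dotDr P (DX _ Dg) (DY _ (DY _ Dg)) Df).
rewrite hX// !IH//; try exact/DY.
by rewrite fmorphV rmorph_nat.
Qed.

Lemma sqrt_lim_herm f g : D f -> D g -> '[L f, g] = '[f, L g].
Proof.
move=> Df Dg; have [Df' hf] := sqrt_limP Df; have [Dg' hg] := sqrt_limP Dg.
have DY k g' : D g' -> D (Y k g') by exact: sqrt_iterD.
have h1 := ncvg_dotl H (fun n => DY n _ Df) Df' Dg hf.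
have h2 := cvgJ (ncvg_dotl H (fun n => DY n _ Dg) Dg' Df hg).
rewrite [RHS](ph_sym P Dg' Df).
apply: (cvg_uniqueC h1); apply: cvg_ext (h2 _) => n.
by rewrite -(ph_sym P (DY _ _ Dg) Df) sqrt_iter_herm.
Qed.

End Iteration.

Section Root.
Variables (T : E -> E) (M : R).
Hypothesis M0 : 0 < M.
Hypothesis oT : is_operator D T.
Hypothesis pT : forall f, D f -> 0 <= '[T f, f].
Hypothesis bT : forall f, D f -> Re '[T f, f] <= M * nsq f.

Let X f := f - (M^-1)%:C *: T f.

Let DX f : D f -> D (X f).
Proof. by move=> Df; apply: (phB P) => //; apply: (phZ P); exact: oT.1. Qed.

Let oX : is_operator D X.
Proof.
split => // a f g Df Dg; rewrite /X oT.2// scalerDr opprD addrACA scalerBr.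
by rewrite !scalerA [a * _]mulrC.
Qed.

Let hT f g : D f -> D g -> '[T f, g] = '[f, T g].
Proof.
move=> Df Dg; rewrite (pos_herm H oT pT Dg Df) (ph_sym P _ Df)//.
exact: oT.1.
Qed.

Let hX f g : D f -> D g -> '[X f, g] = '[f, X g].
Proof.
move=> Df Dg; have DT := oT.1; rewrite (dotBl P)// ?(dotBr P)//; try by apply: (phZ P); exact: DT.
rewrite (dotZl P)// ?(dotZr P)//; try exact: DT.
by rewrite hT// CRJ.
Qed.

Let pX f : D f -> 0 <= '[X f, f] /\ Re '[X f, f] <= nsq f.
Proof.
move=> Df; have DT := oT.1; rewrite (dotBl P)//; last by apply: (phZ P); exact: DT.
rewrite (dotZl P)//; last exact: DT.
have := pT Df; rewrite ge0C => /andP[/eqP h1 h2]; have h3 := bT Df.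
rewrite (dot_nsq P)// ge0C ReB ImB ReMC ImMC h1 /= mulr0 subrr eqxx /=.
rewrite subr_ge0 ler_pdivrMl// h3; split => //.
by rewrite lerBlDr lerDl mulr_ge0// invr_ge0 ltW.
Qed.

(** Cauchy-Schwarz for the positive form [<X ., .>] at [f] and [X f]: [|X f|^4 <= <X f, f> <X (X f),
    X f> <= |f|^2 |X f|^2]. *)
Let nX f : D f -> nrm (X f) <= nrm f.
Proof.
move=> Df; rewrite ler_wsqrtr//.
pose x a b := '[X a, b].
have Px : prehilbert D x.
  split; [exact: (ph0 P)|exact: (phL P)| | |by move=> g /pX[]].
    by move=> a g h k Dg Dh Dk; rewrite /x oX.2// (ph_lin P)//; exact: DX.
  by move=> g h Dg Dh; rewrite /x hX// (ph_sym P (DX Dg) Dh).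
have := CS2 Px Df (DX Df).
rewrite /nsqd /x -/(nsqd dot (X f)) [cab _](_ : _ = nsq (X f)); last first.
  by rewrite (dot_nsq P) ?cab_real ?ger0_norm ?(nsq_ge0 P)//; exact: DX.
have [p1 b1] := pX Df; have [p2 b2] := pX (DX Df).
have q1 : 0 <= Re '[X f, f] by move: p1; rewrite ge0C => /andP[].
have q2 : 0 <= Re '[X (X f), X f] by move: p2; rewrite ge0C => /andP[].
have := nsq_ge0 P Df; have := nsq_ge0 P (DX Df).
rewrite -!/(nsqd dot _); set a := nsq (X f); set b := nsq f => a0 b0 h.
have {}h : a ^+ 2 <= b * a by rewrite (le_trans h)// ler_pM.
have [->//|an0] := eqVneq a 0.
by move: h; rewrite expr2 ler_pM2r// lt0r an0.
Qed.

Let L := sqrt_lim X.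
Definition psd_root f := (Num.sqrt M)%:C *: (f - L f).
Local Notation S := psd_root.

Let oL : is_operator D L := sqrt_lim_op oX nX.

Lemma psd_root_op : is_operator D S.
Proof.
split=> [f Df|a f g Df Dg].
  by apply: (phZ P); apply: (phB P) => //; exact: oL.1.
rewrite /psd_root oL.2// opprD addrACA !scalerDr; congr (_ + _).
by rewrite -!scalerDr -scalerBr !scalerA mulrC.
Qed.

Lemma psd_root_sq f : D f -> S (S f) = T f.
Proof.
move=> Df; have DL g : D g -> D (L g) by exact: oL.1.
rewrite [LHS]/psd_root [X in X - _]/psd_root (opZ _ oL); last by apply: (phB P) => //; exact: DL.
rewrite -scalerBr scalerA -CRM -expr2 sqr_sqrtr ?(ltW M0)//.
rewrite (opB oL)//; last exact: DL.
have h := sqrt_lim_eq oX nX Df; rewrite -/L in h.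
have h2 : L (L f) = 2 *: L f - X f.
  by rewrite [in RHS]h scalerA divff ?pnatr_eq0// scale1r addrC addKr.
have -> : f - L f - (L f - L (L f)) = M^-1%:C *: T f.
  rewrite h2 /X scaler_nat mulr2n opprB [X in _ + X]addrAC addrK subrKA opprB.
  by rewrite addrC subrK.
by rewrite scalerA -CRM divff ?gt_eqF// CR1 scale1r.
Qed.

Lemma psd_root_pos f : D f -> 0 <= '[S f, f].
Proof.
move=> Df; have DL := oL.1 _ Df.
rewrite (dotZl P)//; last exact: (phB P).
have I0 : Im '[L f, f] = 0.
  have := sqrt_lim_herm oX nX hX Df Df; rewrite -/L (ph_sym P DL Df).
  by move=> /(congr1 (@complex.Im R)); rewrite ImJ; lra.
rewrite (dotBl P)// (dot_nsq P)// ge0C ImMC ReMC ImB ReB I0 /= subrr mulr0 eqxx/=.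
rewrite mulr_ge0 ?sqrtr_ge0// subr_ge0 (le_trans (ler_norm _))// (le_trans (cab_Re _))//.
rewrite (le_trans (CS P DL Df))// -(nrm_sqr P)// expr2 ler_wpM2r ?nrm_ge0//.
exact: (sqrt_lim_nrm oX nX).
Qed.

Lemma psd_root_sqrt : is_sqrt_op D dot T S.
Proof. by split; [exact: psd_root_op|exact: psd_root_pos|exact: psd_root_sq]. Qed.

(** A root [S'] commutes with [T = S'^2], hence with the limit [L] and with [S]. For
    [y = S' f - S f] this gives [(S' + S) y = 0]; both forms are nonnegative at [y], so
    [S' y = S y = 0], and then [|y|^2 = <y, S' f> - <y, S f> = 0]. *)
Lemma sqrt_op_unique S' : is_sqrt_op D dot T S' -> forall f, D f -> S' f = S f.
Proof.
move=> [oS' pS' sqS'] f Df; have DS' := oS'.1; have DS := psd_root_op.1.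
have DL g : D g -> D (L g) by exact: oL.1.
have hS' := pos_herm H oS' pS'.
(* Boundedness of [S'] is automatic from [|S' g|^2 = <T g, g>]; it lets [S'] pass through the limit
   defining [L]. *)
have bS' g : D g -> nrm (S' g) <= Num.sqrt M * nrm g.
  move=> Dg; rewrite -sqrtrM ?(ltW M0)// ler_wsqrtr// /nsqd.
  rewrite hS' //; last exact: DS'.
  by rewrite sqS'// ReJ bT.
have S'T g : D g -> S' (T g) = T (S' g) by move=> Dg; rewrite -!sqS'//; exact: DS'.
have S'X g : D g -> S' (X g) = X (S' g).
  move=> Dg; rewrite /X (opB oS')//; last by apply: (phZ P); exact: oT.1.
  by rewrite (opZ _ oS') ?S'T//; exact: oT.1.
have S'L g : D g -> S' (L g) = L (S' g) by exact: (sqrt_lim_comm oX nX oS' bS' S'X).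
have S'S g : D g -> S' (S g) = S (S' g).
  move=> Dg; rewrite /psd_root (opZ _ oS'); last by apply: (phB P) => //; exact: DL.
  by rewrite (opB oS')// ?S'L//; exact: DL.
have oS := psd_root_op; have pS := psd_root_pos; have hS := pos_herm H oS pS.
pose y := S' f - S f.
have Dy : D y by apply: (phB P); [exact: DS'|exact: DS].
have y0 : S' y + S y = 0.
  rewrite /y (opB oS')// ?(opB oS)//; try exact: DS'; try exact: DS.
  by rewrite S'S// sqS'// psd_root_sq// addrA subrK subrr.
have key (Q : E -> E) : is_operator D Q -> (forall g, D g -> 0 <= '[Q g, g]) ->
    Re '[Q y, y] = 0 -> Q y = 0.
  move=> oQ pQ q0; have hQ := pos_herm H oQ pQ; apply: (hb_def H); first exact: oQ.1.
  pose s a b := '[Q a, b].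
  have Ps : prehilbert D s.
    split; [exact: (ph0 P)|exact: (phL P)| |by move=> g h Dg Dh; exact: hQ|by []].
    by move=> a g h k Dg Dh Dk; rewrite /s oQ.2// (ph_lin P)//; exact: oQ.1.
  by rewrite /nsqd -/(s _ _) (nsq_eq0_dotl Ps)//; exact: oQ.1.
have := pS' _ Dy; have := pS _ Dy; rewrite !ge0C => /andP[_ h1] /andP[_ h2].
have : Re '[S' y + S y, y] = 0 by rewrite y0 (dot0l P).
rewrite (dotDl P) ?ReD//; [|exact: DS'|exact: DS] => h3.
have Sy : S y = 0 by apply: key => //; lra.
have S'y : S' y = 0 by apply: key => //; lra.
apply/eqP; rewrite -subr_eq0 -/y; apply/eqP; apply: (hb_def H) => //.
rewrite /nsqd {1}/y (dotBl P)//; [|exact: DS'|exact: DS].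
rewrite (ph_sym P Dy (DS' _ Df)) (ph_sym P Dy (DS _ Df)).
have e1 : '[y, S' f] = 0.
  by rewrite (ph_sym P (DS' _ Df) Dy) -hS'// S'y (dot0l P)// CJ0.
have e2 : '[y, S f] = 0.
  by rewrite (ph_sym P (DS _ Df) Dy) -hS// Sy (dot0l P)// CJ0.
by rewrite e1 e2 CJ0 subrr.
Qed.

End Root.

Lemma sqrt_op_exists T (M : R) : is_operator D T -> (forall f, D f -> 0 <= '[T f, f]) ->
  (forall f, D f -> Re '[T f, f] <= M * nsq f) -> is_sqrt_op D dot T (sqrt_op D dot T) /\
  forall S', is_sqrt_op D dot T S' -> forall f, D f -> S' f = sqrt_op D dot T f.
Proof.
move=> oT pT bT; pose M' := `|M| + 1.
have M'0 : 0 < M' by rewrite ltr_wpDl.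
have bT' f : D f -> Re '[T f, f] <= M' * nsq f.
  move=> Df; rewrite (le_trans (bT _ Df))// ler_wpM2r ?(nsq_ge0 P)//.
  by rewrite (le_trans (ler_norm _))// lerDl.
have h := psd_root_sqrt M'0 oT pT bT'.
have hs : is_sqrt_op D dot T (sqrt_op D dot T).
  by apply: (xgetPex (fun=> 0)); eexists; exact: h.
split=> // S' hS' f Df.
by rewrite (sqrt_op_unique M'0 oT pT bT' hS')// (sqrt_op_unique M'0 oT pT bT' hs).
Qed.

End SquareRoot.

(** * Adjoints and orthonormal bases *)

Section Riesz.
Context {R : realType} {E : lmodType R[i]}.
Local Notation C := R[i].
Context {D : set E} {dot : E -> E -> C} (H : hilbert D dot).
Local Notation "'[ f , g ]" := (dot f g) (format "''[' f ,  g ]").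
Local Notation nsq := (nsqd dot).
Local Notation nrm := (nrmd dot).
Local Notation ncvg := (@ncvg R E dot).
Let P := hb_pre H.
Variables (e : nat -> E) (oe : orthonormal_basis D dot e).
Let De := onbD oe.

(** The vector is the limit of [r_n = sum_(k < n) conj(phi e_k) e_k]. Since
    [|r_n|^2 = phi r_n <= M |r_n|], the squares [|phi e_k|^2] are summable with sum at most
    [M^2]. *)
Lemma riesz (phi : E -> C) (M : R) :
  (forall (a : C) f g, D f -> D g -> phi (a *: f + g) = a * phi f + phi g) ->
  (forall f, D f -> cab (phi f) <= M * nrm f) ->
  exists2 r, D r & forall f, D f -> phi f = '[f, r].
Proof.
move=> lphi bphi.
have phi0 : phi 0 = 0.
  by have := lphi (-1) _ _ (ph0 P) (ph0 P); rewrite scaler0 addr0 mulN1r addNr.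
have phi_sum n (a : nat -> C) : phi (\sum_(0 <= k < n) a k *: e k) =
    \sum_(0 <= k < n) a k * phi (e k).
  suff [] : D (\sum_(0 <= k < n) a k *: e k) /\ phi (\sum_(0 <= k < n) a k *: e k) =
    \sum_(0 <= k < n) a k * phi (e k) by [].
  elim/big_rec2 : _ => [|i x y _ [Dy h]]; first by split => //; exact: (ph0 P).
  by split; [exact: (phL P)|rewrite lphi// h].
pose r n := \sum_(0 <= k < n) (phi (e k))^* *: e k.
have Dr n : D (r n) by apply: (ph_sum P) => k _; exact: (phZ P).
have dotr n k : '[r n, e k] = if (k < n)%N then (phi (e k))^* else 0.
  rewrite (dot_suml P)//; last by move=> i _; exact: (phZ P).
  under eq_bigr do rewrite (dotZl P)// (onbE oe).
  case: ifPn => kn.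
    rewrite (bigD1_seq k) ?iota_uniq ?mem_index_iota//= eqxx mulr1 big1 ?addr0// => i ik.
    by rewrite (negbTE ik) mulr0.
  rewrite big1_seq// => i; rewrite mem_index_iota => /andP[_ /andP[_ i_n]].
  case: eqP => [ik|_]; last by rewrite mulr0.
  by rewrite ik (negbTE kn) in i_n.
have rE n : onbproj dot e n (r n) = r n.
  rewrite /onbproj /r; apply: eq_big_nat => k /andP[_ kn].
  by rewrite dotr kn.
have nr n : nsq (r n) = \sum_(0 <= k < n) cab (phi (e k)) ^+ 2.
  rewrite -(rE n) (nsq_onbproj H oe)//; apply: eq_big_nat => k /andP[_ kn].
  by rewrite dotr kn cabJ.
have br n : nsq (r n) <= M ^+ 2.
  have h : (nsq (r n))%:C = phi (r n).
    rewrite phi_sum nr CR_sum; apply: eq_bigr => k _.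
    by rewrite mulrC mulJ_cab.
  have := bphi _ (Dr n); rewrite -h cab_real ger0_norm ?(nsq_ge0 P)// => h2.
  have [->|n0] := eqVneq (nsq (r n)) 0; first by rewrite sqr_ge0.
  have n1 : 0 < nrm (r n) by rewrite sqrtr_gt0 lt0r n0 (nsq_ge0 P).
  move: h2; rewrite -(nrm_sqr P)// expr2 ler_pM2r// => h2.
  by rewrite expr2 ler_pM ?nrm_ge0.
have cs : cvgn (series (fun k => cab (phi (e k)) ^+ 2)).
  by apply: (@series_bound _ _ (M ^+ 2)) => [k|n]; rewrite ?sqr_ge0// -nr.
have key m n : (n <= m)%N -> nsq (r m - r n) = \sum_(n <= k < m) cab (phi (e k)) ^+ 2.
  move=> nm; have := nsq_onbprojB H oe (Dr m) nm.
  have -> : onbproj dot e n (r m) = r n.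
    rewrite /onbproj /r; apply: eq_big_nat => k /andP[_ kn].
    by rewrite dotr (leq_trans kn).
  rewrite rE => ->.
  have -> : \sum_(0 <= k < m) cab '[r m, e k] ^+ 2 = \sum_(0 <= k < m) cab (phi (e k)) ^+ 2.
    by apply: eq_big_nat => k /andP[_ km]; rewrite dotr km cabJ.
  have -> : \sum_(0 <= k < n) cab '[r m, e k] ^+ 2 = \sum_(0 <= k < n) cab (phi (e k)) ^+ 2.
    by apply: eq_big_nat => k /andP[_ kn]; rewrite dotr (leq_trans kn)// cabJ.
  by rewrite (big_cat_nat (leq0n n) nm)/= addrAC subrr add0r.
have [//||g Dg hg] := hb_cplt H (u := r).
  move=> d d0; have [N hN] := series_tail (fun k => sqr_ge0 (cab (phi (e k)))) cs d0.
  have key2 m n : (N <= n)%N -> (n <= m)%N -> nsq (r m - r n) <= d.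
    move=> Nn nm; rewrite key// (le_trans _ (hN m))// (big_cat_nat Nn nm)/= lerDr.
    by apply: sumr_ge0 => k _; rewrite sqr_ge0.
  exists N => m n Nm Nn; have [nm|mn] := leqP n m; first exact: key2.
  rewrite -(nsqN P (phB P (Dr m) (Dr n))) opprB.
  exact: key2 Nm (ltnW mn).
exists g => // f Df.
have h1 := ncvg_dotr P Dr Dg Df hg.
have Dp n : D (onbproj dot e n f) by exact: (onbproj_D H oe).
have h2 : (fun n => phi (onbproj dot e n f)) @ \oo --> phi f.
  have := nsq_ncvg (onb_cvg H oe Df) => h3.
  have h4 : (fun n => M * nrm (onbproj dot e n f - f)) @ \oo --> (M * 0 : R).
    by exact: cvgMr.
  rewrite mulr0 in h4; apply: cvg0C_le h4 => n.
  have -> : phi (onbproj dot e n f) - phi f = phi (onbproj dot e n f - f).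
    by have := lphi (-1) f _ Df (Dp n); rewrite mulN1r scaleN1r addrC [RHS]addrC => ->.
  by apply: bphi; exact: (phB P).
apply: (cvg_uniqueC h2); apply: cvg_ext h1 => n.
rewrite phi_sum (dot_sumr P)//; last by move=> k _; exact: (phZ P).
by apply: eq_bigr => k _; rewrite (dotZr P)// CJK mulrC.
Qed.

Lemma adjoint_exists A : bounded_operator D dot A -> exists B, is_adjoint D dot D dot A B.
Proof.
move=> [[DA lA] [M bA]].
have bA' f : D f -> nrm (A f) <= Num.sqrt `|M| * nrm f.
  move=> Df; rewrite -sqrtrM// ler_wsqrtr// (le_trans (bA _ Df))//.
  by rewrite ler_wpM2r ?ler_norm// (nsq_ge0 P).
have key g : exists r, D g -> D r /\ forall f, D f -> '[A f, g] = '[f, r].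
  have [Dg|nDg] := pselect (D g); last by exists 0.
  have [|f Df|r Dr hr] := @riesz (fun f => '[A f, g]) (Num.sqrt `|M| * nrm g).
  - by move=> a f h Df Dh; rewrite lA// (ph_lin P)//; exact: DA.
  - rewrite (le_trans (CS P (DA _ Df) Dg))// mulrAC ler_wpM2r ?nrm_ge0//.
    exact: bA'.
  - by exists r.
have [B hB] := choice key; exists B; split => [g Dg|f g Df Dg].
  by have [] := hB g Dg.
by have [_ ->] := hB g Dg.
Qed.

End Riesz.

(** * Trace-class operators through uniform bounds on Bessel systems *)

Section WeaklyNuclear.
Context {R : realType} {E : lmodType R[i]}.
Local Notation C := R[i].

Lemma sum_CS (a b : nat -> R) n (A B : R) : (forall k, 0 <= a k) -> (forall k, 0 <= b k) ->
  0 <= A -> 0 <= B -> \sum_(0 <= k < n) a k ^+ 2 <= A ^+ 2 ->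
  \sum_(0 <= k < n) b k ^+ 2 <= B ^+ 2 -> \sum_(0 <= k < n) a k * b k <= A * B.
Proof.
move=> a0 b0 A0 B0 hA hB.
have key : A * B * (\sum_(0 <= k < n) a k * b k) <= A * B * (A * B).
  have h : \sum_(0 <= k < n) (A * B * (a k * b k)) <=
      \sum_(0 <= k < n) ((a k ^+ 2 * B ^+ 2 + b k ^+ 2 * A ^+ 2) / 2).
    apply: ler_sum => k _; have := sqr_ge0 (a k * B - b k * A).
    by lra.
  rewrite mulr_sumr (le_trans h)// -mulr_suml big_split/= -!mulr_suml.
  rewrite ler_pdivrMr//.
  have h1 := ler_wpM2r (sqr_ge0 B) hA; have h2 := ler_wpM2r (sqr_ge0 A) hB.
  by apply: le_trans (lerD h1 h2) _; lra.
have [AB0|AB0] := eqVneq (A * B) 0; last by rewrite -(ler_pM2l (x := A * B))// lt0r AB0 mulr_ge0.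
rewrite AB0; move: AB0 => /eqP; rewrite mulf_eq0 => AB0.
have z (c : nat -> R) (X : R) : X == 0 -> \sum_(0 <= k < n) c k ^+ 2 <= X ^+ 2 ->
    forall k, (k < n)%N -> c k = 0.
  move=> /eqP ->; rewrite expr0n/= => h k kn.
  have := psumr_eq0P (I := 'I_n) (P := xpredT) (F := fun k => c k ^+ 2).
  have h' : \sum_(i < n) c i ^+ 2 = 0.
    by apply/eqP; rewrite eq_le -(big_mkord xpredT (fun k => c k ^+ 2)) h sumr_ge0// => i _; rewrite sqr_ge0.
  move=> /(_ (fun i _ => sqr_ge0 _) h' (Ordinal kn) isT)/= /eqP.
  by rewrite sqrf_eq0 => /eqP.
case/orP: AB0 => h0.
  have ha := z a A h0 hA.
  by rewrite big_nat_cond big1// => k /andP[/andP[_ kn] _]; rewrite ha// mul0r.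
have hb := z b B h0 hB.
by rewrite big_nat_cond big1// => k /andP[/andP[_ kn] _]; rewrite hb// mulr0.
Qed.

Context {D : set E} {dot : E -> E -> C} (H : hilbert D dot).
Local Notation "'[ f , g ]" := (dot f g) (format "''[' f ,  g ]").
Local Notation nsq := (nsqd dot).
Local Notation nrm := (nrmd dot).
Let P := hb_pre H.

Definition bessel_system (p : nat -> E) (N : nat) := (forall k, D (p k)) /\
  forall f, D f -> \sum_(0 <= k < N) cab '[f, p k] ^+ 2 <= nsq f.

(* Classically equivalent to being nuclear, and visibly stable under sums,
   adjoints and compressions. *)
Definition wnuclear (A : E -> E) := bounded_operator D dot A /\
  exists M : R, forall N p q, bessel_system p N -> bessel_system q N ->
    \sum_(0 <= k < N) cab '[A (p k), q k] <= M.

(** Each term [j] of the expansion contributes at most [sum_k |<p_k, u_j>| |<v_j, q_k>| <= |u_j|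
    |v_j|], by Cauchy-Schwarz and the two Bessel inequalities. *)
Lemma nuclear_wnuclear A u v : bounded_operator D dot A -> nuclear (D := D) (dot := dot) A u v -> wnuclear A.
Proof.
move=> bA [Du Dv cu cv hA]; split => //.
have cuv := nrmM_cvg H Du Dv cu cv.
exists (limn (series (fun k => nrm (u k) * nrm (v k)))) => N p q [Dp bp] [Dq bq].
have h := cvg_sumC (K := N) (fun k => cvg_cabn (hA _ _ (Dp k) (Dq k))).
rewrite -(cvg_lim _ h)//; apply: limr_le.
  by apply/cvg_ex; eexists; exact: h.
apply: nearW => J; rewrite /series/=.
apply: (@le_trans _ _ (\sum_(0 <= k < N) \sum_(0 <= j < J) cab '[p k, u j] * cab '[v j, q k])).
  apply: ler_sum => k _; rewrite (le_trans (cab_sum _ _ _))//.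
  by apply: ler_sum => j _; rewrite cabM.
rewrite exchange_big/=.
apply: le_trans (series_le_lim J _ cuv); last by move=> k; rewrite mulr_ge0 ?nrm_ge0.
apply: ler_sum => j _; apply: sum_CS => //; rewrite ?nrm_ge0// (nrm_sqr P)//.
  apply: le_trans (bp _ (Du j)); apply: ler_sum => k _.
  by rewrite (ph_sym P (Du j) (Dp k)) cabJ.
exact: bq.
Qed.

(** A polar decomposition by hand. The vectors [S e_k], with [S = |A|], are orthonormalised into
    [q_i = S x_i]; since [<A f, A g> = <S f, S g>], the [p_i = A x_i] are orthonormal in the same
    sense and play the role of [U q_i] in [A = U S]. Then [sum_(k < N) <S e_k, e_k> = Re sum_(i < N)
    <A P_N q_i, p_i>], which is at most [M]. *)
Lemma wnuclear_trace_class e A : orthonormal_basis D dot e -> wnuclear A ->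
  trace_class D dot A.
Proof.
move=> oe [bA [M hM]]; split => //.
have De := onbD oe.
have [B adjB] := adjoint_exists H oe bA.
have [[DA lA] [m hm]] := bA; have [DB hB] := adjB.
have hB' f g : D f -> D g -> '[B g, f] = '[g, A f].
  move=> Df Dg; rewrite (ph_sym P Df (DB _ Dg)) -hB//.
  by rewrite -(ph_sym P)//; exact: DA.
have oT : is_operator D (B \o A).
  split=> [f Df|a f g Df Dg] /=; first exact/DB/DA.
  rewrite lA//; have DAf := DA _ Df; have DAg := DA _ Dg.
  have DL : D (a *: A f + A g) by exact: (phL P).
  have DR : D (a *: B (A f) + B (A g)) by apply: (phL P); exact: DB.
  apply/eqP; rewrite -subr_eq0; apply/eqP; apply: (hb_def H).
    by apply: (phB P) => //; exact: DB.
  rewrite /nsqd; set w := (X in '[X, X]).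
  have Dw : D w by apply: (phB P) => //; exact: DB.
  suff -> : '[w, w] = 0 by [].
  rewrite {1}/w (dotBl P)//; last exact: DB.
  rewrite (ph_lin P)//; try exact: DB.
  rewrite !hB'// (ph_lin P)//; first by rewrite subrr.
  exact: DA.
have nT f : D f -> '[(B \o A) f, f] = '[A f, A f] by move=> Df; rewrite /= hB'//; exact: DA.
have pT f : D f -> 0 <= '[(B \o A) f, f].
  by move=> Df; rewrite nT//; apply: (ph_ge0 P); exact: DA.
have bT f : D f -> Re '[(B \o A) f, f] <= m * nsq f by move=> Df; rewrite nT//; exact: hm.
have [[oS pS sqS] _] := sqrt_op_exists H oT pT bT.
set S := sqrt_op _ _ _ in oS pS sqS; have [DS lS] := oS.
exists B, S, e; split => //.
have hS := pos_herm H oS pS.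
apply: (@series_bound _ _ M) => [k|N].
  by have := pS _ (De k); rewrite ge0C => /andP[].
pose y k := S (e k).
have Dy k : D (y k) by exact: DS.
pose q := gs (dot := dot) y; pose c := gs_nz (dot := dot) y.
have Dq k : D (q k) by exact: (gs_D P).
have oq : qorthon (dot := dot) q c by exact: (gs_qorthon P).
have [x hx] : exists x : nat -> E, forall k, D (x k) /\ q k = S (x k).
  suff h : forall k, exists z, D z /\ q k = S z by have [x hx] := choice h; exists x.
  apply: (gs_in (P := [set f | exists z, D z /\ f = S z])).
  - by exists 0; split; [exact: (ph0 P)|rewrite (op0 H oS)].
  - move=> a _ _ [z1 [D1 ->]] [z2 [D2 ->]]; exists (a *: z1 + z2).
    by split; [exact: (phL P)|rewrite lS].
  - by move=> k; exists (e k).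
pose p k := A (x k).
have Dx k : D (x k) by have [] := hx k.
have Dp k : D (p k) by exact: DA.
have AS f g : D f -> D g -> '[A f, A g] = '[S f, S g].
  move=> Df Dg; have DAg := DA _ Dg; have DSg := DS _ Dg.
  rewrite hB// -[B (A g)]/((B \o A) g) -sqS// (ph_sym P (DS _ DSg) Df).
  by rewrite hS// CJK.
have op : qorthon (dot := dot) p c.
  by move=> i j; rewrite AS// -!(proj2 (hx _)) oq.
have yE k : (k < N)%N -> y k = \sum_(0 <= i < N) '[y k, q i] *: q i.
  move=> kN; apply/eqP; rewrite -subr_eq0; apply/eqP; apply: (hb_def H).
    by apply: (phB P) => //; apply: (ph_sum P) => i _; exact: (phZ P).
  exact: (gs_span_lt P).
(* The truncations [P_N q_i] are not orthonormal, but [<f, P_N q_i> = <P_N f, q_i>] keeps Bessel's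
   inequality for them. *)
apply: (@le_trans _ _ (\sum_(0 <= i < N) cab '[A (onbproj dot e N (q i)), p i])); last first.
  apply: hM; split => //; try by move=> k; exact: (onbproj_D H oe).
    move=> f Df; have Df' : D (onbproj dot e N f) by exact: (onbproj_D H oe).
    apply: le_trans (_ : nsq (onbproj dot e N f) <= _); last first.
      by rewrite (nsq_onbproj H oe)// (bessel_onb H oe).
    apply: le_trans (bessel P N Dq oq Df').
    apply: ler_sum => k _.
    rewrite (dot_onbproj H oe)// (dot_sumr P)//; last by move=> i _; exact: (phZ P).
    rewrite le_eqVlt; apply/orP; left; apply/eqP; congr (cab _ ^+ 2).
    apply: eq_bigr => i _; rewrite (dotZr P)// mulrC; congr (_ * _).
    by rewrite -(ph_sym P).
  by move=> f Df; exact: (bessel P N Dp op Df).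
have -> : \sum_(0 <= k < N) Re '[S (e k), e k] =
    Re (\sum_(0 <= i < N) '[A (onbproj dot e N (q i)), p i]).
  rewrite !Re_sum; under [RHS]eq_bigr => i _.
    rewrite (op_sum H); [|by []|by move=> k _; exact: (phZ P)].
    rewrite (dot_suml P)//; last by move=> k _; apply: DA; exact: (phZ P).
    over.
  under [RHS]eq_bigr do rewrite Re_sum.
  rewrite exchange_big/=; apply: eq_big_nat => k /andP[_ kN].
  rewrite -/(y k) [in LHS](yE k kN) (dot_suml P)//; last by move=> i _; exact: (phZ P).
  rewrite Re_sum; apply: eq_bigr => i _; congr Re.
  rewrite (opZ H)// !(dotZl P)//; last exact: DA.
  by rewrite mulrC AS// -(proj2 (hx i)).
rewrite (le_trans (ler_norm _))// (le_trans (cab_Re _))//.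
exact: cab_sum.
Qed.

Lemma bounded_lin (a : C) A B : bounded_operator D dot A -> bounded_operator D dot B ->
  bounded_operator D dot (a *: A + B).
Proof.
move=> [[DA lA] [m hm]] [[DB lB] [k hk]]; split.
  split=> [f Df|c f g Df Dg].
    by apply: (phL P); [exact: DA|exact: DB].
  by rewrite !fctE lA// lB// scalerDr !scalerDr addrACA !scalerA mulrC.
have bb T' t f : (D f -> D (T' f)) -> D f -> (D f -> nsq (T' f) <= t * nsq f) ->
    nrm (T' f) <= Num.sqrt `|t| * nrm f.
  move=> DT Df h; rewrite -sqrtrM// ler_wsqrtr// (le_trans (h Df))//.
  by rewrite ler_wpM2r ?ler_norm// (nsq_ge0 P).
exists ((cab a * Num.sqrt `|m| + Num.sqrt `|k|) ^+ 2) => f Df.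
have DAf := DA _ Df; have DBf := DB _ Df.
rewrite -!/(nsqd dot _) -!(nrm_sqr P)//; last exact: (phL P).
rewrite -exprMn ler_pXn2r// ?nnegrE ?nrm_ge0 ?mulr_ge0 ?addr_ge0 ?mulr_ge0 ?sqrtr_ge0 ?nrm_ge0//.
rewrite (le_trans (nrmD P (phZ P _ DAf) DBf))// (nrmZ P)// mulrDl -mulrA.
apply: lerD; first by rewrite ler_wpM2l// (bb A m)//; exact: hm.
by rewrite (bb B k)//; exact: hk.
Qed.

Lemma wnuclear_lin (a : C) A B : wnuclear A -> wnuclear B -> wnuclear (a *: A + B).
Proof.
move=> [bA [M hM]] [bB [K hK]]; split; first exact: bounded_lin.
have [DA _] := bA.1; have [DB _] := bB.1.
exists (cab a * M + K) => N p q bp bq; have [Dp _] := bp; have [Dq _] := bq.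
apply: (@le_trans _ _ (cab a * (\sum_(0 <= k < N) cab '[A (p k), q k]) +
  \sum_(0 <= k < N) cab '[B (p k), q k])); last first.
  by rewrite lerD ?hK// ler_wpM2l// hM.
rewrite mulr_sumr -big_split/=; apply: ler_sum => k _.
rewrite fctE (ph_lin P)//; [|exact: DA|exact: DB].
by rewrite (le_trans (cabD _ _))// cabM.
Qed.

Lemma bounded_adjoint A B : bounded_operator D dot A -> is_adjoint D dot D dot A B ->
  bounded_operator D dot B.
Proof.
move=> [[DA lA] [m hm]] [DB hB].
have hB' f g : D f -> D g -> '[B g, f] = '[g, A f].
  move=> Df Dg; rewrite (ph_sym P Df (DB _ Dg)) -hB//.
  by rewrite -(ph_sym P)//; exact: DA.
split.
  split=> [//|a f g Df Dg].
  have DL : D (a *: f + g) by exact: (phL P).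
  have DR : D (a *: B f + B g) by apply: (phL P); exact: DB.
  apply/eqP; rewrite -subr_eq0; apply/eqP; apply: (hb_def H).
    by apply: (phB P) => //; exact: DB.
  rewrite /nsqd; set w := (X in '[X, X]).
  have Dw : D w by apply: (phB P) => //; exact: DB.
  suff -> : '[w, w] = 0 by [].
  rewrite {1}/w (dotBl P)//; last exact: DB.
  rewrite (ph_lin P)//; try exact: DB.
  rewrite !hB'// (ph_lin P)//; first by rewrite subrr.
  exact: DA.
exists `|m| => g Dg; have DBg := DB _ Dg; have DABg := DA _ DBg.
rewrite -!/(nsqd dot _).
have h1 : nsq (B g) <= nrm g * nrm (A (B g)).
  rewrite /nsqd hB'// (le_trans (ler_norm _))// (le_trans (cab_Re _))//.
  exact: (CS P).
have h2 : nrm (A (B g)) <= Num.sqrt `|m| * nrm (B g).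
  rewrite -sqrtrM// ler_wsqrtr// (le_trans (hm _ DBg))//.
  by rewrite ler_wpM2r ?ler_norm// (nsq_ge0 P).
rewrite -(nrm_sqr P)// in h1; rewrite -!(nrm_sqr P)//.
have [->|n0] := eqVneq (nrm (B g)) 0; first by rewrite expr0n mulr_ge0// sqr_ge0.
have n1 : 0 < nrm (B g) by rewrite lt0r n0 nrm_ge0.
have h3 : nrm (B g) <= Num.sqrt `|m| * nrm g.
  rewrite -(ler_pM2r n1) -expr2 (le_trans h1)// [X in _ <= X](_ : _ = nrm g * (Num.sqrt `|m| * nrm (B g))); last by ring.
  by rewrite ler_wpM2l// nrm_ge0.
have s2 : Num.sqrt `|m| ^+ 2 = `|m| by rewrite sqr_sqrtr.
have := @lerXn2r _ 2 (nrm (B g)) (Num.sqrt `|m| * nrm g).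
by rewrite !nnegrE nrm_ge0 mulr_ge0 ?sqrtr_ge0 ?nrm_ge0// exprMn s2 => h4; exact: h4.
Qed.

Lemma wnuclear_adjoint A B : wnuclear A -> is_adjoint D dot D dot A B -> wnuclear B.
Proof.
move=> [bA [M hM]] adjB; split; first exact: bounded_adjoint adjB.
exists M => N p q bp bq; apply: le_trans (hM N q p bq bp); apply: ler_sum => k _.
have [[Dp _] [Dq _]] := (bp, bq); have [DA _] := bA.1; have [DB hB] := adjB.
by rewrite (ph_sym P (Dq k) (DB _ (Dp k))) -hB// cabJ.
Qed.

End WeaklyNuclear.

(** * Existence of orthonormal bases *)

Section BasisExists.
Context {R : realType} {E : lmodType R[i]}.
Local Notation C := R[i].
Context {D : set E} {dot : E -> E -> C} (H : hilbert D dot).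
Local Notation "'[ f , g ]" := (dot f g) (format "''[' f ,  g ]").
Local Notation nsq := (nsqd dot).
Let P := hb_pre H.

Lemma orthogonal_exists (w : nat -> E) (q : nat -> E) N : (forall k, D (w k)) ->
  (forall k, D (q k)) ->
  (forall c : nat -> C, \sum_(0 <= m < N.+1) c m *: w m = 0 ->
     forall m, (m < N.+1)%N -> c m = 0) ->
  exists f, [/\ D f, f <> 0 & forall k, (k < N)%N -> '[f, q k] = 0].
Proof.
move=> Dw Dq indep.
pose A : 'M[C]_(N.+1, N) := \matrix_(m, k) '[w m, q k].
have : kermx A != 0.
  rewrite kermx_eq0 /row_free neq_ltn; apply/orP; left.
  by rewrite ltnS rank_leq_col.
move=> /rowV0Pn[v /sub_kermxP vA v0].
pose c m := v 0 (inord m).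
exists (\sum_(0 <= m < N.+1) c m *: w m); split.
- by apply: (ph_sum P) => m _; exact: (phZ P).
- move=> /indep c0; move/eqP: v0; apply; apply/rowP => m; rewrite mxE.
  by rewrite -(c0 m) ?ltn_ord// /c inord_val.
- move=> k kN; rewrite (dot_suml P)//; last by move=> m _; exact: (phZ P).
  have := congr1 (fun M : 'rV[C]_N => M 0 (Ordinal kN)) vA; rewrite !mxE => h.
  rewrite big_mkord -[RHS]h; apply: eq_bigr => m _.
  by rewrite (dotZl P)// mxE /c inord_val.
Qed.

Lemma infinite_enum (c : pred nat) : (forall n, exists k, (n <= k)%N && c k) ->
  exists s : nat -> nat, [/\ injective s, forall j, c (s j) &
    forall k, c k -> exists j, s j = k].
Proof.
move=> hc; pose nx n := ex_minn (hc n).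
have nxP n : [/\ (n <= nx n)%N, c (nx n) & forall k, (n <= k)%N -> c k -> (nx n <= k)%N].
  rewrite /nx; case: ex_minnP => k /andP[h1 h2] h3; split => // m nm cm.
  by apply: h3; rewrite nm.
pose s := fix s j := if j is j'.+1 then nx (s j').+1 else nx 0%N.
have sS j : (s j < s j.+1)%N by have [] := nxP (s j).+1.
have smono : {homo s : i j / (i < j)%N}.
  move=> i j; elim: j => // j IH; rewrite ltnS leq_eqVlt => /orP[/eqP ->//|/IH h].
  exact: ltn_trans (sS j).
have sge j : (j <= s j)%N.
  by elim: j => // j IH; exact: leq_ltn_trans (sS j).
exists s; split.
- move=> i j; have [/smono|/smono|//] := ltngtP i j; by move=> + e; rewrite e ltnn.
- by case=> [|j]; [have [] := nxP 0%N|have [] := nxP (s j).+1].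
- move=> k ck.
  have ex : exists j, (k <= s j)%N by exists k.
  case: (ex_minnP ex) => j kj jmin; exists j; apply/eqP; rewrite eqn_leq kj andbT.
  case: j kj jmin => [|j] kj jmin.
    by have [_ _] := nxP 0%N; apply.
  have [_ _] := nxP (s j).+1; apply => //; rewrite ltnNge; apply/negP => /jmin.
  by rewrite ltnn.
Qed.

(** Gram-Schmidt on the total sequence [y], keeping the unit vectors. Infinitely many remain:
    otherwise all of them have index below some [N], the [N + 1] independent vectors [w] combine
    into a nonzero vector orthogonal to them, and this contradicts totality. *)
Lemma basis_exists (y w : nat -> E) : (forall k, D (y k)) -> (forall k, D (w k)) ->
  (forall f, D f -> (forall k, '[f, y k] = 0) -> f = 0) ->
  (forall N (c : nat -> C), \sum_(0 <= m < N.+1) c m *: w m = 0 ->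
     forall m, (m < N.+1)%N -> c m = 0) ->
  exists2 e, orthonormal_basis D dot e & forall X : set E, X 0 ->
    (forall a f g, X f -> X g -> X (a *: f + g)) -> (forall k, X (y k)) -> forall k, X (e k).
Proof.
move=> Dy Dw tot indep.
pose q := gs (dot := dot) y; pose c := gs_nz (dot := dot) y.
have Dq k : D (q k) by exact: (gs_D P).
have oq : qorthon (dot := dot) q c by exact: (gs_qorthon P).
have qtot f : D f -> (forall k, c k -> '[f, q k] = 0) -> f = 0.
  move=> Df h; have h' k : '[f, q k] = 0.
    case: (boolP (c k)) => [|ck]; first exact: h.
    rewrite (ph_sym P (Dq k) Df) (nsq_eq0_dotl P) ?CJ0//.
    by rewrite /nsqd oq (negbTE ck) andbF.
  apply: tot => // k.
  have -> : y k = \sum_(0 <= i < k.+1) '[y k, q i] *: q i.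
    apply/eqP; rewrite -subr_eq0; apply/eqP; apply: (hb_def H).
      by apply: (phB P) => //; apply: (ph_sum P) => i _; exact: (phZ P).
    exact: (gs_span P).
  rewrite (dot_sumr P)//; last by move=> i _; exact: (phZ P).
  by rewrite big1// => i _; rewrite (dotZr P)// h' mulr0.
have [|s [sinj cs ssurj]] := @infinite_enum c.
  move=> n; apply: contrapT => hn.
  have [f [Df f0 hf]] := orthogonal_exists Dw Dq (indep n).
  apply: f0; apply: qtot => // k ck; apply: hf; rewrite ltnNge; apply/negP => nk.
  by apply: hn; exists k; rewrite nk.
exists (fun j => q (s j)); last by move=> X X0 XL Xy k; exact: gs_in.
split => //.
- by move=> i j; rewrite oq cs andbT (inj_eq sinj).
- move=> f Df h; apply: qtot => // k /ssurj[j <-]; exact: h.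
Qed.

Lemma finite_basis_hilbert (D' : set E) (dot' : E -> E -> C) m (b : 'I_m -> E) :
  prehilbert D' dot' -> (forall i, D' (b i)) ->
  (forall i j, dot' (b i) (b j) = (i == j)%:R) ->
  (forall f, D' f -> f = \sum_i dot' f (b i) *: b i) -> hilbert D' dot'.
Proof.
move=> P' Db ob bE.
have nE (l : 'I_m -> C) : nsqd dot' (\sum_i l i *: b i) = \sum_i cab (l i) ^+ 2.
  have Ds : D' (\sum_i l i *: b i) by apply: (ph_sum P') => i _; exact: (phZ P').
  rewrite /nsqd (dot_suml P')//; last by move=> i _; exact: (phZ P').
  rewrite Re_sum; apply: eq_bigr => i _; rewrite (dotZl P')//.
  rewrite (dot_sumr P')//; last by move=> j _; exact: (phZ P').
  rewrite (bigD1 i)//= big1 ?addr0 => [|j ji].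
    by rewrite (dotZr P')// ob eqxx mulr1 mulJ_cab.
  by rewrite (dotZr P')// ob eq_sym (negbTE ji) mulr0.
split => // [f Df f0|u Du cu].
  by rewrite (bE f Df) big1// => i _; rewrite (nsq_eq0_dotl P')// scale0r.
have [l hl] : exists l : 'I_m -> C, forall i, (fun n => dot' (u n) (b i)) @ \oo --> l i.
  suff h (i : 'I_m) : exists l : C, (fun n => dot' (u n) (b i)) @ \oo --> l.
    by have [l hl] := choice h; exists l.
  apply: ccauchy_cvg => d d0.
  have [N hN] := cu (d ^+ 2) (exprn_gt0 2 d0); exists N => p q Np Nq.
  rewrite -(dotBl P')// -(@ler_pXn2r _ 2)// ?nnegrE ?(ltW d0)//.
  rewrite (le_trans (CS2 P' (phB P' (Du p) (Du q)) (Db i)))//.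
  by rewrite [X in _ * X](_ : _ = 1) ?mulr1 ?hN// /nsqd ob eqxx.
have Dl : D' (\sum_i l i *: b i) by apply: (ph_sum P') => i _; exact: (phZ P').
exists (\sum_i l i *: b i) => //.
have h : (fun n => \sum_i cab (dot' (u n) (b i) - l i) ^+ 2) @ \oo --> (\sum_(i < m) 0 : R).
  apply: cvg_sum_seq => i.
  have /cvgCP hi := hl i.
  have h2 : (fun n => cab (dot' (u n) (b i) - l i) * cab (dot' (u n) (b i) - l i)) @ \oo --> (0 * 0 : R).
    exact: (cvgM hi hi).
  by rewrite mulr0 in h2; apply: cvg_ext h2 => n; rewrite expr2.
rewrite big1// in h; apply: cvg_ext h => n.
rewrite [in RHS](bE _ (Du n)) -sumrB -nE; congr (nsqd _ _).
by apply: eq_bigr => i _; rewrite scalerBl.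
Qed.

End BasisExists.

(** * Integration of complex-valued functions *)

Section ComplexIntegral.
Context {R : realType} {d : measure_display} {T : measurableType d}.
Local Notation C := R[i].
Implicit Types (f g : T -> C).

Definition cmeasurable f := measurable_fun [set: T] (fun x => Re (f x)) /\
  measurable_fun [set: T] (fun x => Im (f x)).

Lemma cmeasurable_cst (c : C) : cmeasurable (fun=> c).
Proof. by split; exact: measurable_cst. Qed.

Lemma cmeasurableD f g : cmeasurable f -> cmeasurable g -> cmeasurable (fun x => f x + g x).
Proof.
move=> [f1 f2] [g1 g2]; split.
  by under eq_fun do rewrite ReD; exact: measurable_funD.
by under eq_fun do rewrite ImD; exact: measurable_funD.
Qed.

Lemma cmeasurableN f : cmeasurable f -> cmeasurable (fun x => - f x).
Proof.
move=> [f1 f2]; split.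
  by under eq_fun do rewrite ReN; exact: measurableT_comp.
by under eq_fun do rewrite ImN; exact: measurableT_comp.
Qed.

Lemma cmeasurableM f g : cmeasurable f -> cmeasurable g -> cmeasurable (fun x => f x * g x).
Proof.
move=> [f1 f2] [g1 g2]; split.
  by under eq_fun do rewrite ReM; apply: measurable_funB; exact: measurable_funM.
by under eq_fun do rewrite ImM; apply: measurable_funD; exact: measurable_funM.
Qed.

Lemma cmeasurableJ f : cmeasurable f -> cmeasurable (fun x => (f x)^*).
Proof.
move=> [f1 f2]; split; first by under eq_fun do rewrite ReJ.
by under eq_fun do rewrite ImJ; exact: measurableT_comp.
Qed.

Lemma cmeasurable_CR (h : T -> R) : measurable_fun [set: T] h -> cmeasurable (fun x => (h x)%:C).
Proof. by move=> mh; split => //=; exact: measurable_cst. Qed.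

Lemma cmeasurable_sum I (s : seq I) (F : I -> T -> C) : (forall i, cmeasurable (F i)) ->
  cmeasurable (fun x => \sum_(i <- s) F i x).
Proof.
move=> mF; elim: s => [|i s IH].
  by under eq_fun do rewrite big_nil; exact: cmeasurable_cst.
by under eq_fun do rewrite big_cons; exact: cmeasurableD.
Qed.

Lemma cmeasurable_cab f : cmeasurable f -> measurable_fun [set: T] (fun x => cab (f x)).
Proof.
move=> [f1 f2]; have ms : measurable_fun [set: R] (@Num.sqrt R).
  by apply: continuous_measurable_fun; exact: sqrt_continuous.
apply: (measurableT_comp ms).
by apply: measurable_funD; exact: measurable_funX.
Qed.

Lemma cmeasurable_lim (F : nat -> T -> C) f : (forall n, cmeasurable (F n)) ->
  (forall x, F ^~ x @ \oo --> f x) -> cmeasurable f.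
Proof.
move=> mF cF; split.
  apply: (@measurable_fun_cvg _ _ _ _ (fun n x => Re (F n x))) => [n|x _].
    by have [] := mF n.
  by have /cvgC_ReIm[] := cF x.
apply: (@measurable_fun_cvg _ _ _ _ (fun n x => Im (F n x))) => [n|x _].
  by have [] := mF n.
by have /cvgC_ReIm[] := cF x.
Qed.

Variable mu : {measure set T -> \bar R}.
Local Notation cintegrable := (cintegrable mu).
Local Notation cintegral := (cintegral mu).

Lemma cintegrable_meas f : cintegrable f -> cmeasurable f.
Proof.
by move=> [/integrableP[m1 _] /integrableP[m2 _]]; split; apply/measurable_EFinP.
Qed.

Lemma integrable_fin (h : T -> R) : measurable_fun [set: T] h -> (forall x, 0 <= h x) ->
  (\int[mu]_x (h x)%:E < +oo)%E -> mu.-integrable [set: T] (fun x => (h x)%:E).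
Proof.
move=> mh h0 hoo; apply/integrableP; split; first exact/measurable_EFinP.
by under eq_integral do rewrite /= ger0_norm//.
Qed.

Lemma integrable_le (h k : T -> R) : measurable_fun [set: T] h ->
  (forall x, `|h x| <= k x) -> mu.-integrable [set: T] (fun x => (k x)%:E) ->
  mu.-integrable [set: T] (fun x => (h x)%:E).
Proof.
move=> mh hk; apply: le_integrable => //; first exact/measurable_EFinP.
by move=> x _; rewrite /= lee_fin (le_trans (hk x))// ler_norm.
Qed.

Lemma cintegrableP f : cmeasurable f ->
  mu.-integrable [set: T] (fun x => (cab (f x))%:E) -> cintegrable f.
Proof.
move=> [m1 m2] h; split; apply: integrable_le h => // x.
  exact: cab_Re.
exact: cab_Im.
Qed.

Lemma cintegrable_cab f : cintegrable f -> mu.-integrable [set: T] (fun x => (cab (f x))%:E).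
Proof.
move=> cf; have mf := cintegrable_meas cf; case: cf => c1 c2.
apply: (@integrable_le _ (fun x => `|Re (f x)| + `|Im (f x)|)).
- exact: cmeasurable_cab.
- by move=> x; rewrite ger0_norm// cab_le.
- under eq_fun do rewrite EFinD.
  by apply: integrableD => //; [exact: (integrable_abse c1)|exact: (integrable_abse c2)].
Qed.

Lemma cintegrableD f g : cintegrable f -> cintegrable g -> cintegrable (fun x => f x + g x).
Proof.
move=> [f1 f2] [g1 g2]; split.
  by under eq_fun do rewrite ReD EFinD; exact: integrableD.
by under eq_fun do rewrite ImD EFinD; exact: integrableD.
Qed.

Lemma cintegralD f g : cintegrable f -> cintegrable g ->
  cintegral (fun x => f x + g x) = cintegral f + cintegral g.
Proof.
move=> [f1 f2] [g1 g2]; apply: Cext; rewrite ?ReD ?ImD /=.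
  by under eq_Rintegral do rewrite ReD; exact: RintegralD.
by under eq_Rintegral do rewrite ImD; exact: RintegralD.
Qed.

Lemma cintegrableZ (c : C) f : cintegrable f -> cintegrable (fun x => c * f x).
Proof.
move=> [f1 f2]; split.
  under eq_fun do rewrite ReM EFinB !EFinM.
  by apply: integrableB => //; exact: integrableZl.
under eq_fun do rewrite ImM EFinD !EFinM.
by apply: integrableD => //; exact: integrableZl.
Qed.

Lemma integrableZl_fin (r : R) (h : T -> R) : mu.-integrable [set: T] (fun x => (h x)%:E) ->
  mu.-integrable [set: T] (fun x => (r * h x)%:E).
Proof. by move=> ih; under eq_fun do rewrite EFinM; exact: integrableZl. Qed.

Lemma cintegralZ (c : C) f : cintegrable f ->
  cintegral (fun x => c * f x) = c * cintegral f.
Proof.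
move=> [f1 f2]; have mT := @measurableT _ T.
apply: Cext; rewrite ?ReM ?ImM /=.
  under eq_Rintegral do rewrite ReM.
  by rewrite RintegralB ?RintegralZl//; exact: integrableZl_fin.
under eq_Rintegral do rewrite ImM.
by rewrite RintegralD ?RintegralZl//; exact: integrableZl_fin.
Qed.

Lemma cintegralJ f : cintegrable f -> cintegral (fun x => (f x)^*) = (cintegral f)^*.
Proof.
move=> [f1 f2]; apply: Cext; rewrite ?ReJ ?ImJ /=.
  by under eq_Rintegral do rewrite ReJ.
under eq_Rintegral do rewrite ImJ -mulN1r.
by rewrite RintegralZl// mulN1r.
Qed.

Lemma eq_cintegral f g : f =1 g -> cintegral f = cintegral g.
Proof. by move=> /funext ->. Qed.

Lemma cintegral_CR (h : T -> R) : cintegral (fun x => (h x)%:C) = (\int[mu]_x h x)%:C.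
Proof.
apply: Cext => //=.
rewrite (@eq_Rintegral _ _ _ _ _ (cst 0)) ?Rintegral_cst ?mul0r//.
Qed.

Lemma cintegrable0 : cintegrable (fun=> 0).
Proof. by split; exact: integrable0. Qed.

Lemma cintegral0 : cintegral (fun=> 0) = 0.
Proof. by rewrite (cintegral_CR (fun=> 0)) Rintegral_cst// mul0r. Qed.

Lemma cintegrable_sum I (s : seq I) (F : I -> T -> C) : (forall i, cintegrable (F i)) ->
  cintegrable (fun x => \sum_(i <- s) F i x) /\
  cintegral (fun x => \sum_(i <- s) F i x) = \sum_(i <- s) cintegral (F i).
Proof.
move=> iF; elim: s => [|i s [IH1 IH2]].
  rewrite big_nil -[in RHS]cintegral0; split.
    by under eq_fun do rewrite big_nil; exact: cintegrable0.
  by apply: eq_cintegral => x; rewrite big_nil.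
split; first by under eq_fun do rewrite big_cons; exact: cintegrableD.
rewrite big_cons -IH2 -cintegralD//; apply: eq_cintegral => x.
by rewrite big_cons.
Qed.

(** Functions rather than classes modulo null sets, since symbols are evaluated at points; [L2dot]
    is therefore only semi-definite. *)
Definition L2 : set (T -> C) :=
  [set f | cmeasurable f /\ (\int[mu]_x (cab (f x) ^+ 2)%:E < +oo)%E].

Definition L2dot f g : C := cintegral (fun x => f x * (g x)^*).

Lemma L2_integrable f : L2 f -> mu.-integrable [set: T] (fun x => (cab (f x) ^+ 2)%:E).
Proof.
move=> [mf hf]; apply: integrable_fin => //.
  by apply: measurable_funX; exact: cmeasurable_cab.
by move=> x; rewrite sqr_ge0.
Qed.

Lemma L2_le f (h : T -> R) : cmeasurable f -> (forall x, cab (f x) ^+ 2 <= h x) ->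
  mu.-integrable [set: T] (fun x => (h x)%:E) -> L2 f.
Proof.
move=> mf fh ih; split => //.
have := @integrable_le (fun x => cab (f x) ^+ 2) h _ _ ih.
have mm : measurable_fun [set: T] (fun x => cab (f x) ^+ 2).
  by apply: measurable_funX; exact: cmeasurable_cab.
move=> /(_ mm); have hh x : `|cab (f x) ^+ 2| <= h x by rewrite ger0_norm ?sqr_ge0.
move=> /(_ hh)/integrableP[_]; apply: le_lt_trans.
by under [X in (_ <= X)%E]eq_integral do rewrite /= ger0_norm ?sqr_ge0//.
Qed.

Lemma L2M_integrable f g : L2 f -> L2 g -> cintegrable (fun x => f x * g x).
Proof.
move=> Lf Lg; have [mf _] := Lf; have [mg _] := Lg.
apply: cintegrableP; first exact: cmeasurableM.
apply: (@integrable_le _ (fun x => cab (f x) ^+ 2 + cab (g x) ^+ 2)).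
- by apply: cmeasurable_cab; exact: cmeasurableM.
- move=> x; rewrite ger0_norm// cabM.
  have := sqr_ge0 (cab (f x) - cab (g x)); have := cab_ge0 (f x); have := cab_ge0 (g x).
  by move=> *; nra.
- by under eq_fun do rewrite EFinD; apply: integrableD => //; exact: L2_integrable.
Qed.

Lemma L2_J f : L2 f -> L2 (fun x => (f x)^*).
Proof.
move=> [mf hf]; split; first exact: cmeasurableJ.
by under eq_integral do rewrite cabJ.
Qed.

Lemma L2dot_integrable f g : L2 f -> L2 g -> cintegrable (fun x => f x * (g x)^*).
Proof. by move=> Lf Lg; apply: L2M_integrable => //; exact: L2_J. Qed.

Lemma L2_lin (a : C) f g : L2 f -> L2 g -> L2 (a *: f + g).
Proof.
move=> Lf Lg; have [mf _] := Lf; have [mg _] := Lg.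
apply: (@L2_le _ (fun x => 2 * cab a ^+ 2 * cab (f x) ^+ 2 + 2 * cab (g x) ^+ 2)).
- by apply: cmeasurableD => //; apply: cmeasurableM => //; exact: cmeasurable_cst.
- move=> x; have := cabD (a * f x) (g x); rewrite cabM => h.
  have := cab_ge0 (a * f x + g x); have := mulr_ge0 (cab_ge0 a) (cab_ge0 (f x)).
  have := cab_ge0 (g x); rewrite -mulrA -exprMn.
  have := sqr_ge0 (cab a * cab (f x) - cab (g x)).
  move: (cab a * cab (f x)) (cab (g x)) (cab (a * f x + g x)) h => u v w *.
  by nra.
- under eq_fun do rewrite EFinD.
  by apply: integrableD => //; apply: integrableZl_fin; exact: L2_integrable.
Qed.

Lemma L2_0 : L2 0.
Proof.
split; first exact: cmeasurable_cst.
under eq_integral do rewrite cab0 expr0n.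
by rewrite integral0 ltry.
Qed.

Lemma L2_nsq f : L2 f -> (nsqd L2dot f)%:E = (\int[mu]_x (cab (f x) ^+ 2)%:E)%E.
Proof.
move=> Lf; rewrite /nsqd /L2dot.
have -> : (fun x => f x * (f x)^*) = (fun x => (cab (f x) ^+ 2)%:C).
  by apply/funext => x; rewrite mulJ_cab.
rewrite cintegral_CR/= /Rintegral fineK//.
have /integrable_fin_num := L2_integrable Lf.
exact.
Qed.

Lemma L2_prehilbert : prehilbert L2 L2dot.
Proof.
split; [exact: L2_0|exact: L2_lin| | |].
- move=> a f g h Lf Lg Lh; rewrite /L2dot.
  rewrite -cintegralZ; last exact: L2dot_integrable.
  rewrite -cintegralD; [|by apply: cintegrableZ; exact: L2dot_integrable|exact: L2dot_integrable].
  by apply: eq_cintegral => x; rewrite !fctE mulrDl -mulrA.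
- move=> f g Lf Lg; rewrite /L2dot -cintegralJ; last exact: L2dot_integrable.
  by apply: eq_cintegral => x; rewrite CJM CJK mulrC.
- move=> f Lf; rewrite /L2dot.
  have -> : (fun x => f x * (f x)^*) = (fun x => (cab (f x) ^+ 2)%:C).
    by apply/funext => x; rewrite mulJ_cab.
  by rewrite cintegral_CR ler0c Rintegral_ge0// => x _; rewrite sqr_ge0.
Qed.

Lemma L2_fatou (F : nat -> T -> C) f (M : R) : (forall n, L2 (F n)) ->
  (forall x, F ^~ x @ \oo --> f x) -> (forall n, nsqd L2dot (F n) <= M) ->
  L2 f /\ nsqd L2dot f <= M.
Proof.
move=> LF cF bF.
have mF n : cmeasurable (F n) by case: (LF n).
have mf := cmeasurable_lim mF cF.
have key : (\int[mu]_x (cab (f x) ^+ 2)%:E <= M%:E)%E.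
  have := @fatou _ _ _ mu _ measurableT (fun n x => (cab (F n x) ^+ 2)%:E).
  have m1 n : measurable_fun [set: T] (fun x => (cab (F n x) ^+ 2)%:E).
    by apply/measurable_EFinP; apply: measurable_funX; exact: cmeasurable_cab.
  move=> /(_ m1); have p1 n x : setT x -> (0 <= (cab (F n x) ^+ 2)%:E)%E by rewrite lee_fin sqr_ge0.
  move=> /(_ p1).
  have -> : (\int[mu]_x limn_einf (fun n => (cab (F n x) ^+ 2)%:E))%E =
      (\int[mu]_x (cab (f x) ^+ 2)%:E)%E.
    apply: eq_integral => x _.
    have h : (fun n => (cab (F n x) ^+ 2)%:E) @ \oo --> (cab (f x) ^+ 2)%:E.
      apply: cvg_EFin; first exact: nearW.
      have h0 := cvg_cabn (cF x).
      have h1 : (fun n => cab (F n x) * cab (F n x)) @ \oo --> cab (f x) * cab (f x).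
        exact: (cvgM h0 h0).
      by rewrite -expr2 in h1; apply: cvg_ext h1 => n; rewrite /= expr2.
    by have [] := cvg_limn_einf_sup h.
  move=> /le_trans; apply.
  under eq_fun do rewrite -L2_nsq//.
  rewrite limn_einf_lim; apply: lime_le; first exact: is_cvg_einfs.
  apply: nearW => n; rewrite /einfs/=; apply: le_trans (_ : (nsqd L2dot (F n))%:E <= _)%E.
    by apply: ereal_inf_lbound; exists n => /=.
  by rewrite lee_fin.
have Lf : L2 f by split => //; apply: le_lt_trans key (ltry _).
by split => //; rewrite -lee_fin L2_nsq.
Qed.

(** Completeness for Cauchy sequences with a known pointwise limit: Fatou's lemma, applied to
    [F n - F (m + N)] as [m] grows, bounds [F n - f]. In each use the pointwise limit comes from
    bounded evaluations. *)
Lemma L2_complete (F : nat -> T -> C) f : (forall n, L2 (F n)) ->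
  (forall x, F ^~ x @ \oo --> f x) ->
  (forall e : R, 0 < e -> exists N, forall m n, (N <= m)%N -> (N <= n)%N ->
       nsqd L2dot (F m - F n) <= e) ->
  L2 f /\ (fun n => nsqd L2dot (F n - f)) @ \oo --> (0 : R).
Proof.
move=> LF cF hF; have P := L2_prehilbert.
have key e : 0 < e -> exists N, forall n, (N <= n)%N -> L2 (F n - f) /\ nsqd L2dot (F n - f) <= e.
  move=> e0; have [N hN] := hF e e0; exists N => n Nn.
  apply: (@L2_fatou (fun m => F n - F (m + N)%N)).
  - by move=> m; exact: (phB P).
  - move=> x; have h : (fun m => F (m + N)%N x) @ \oo --> f x by rewrite (cvg_shiftn N (F ^~ x)); exact: cF.
    have h2 : (fun m => F n x - F (m + N)%N x) @ \oo --> F n x - f x.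
      exact: (cvgB (cvg_cst _) h).
    exact: h2.
  - by move=> m; apply: hN => //; rewrite leq_addl.
have [N /(_ N (leqnn _))[h _]] := key 1 ltr01.
split.
  have -> : f = F N - (F N - f) by rewrite opprB addrC subrK.
  exact: (phB P).
apply/cvgr0Pnorm_le => e /key[N' hN']; exists N' => // n /= Nn.
have [h1 h2] := hN' n Nn; rewrite ger0_norm//.
exact: (nsq_ge0 P).
Qed.

End ComplexIntegral.

(** * Measure-preserving maps and sigma-finiteness *)

Section MeasurePreserving.
Context {R : realType} {d : measure_display} {T : measurableType d}.
Local Notation C := R[i].
Variable mu : {measure set T -> \bar R}.

Lemma preserving_ge0_integral (tau : T -> T) (F : T -> \bar R) :
  measurable_fun [set: T] tau ->
  (forall A, measurable A -> mu (tau @^-1` A) = mu A) ->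
  measurable_fun [set: T] F -> (forall x, 0 <= F x)%E ->
  (\int[mu]_x F (tau x) = \int[mu]_x F x)%E.
Proof.
move=> mt ht mF F0; rewrite -[RHS](@eq_measure_integral _ _ _ _ _ (pushforward mu tau)).
  have := ge0_integral_pushforward mt mu (D := setT) measurableT mF (fun y _ => F0 y).
  by rewrite preimage_setT => ->.
by move=> A mA _; exact: ht.
Qed.

Lemma ge0_integral_preserving (tau : T -> T) : measurable_fun [set: T] tau ->
  (forall F : T -> \bar R, measurable_fun [set: T] F -> (forall x, 0 <= F x)%E ->
    (\int[mu]_x F (tau x) = \int[mu]_x F x)%E) ->
  forall A, measurable A -> mu (tau @^-1` A) = mu A.
Proof.
move=> mt h A mA; have mA' : measurable (tau @^-1` A) by rewrite -[_ @^-1` _]setTI; exact: mt.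
have H := h (EFin \o \1_A).
transitivity (\int[mu]_x (\1_A (tau x))%:E)%E.
  have -> : (fun x => (\1_A (tau x))%:E) = EFin \o \1_(tau @^-1` A) :> (T -> \bar R) by [].
  by rewrite integral_indic ?setIT.
transitivity (\int[mu]_x (\1_A x)%:E)%E; last by rewrite integral_indic ?setIT.
apply: H; first by apply/measurable_EFinP.
by move=> x; rewrite lee_fin.
Qed.

Lemma preserving_Rintegral (tau : T -> T) (f : T -> R) :
  measurable_fun [set: T] tau ->
  (forall A, measurable A -> mu (tau @^-1` A) = mu A) -> measurable_fun [set: T] f ->
  \int[mu]_x f (tau x) = \int[mu]_x f x.
Proof.
move=> mt ht mf; have mfE : measurable_fun [set: T] (fun x => (f x)%:E) by exact/measurable_EFinP.
rewrite /Rintegral integralE [in RHS]integralE; congr (fine (_ - _)).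
  have h1 := preserving_ge0_integral mt ht (measurable_funepos mfE).
  rewrite -h1; last exact: funepos_ge0.
  by apply: eq_integral => x _; rewrite !funeposE.
have h1 := preserving_ge0_integral mt ht (measurable_funeneg mfE).
rewrite -h1; last exact: funeneg_ge0.
by apply: eq_integral => x _; rewrite !funenegE.
Qed.

Lemma preserving_cintegral (tau : T -> T) (f : T -> C) :
  measurable_fun [set: T] tau ->
  (forall A, measurable A -> mu (tau @^-1` A) = mu A) -> cmeasurable f ->
  cintegral mu (fun x => f (tau x)) = cintegral mu f.
Proof.
move=> mt ht [m1 m2]; apply: Cext => /=.
  exact: (preserving_Rintegral mt ht m1).
exact: (preserving_Rintegral mt ht m2).
Qed.

Lemma cmeasurable_comp d' (T' : measurableType d') (tau : T' -> T) (f : T -> C) :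
  measurable_fun [set: T'] tau -> cmeasurable f -> cmeasurable (f \o tau).
Proof. by move=> mt [m1 m2]; split; [exact: (measurableT_comp m1 mt)|exact: (measurableT_comp m2 mt)]. Qed.

Lemma preserving_L2dot (tau : T -> T) (f g : T -> C) :
  measurable_fun [set: T] tau ->
  (forall A, measurable A -> mu (tau @^-1` A) = mu A) -> L2 mu f -> L2 mu g ->
  L2 mu (f \o tau) /\ L2dot mu (f \o tau) (g \o tau) = L2dot mu f g.
Proof.
move=> mt ht [mf ff] [mg _]; split.
  split; first exact: cmeasurable_comp.
  have := preserving_ge0_integral mt ht (F := fun x => (cab (f x) ^+ 2)%:E).
  move=> ->//; last by move=> x; rewrite lee_fin sqr_ge0.
  by apply/measurable_EFinP; apply: measurable_funX; exact: cmeasurable_cab.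
apply: (preserving_cintegral mt ht (f := fun x => f x * (g x)^*)).
by apply: cmeasurableM => //; exact: cmeasurableJ.
Qed.

(** Markov's inequality on the sets [1/(k+1) <= g], which exhaust the space because [g] is positive.
    It is applied to Gaussians. *)
Lemma sigma_finite_ge0_integrable (g : T -> R) : measurable_fun [set: T] g ->
  (forall x, 0 < g x) -> (\int[mu]_x (g x)%:E < +oo)%E -> sigma_finite [set: T] mu.
Proof.
move=> mg g0 ig; exists (fun k => [set x | k.+1%:R^-1 <= g x]).
  apply/esym/seteqP; split => // x _ /=.
  have [k hk] : exists k : nat, (g x)^-1 < k.+1%:R.
    exists (Num.bound (g x)^-1); have gi0 : 0 <= (g x)^-1 by rewrite invr_ge0 ltW.
    by rewrite (lt_le_trans (archi_boundP gi0))// ler_nat.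
  exists k => //=; rewrite -[leRHS]invrK lef_pV2 ?posrE ?invr_gt0// ltW//.
move=> k; have mA : measurable [set x | k.+1%:R^-1 <= g x].
  rewrite -[X in measurable X]setTI; have -> : [set x | k.+1%:R^-1 <= g x] = g @^-1` `[k.+1%:R^-1, +oo[%classic.
    by apply/seteqP; split => x /=; rewrite in_itv/= andbT.
  exact: mg.
split => //; have k0 : (0 : R) < k.+1%:R by [].
have : ((k.+1%:R^-1)%:E * mu [set x | ((k.+1%:R)^-1 <= g x)%R] < +oo)%E.
  apply: le_lt_trans ig; rewrite -[in leLHS](setIT [set x | _ <= _]) -integral_indic//.
  rewrite -ge0_integralZl//; first last.
  - by apply/measurable_EFinP.
  apply: ge0_le_integral => //.
  - by apply: measurable_funeM; apply/measurable_EFinP.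
  - exact/measurable_EFinP.
  move=> x _; rewrite -EFinM lee_fin indicE.
  case: (boolP (x \in _)) => [/set_mem|_]; first by rewrite mulr1.
  by rewrite mulr0 ltW.
case: (mu _) => [r _||_]; [by rewrite ltry| |by []].
by rewrite gt0_muley ?lte_fin ?invr_gt0// ltxx.
Qed.

(** Fubini's theorem is stated for bundled sigma-finite measures, while the measures of the
    definitions are plain; the bundled one is the same set function. *)
Lemma sigma_finite_pack : sigma_finite [set: T] mu ->
  exists m : {sigma_finite_measure set T -> \bar R}, m = mu :> (set T -> \bar R).
Proof.
move=> h; pose H1 := isSFinite.Build _ _ _ mu (sfinite_measure_sigma_finite h).
pose H2 := isSigmaFinite.Build _ _ _ mu h.
pose m := HB.pack_for (SigmaFiniteMeasure.type T R) (Measure.sort mu) H1 H2.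
by exists m.
Qed.

End MeasurePreserving.

Section LebesgueTranslation.
Context {R : realType}.
Local Notation leb := (@lebesgue_measure R).

Lemma lebesgue_translation (a : R) (A : set (measurableTypeR R)) : measurable A ->
  leb ((fun x => x + a) @^-1` A) = leb A.
Proof.
move=> mA; have ms : measurable_fun [set: measurableTypeR R] ((fun x => x + a) : measurableTypeR R -> measurableTypeR R).
  by apply: measurable_funD => //; exact: measurable_cst.
rewrite -[LHS]/(pushforward leb ((fun x => x + a) : measurableTypeR R -> measurableTypeR R) A).
apply/esym; apply: (lebesgue_measure_unique (mu := pushforward_measure leb ms)) => // X.
move=> [[x y] /= _ <-]; rewrite /pushforward/=.
have -> : (fun z => z + a) @^-1` `]x, y]%classic = `]x - a, y - a]%classic.
  by apply/seteqP; split => z /=; rewrite !in_itv/= ltrBlDr lerBrDr.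
by rewrite !lebesgue_measure_itv/= !lte_fin ltrD2r -!EFinB; case: ifP => // _; congr EFin; ring.
Qed.

Lemma integral_translation (a : R) (F : measurableTypeR R -> \bar R) :
  measurable_fun [set: measurableTypeR R] F -> (forall x, 0 <= F x)%E ->
  (\int[leb]_x F (x + a)%R = \int[leb]_x F x)%E.
Proof.
move=> mF F0; apply: (preserving_ge0_integral (mu := leb)
    (tau := (fun x => x + a) : measurableTypeR R -> measurableTypeR R)) => //.
  by apply: measurable_funD => //; exact: measurable_cst.
by move=> A mA; exact: lebesgue_translation.
Qed.

End LebesgueTranslation.

Section LebesgueTuple.
Context {R : realType}.
Local Notation leb := (@lebesgue_measure R).
Local Notation R2 := (measurableTypeR R * measurableTypeR R)%type.

Definition tuple_gauss (s : R) n (t : n.-tuple R2) : R :=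
  expR (- (\sum_(i < n) ((tnth t i).1 ^+ 2 + (tnth t i).2 ^+ 2)) / (s ^+ 2 *+ 2)).

Lemma measurable_tuple_gauss s n : measurable_fun [set: n.-tuple R2] (@tuple_gauss s n).
Proof.
apply: measurableT_comp => //; apply: measurable_funM; last exact: measurable_cst.
apply: measurableT_comp => //; apply: measurable_sum => i.
by apply: measurable_funD; apply: measurable_funX; apply: measurableT_comp => //; exact: measurable_tnth.
Qed.

Lemma integral_gauss1 (s : R) : 0 < s ->
  (\int[leb]_x (expR (- x ^+ 2 / (s ^+ 2 *+ 2)))%:E = (Num.sqrt (s ^+ 2 * pi *+ 2))%:E)%E.
Proof.
move=> s0; have := integral_normal_pdf 0 s; rewrite /normal_pdf gt_eqF//.
have p0 : 0 < Num.sqrt (s ^+ 2 * pi *+ 2).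
  by rewrite sqrtr_gt0 pmulrn_lgt0// mulr_gt0 ?exprn_gt0 ?pi_gt0.
have -> : (\int[leb]_x (normal_peak s * normal_fun 0 s x)%:E =
    (normal_peak s)%:E * \int[leb]_x (expR (- x ^+ 2 / (s ^+ 2 *+ 2)))%:E)%E.
  rewrite -ge0_integralZl//.
  - by apply: eq_integral => x _; rewrite -EFinM /normal_fun subr0.
  - apply/measurable_EFinP; apply: measurableT_comp => //.
    apply: measurable_funM; last exact: measurable_cst.
    by apply: measurableT_comp => //; exact: measurable_funX.
  - by rewrite lee_fin invr_ge0 ltW.
move=> h; have := congr1 (fun z => (Num.sqrt (s ^+ 2 * pi *+ 2))%:E * z)%E h.
by rewrite muleA -EFinM /normal_peak divff ?gt_eqF// mul1e mule1.
Qed.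

Lemma measurable_tuple_consE n (F : n.+1.-tuple R2 -> \bar R) :
  measurable_fun [set: n.+1.-tuple R2] F ->
  measurable_fun [set: n.-tuple R2 * measurableTypeR R * measurableTypeR R] (fun p => F (tuple_cons p)).
Proof. by move=> mF; apply: measurableT_comp => //; exact: measurable_tuple_cons. Qed.

Lemma tuple_gauss_cons s n (p : n.-tuple R2 * measurableTypeR R * measurableTypeR R) :
  tuple_gauss s (tuple_cons p) = tuple_gauss s p.1.1 *
   (expR (- p.1.2 ^+ 2 / (s ^+ 2 *+ 2)) * expR (- p.2 ^+ 2 / (s ^+ 2 *+ 2))).
Proof.
rewrite /tuple_gauss big_ord_recl (tnth_nth (0, 0))/= -!expRD; congr expR.
rewrite -!mulrDl -!opprD addrC; congr (- (_ + _) / _).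
by apply: eq_bigr => i _; rewrite !(tnth_nth (0, 0)).
Qed.

End LebesgueTuple.

(** * The measure on the complex vector space *)

Lemma sigma_finite_product {R : realType} d1 d2 (T1 : measurableType d1) (T2 : measurableType d2)
  (m1 : {sigma_finite_measure set T1 -> \bar R}) (m2 : {sigma_finite_measure set T2 -> \bar R}) :
  sigma_finite [set: T1 * T2] (m1 \x m2)%E.
Proof.
have /sigma_finiteP[F [TF ndF Foo]] := sigma_finiteT m1.
have /sigma_finiteP[G [TG ndG Goo]] := sigma_finiteT m2.
exists (fun k => F k `*` G k).
  apply/esym/seteqP; split => // -[x y] _.
  have [k _ Fx] : (\bigcup_i F i) x by rewrite -TF.
  have [l _ Gy] : (\bigcup_i G i) y by rewrite -TG.
  exists (maxn k l) => //; split => /=.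
    by move: x Fx; exact/subsetPset/ndF/leq_maxl.
  by move: y Gy; exact/subsetPset/ndG/leq_maxr.
move=> k; have [? ?] := Foo k; have [? ?] := Goo k.
split; first exact: measurableX.
by rewrite product_measure1E// lte_mul_pinfty// ge0_fin_numE.
Qed.

Section TripleTonelli.
Context {R : realType} {d : measure_display} {T : measurableType d}.
Local Notation leb := (@lebesgue_measure R).
Variable m : {sigma_finite_measure set T -> \bar R}.
Variable G : T * measurableTypeR R * measurableTypeR R -> \bar R.
Hypotheses (mG : measurable_fun [set: T * measurableTypeR R * measurableTypeR R] G)
  (G0 : forall p, (0 <= G p)%E).

Lemma triple_tonelli_meas :
  [/\ measurable_fun [set: T] (fun t => \int[leb]_x \int[leb]_y G (t, x, y))%E,
   forall t, measurable_fun [set: measurableTypeR R] (fun x => \int[leb]_y G (t, x, y))%E &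
   forall t x, measurable_fun [set: measurableTypeR R] (fun y => G (t, x, y))].
Proof.
have mH := @measurable_fun_fubini_tonelli_F _ _ _ _ R leb G mG G0.
have H0 p : (0 <= fubini_F leb G p)%E by apply: integral_ge0.
split.
- exact: (@measurable_fun_fubini_tonelli_F _ _ _ _ R leb _ mH H0).
- by move=> t; exact: (measurableT_comp mH (pair1_measurable t)).
- by move=> t x; exact: (measurableT_comp mG (pair1_measurable (t, x))).
Qed.

Lemma triple_tonelli :
  (\int[m \x leb \x leb]_p G p = \int[m]_t \int[leb]_x \int[leb]_y G (t, x, y))%E.
Proof.
have mH := @measurable_fun_fubini_tonelli_F _ _ _ _ R leb G mG G0.
have H0 p : (0 <= fubini_F leb G p)%E by apply: integral_ge0.
have h2 := @fubini_tonelli1 _ _ _ _ R m leb _ mH H0.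
rewrite (_ : (\int[m]_t _)%E = (\int[m]_x fubini_F leb (fubini_F leb G) x)%E) //.
rewrite -[RHS]h2.
have [M ME] := sigma_finite_pack (@sigma_finite_product R _ _ T _ m leb).
have h := @fubini_tonelli1 _ _ _ _ R M leb G mG G0.
transitivity (\int[M \x leb]_z G z)%E.
  apply: eq_measure_integral => A mA _; rewrite /product_measure1.
  by apply: eq_measure_integral => B mB _; exact: (congr1 (fun f => f B) (esym ME)).
rewrite h; apply: eq_measure_integral => B mB _.
exact: (congr1 (fun f => f B) ME).
Qed.

End TripleTonelli.

Section LebesgueTupleRec.
Context {R : realType}.
Local Notation leb := (@lebesgue_measure R).
Local Notation R2 := (measurableTypeR R * measurableTypeR R)%type.

Lemma lebesgue_tuple_rec n (F : n.+1.-tuple R2 -> \bar R) :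
  sigma_finite [set: n.-tuple R2] (lebesgue_tuple R n) ->
  measurable_fun [set: n.+1.-tuple R2] F -> (forall t, 0 <= F t)%E ->
  (\int[lebesgue_tuple R n.+1]_t F t =
   \int[lebesgue_tuple R n]_t \int[leb]_x \int[leb]_y F (tuple_cons (t, x, y)))%E.
Proof.
move=> /sigma_finite_pack[m mE] mF F0.
have mF' := measurable_tuple_consE mF.
transitivity (\int[(lebesgue_tuple R n \x leb \x leb)%E]_p F (tuple_cons p))%E.
  have := ge0_integral_pushforward (@measurable_tuple_cons R n)
    (lebesgue_tuple R n \x leb \x leb : {measure set _ -> \bar R})%E
    measurableT mF (fun y _ => F0 y).
  by rewrite preimage_setT.
rewrite (_ : lebesgue_tuple R n = m :> (set _ -> \bar R)); last by rewrite mE.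
by rewrite triple_tonelli.
Qed.

(** Both claims go together: the finite Gaussian integral in dimension [n] gives sigma-finiteness
    there, which Tonelli's theorem requires in the step to dimension [n + 1]. *)
Lemma lebesgue_tuple_gauss (s : R) : 0 < s -> forall n,
  sigma_finite [set: n.-tuple R2] (lebesgue_tuple R n) /\
  (\int[lebesgue_tuple R n]_t (tuple_gauss s t)%:E = ((s ^+ 2 * pi *+ 2) ^+ n)%:E)%E.
Proof.
move=> s0; have p0 : 0 < s ^+ 2 * pi *+ 2.
  by rewrite pmulrn_lgt0// mulr_gt0 ?exprn_gt0 ?pi_gt0.
suff key n : (\int[lebesgue_tuple R n]_t (tuple_gauss s t)%:E = ((s ^+ 2 * pi *+ 2) ^+ n)%:E)%E.
  move=> n; split; last exact: key.
  apply: (sigma_finite_ge0_integrable (mu := lebesgue_tuple R n) (g := @tuple_gauss R s n)).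
  - exact: measurable_tuple_gauss.
  - by move=> t; rewrite expR_gt0.
  - by rewrite key ltry.
elim: n => [|n IH].
  rewrite /= integral_dirac//.
    by rewrite diracT mul1e /tuple_gauss big_ord0 oppr0 mul0r expR0 expr0.
  by apply/measurable_EFinP; exact: (@measurable_tuple_gauss R s 0).
have sf : sigma_finite [set: n.-tuple R2] (lebesgue_tuple R n).
  apply: (sigma_finite_ge0_integrable (mu := lebesgue_tuple R n) (g := @tuple_gauss R s n)).
  - exact: measurable_tuple_gauss.
  - by move=> t; rewrite expR_gt0.
  - by rewrite IH ltry.
rewrite lebesgue_tuple_rec//; first last.
- by move=> t; rewrite lee_fin expR_ge0.
- by apply/measurable_EFinP; exact: (@measurable_tuple_gauss R s n.+1).
have mg : measurable_fun [set: measurableTypeR R] (fun x => (expR (- x ^+ 2 / (s ^+ 2 *+ 2)))%:E).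
  apply/measurable_EFinP; apply: measurableT_comp => //.
  apply: measurable_funM; last exact: measurable_cst.
  by apply: measurableT_comp => //; exact: measurable_funX.
have gI c : 0 <= c -> (\int[leb]_y (c * expR (- y ^+ 2 / (s ^+ 2 *+ 2)))%:E =
    (c * Num.sqrt (s ^+ 2 * pi *+ 2))%:E)%E.
  move=> c0; under eq_integral do rewrite EFinM.
  by rewrite ge0_integralZl ?integral_gauss1 ?EFinM//.
transitivity (\int[lebesgue_tuple R n]_t ((s ^+ 2 * pi *+ 2)%:E * (tuple_gauss s t)%:E))%E.
  apply: eq_integral => t _.
  transitivity (\int[leb]_x (tuple_gauss s t * Num.sqrt (s ^+ 2 * pi *+ 2) * expR (- x ^+ 2 / (s ^+ 2 *+ 2)))%:E)%E.
    apply: eq_integral => x _; rewrite mulrAC -gI ?mulr_ge0 ?expR_ge0//.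
    by apply: eq_integral => y _; rewrite tuple_gauss_cons mulrA.
  rewrite gI ?mulr_ge0 ?expR_ge0 ?sqrtr_ge0// -mulrA -expr2 sqr_sqrtr ?(ltW p0)//.
  by rewrite mulrC EFinM.
rewrite ge0_integralZl//.
- by rewrite IH -EFinM -[in LHS]exprS.
- by apply/measurable_EFinP; exact: (@measurable_tuple_gauss R s n).
- by move=> y _; rewrite lee_fin expR_ge0.
- by rewrite lee_fin ltW.
Qed.

Lemma lebesgue_tuple_sf n : sigma_finite [set: n.-tuple R2] (lebesgue_tuple R n).
Proof. exact: (lebesgue_tuple_gauss ltr01 n).1. Qed.

Definition tuple_shift n (a t : n.-tuple (R * R)) : n.-tuple (R * R) :=
  [tuple ((tnth t i).1 + (tnth a i).1, (tnth t i).2 + (tnth a i).2) | i < n].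

Lemma measurable_tuple_shift n a : measurable_fun [set: n.-tuple R2] (@tuple_shift n a : _ -> n.-tuple R2).
Proof.
apply/measurable_fun_tnthP => i.
rewrite (_ : _ \o _ = fun t : n.-tuple R2 => ((tnth t i).1 + (tnth a i).1, (tnth t i).2 + (tnth a i).2) : R2); last first.
  by apply/funext => t; rewrite /= tnth_mktuple.
by apply/measurable_fun_pair; (apply: measurable_funD; last exact: measurable_cst);
  (apply: measurableT_comp => //; exact: measurable_tnth).
Qed.

Lemma tuple_shift_cons n (a : n.+1.-tuple (R * R)) (t : n.-tuple R2) x y :
  tuple_shift a (tuple_cons (t, x, y)) =
  tuple_cons (tuple_shift [tuple of behead a] t, x + (tnth a ord0).1, y + (tnth a ord0).2).
Proof.
apply: eq_from_tnth => i; rewrite tnth_mktuple.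
case: (unliftP ord0 i) => [j|] ->.
  rewrite !(tnth_nth (0, 0))/= -(tnth_nth (0, 0) (tuple_shift [tuple of behead a] t)) tnth_mktuple.
  by rewrite !(tnth_nth (0, 0))/= nth_behead.
by rewrite !(tnth_nth (0, 0)).
Qed.

Lemma lebesgue_tuple_translation n (a : n.-tuple (R * R)) (F : n.-tuple R2 -> \bar R) :
  measurable_fun [set: n.-tuple R2] F -> (forall t, 0 <= F t)%E ->
  (\int[lebesgue_tuple R n]_t F (tuple_shift a t) = \int[lebesgue_tuple R n]_t F t)%E.
Proof.
elim: n a F => [|n IH] a F mF F0.
  by apply: eq_integral => t _; congr F; apply: eq_from_tnth => -[].
have mFs : measurable_fun [set: n.+1.-tuple R2] (fun t => F (tuple_shift a t)).
  apply: (measurableT_comp mF); exact: measurable_tuple_shift.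
have mFc := measurable_tuple_consE mF.
rewrite (lebesgue_tuple_rec (lebesgue_tuple_sf n) mFs (fun t => F0 (tuple_shift a t))).
rewrite (lebesgue_tuple_rec (lebesgue_tuple_sf n) mF F0).
have [m4 m3 m2] := triple_tonelli_meas mFc (fun p => F0 _).
have p4 t : (0 <= \int[leb]_x \int[leb]_y F (tuple_cons (t, x, y)))%E.
  by do 2 (apply: integral_ge0 => ? _).
rewrite -[RHS](IH [tuple of behead a] _ m4 p4).
apply: eq_integral => t _.
have p3 t' x : (0 <= \int[leb]_y F (tuple_cons (t', x, y)))%E by apply: integral_ge0.
rewrite -[RHS](integral_translation (tnth a ord0).1 (m3 _) (p3 _)).
apply: eq_integral => x _.
rewrite -[RHS](integral_translation (tnth a ord0).2 (m2 _ _) (fun y => F0 _)).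
by apply: eq_integral => y _; rewrite tuple_shift_cons.
Qed.

End LebesgueTupleRec.

Section ComplexSpaceMeasure.
Context {R : realType} {n : nat}.
Local Notation C := R[i].
Local Notation R2 := (measurableTypeR R * measurableTypeR R)%type.
Local Notation Cn := (Cn R n).

Lemma measurable_real_coords : measurable_fun [set: Cn] (@real_coords R n : _ -> n.-tuple R2).
Proof. by move=> _ B mB; exists B => //; rewrite setTI. Qed.

Lemma measurable_to_Cn d (T : measurableType d) (f : T -> Cn) :
  (forall k, cmeasurable (fun x => (f x : 'cV[C]_n) k 0)) -> measurable_fun [set: T] f.
Proof.
move=> mf _ A [B mB <-]; rewrite !setTI -comp_preimage -[X in measurable X]setTI.
suff : measurable_fun [set: T] (@real_coords R n \o f : T -> n.-tuple R2) by apply.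
apply/measurable_fun_tnthP => i.
rewrite (_ : _ \o _ = fun x => (Re ((f x : 'cV[C]_n) i 0), Im ((f x : 'cV[C]_n) i 0)) : R2); last first.
  by apply/funext => x; rewrite /= tnth_mktuple.
by have [m1 m2] := mf i; exact/measurable_fun_pair.
Qed.

Lemma cmeasurable_coord k : cmeasurable (fun z : Cn => (z : 'cV[C]_n) k 0).
Proof.
have h := measurable_tnth (T := R2) k.
have h2 := measurableT_comp h measurable_real_coords.
split.
  have h3 : measurable_fun [set: Cn] (fun z : Cn => (tnth (real_coords z) k).1 : measurableTypeR R).
    exact: (measurableT_comp (@measurable_fst _ _ (measurableTypeR R) (measurableTypeR R)) h2).
  by rewrite (_ : (fun z => _) = fun z : Cn => (tnth (real_coords z) k).1)//; apply/funext => z; rewrite tnth_mktuple.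
have h3 : measurable_fun [set: Cn] (fun z : Cn => (tnth (real_coords z) k).2 : measurableTypeR R).
  exact: (measurableT_comp (@measurable_snd _ _ (measurableTypeR R) (measurableTypeR R)) h2).
by rewrite (_ : (fun z => _) = fun z : Cn => (tnth (real_coords z) k).2)//; apply/funext => z; rewrite tnth_mktuple.
Qed.

Lemma measurable_affine (A : 'M[C]_n) (b : 'cV[C]_n) :
  measurable_fun [set: Cn] ((fun z : 'cV[C]_n => A *m z + b) : Cn -> Cn).
Proof.
apply: measurable_to_Cn => k.
under [X in cmeasurable X]eq_fun do rewrite mxE mxE.
apply: cmeasurableD; last exact: cmeasurable_cst.
apply: cmeasurable_sum => j; apply: cmeasurableM; first exact: cmeasurable_cst.
exact: cmeasurable_coord.
Qed.

Lemma integral_lebesgue_Cn (F : Cn -> \bar R) : measurable_fun [set: Cn] F ->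
  (forall z, 0 <= F z)%E ->
  (\int[lebesgue_Cn R n]_z F z = \int[lebesgue_tuple R n]_t F (of_real_coords t))%E.
Proof.
move=> mF F0.
have := ge0_integral_pushforward (@measurable_of_real_coords R n) (lebesgue_tuple R n)
  measurableT mF (fun y _ => F0 y).
by rewrite preimage_setT.
Qed.

Lemma sqnormE (z : 'cV[C]_n) : sqnorm z = \sum_k (Re (z k 0) ^+ 2 + Im (z k 0) ^+ 2).
Proof.
rewrite /sqnorm /cdot Re_sum; apply: eq_bigr => k _.
by rewrite mxE mulJ_cab /= cab_sqr.
Qed.

Lemma measurable_sqnorm : measurable_fun [set: Cn] (@sqnorm R n).
Proof.
rewrite (_ : @sqnorm R n = fun z => \sum_k (Re (z k 0) ^+ 2 + Im (z k 0) ^+ 2)); last first.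
  by apply/funext => z; rewrite sqnormE.
apply: measurable_sum => k; have [m1 m2] := cmeasurable_coord k.
by apply: measurable_funD; exact: measurable_funX.
Qed.

Lemma measurable_gauss (lam : {posnum R}) : measurable_fun [set: Cn] (gauss (n := n) lam).
Proof.
apply: measurableT_comp => //; apply: measurableT_comp => //.
by apply: measurable_funM; [exact: measurable_sqnorm|exact: measurable_cst].
Qed.

Lemma integral_gauss_lebesgue (lam : {posnum R}) :
  (\int[lebesgue_Cn R n]_z (gauss lam z)%:E = ((2 * pi * lam%:num) ^+ n)%:E)%E.
Proof.
rewrite integral_lebesgue_Cn; last 2 first.
- exact/measurable_EFinP/measurable_gauss.
- by move=> z; rewrite lee_fin expR_ge0.
have l0 : 0 < Num.sqrt lam%:num by rewrite sqrtr_gt0.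
have [_ ] := lebesgue_tuple_gauss l0 n; rewrite sqr_sqrtr// => h.
rewrite (_ : 2 * pi * lam%:num = lam%:num * pi *+ 2); last by ring.
rewrite -h; apply: eq_integral => t _; congr EFin; rewrite /gauss /tuple_gauss; congr expR.
rewrite sqr_sqrtr// sqnormE -mulNr; congr (- _ / _); last by rewrite mulr_natl.
by apply: eq_bigr => k _; rewrite mxE.
Qed.

Lemma lebesgue_Cn_sf : sigma_finite [set: Cn] (lebesgue_Cn R n).
Proof.
apply: (sigma_finite_ge0_integrable (mu := lebesgue_Cn R n) (g := gauss (PosNum (@ltr01 R)))).
- exact: measurable_gauss.
- by move=> z; rewrite expR_gt0.
- by rewrite integral_gauss_lebesgue ltry.
Qed.

Lemma lebesgue_Cn_translation (a : 'cV[C]_n) (F : Cn -> \bar R) : measurable_fun [set: Cn] F ->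
  (forall z, 0 <= F z)%E ->
  (\int[lebesgue_Cn R n]_z F ((z : 'cV[C]_n) + a)%R = \int[lebesgue_Cn R n]_z F z)%E.
Proof.
move=> mF F0; have ms : measurable_fun [set: Cn] ((fun z : 'cV[C]_n => z + a) : Cn -> Cn).
  apply: measurable_to_Cn => k; under [X in cmeasurable X]eq_fun do rewrite mxE.
  by apply: cmeasurableD; [exact: cmeasurable_coord|exact: cmeasurable_cst].
rewrite !integral_lebesgue_Cn//; last exact: (measurableT_comp mF ms).
have mF' : measurable_fun [set: n.-tuple R2] (fun t => F (of_real_coords t)).
  by apply: (measurableT_comp mF); exact: measurable_of_real_coords.
rewrite -[RHS](lebesgue_tuple_translation (real_coords a))//.
apply: eq_integral => t _; congr F; apply/colP => k; rewrite !mxE !tnth_mktuple /=.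
by apply: Cext => /=; case: (a k 0).
Qed.

Lemma sqnorm_unitary (k : 'M[C]_n) (z : 'cV[C]_n) : k \is unitarymx -> sqnorm (k *m z) = sqnorm z.
Proof.
move=> uk; rewrite /sqnorm; congr Re.
have cE (u v : 'cV[C]_n) : cdot u v = (u^T *m v) 0 0.
  by rewrite mxE; apply: eq_bigr => j _; rewrite mxE.
rewrite !cE /zbar map_mxM trmx_mul mulmxA -(mulmxA z^T).
have -> : k^T *m map_mx Num.conj k = 1%:M.
  have := mulVmx (unitarymx_unit uk); rewrite invmx_unitary//.
  move=> /(congr1 (fun M : 'M[C]_n => M^T)).
  by rewrite trmx_mul trmx1 -map_trmx trmxK.
by rewrite mulmx1.
Qed.

Lemma sqnormN (z : 'cV[C]_n) : sqnorm (- z) = sqnorm z.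
Proof. by rewrite !sqnormE; apply: eq_bigr => k _; rewrite mxE ReN ImN !sqrrN. Qed.

(** Computes [G = int int a(x) F(x + k y) dx dy] in two ways, for a radial Gaussian [a] of integral
    [A]. Translating [y] by [k^-1 x] gives [A int F(k y) dy]. Translating [x] by [k y] gives
    [int F(x) (int a(x - k y) dy) dx], and [a(x - k y) = a(y - k^-1 x)] makes the inner integral
    equal to [A]. Only translation invariance is used, no Jacobian. *)
Lemma lebesgue_Cn_unitary (k : 'M[C]_n) (F : Cn -> \bar R) : k \is unitarymx ->
  measurable_fun [set: Cn] F -> (forall z, 0 <= F z)%E ->
  (\int[lebesgue_Cn R n]_z F (k *m (z : 'cV[C]_n))%R = \int[lebesgue_Cn R n]_z F z)%E.
Proof.
move=> uk mF F0; have ku := unitarymx_unit uk.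
pose l1 : {posnum R} := PosNum (@ltr01 R); pose A := (2 * pi * l1%:num) ^+ n : R.
have A0 : 0 < A by rewrite exprn_gt0// !mulr_gt0// pi_gt0.
have mk : measurable_fun [set: Cn] ((fun z : 'cV[C]_n => k *m z) : Cn -> Cn).
  rewrite (_ : (fun z => _) = (fun z : 'cV[C]_n => k *m z + 0)); last by apply/funext => z; rewrite addr0.
  exact: measurable_affine.
have mFk : measurable_fun [set: Cn] (fun z => F (k *m (z : 'cV[C]_n))) by exact: (measurableT_comp mF mk).
have [m mE] := sigma_finite_pack lebesgue_Cn_sf.
have mI (H : Cn -> \bar R) : (\int[lebesgue_Cn R n]_z H z = \int[m]_z H z)%E.
  by apply: eq_measure_integral => B mB _; exact: (congr1 (fun f => f B) (esym mE)).
pose a : Cn -> \bar R := fun z => (gauss l1 (z : 'cV[C]_n))%:E.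
have ma : measurable_fun [set: Cn] a by apply/measurable_EFinP; exact: measurable_gauss.
have a0 z : (0 <= a z)%E by rewrite lee_fin expR_ge0.
have mxk : measurable_fun [set: Cn * Cn] ((fun p => (p.1 : 'cV[C]_n) + k *m (p.2 : 'cV[C]_n)) : Cn * Cn -> Cn).
  apply: measurable_to_Cn => i; under [X in cmeasurable X]eq_fun do rewrite mxE mxE.
  apply: cmeasurableD.
    exact: (cmeasurable_comp (@measurable_fst _ _ Cn Cn) (cmeasurable_coord i)).
  apply: cmeasurable_sum => j; apply: cmeasurableM; first exact: cmeasurable_cst.
  exact: (cmeasurable_comp (@measurable_snd _ _ Cn Cn) (cmeasurable_coord j)).
pose G (p : Cn * Cn) := (a p.1 * F ((p.1 : 'cV[C]_n) + k *m (p.2 : 'cV[C]_n))%R)%E : \bar R.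
have mG : measurable_fun [set: Cn * Cn] G.
  apply: emeasurable_funM; last exact: (measurableT_comp mF mxk).
  exact: (measurableT_comp ma (@measurable_fst _ _ Cn Cn)).
have G0 p : (0 <= G p)%E by rewrite mule_ge0.
have mFs (b : 'cV[C]_n) : measurable_fun [set: Cn] (fun z => F ((z : 'cV[C]_n) + b)).
  apply: (measurableT_comp mF); apply: measurable_to_Cn => i.
  under [X in cmeasurable X]eq_fun do rewrite mxE.
  by apply: cmeasurableD; [exact: cmeasurable_coord|exact: cmeasurable_cst].
have D1 : (\int[m]_x \int[m]_y G (x, y) = A%:E * \int[m]_z F (k *m (z : 'cV[C]_n))%R)%E.
  have I0 : (0 <= \int[m]_z F (k *m (z : 'cV[C]_n))%R)%E by apply: integral_ge0.
  transitivity (\int[m]_x (a x * \int[m]_z F (k *m (z : 'cV[C]_n))%R))%E.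
    apply: eq_integral => x _; rewrite /G/= ge0_integralZl//.
    2: by rewrite (_ : (fun y => _) = (fun y => F (k *m (y : 'cV[C]_n) + x))); [exact: (measurableT_comp (mFs x) mk)|apply/funext => y; rewrite addrC].
    congr (_ * _)%E; rewrite -mI -[RHS]mI.
    rewrite -[RHS](lebesgue_Cn_translation (invmx k *m (x : 'cV[C]_n)) mFk (fun z => F0 _)).
    by apply: eq_integral => y _; rewrite mulmxDr mulmxA mulmxV// mul1mx addrC.
  rewrite ge0_integralZr//; congr (_ * _)%E.
  by rewrite -mI integral_gauss_lebesgue.
have D2 : (\int[m]_y \int[m]_x G (x, y) = A%:E * \int[m]_z F z)%E.
  transitivity (\int[m]_y \int[m]_x (a ((x : 'cV[C]_n) - k *m (y : 'cV[C]_n))%R * F x))%E.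
    apply: eq_integral => y _; rewrite -mI -[RHS]mI.
    rewrite -[RHS](lebesgue_Cn_translation (k *m (y : 'cV[C]_n))).
    - by apply: eq_integral => x _; rewrite addrK.
    - apply: emeasurable_funM => //; apply: (measurableT_comp ma).
      apply: measurable_to_Cn => i; under [X in cmeasurable X]eq_fun do rewrite mxE.
      by apply: cmeasurableD; [exact: cmeasurable_coord|exact: cmeasurable_cst].
    - by move=> x; rewrite mule_ge0.
  have mxk' : measurable_fun [set: Cn * Cn] ((fun p => (p.2 : 'cV[C]_n) - k *m (p.1 : 'cV[C]_n)) : Cn * Cn -> Cn).
    apply: measurable_to_Cn => i; under [X in cmeasurable X]eq_fun do rewrite mxE mxE.
    apply: cmeasurableD.
      exact: (cmeasurable_comp (@measurable_snd _ _ Cn Cn) (cmeasurable_coord i)).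
    under [X in cmeasurable X]eq_fun do rewrite mxE.
    apply: cmeasurableN; apply: cmeasurable_sum => j; apply: cmeasurableM; first exact: cmeasurable_cst.
    exact: (cmeasurable_comp (@measurable_fst _ _ Cn Cn) (cmeasurable_coord j)).
  rewrite (fubini_tonelli (m1 := m) (m2 := m) (fun p : Cn * Cn => a ((p.2 : 'cV[C]_n) - k *m (p.1 : 'cV[C]_n))%R * F p.2)%E) /=; first last.
  - by move=> p; rewrite mule_ge0.
  - apply: emeasurable_funM; first exact: (measurableT_comp ma mxk').
    exact: (measurableT_comp mF (@measurable_snd _ _ Cn Cn)).
  transitivity (\int[m]_x (A%:E * F x))%E; last by rewrite ge0_integralZl// lee_fin ltW.
  apply: eq_integral => x _; rewrite ge0_integralZr//; last first.
    exact: (measurableT_comp (measurableT_comp ma mxk') (pair2_measurable (x : Cn))).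
  congr (_ * _)%E; rewrite -(integral_gauss_lebesgue l1).
  rewrite -[LHS]mI -(lebesgue_Cn_translation (- (invmx k *m (x : 'cV[C]_n))) ma a0).
  have ea (u v : 'cV[C]_n) : sqnorm u = sqnorm v -> a u = a v by rewrite /a /gauss => ->.
  apply: eq_integral => y _; apply: ea.
  rewrite -[RHS](sqnorm_unitary _ uk) mulmxDr mulmxN mulmxA mulmxV// mul1mx.
  by rewrite -[LHS]sqnormN opprB.
rewrite !mI.
have : (A%:E * \int[m]_z F (k *m (z : 'cV[C]_n))%R = A%:E * \int[m]_z F z)%E.
  by rewrite -D1 -D2; exact: (fubini_tonelli (m1 := m) (m2 := m) G).
move=> /(congr1 (fun e => (A^-1)%:E * e)%E).
by rewrite !muleA -EFinM mulVf ?gt_eqF// !mul1e.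
Qed.

End ComplexSpaceMeasure.

(** * Hermitian geometry, dense sequences and measurability of continuous functions *)

Section ComplexVectors.
Context {R : realType} {n : nat}.
Local Notation C := R[i].
Local Notation cV := 'cV[C]_n.

Definition cVdot (z w : cV) : C := cdot z (zbar w).

Lemma cVdotE z w : cVdot z w = \sum_k z k 0 * (w k 0)^*.
Proof. by apply: eq_bigr => k _; rewrite mxE. Qed.

Lemma sqnorm_cab (z : cV) : sqnorm z = \sum_k cab (z k 0) ^+ 2.
Proof. by rewrite sqnormE; apply: eq_bigr => k _; rewrite cab_sqr. Qed.

Lemma cV_prehilbert : prehilbert [set: cV] cVdot.
Proof.
split => //.
- move=> a f g h _ _ _; rewrite !cVdotE mulr_sumr -big_split; apply: eq_bigr => k _ /=.
  by rewrite !mxE mulrDl mulrA.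
- move=> f g _ _; rewrite !cVdotE CJ_sum; apply: eq_bigr => k _.
  by rewrite CJM CJK mulrC.
- move=> f _; rewrite cVdotE; apply: sumr_ge0 => k _.
  by rewrite mulJ_cab ler0c sqr_ge0.
Qed.

Definition cnrm (z : cV) : R := nrmd cVdot z.

Lemma cnrm_sqr z : cnrm z ^+ 2 = sqnorm z.
Proof. exact: (nrm_sqr cV_prehilbert). Qed.

Lemma cnrm_ge0 z : 0 <= cnrm z. Proof. exact: sqrtr_ge0. Qed.

Lemma sqnorm_ge0 (z : cV) : 0 <= sqnorm z.
Proof. by rewrite -cnrm_sqr sqr_ge0. Qed.

Lemma cVdotJ (z w : cV) : (cVdot z w)^* = cVdot w z.
Proof. by rewrite (ph_sym cV_prehilbert (f := w) (g := z)) ?CJK. Qed.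

Lemma cnrm_distC (z w : cV) : cnrm (z - w) = cnrm (w - z).
Proof. by rewrite -opprB; exact: (nrmN cV_prehilbert). Qed.

Lemma cab_coord_le (z : cV) k : cab (z k 0) <= cnrm z.
Proof.
rewrite -(@ler_pXn2r _ 2) ?nnegrE ?cab_ge0 ?cnrm_ge0// cnrm_sqr sqnorm_cab.
by rewrite (bigD1 k)//= lerDl sumr_ge0// => j _; rewrite sqr_ge0.
Qed.

Lemma mxnorm_le_cnrm (z : cV) : `|z| <= (cnrm z)%:C.
Proof.
have [->|z0] := eqVneq `|z| 0; first by rewrite ler0c cnrm_ge0.
have [[i j] /= e] := mx_norm_neq0 z0.
rewrite -[leLHS]/(mx_norm z) e cabE lecR; have -> : j = 0 by rewrite ord1.
exact: cab_coord_le.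
Qed.

Lemma cab_le_mxnorm (z : cV) k : (cab (z k 0))%:C <= `|z|.
Proof.
rewrite -cabE -[leRHS]/(mx_norm z) mx_normE -[leLHS]nngE num_le.
exact: (@le_bigmax _ _ _ _ (fun i : 'I_n * 'I_1 => `|z i.1 i.2|%:nng) (k, 0)).
Qed.

Lemma cnrm_le_mxnorm (z : cV) : (cnrm z)%:C <= n%:R * `|z|.
Proof.
have h0 : 0 <= \sum_k cab (z k 0) by apply: sumr_ge0 => k _; exact: cab_ge0.
have h : cnrm z <= \sum_k cab (z k 0).
  rewrite -(@ler_pXn2r _ 2) ?nnegrE ?cnrm_ge0// cnrm_sqr sqnorm_cab expr2 mulr_suml.
  apply: ler_sum => k _; rewrite expr2 ler_wpM2l ?cab_ge0// (bigD1 k)//= lerDl.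
  by apply: sumr_ge0 => j _; exact: cab_ge0.
apply: le_trans (_ : (\sum_k cab (z k 0))%:C <= _); first by rewrite lecR.
rewrite CR_sum; apply: le_trans (_ : \sum_(k < n) `|z| <= _).
  by apply: ler_sum => k _; exact: cab_le_mxnorm.
by rewrite sumr_const card_ord mulr_natl.
Qed.

Lemma cV_continuous_eps (f : cV -> C) z : f w @[w --> z] --> f z ->
  forall e : R, 0 < e -> exists2 d : R, 0 < d &
    forall w, cnrm (w - z) < d -> cab (f w - f z) < e.
Proof.
move=> /cvgrPdist_lt h e e0.
have /h/nbhs_normP[d /= d0 hd] : 0 < e%:C :> C by rewrite ltcR.
have dE := ge0_CRe (ltW d0).
exists (Re d); first by rewrite -ltcR -dE.
move=> w wd; rewrite cab_distC -ltcR -cabE; apply: hd.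
by rewrite /ball_/= distrC (le_lt_trans (mxnorm_le_cnrm _))// dE ltcR.
Qed.

Definition rat_vec (q : 'cV[rat * rat]_n) : cV :=
  \col_k (ratr (q k 0).1 +i* ratr (q k 0).2)%C.

Definition dense_vec (j : nat) : cV := oapp rat_vec 0 (unpickle j).

Lemma dense_vecP (z : cV) (e : R) : 0 < e -> exists j, cnrm (z - dense_vec j) < e.
Proof.
(* As [d <= 1], each of the [2 n] squared coordinate errors is below [d], and [2 n d] stays below
   [e^2]; [n.+1] avoids dividing by zero. *)
move=> e0; pose d := Num.min 1 (e ^+ 2 / (2 * n.+1%:R)).
have n0 : (0 : R) < 2 * n.+1%:R by rewrite mulr_gt0.
have d0 : 0 < d by rewrite lt_min ltr01 divr_gt0// exprn_gt0.
have ch (x : R) : exists q : rat, `|x - ratr q| < d.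
  have [q] : exists q : rat, ratr q \in `]x - d, x + d[ by apply: rat_in_itvoo; lra.
  by rewrite in_itv/= => /andP[h1 h2]; exists q; rewrite ltr_norml; apply/andP; split; lra.
have [q1 h1] := choice (fun k : 'I_n => ch (Re (z k 0))).
have [q2 h2] := choice (fun k : 'I_n => ch (Im (z k 0))).
exists (pickle (\col_k (q1 k, q2 k) : 'cV[rat * rat]_n)).
rewrite /dense_vec pickleK /=.
rewrite -(@ltr_pXn2r _ 2) ?nnegrE ?cnrm_ge0 ?(ltW e0)// cnrm_sqr sqnormE.
have d1 : d <= 1 by rewrite ge_min lexx.
have d2 : d * (2 * n.+1%:R) <= e ^+ 2 by rewrite -ler_pdivlMr// ge_min lexx orbT.
apply: le_lt_trans (_ : \sum_(k < n) 2 * d < _).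
  apply: ler_sum => k _; rewrite !mxE ReB ImB /=.
  have s (x : R) : `|x| < d -> x ^+ 2 <= d.
    move=> xd; rewrite -real_normK ?num_real// expr2.
    by have := normr_ge0 x; nra.
  by have := s _ (h1 k); have := s _ (h2 k); lra.
rewrite sumr_const card_ord -mulr_natr.
apply: lt_le_trans d2; rewrite -natr1; lra.
Qed.

Lemma measurable_cnrm (z : cV) : measurable_fun [set: Cn R n] (fun w : Cn R n => cnrm ((w : cV) - z)).
Proof.
have ms : measurable_fun [set: R] (@Num.sqrt R).
  by apply: continuous_measurable_fun; exact: sqrt_continuous.
have mz : measurable_fun [set: Cn R n] ((fun w : cV => w - z) : Cn R n -> Cn R n).
  apply: measurable_to_Cn => k; under [X in cmeasurable X]eq_fun do rewrite mxE.
  by apply: cmeasurableD; [exact: cmeasurable_coord|exact: cmeasurable_cst].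
have h := measurableT_comp measurable_sqnorm mz.
exact: (measurableT_comp ms h).
Qed.

(* Approximate [f] by [f] at the first point of a dense sequence that is
   [1/(m+1)]-close. *)
Lemma continuous_cmeasurable (f : cV -> C) : (forall z, f w @[w --> z] --> f z) ->
  cmeasurable (f : Cn R n -> C).
Proof.
move=> cf.
pose A m j := [set z : Cn R n | cnrm ((z : cV) - dense_vec j) < m.+1%:R^-1].
have mA m j : measurable (A m j).
  rewrite -[A m j]setTI (_ : A m j = (fun w : Cn R n => cnrm ((w : cV) - dense_vec j)) @^-1` `]-oo, m.+1%:R^-1[%classic).
    exact: measurable_cnrm.
  by apply/seteqP; split => z /=; rewrite in_itv.
pose B m j := A m j `\` \bigcup_(i < j) A m i.
have mB m j : measurable (B m j).
  by apply: measurableD => //; apply: bigcup_measurable.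
have ex m (z : cV) : exists j, B m j z.
  have [j hj] : exists j, `[< A m j z >].
    have m0 : (0 : R) < m.+1%:R^-1 by rewrite invr_gt0.
    by have [j hj] := dense_vecP z m0; exists j; apply/asboolP.
  have [i /asboolP Ai mi] := ex_minnP (ex_intro (fun j => `[< A m j z >]) j hj).
  exists i; split => // -[l /= li Al].
  by have := mi l; rewrite leqNgt li; move=> h; have := h (asboolT Al).
have uni m z i j : B m i z -> B m j z -> i = j.
  move=> [Ai nAi] [Aj nAj]; apply/eqP; case: (ltngtP i j) => // h; exfalso.
    by apply: nAj; exists i.
  by apply: nAi; exists j.
pose J m := projT1 (choice (ex m)); have hJ m z : B m (J m z) z := projT2 (choice (ex m)) z.
have mJ m (g : nat -> R) : measurable_fun [set: Cn R n] (fun z => g (J m z)).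
  move=> _ Y mY; rewrite setTI.
  rewrite (_ : _ @^-1` _ = \bigcup_(j in [set j | Y (g j)]) B m j); first exact: bigcup_measurable.
  apply/seteqP; split => [z /= Yz|z [j /= Yj Bj] /=]; first by exists (J m z).
  by rewrite (uni _ _ _ _ (hJ m z) Bj).
apply: (@cmeasurable_lim R _ (Cn R n) (fun m z => f (dense_vec (J m z))) f).
  by move=> m; split; [exact: (mJ m (fun j => Re (f (dense_vec j))))|exact: (mJ m (fun j => Im (f (dense_vec j))))].
move=> z; apply/cvgCP/cvgr0Pnorm_lt => e e0.
have [d d0 hd] := cV_continuous_eps (cf z) e0.
have [N hN] : exists N, N.+1%:R^-1 < d.
  exists (Num.bound d^-1); rewrite -[ltRHS]invrK ltf_pV2 ?posrE ?invr_gt0//.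
  by rewrite (lt_le_trans (archi_boundP _)) ?invr_ge0 ?(ltW d0)// ler_nat.
exists N => // m /= Nm; rewrite ger0_norm ?cab_ge0//; apply: hd.
have [+ _] := hJ m z; rewrite /A/= cnrm_distC => h.
apply: lt_trans hN; apply: lt_le_trans h _.
by rewrite lef_pV2 ?posrE// ler_nat.
Qed.

End ComplexVectors.

Section FockMeasure.
Context {R : realType} {n : nat} (lam : {posnum R}).
Local Notation C := R[i].
Local Notation cV := 'cV[C]_n.
Local Notation Cn := (Cn R n).
Local Notation fm := (fock_measure n lam).

Lemma fock_measure_integral (F : Cn -> \bar R) : measurable_fun [set: Cn] F -> (forall z, 0 <= F z)%E ->
  (\int[fm]_z F z = ((2 * pi * lam%:num) ^- n)%:E * \int[lebesgue_Cn R n]_z F z)%E.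
Proof. by move=> mF F0; exact: ge0_integral_mscale. Qed.

Lemma fock_translation (a : cV) (A : set Cn) : measurable A ->
  fm ((fun z : cV => z + a) @^-1` A) = fm A.
Proof.
apply: ge0_integral_preserving.
  apply: measurable_to_Cn => k; under [X in cmeasurable X]eq_fun do rewrite mxE.
  by apply: cmeasurableD; [exact: cmeasurable_coord|exact: cmeasurable_cst].
move=> F mF F0; rewrite !fock_measure_integral// ?lebesgue_Cn_translation//.
apply: (measurableT_comp mF); apply: measurable_to_Cn => k.
under [X in cmeasurable X]eq_fun do rewrite mxE.
by apply: cmeasurableD; [exact: cmeasurable_coord|exact: cmeasurable_cst].
Qed.

Lemma measurable_mulmx (k : 'M[C]_n) : measurable_fun [set: Cn] ((fun z : cV => k *m z) : Cn -> Cn).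
Proof.
rewrite (_ : (fun z => _) = (fun z : cV => k *m z + 0)); last by apply/funext => z; rewrite addr0.
exact: measurable_affine.
Qed.

Lemma fock_unitary (k : 'M[C]_n) (A : set Cn) : k \is unitarymx -> measurable A ->
  fm ((fun z : cV => k *m z) @^-1` A) = fm A.
Proof.
move=> uk; apply: ge0_integral_preserving; first exact: measurable_mulmx.
move=> F mF F0; rewrite !fock_measure_integral// ?lebesgue_Cn_unitary//.
exact: (measurableT_comp mF (measurable_mulmx k)).
Qed.

Lemma fock_affine (k : 'M[C]_n) (b : cV) (A : set Cn) : k \is unitarymx -> measurable A ->
  fm ((fun z : cV => k *m z + b) @^-1` A) = fm A.
Proof.
move=> uk mA; rewrite -[RHS](fock_translation b)// -[RHS](fock_unitary uk)//.
have mt : measurable_fun [set: Cn] ((fun z : cV => 1%:M *m z + b) : Cn -> Cn) by exact: measurable_affine.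
rewrite (_ : (fun z : cV => z + b) = (fun z => 1%:M *m z + b)); last by apply/funext => z; rewrite mul1mx.
by have := mt measurableT A mA; rewrite setTI.
Qed.

Lemma integral_gauss : (\int[fm]_z (gauss lam (z : cV))%:E = 1)%E.
Proof.
rewrite fock_measure_integral ?integral_gauss_lebesgue.
- by rewrite -EFinM mulVf// gt_eqF// exprn_gt0// !mulr_gt0// pi_gt0.
- by apply/measurable_EFinP; exact: measurable_gauss.
- by move=> z; rewrite lee_fin expR_ge0.
Qed.

Lemma fock_measure_sf : sigma_finite [set: Cn] fm.
Proof.
apply: (sigma_finite_ge0_integrable (mu := fm) (g := gauss lam)).
- exact: measurable_gauss.
- by move=> z; rewrite expR_gt0.
- by rewrite integral_gauss ltry.
Qed.

End FockMeasure.

(** * Holomorphic functions *)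

Section ComplexExponential.
Context {R : realType}.
Local Notation C := R[i].
Implicit Types (z w : C) (x y : R).

Lemma Re_cexp z : Re (cexp z) = expR (Re z) * cos (Im z).
Proof. by rewrite /cexp ReMC. Qed.

Lemma Im_cexp z : Im (cexp z) = expR (Re z) * sin (Im z).
Proof. by rewrite /cexp ImMC. Qed.

Lemma cexpD z w : cexp (z + w) = cexp z * cexp w.
Proof.
apply: Cext.
  by rewrite [in RHS]ReM !Re_cexp !Im_cexp ReD ImD expRD cosD; ring.
by rewrite [in RHS]ImM !Re_cexp !Im_cexp ReD ImD expRD sinD; ring.
Qed.

Lemma cexp_CR x : cexp x%:C = (expR x)%:C.
Proof. by apply: Cext; rewrite ?Re_cexp ?Im_cexp /= ?cos0 ?sin0 ?mulr1 ?mulr0. Qed.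

Lemma cexp0 : cexp 0 = 1 :> C.
Proof. by rewrite -[0]CR0 cexp_CR expR0. Qed.

Lemma cexpJ z : (cexp z)^* = cexp z^*.
Proof.
by apply: Cext; rewrite ?ReJ ?ImJ !(Re_cexp, Im_cexp) ReJ ImJ ?cosN ?sinN// mulrN.
Qed.

Lemma cab_cexp z : cab (cexp z) = expR (Re z).
Proof.
rewrite /cab Re_cexp Im_cexp !exprMn -mulrDr cos2Dsin2 mulr1 sqrtr_sqr.
by rewrite ger0_norm// expR_ge0.
Qed.

Lemma cexp_2pi z : cexp (z + (0 +i* (pi *+ 2))%C) = cexp z.
Proof.
apply: Cext; rewrite !(Re_cexp, Im_cexp) ReD ImD /= addr0.
  by rewrite cosD cos2pi sin2pi mulr1 mulr0 subr0.
by rewrite sinD cos2pi sin2pi mulr1 mulr0 addr0.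
Qed.

Lemma mvt_bound (f df : R -> R) (g : R -> R) x : 0 <= x ->
  (forall t : R, is_derive t 1 f (df t)) -> (forall t, 0 <= t -> t <= x -> `|df t| <= g x) ->
  `|f x - f 0| <= g x * x.
Proof.
move=> x0 d h; have cf : {within `[0, x], continuous f}.
  apply: continuous_subspaceT => t; apply: differentiable_continuous.
  by apply/derivable1_diffP; have [] := d t.
have [c] := MVT_segment x0 (fun t _ => d t) cf.
rewrite in_itv/= subr0 => /andP[c0 cx] ->.
by rewrite normrM (ger0_norm x0) ler_wpM2r// h.
Qed.

Lemma sin_bound x : `|sin x| <= `|x|.
Proof.
wlog x0 : x / 0 <= x.
  move=> H; have [|x0] := leP 0 x; first exact: H.
  by rewrite -normrN -sinN -[leRHS]normrN; apply: H; rewrite oppr_ge0 ltW.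
have := mvt_bound (g := fun=> 1) x0 (@is_derive_sin R).
rewrite sin0 subr0 mul1r (ger0_norm x0); apply => t _ _.
by rewrite ler_norml cos_geN1 cos_le1.
Qed.

Lemma cos1_bound x : `|cos x - 1| <= x ^+ 2.
Proof.
wlog x0 : x / 0 <= x.
  move=> H; have [|x0] := leP 0 x; first exact: H.
  by rewrite -cosN -sqrrN; apply: H; rewrite oppr_ge0 ltW.
have := mvt_bound (g := id) x0 (@is_derive_cos R).
rewrite cos0 expr2; apply => t t0 tx; rewrite normrN.
by rewrite (le_trans (sin_bound t))// ger0_norm.
Qed.

Lemma sinx_bound x : `|sin x - x| <= x ^+ 2.
Proof.
wlog x0 : x / 0 <= x.
  move=> H; have [|x0] := leP 0 x; first exact: H.
  rewrite -normrN opprB addrC -sqrrN; have := H (- x).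
  by rewrite sinN opprK addrC oppr_ge0; apply; exact: ltW.
have d (t : R) : is_derive t 1 (sin - id : R -> R) (cos t - 1) by apply: is_deriveB.
have := mvt_bound (g := id) x0 d.
rewrite !fctE sin0 !subr0 expr2; apply => t t0 tx.
have d1 (s : R) : is_derive s 1 cos (- sin s) by exact: is_derive_cos.
have := mvt_bound (g := fun=> 1) t0 d1; rewrite cos0 mul1r => h; apply: le_trans tx; apply: h => s _ _.
by rewrite normrN ler_norml sin_geN1 sin_le1.
Qed.

Lemma expR1_bound x : `|expR x - 1| <= `|x| * expR `|x|.
Proof.
have h1 := expR_ge1Dx x; have h2 := expR_ge1Dx (- x).
have e0 := expR_gt0 x.
have h3 : (1 - x) * expR x <= 1.
  by rewrite -[leRHS](expRxMexpNx_1 x) mulrC ler_pM2l.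
have [x0|x0] := leP 0 x.
  rewrite (ger0_norm x0) ger0_norm; last lra.
  lra.
have x1 : expR x <= 1 by rewrite -expR0 ler_expR ltW.
rewrite (ltr0_norm x0) ler0_norm; last lra.
have : 1 <= expR (- x) by rewrite -expR0 ler_expR; lra.
by move=> *; nra.
Qed.

Lemma expR2_bound x : `|expR x - 1 - x| <= x ^+ 2 * expR `|x|.
Proof.
have h1 := expR_ge1Dx x; have h2 := expR_ge1Dx (- x).
have e0 := expR_gt0 x.
have h3 : (1 - x) * expR x <= 1.
  by rewrite -[leRHS](expRxMexpNx_1 x) mulrC ler_pM2l.
rewrite ger0_norm; last lra.
have [x0|x0] := leP 0 x; first by rewrite (ger0_norm x0); nra.
have x1 : expR x <= 1 by rewrite -expR0 ler_expR ltW.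
have : 1 <= expR `|x| by rewrite -expR0 ler_expR.
by move=> *; nra.
Qed.

(** Mean value bounds for [exp], [cos] and [sin]. The real part costs one copy of [|z|^2 exp |z|]
    and the imaginary part two, hence the 3. *)
Lemma cexp_bound z : cab (cexp z - 1 - z) <= 3 * (cab z ^+ 2 * expR (cab z)).
Proof.
set x := Re z; set y := Im z; have xz := cab_Re z; have yz := cab_Im z.
rewrite -/x -/y in xz yz.
have ex : expR x <= expR (cab z) by rewrite ler_expR (le_trans _ xz)// ler_norm.
have ax : expR `|x| <= expR (cab z) by rewrite ler_expR.
have [e0 a0] := (expR_gt0 x, expR_gt0 `|x|).
have c0 := cab_ge0 z; have ec := expR_gt0 (cab z).
have czz := cab_sqr z; rewrite -/x -/y in czz.
apply: le_trans (cab_le _) _; rewrite !(ReB, ImB) Re_cexp Im_cexp -/x -/y /= subr0.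
have -> : expR x * cos y - 1 - x = expR x * (cos y - 1) + (expR x - 1 - x) by ring.
have -> : expR x * sin y - y = expR x * (sin y - y) + (expR x - 1) * y by ring.
have b1 : `|expR x * (cos y - 1)| <= expR (cab z) * y ^+ 2.
  by rewrite normrM (ger0_norm (ltW e0)) ler_pM ?normr_ge0 ?(ltW e0)// cos1_bound.
have b2 : `|expR x - 1 - x| <= expR (cab z) * x ^+ 2.
  by apply: le_trans (expR2_bound x) _; rewrite mulrC ler_wpM2r// sqr_ge0.
have b3 : `|expR x * (sin y - y)| <= expR (cab z) * y ^+ 2.
  by rewrite normrM (ger0_norm (ltW e0)) ler_pM ?normr_ge0 ?(ltW e0)// sinx_bound.
have b4 : `|(expR x - 1) * y| <= expR (cab z) * (`|x| * `|y|).
  rewrite normrM mulrA [_ * `|x|]mulrC; apply: ler_wpM2r => //.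
  by apply: le_trans (expR1_bound x) _; rewrite ler_wpM2l.
have b5 : `|x| * `|y| <= cab z ^+ 2 by rewrite expr2 ler_pM.
have b6 := ler_normD (expR x * (cos y - 1)) (expR x - 1 - x).
have b7 := ler_normD (expR x * (sin y - y)) ((expR x - 1) * y).
have b8 : y ^+ 2 <= cab z ^+ 2 by rewrite czz lerDr sqr_ge0.
have b9 : expR (cab z) * y ^+ 2 <= expR (cab z) * cab z ^+ 2 by rewrite ler_wpM2l// ltW.
have b10 : expR (cab z) * (`|x| * `|y|) <= expR (cab z) * cab z ^+ 2 by rewrite ler_wpM2l// ltW.
have b11 : expR (cab z) * y ^+ 2 + expR (cab z) * x ^+ 2 = expR (cab z) * cab z ^+ 2 by rewrite czz; ring.
lra.
Qed.

End ComplexExponential.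

(** * Cauchy's theorem for rectangles and the mean value property on circles *)

Section ComplexDerivative.
Context {R : realType}.
Local Notation C := R[i].

(** Complex differentiability at a point with real radii, the form in which Goursat's subdivision
    uses it. *)
Definition cdiff_at (f : C -> C) (p : C) : Prop := exists beta : C, forall e : R, 0 < e ->
  exists2 d : R, 0 < d & forall z, cab (z - p) < d ->
    cab (f z - f p - beta * (z - p)) <= e * cab (z - p).

Lemma cdiff_cont f p : cdiff_at f p -> forall e : R, 0 < e -> exists2 d : R, 0 < d &
  forall z, cab (z - p) < d -> cab (f z - f p) < e.
Proof.
move=> [b h] e e0; have [d d0 hd] := h 1 ltr01.
have b0 := cab_ge0 b; have q0 : 0 < 1 + cab b by lra.
exists (Num.min d (e / (1 + cab b))); first by rewrite lt_min d0 divr_gt0.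
move=> z; rewrite lt_min ltr_pdivlMr// => /andP[/hd h1 h2].
have := cabD (f z - f p - b * (z - p)) (b * (z - p)); rewrite subrK cabM => h3.
by rewrite mul1r in h1; lra.
Qed.

Lemma cdiff_cexp p : cdiff_at (@cexp R) p.
Proof.
exists (cexp p) => e e0; pose E := expR (Re p); have E0 : 0 < E := expR_gt0 _.
have ee0 := expR_gt0 (1 : R).
have q0 : 0 < E * 3 * expR 1 by rewrite !mulr_gt0.
exists (Num.min 1 (e / (E * 3 * expR 1))); first by rewrite lt_min ltr01 divr_gt0.
move=> z; rewrite lt_min; set h := z - p => /andP[h1 h2].
have -> : cexp z - cexp p - cexp p * h = cexp p * (cexp h - 1 - h).
  by rewrite !mulrBr mulr1 -cexpD /h [p + _]addrC subrK.
rewrite cabM cab_cexp -/E; have := cexp_bound h; have c0 := cab_ge0 h.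
have : expR (cab h) <= expR 1 by rewrite ler_expR ltW.
have := expR_gt0 (cab h); move: h2; rewrite ltr_pdivlMr// => h2 h3 h4 h5.
have h6 : cab h ^+ 2 * expR (cab h) <= cab h ^+ 2 * expR 1 by rewrite ler_wpM2l// sqr_ge0.
apply: le_trans (_ : E * (3 * (cab h ^+ 2 * expR 1)) <= _).
  by rewrite ler_wpM2l ?(ltW E0)//; lra.
have -> : E * (3 * (cab h ^+ 2 * expR 1)) = (cab h * (E * 3 * expR 1)) * cab h by ring.
by rewrite ler_wpM2r// ltW.
Qed.

Lemma cdiff_comp f g p : cdiff_at g p -> cdiff_at f (g p) -> cdiff_at (f \o g) p.
Proof.
move=> Hg Hf; have [b hg] := Hg; have [c hf] := Hf.
exists (c * b) => e e0.
have b0 := cab_ge0 b; have c0 := cab_ge0 c.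
pose e1 := e / (2 * (1 + cab b)); pose e2 := Num.min 1 (e / (2 * (1 + cab c))).
have e10 : 0 < e1 by rewrite divr_gt0// mulr_gt0//; lra.
have e20 : 0 < e2 by rewrite lt_min ltr01 divr_gt0// mulr_gt0//; lra.
have e21 : e2 <= 1 by rewrite ge_min lexx.
have e22 : e2 * (2 * (1 + cab c)) <= e.
  by rewrite -ler_pdivlMr ?ge_min ?lexx ?orbT// mulr_gt0//; lra.
have e11 : e1 * (2 * (1 + cab b)) = e by rewrite divfK// gt_eqF// mulr_gt0//; lra.
have [d1 d10 h1] := hf e1 e10; have [d2 d20 h2] := hg e2 e20.
have [d3 d30 h3] := cdiff_cont Hg d10.
exists (Num.min d2 d3); first by rewrite lt_min d20.
move=> z; rewrite lt_min => /andP[z2 z3]; set h := z - p in z2 z3 *.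
have := h1 _ (h3 z z3); have := h2 z z2; rewrite -/h.
set u := g z - g p => h4 h5.
have -> : (f \o g) z - (f \o g) p - c * b * h = (f (g z) - f (g p) - c * u) + c * (u - b * h).
  by rewrite /=; ring.
apply: le_trans (cabD _ _) _; rewrite cabM.
have u1 := cabD (u - b * h) (b * h); rewrite subrK cabM in u1.
have hh := cab_ge0 h; have := cab_ge0 (u - b * h).
have h6 : e1 * cab u <= e1 * ((1 + cab b) * cab h) by rewrite ler_wpM2l ?(ltW e10)//; nra.
have h7 : cab c * cab (u - b * h) <= cab c * (e2 * cab h) by rewrite ler_wpM2l.
have h8 : cab c * (e2 * cab h) <= (e2 * (1 + cab c)) * cab h by nra.
have h9 : e1 * ((1 + cab b) * cab h) = e / 2 * cab h.
  rewrite mulrA; congr (_ * _); rewrite -[in RHS]e11; lra.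
have h10 : e2 * (1 + cab c) * cab h <= e / 2 * cab h by rewrite ler_wpM2r//; lra.
lra.
Qed.

End ComplexDerivative.

Section IntervalIntegral.
Context {R : realType}.
Local Notation C := R[i].
Local Notation leb := (@lebesgue_measure R).
Implicit Types (f g : R -> C) (a b : R).

Definition rcont f := forall x (e : R), 0 < e -> exists2 d : R, 0 < d &
  forall y, `|y - x| < d -> cab (f y - f x) < e.

Lemma rcont_cst (c : C) : rcont (fun=> c).
Proof. by move=> x e e0; exists 1 => // y _; rewrite subrr cab0. Qed.

Lemma rcontD f g : rcont f -> rcont g -> rcont (fun x => f x + g x).
Proof.
move=> hf hg x e e0; have e20 : 0 < e / 2 by rewrite divr_gt0.
have [d1 d10 h1] := hf x _ e20; have [d2 d20 h2] := hg x _ e20.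
exists (Num.min d1 d2); first by rewrite lt_min d10.
move=> y; rewrite lt_min => /andP[/h1 + /h2].
have -> : f y + g y - (f x + g x) = (f y - f x) + (g y - g x) by ring.
by have := cabD (f y - f x) (g y - g x); lra.
Qed.

Lemma rcontN f : rcont f -> rcont (fun x => - f x).
Proof.
move=> hf x e /(hf x)[d d0 h]; exists d => // y /h.
by rewrite -opprD cabN.
Qed.

Lemma rcontB f g : rcont f -> rcont g -> rcont (fun x => f x - g x).
Proof. by move=> hf hg; apply: rcontD => //; exact: rcontN. Qed.

Lemma rcont_ReIm f : rcont f -> continuous (fun x => Re (f x)) /\ continuous (fun x => Im (f x)).
Proof.
move=> hf; split => x; apply/cvgrPdist_lt => e /(hf x)[d d0 h]; exists d => //= y;
  rewrite /ball_/= => xy; have := h y; rewrite distrC in xy; move=> /(_ xy); apply: le_lt_trans;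
  rewrite cab_distC; [rewrite -ReB; exact: cab_Re|rewrite -ImB; exact: cab_Im].
Qed.

(** The half-open interval makes adjacent integrals add up exactly, and integrating an indicator
    over the whole line puts [cint] within reach of Fubini's theorem. *)
Definition cint a b f : C := cintegral leb (fun x => (\1_(`[a, b[%classic) x)%:C * f x).

Lemma cint_integrable a b f : rcont f ->
  cintegrable leb (fun x : measurableTypeR R => (\1_(`[a, b[%classic) x)%:C * f x).
Proof.
move=> hf; have [h1 h2] := rcont_ReIm hf.
have mI : measurable (`[a, b[%classic : set (measurableTypeR R)) by exact: measurable_itv.
have key (g : R -> R) : continuous g -> leb.-integrable [set: measurableTypeR R]
    (fun x : measurableTypeR R => (\1_(`[a, b[%classic) x * g x)%:E).
  move=> cg; have ig : leb.-integrable `[a, b]%classic (EFin \o g).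
    apply: continuous_compact_integrable; first exact: segment_compact.
    exact: continuous_subspaceT.
  have ig2 : leb.-integrable (`[a, b[%classic : set (measurableTypeR R)) (EFin \o g).
    apply: (integrableS _ mI _ ig); first exact: measurable_itv.
    by move=> x /=; rewrite !in_itv/= => /andP[-> /ltW].
  have := (integrable_mkcond (T := measurableTypeR R) _ mI).1 ig2.
  apply: eq_integrable => // x _; rewrite patchE indicE.
  by case: ifP => _; rewrite ?mul1r ?mul0r.
split; first by under eq_fun do rewrite ReMC; exact: key.
by under eq_fun do rewrite ImMC; exact: key.
Qed.

Lemma cintD a b f g : rcont f -> rcont g ->
  cint a b (fun x => f x + g x) = cint a b f + cint a b g.
Proof.
move=> hf hg; rewrite /cint -cintegralD; [|exact: cint_integrable|exact: cint_integrable].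
by apply: eq_cintegral => x; rewrite mulrDr.
Qed.

Lemma cint_cst a b (c : C) : a <= b -> cint a b (fun=> c) = (b - a)%:C * c.
Proof.
move=> ab; have mI : measurable (`[a, b[%classic : set (measurableTypeR R)) by exact: measurable_itv.
have i1 := cint_integrable a b (rcont_cst 1).
rewrite [RHS]mulrC -[(b - a)%:C]mulr1; transitivity (c * cint a b (fun=> 1)).
  rewrite /cint -cintegralZ//; apply: eq_cintegral => x; rewrite mulr1; exact: mulrC.
congr (_ * _); rewrite mulr1 /cint.
transitivity ((\int[leb]_x \1_(`[a, b[%classic) x : R)%:C).
  by rewrite -cintegral_CR; apply: eq_cintegral => x; rewrite mulr1.
congr (_%:C); rewrite -[RHS]/(fine (b - a)%:E) /Rintegral; congr fine.
rewrite integral_indic// setIT.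
etransitivity; first exact: (lebesgue_measure_itv `[a, b[).
rewrite /= lte_fin; case: ltP => [_|ba] //=; have -> : b = a by apply/eqP; rewrite eq_le ba.
by rewrite subrr.
Qed.

Lemma cint_split a b c f : rcont f -> a <= b -> b <= c -> cint a c f = cint a b f + cint b c f.
Proof.
move=> hf ab bc; rewrite /cint -cintegralD; [|exact: cint_integrable|exact: cint_integrable].
apply: eq_cintegral => x; rewrite -mulrDl; congr (_ * _); rewrite -CRD; congr (_%:C).
rewrite !indicE !mem_setE !in_itv/=; case: (ltP x b) => xb; case: (leP a x) => ax /=;
  rewrite ?addr0 ?add0r//.
- by rewrite (lt_le_trans xb bc).
- by have := lt_le_trans ax (le_trans ab xb); rewrite ltxx.
Qed.

(** The factor 2 comes from bounding the real and imaginary parts separately. *)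
Lemma cint_bound a b f (M : R) : a <= b -> rcont f -> (forall x, a <= x -> x <= b -> cab (f x) <= M) ->
  cab (cint a b f) <= 2 * (M * (b - a)).
Proof.
move=> ab hf hM; have i0 := cint_integrable a b hf.
have i1 := cint_integrable a b (rcont_cst M%:C).
have key (g : measurableTypeR R -> R) : leb.-integrable setT (fun x => (g x)%:E) ->
    (forall x, `|g x| <= (\1_(`[a, b[%classic) x : R) * M) -> `|\int[leb]_x g x| <= M * (b - a).
  move=> ig h; apply: le_trans (le_normr_Rintegral measurableT ig) _.
  have <- : \int[leb]_x ((\1_(`[a, b[%classic) x : R) * M) = M * (b - a).
    have := cint_cst M%:C ab; rewrite /cint.
    transitivity (Re (cint a b (fun=> M%:C))).
      by rewrite /cint /=; apply: eq_Rintegral => x _; rewrite /= mul0r subr0.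
    by rewrite cint_cst// -CRM mulrC.
  apply: le_Rintegral => //; first exact: integrable_abse ig.
  case: i1 => + _; apply: eq_integrable => // x _ /=.
  by rewrite mul0r subr0.
case: i0 => j1 j2; apply: le_trans (cab_le _) _; rewrite [leRHS]mulr_natl mulr2n.
apply: lerD; apply: key => // x; rewrite ?ReMC ?ImMC normrM (ger0_norm (_ : 0 <= \1__ x))//;
  rewrite indicE mem_setE in_itv/=; case: (leP a x) => ax; rewrite ?mul0r//;
  case: (ltP x b) => xb; rewrite ?mul0r// !mul1r; apply: le_trans (hM _ ax (ltW xb)).
  exact: cab_Re.
exact: cab_Im.
Qed.

End IntervalIntegral.

Lemma cab_i (R : realType) : cab ('i : R[i]) = 1.
Proof. by rewrite /cab /= expr0n expr1n add0r sqrtr1. Qed.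

Section Goursat.
Context {R : realType}.
Local Notation C := R[i].
Variable psi : C -> C.
Hypothesis dpsi : forall p, cdiff_at psi p.
Local Notation pt x y := (x +i* y)%C.

Let cont_h (y : R) : rcont (fun x => psi (pt x y)).
Proof.
move=> x e e0; have [d d0 h] := cdiff_cont (dpsi (pt x y)) e0; exists d => // x' xx.
apply: h; rewrite (_ : pt x' y - pt x y = (x' - x)%:C) ?cab_real//.
by apply: Cext; rewrite ?ReB ?ImB /= ?subrr.
Qed.

Let cont_v (x : R) : rcont (fun y => psi (pt x y)).
Proof.
move=> y e e0; have [d d0 h] := cdiff_cont (dpsi (pt x y)) e0; exists d => // y' yy.
apply: h; apply: le_lt_trans (cab_le _) _.
by rewrite ReB ImB /= subrr normr0 add0r.
Qed.

(** The contour integral along the boundary of the rectangle with lower left corner [(x, y)],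
    counterclockwise: bottom minus top, plus [i] times right minus left. *)
Definition rect_int (x y w h : R) : C :=
  cint x (x + w) (fun t => psi (pt t y) - psi (pt t (y + h))) +
  'i * cint y (y + h) (fun t => psi (pt (x + w) t) - psi (pt x t)).

Lemma rect_int_split_h x y w h : 0 <= w -> 0 <= h ->
  rect_int x y (w + w) h = rect_int x y w h + rect_int (x + w) y w h.
Proof.
move=> w0 h0; rewrite /rect_int addrA.
rewrite (@cint_split _ x (x + w) (x + w + w)); [|exact: rcontB|lra|lra].
have -> : cint y (y + h) (fun t => psi (pt (x + w + w) t) - psi (pt x t)) =
    cint y (y + h) (fun t => psi (pt (x + w) t) - psi (pt x t)) +
    cint y (y + h) (fun t => psi (pt (x + w + w) t) - psi (pt (x + w) t)).
  rewrite -cintD; [|exact: rcontB|exact: rcontB].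
  by congr cint; apply/funext => t; ring.
ring.
Qed.

Lemma rect_int_split_v x y w h : 0 <= w -> 0 <= h ->
  rect_int x y w (h + h) = rect_int x y w h + rect_int x (y + h) w h.
Proof.
move=> w0 h0; rewrite /rect_int addrA.
rewrite (@cint_split _ y (y + h) (y + h + h)); [|exact: rcontB|lra|lra].
have -> : cint x (x + w) (fun t => psi (pt t y) - psi (pt t (y + h + h))) =
    cint x (x + w) (fun t => psi (pt t y) - psi (pt t (y + h))) +
    cint x (x + w) (fun t => psi (pt t (y + h)) - psi (pt t (y + h + h))).
  rewrite -cintD; [|exact: rcontB|exact: rcontB].
  by congr cint; apply/funext => t; ring.
ring.
Qed.

Lemma rect_int_quarter x y w h : 0 <= w -> 0 <= h -> exists q : R * R,
  [/\ x <= q.1, q.1 + w / 2 <= x + w, y <= q.2, q.2 + h / 2 <= y + h &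
      cab (rect_int x y w h) <= 4 * cab (rect_int q.1 q.2 (w / 2) (h / 2))].
Proof.
move=> w0 h0; have w20 : 0 <= w / 2 by rewrite divr_ge0.
have h20 : 0 <= h / 2 by rewrite divr_ge0.
have E : rect_int x y w h =
    rect_int x y (w / 2) (h / 2) + rect_int x (y + h / 2) (w / 2) (h / 2) +
    (rect_int (x + w / 2) y (w / 2) (h / 2) + rect_int (x + w / 2) (y + h / 2) (w / 2) (h / 2)).
  rewrite -!rect_int_split_v// -rect_int_split_h//; last lra.
  by rewrite -!splitr.
have := cabD (rect_int x y (w / 2) (h / 2) + rect_int x (y + h / 2) (w / 2) (h / 2))
   (rect_int (x + w / 2) y (w / 2) (h / 2) + rect_int (x + w / 2) (y + h / 2) (w / 2) (h / 2)).
rewrite -E.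
have := cabD (rect_int x y (w / 2) (h / 2)) (rect_int x (y + h / 2) (w / 2) (h / 2)).
have := cabD (rect_int (x + w / 2) y (w / 2) (h / 2)) (rect_int (x + w / 2) (y + h / 2) (w / 2) (h / 2)).
have aux (B a b c d s t : R) : t <= c + d -> s <= a + b -> B <= s + t ->
    [\/ B <= 4 * a, B <= 4 * b, B <= 4 * c | B <= 4 * d].
  move=> h1 h2 h3; case: (leP B (4 * a)) => [?|b1]; first by constructor 1.
  case: (leP B (4 * b)) => [?|b2]; first by constructor 2.
  case: (leP B (4 * c)) => [?|b3]; first by constructor 3.
  by constructor 4; lra.
move=> h1 h2 h3; have := aux _ _ _ _ _ _ _ h1 h2 h3; clear - w0 h0.
have [w1 w2 h1 h2] : [/\ x <= x + w / 2, x + w / 2 + w / 2 = x + w, y <= y + h / 2 & y + h / 2 + h / 2 = y + h].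
  by split; lra.
have [w3 h3] : x + w / 2 <= x + w /\ y + h / 2 <= y + h by lra.
case=> H; [exists (x, y)|exists (x, y + h / 2)|exists (x + w / 2, y)|exists (x + w / 2, y + h / 2)];
  by split; [..|exact: H]; rewrite /= ?w2 ?h2.
Qed.

Lemma rect_int_small p (e : R) : 0 < e -> exists2 d : R, 0 < d &
  forall x y w h, x <= Re p -> Re p <= x + w -> y <= Im p -> Im p <= y + h ->
    w + h < d -> cab (rect_int x y w h) <= e * (w + h) ^+ 2.
Proof.
move=> e0; have [b hb] := dpsi p.
(* The remainder is at most [e/4 (w + h)] at a boundary point and [e/2 (w + h)] for a difference of
   two; [cint_bound] doubles this, which leaves [e (w + h)^2] in all. *)
have e40 : 0 < e / 4 by rewrite divr_gt0.
have [d d0 hd] := hb _ e40; exists d => // x y w h x1 x2 y1 y2 wh.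
have w0 : 0 <= w by lra.
have h0 : 0 <= h by lra.
pose r z := psi z - psi p - b * (z - p).
have rb s t : x <= s -> s <= x + w -> y <= t -> t <= y + h -> cab (r (pt s t)) <= e / 4 * (w + h).
  move=> s1 s2 t1 t2; have st : cab (pt s t - p) <= w + h.
    apply: le_trans (cab_le _) _; rewrite ReB ImB /=.
    by apply: lerD; rewrite ler_norml; apply/andP; split; lra.
  by apply: le_trans (hd _ (le_lt_trans st wh)) _; rewrite ler_wpM2l// ltW.
(* The differences across the rectangle of the affine part of [psi] at [p]. As [w c1 + i h c2 = 0],
   the affine part has zero boundary integral. *)
pose c1 := b * - ('i * h%:C); pose c2 := b * w%:C.
pose r1 t := psi (pt t y) - psi (pt t (y + h)) - c1.
pose r2 t := psi (pt (x + w) t) - psi (pt x t) - c2.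
have R1 : rcont r1 by apply: rcontB (rcont_cst _); exact: rcontB.
have R2 : rcont r2 by apply: rcontB (rcont_cst _); exact: rcontB.
have xw : x <= x + w by rewrite lerDl.
have yh : y <= y + h by rewrite lerDl.
have rect : rect_int x y w h = cint x (x + w) r1 + 'i * cint y (y + h) r2.
  have h1 : cint x (x + w) (fun t => psi (pt t y) - psi (pt t (y + h))) = cint x (x + w) r1 + w%:C * c1.
    have -> : w%:C * c1 = cint x (x + w) (fun=> c1).
      by rewrite cint_cst//; congr (_%:C * _); ring.
    rewrite -cintD//; last exact: rcont_cst.
    by congr cint; apply/funext => t; rewrite /r1 subrK.
  have h2 : cint y (y + h) (fun t => psi (pt (x + w) t) - psi (pt x t)) = cint y (y + h) r2 + h%:C * c2.
    have -> : h%:C * c2 = cint y (y + h) (fun=> c2).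
      by rewrite cint_cst//; congr (_%:C * _); ring.
    rewrite -cintD//; last exact: rcont_cst.
    by congr cint; apply/funext => t; rewrite /r2 subrK.
  rewrite /rect_int h1 h2 /c1 /c2.
  move: (cint x _ _) (cint y _ _) => I1 I2; ring.
have b1 := cint_bound (M := e / 2 * (w + h)) xw R1; have b2 := cint_bound (M := e / 2 * (w + h)) yh R2.
rewrite rect; apply: le_trans (cabD _ _) _; rewrite cabM.
rewrite cab_i mul1r; apply: le_trans (lerD (b1 _) (b2 _)) _.
- move=> t t1 t2; have -> : r1 t = r (pt t y) - r (pt t (y + h)).
    rewrite /r1 /r /c1; have -> : pt t (y + h) = pt t y + 'i * h%:C.
      by apply: Cext; rewrite ?ReD ?ImD ?ReM ?ImM /=; ring.
    ring.
  apply: le_trans (cabB _ _) _.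
  have := rb t y t1 t2 (lexx _) yh; have := rb t (y + h) t1 t2 yh (lexx _); lra.
- move=> t t1 t2; have -> : r2 t = r (pt (x + w) t) - r (pt x t).
    rewrite /r2 /r /c2; have -> : pt (x + w) t = pt x t + w%:C.
      by apply: Cext; rewrite ?ReD ?ImD /=; ring.
    ring.
  apply: le_trans (cabB _ _) _.
  have := rb (x + w) t xw (lexx _) t1 t2; have := rb x t (lexx _) xw t1 t2; lra.
have -> : x + w - x = w by ring.
have -> : y + h - y = h by ring.
by rewrite le_eqVlt; apply/orP; left; apply/eqP; field.
Qed.

(** Quartering keeps a rectangle carrying at least [4^-k] of the modulus of the integral; the nested
    rectangles shrink to a point, where differentiability makes the integral [o(4^-k)]. *)
Theorem goursat x y w h : 0 <= w -> 0 <= h -> rect_int x y w h = 0.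
Proof.
move=> w0 h0; apply/eqP; rewrite -cab_eq0 eq_le cab_ge0 andbT leNgt; apply/negP => B0.
pose W k := w / 2 ^+ k; pose H k := h / 2 ^+ k.
have Wp k : 0 <= W k by rewrite divr_ge0// exprn_ge0.
have Hp k : 0 <= H k by rewrite divr_ge0// exprn_ge0.
have WS k : W k.+1 = W k / 2 by rewrite /W exprS invfM; ring.
have HS k : H k.+1 = H k / 2 by rewrite /H exprS invfM; ring.
have [s hs] : exists s : nat * (R * R) -> R * R, forall kq,
   [/\ kq.2.1 <= (s kq).1, (s kq).1 + W kq.1 / 2 <= kq.2.1 + W kq.1,
       kq.2.2 <= (s kq).2, (s kq).2 + H kq.1 / 2 <= kq.2.2 + H kq.1 &
      cab (rect_int kq.2.1 kq.2.2 (W kq.1) (H kq.1)) <= 4 * cab (rect_int (s kq).1 (s kq).2 (W kq.1 / 2) (H kq.1 / 2))].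
  by have [s hs] := choice (fun kq : nat * (R * R) => rect_int_quarter kq.2.1 kq.2.2 (Wp kq.1) (Hp kq.1)); exists s.
pose fix q k : R * R := if k is k'.+1 then s (k', q k') else (x, y).
have X k : (q k).1 <= (q k.+1).1 /\ (q k.+1).1 + W k.+1 <= (q k).1 + W k.
  by have [? ? _ _ _] := hs (k, q k); rewrite WS.
have Y k : (q k).2 <= (q k.+1).2 /\ (q k.+1).2 + H k.+1 <= (q k).2 + H k.
  by have [_ _ ? ? _] := hs (k, q k); rewrite HS.
have Bk k : cab (rect_int x y w h) <= 4 ^+ k * cab (rect_int (q k).1 (q k).2 (W k) (H k)).
  elim: k => [|k IH]; first by rewrite expr0 mul1r /W /H expr0 !divr1.
  apply: le_trans IH _; rewrite exprSr -mulrA ler_wpM2l ?exprn_ge0// WS HS.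
  by have [_ _ _ _] := hs (k, q k).
have lim (u : nat -> R) (L : nat -> R) : (forall k, 0 <= L k) ->
    (forall k, u k <= u k.+1 /\ u k.+1 + L k.+1 <= u k + L k) ->
    exists p, forall k, u k <= p /\ p <= u k + L k.
  move=> L0 hu.
  have mono k j : u k <= u (k + j)%N /\ u (k + j)%N + L (k + j)%N <= u k + L k.
    elim: j => [|j [IH1 IH2]]; first by rewrite addn0.
    by rewrite addnS; have [] := hu (k + j)%N; lra.
  have ub k j : u j <= u k + L k.
    case: (leqP k j) => kj.
      by have [_] := mono k (j - k)%N; rewrite subnKC//; have := L0 j; lra.
    by have [+ _] := mono j (k - j)%N; rewrite subnKC ?(ltnW kj)//; have := L0 k; lra.
  have ss : has_sup (range u).
    by split; [exists (u 0%N), 0%N|exists (u 0%N + L 0%N) => _ [j _ <-]; exact: ub].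
  exists (sup (range u)) => k; split; first by apply: ub_le_sup; [case: ss|exists k].
  by apply: ge_sup; [case: ss|move=> _ [j _ <-]; exact: ub].
have [px hpx] := lim _ _ Wp X; have [py hpy] := lim _ _ Hp Y.
have wh0 : 0 <= (w + h) ^+ 2 by rewrite sqr_ge0.
(* Makes [e (w + h)^2] strictly smaller than the modulus of the integral, even when [w + h = 0]; the
   two factors [4^k] cancel. *)
pose e := cab (rect_int x y w h) / (1 + (w + h) ^+ 2).
have e0 : 0 < e by rewrite divr_gt0//; lra.
have [d d0 hd] := rect_int_small (pt px py) e0.
have [k hk] : exists k : nat, (w + h) / 2 ^+ k < d.
  exists (Num.bound ((w + h) / d)); rewrite ltr_pdivrMr ?exprn_gt0// -ltr_pdivrMl// mulrC.
  have q0 : 0 <= (w + h) / d by rewrite divr_ge0 ?(ltW d0)//; lra.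
  apply: lt_le_trans (archi_boundP q0) _; rewrite -natrX ler_nat.
  exact/ltnW/ltn_expl.
have [x1 x2] := hpx k; have [y1 y2] := hpy k.
have WH : W k + H k < d by rewrite /W /H -mulrDl.
have := hd _ _ _ _ x1 x2 y1 y2 WH.
have -> : (W k + H k) ^+ 2 = (w + h) ^+ 2 / 4 ^+ k.
  rewrite /W /H -mulrDl exprMn exprVn -exprM mulnC exprM; congr (_ / _ ^+ _); ring.
have := Bk k; have f0 : (0 : R) < 4 ^+ k by rewrite exprn_gt0.
rewrite mulrA ler_pdivlMr// mulrC => /le_trans h1 /h1.
rewrite /e mulrAC ler_pdivlMr; last lra.
nra.
Qed.

End Goursat.

Section CircleMean.
Context {R : realType}.
Local Notation C := R[i].

(** Goursat's theorem for [phi \o cexp] on the strip [[s, 0] x [0, 2 pi]]: the horizontal sides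
    cancel by periodicity, so circles of radius [1] and [exp s] have the same integral. Letting [s]
    be very negative gives the value at the centre. *)
Lemma circle_mean (phi : C -> C) : (forall p, cdiff_at phi p) ->
  cint 0 (pi *+ 2) (fun t => phi (cexp (0 +i* t)%C)) = (pi *+ 2 : R)%:C * phi 0.
Proof.
move=> dphi; have pi2 : 0 <= pi *+ 2 :> R by rewrite mulrn_wge0// pi_ge0.
have dpsi p : cdiff_at (phi \o @cexp R) p.
  by apply: cdiff_comp => //; exact: cdiff_cexp.
pose psi := phi \o @cexp R.
have cv x : rcont (fun y => psi (x +i* y)%C).
  move=> y e e0; have [d d0 h] := cdiff_cont (dpsi (x +i* y)%C) e0; exists d => // y' yy.
  apply: h; apply: le_lt_trans (cab_le _) _.
  by rewrite ReB ImB /= subrr normr0 add0r.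
have G s : s <= 0 -> cint 0 (pi *+ 2) (fun t => psi (0 +i* t)%C - psi (s +i* t)%C) = 0.
  move=> s0; have := goursat dpsi s 0 (w := - s) (h := pi *+ 2) _ pi2.
  rewrite oppr_ge0 => /(_ s0); rewrite /rect_int subrr add0r.
  have -> : (fun t => (phi \o @cexp R) (t +i* 0)%C - (phi \o @cexp R) (t +i* (pi *+ 2))%C) = fun=> 0.
    apply/funext => t /=; rewrite -(cexp_2pi (t +i* 0)%C).
    rewrite (_ : (t +i* 0)%C + _ = (t +i* (pi *+ 2))%C) ?subrr//.
    by apply: Cext; rewrite ?ReD ?ImD /= ?addr0 ?add0r.
  rewrite cint_cst// mulr0 add0r => /eqP.
  by rewrite mulf_eq0 -cab_eq0 cab_i oner_eq0 => /eqP.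
apply/eqP; rewrite -subr_eq0 -cab_eq0 eq_le cab_ge0 andbT.
apply/ler_addgt0Pr => e e0; rewrite add0r.
have q0 : 0 < 2 * (pi *+ 2) + 1 :> R by lra.
have e20 : 0 < e / (2 * (pi *+ 2) + 1) by rewrite divr_gt0.
have [d d0 hd] := cdiff_cont (dphi 0) e20.
have [s s0 sd] : exists2 s : R, s <= 0 & expR s < d.
  exists (Num.min 0 (ln (d / 2))); first by rewrite ge_min lexx.
  apply: le_lt_trans (_ : d / 2 < d); last lra.
  by rewrite -[leRHS]lnK ?posrE ?divr_gt0// ler_expR ge_min lexx orbT.
have cB x : rcont (fun y => psi (x +i* y)%C - phi 0) by apply: rcontB => //; exact: rcont_cst.
have -> : cint 0 (pi *+ 2) (fun t => phi (cexp (0 +i* t)%C)) - (pi *+ 2 : R)%:C * phi 0 =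
    cint 0 (pi *+ 2) (fun t => psi (s +i* t)%C - phi 0).
  have -> : (fun t => phi (cexp (0 +i* t)%C)) =
      (fun t => (psi (0 +i* t)%C - psi (s +i* t)%C) + ((psi (s +i* t)%C - phi 0) + phi 0)).
    by apply/funext => t; rewrite /psi/=; ring.
  rewrite (cintD _ _ (rcontB (cv 0) (cv s)) (rcontD (cB s) (rcont_cst (phi 0)))).
  rewrite (G s s0) add0r (cintD _ _ (cB s) (rcont_cst (phi 0))).
  by rewrite cint_cst// subr0 addrK.
apply: le_trans (cint_bound (M := e / (2 * (pi *+ 2) + 1)) pi2 (cB s) _) _.
  move=> t _ _; apply/ltW; apply: hd; rewrite subr0 cab_cexp//.
rewrite subr0; have -> : 2 * (e / (2 * (pi *+ 2) + 1) * (pi *+ 2)) =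
   e / (2 * (pi *+ 2) + 1) * (2 * (pi *+ 2)) by ring.
by rewrite mulrAC ler_pdivrMr// ler_wpM2l ?(ltW e0)//; lra.
Qed.

End CircleMean.

Lemma linear_lipschitz_differentiable (R : realType) (V W : normedModType R[i]) (L : V -> W)
  (M : R[i]) : linear L -> 0 < M -> (forall h, `|L h| <= M * `|h|) -> forall z, differentiable L z.
Proof.
move=> Llin M0 LM z.
pose isL := GRing.isLinear.Build _ _ _ _ L Llin.
pose Ll : {linear V -> W} := HB.pack L isL.
apply: (linear_differentiable (f := Ll)).
move=> h; apply/cvgrPdist_lt => e e0.
have d0 : 0 < e / M by rewrite divr_gt0.
apply/nbhs_normP; exists (e / M) => //= h' hh.
rewrite -[L h - L h']/(Ll h - Ll h') -linearB; apply: le_lt_trans (LM _) _.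
by rewrite mulrC -ltr_pdivlMr.
Qed.

(** * Holomorphic functions of several variables *)

Section Holomorphy.
Context {R : realType} {n : nat}.
Local Notation C := R[i].
Local Notation cV := 'cV[C]_n.

Definition holo m (f : 'cV[C]_m -> C) := forall z, differentiable f z.

Lemma differentiable_quad m (f : 'cV[C]_m -> C) z (c : 'cV[C]_m) (M : R) :
  (forall h, cnrm h <= 1 -> cab (f (z + h) - f z - cVdot h c) <= M * cnrm h ^+ 2) ->
  differentiable f z.
Proof.
move=> H; pose L (h : 'cV[C]_m) : C := cVdot h c.
have Llin : linear L.
  move=> a u v; rewrite /L (ph_lin cV_prehilbert)//.
pose isL := GRing.isLinear.Build _ _ _ _ L Llin.
pose Ll : {linear 'cV[C]_m -> C} := HB.pack L isL.
have cL : continuous Ll.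
  move=> h; apply: differentiable_continuous.
  apply: (@linear_lipschitz_differentiable R _ _ L ((cnrm c + 1) * m.+1%:R)%:C) => //.
    by rewrite ltcR mulr_gt0// ltr_wpDl// cnrm_ge0.
  move=> u; rewrite cabE CRM -mulrA CRnat; apply: le_trans (_ : (cnrm c + 1)%:C * (cnrm u)%:C <= _).
    rewrite -CRM lecR; have := CS cV_prehilbert (f := u) (g := c) I I.
    rewrite -/(cnrm u) -/(cnrm c) -/(L u); have := cnrm_ge0 u; nra.
  apply: ler_wpM2l; first by rewrite ler0c addr_ge0// cnrm_ge0.
  apply: le_trans (cnrm_le_mxnorm u) _.
  by rewrite ler_wpM2r// ler_nat.
have oL : f \o shift z = cst (f z) + Ll +o_ (0 : 'cV[C]_m) id.
  apply/eqaddoP => e e0; have eE := ge0_CRe (ltW e0).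
  have e0' : 0 < Re e by rewrite -ltcR -eE.
  (* [N] compares [cnrm] with the entrywise maximum norm underlying differentiability; the successor
     keeps it positive in dimension zero. *)
  pose N : R := m.+1%:R; have N0 : 0 < N by [].
  pose M1 := `|M| + 1; have M0 : 0 < M1 by rewrite ltr_wpDl.
  pose d := Num.min (N^-1) (Re e / (M1 * N ^+ 2)).
  have d0 : 0 < d by rewrite lt_min invr_gt0 N0 divr_gt0// mulr_gt0// exprn_gt0.
  suff : \forall x \near (0 : 'cV[C]_m), `|(f \o shift z - (cst (f z) + L)) x| <= e * `|x| by [].
  apply/nbhs_normP; exists d%:C; first by rewrite /= ltcR.
  move=> h; rewrite /= sub0r normrN => hd.
  have [r hr r0] : exists2 r : R, `|h| = r%:C & 0 <= r.
    have hh := ge0_CRe (normr_ge0 h); exists (Re `|h|) => //.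
    by rewrite -ler0c -hh.
  rewrite hr ltcR in hd.
  have hN : cnrm h <= N * r.
    rewrite -lecR; apply: le_trans (cnrm_le_mxnorm h) _; rewrite hr CRM CRnat.
    by rewrite ler_wpM2r ?ler0c// ler_nat.
  move: hd; rewrite lt_min => /andP[d1 d2].
  have h1 : cnrm h <= 1.
    by apply: le_trans hN _; rewrite mulrC -ler_pdivlMr// mul1r ltW.
  have := H h h1; rewrite !fctE /= -[X in `|X|]/(f (h + z) - (f z + L h)) cabE hr eE -CRM lecR.
  have -> : f (h + z) - (f z + L h) = f (z + h) - f z - cVdot h c by rewrite [h + z]addrC -[cVdot h c]/(L h) opprD addrA.
  move=> h2; apply: le_trans h2 _.
  apply: le_trans (_ : M1 * (N * r) ^+ 2 <= _).
    apply: le_trans (_ : M1 * cnrm h ^+ 2 <= _).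
      by rewrite ler_wpM2r ?sqr_ge0// /M1 (le_trans (ler_norm M))// lerDl.
    by rewrite ler_wpM2l ?(ltW M0)// lerXn2r// nnegrE ?cnrm_ge0 ?mulr_ge0 ?(ltW N0).
  have : r * (M1 * N ^+ 2) < Re e by rewrite -ltr_pdivlMr// mulr_gt0// exprn_gt0.
  move=> h3; rewrite exprMn mulrA [r ^+ 2]expr2 mulrA ler_wpM2r// [_ * r]mulrC.
  exact: ltW.
have dE := diff_unique cL oL.
by apply/diff_locallyP; rewrite dE.
Qed.

Lemma differentiable_cdiff (f : C -> C) p : differentiable f p -> cdiff_at f p.
Proof.
move=> df; have /diff_locallyP[_ /eqaddoP h] := df.
exists ('d f p 1) => e e0.
have [d d0 hd] : exists2 d : R, 0 < d & forall z, cab z < d ->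
   cab (f (z + p) - (f p + 'd f p z)) <= e * cab z.
  have /h/nbhs_normP[d /= d0 hd] : 0 < e%:C :> C by rewrite ltcR.
  have dE := ge0_CRe (ltW d0); exists (Re d); first by rewrite -ltcR -dE.
  move=> z zd; have := hd z; rewrite /= sub0r normrN cabE dE ltcR => /(_ zd).
  by rewrite !fctE /= cabE -CRM lecR.
exists d => // z /hd; rewrite subrK.
have -> : 'd f p (z - p) = 'd f p 1 * (z - p).
  by rewrite -[in LHS](mulr1 (z - p)) -[(z - p) * 1]/((z - p) *: (1 : C^o)) linearZ /= mulrC.
by rewrite opprD addrA.
Qed.

Lemma holo_line (f : cV -> C) (a z : cV) p : holo f -> cdiff_at (fun t => f (a + t *: z)) p.
Proof.
move=> hf; apply: differentiable_cdiff.
apply: (@differentiable_comp _ _ _ _ (fun t : C => a + t *: z) f); last exact: hf.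
apply: (differentiableD (differentiable_cst a p)).
apply: (linear_lipschitz_differentiable (M := `|z| + 1)).
- by move=> b u v; rewrite scalerDl scalerA.
- by rewrite ltr_wpDl.
- by move=> h; rewrite normrZ mulrC ler_wpM2r// lerDl.
Qed.

Lemma holoM (f g : cV -> C) : holo f -> holo g -> holo (fun z => f z * g z).
Proof. by move=> hf hg z; exact: (differentiableM (hf z) (hg z)). Qed.

Lemma holo_comp_affine (f : cV -> C) (k : 'M[C]_n) b : k \is unitarymx -> holo f ->
  holo (fun z => f (k *m z + b)).
Proof.
move=> uk hf z; apply: (@differentiable_comp _ _ _ _ (fun z : cV => k *m z + b) f); last exact: hf.
apply: (differentiableD _ (differentiable_cst b z)).
apply: (linear_lipschitz_differentiable (M := n.+1%:R)) => //.
  by move=> c u v; rewrite mulmxDr -scalemxAr.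
move=> h; apply: le_trans (mxnorm_le_cnrm _) _.
have -> : cnrm (k *m h) = cnrm h by rewrite /cnrm /nrmd; congr Num.sqrt; exact: (sqnorm_unitary h uk).
apply: le_trans (cnrm_le_mxnorm h) _.
by rewrite ler_wpM2r// ler_nat.
Qed.

Lemma holo_cst c : holo (fun _ : cV => c).
Proof. by move=> z; exact: differentiable_cst. Qed.

Lemma holoD (f g : cV -> C) : holo f -> holo g -> holo (fun z => f z + g z).
Proof. by move=> hf hg z; exact: (differentiableD (hf z) (hg z)). Qed.

Lemma holo_cexp (c : cV) (b : C) : holo (fun z => cexp (cVdot z c + b)).
Proof.
move=> z; pose E := cexp (cVdot z c + b).
apply: (@differentiable_quad _ _ _ (E^* *: c) (cab E * (3 * (cnrm c ^+ 2 * expR (cnrm c))))).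
move=> h h1.
have -> : cexp (cVdot (z + h) c + b) - cexp (cVdot z c + b) - cVdot h (E^* *: c) =
   E * (cexp (cVdot h c) - 1 - cVdot h c).
  have -> : cVdot (z + h) c + b = (cVdot z c + b) + cVdot h c.
    by rewrite (dotDl cV_prehilbert)// addrAC.
  by rewrite cexpD -/E (dotZr cV_prehilbert)// CJK; ring.
rewrite cabM -mulrA ler_wpM2l ?cab_ge0//; apply: le_trans (cexp_bound _) _.
rewrite -mulrA ler_wpM2l//.
have cs : cab (cVdot h c) <= cnrm h * cnrm c := CS cV_prehilbert (f := h) (g := c) I I.
have h0 := cnrm_ge0 h; have c0 := cnrm_ge0 c; have s0 := cab_ge0 (cVdot h c).
rewrite [leRHS](_ : _ = cnrm c ^+ 2 * cnrm h ^+ 2 * expR (cnrm c)); last by ring.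
apply: ler_pM; rewrite ?sqr_ge0 ?expR_ge0//.
  by rewrite -exprMn mulrC lerXn2r// nnegrE mulr_ge0.
by rewrite ler_expR; apply: le_trans cs _; nra.
Qed.

Lemma holo_cont (f : cV -> C) : holo f -> forall z, f w @[w --> z] --> f z.
Proof. by move=> hf z; exact: differentiable_continuous. Qed.

End Holomorphy.

Section MeasureEq.
Context {R : realType} {d : measure_display} {T : measurableType d}.
Local Notation C := R[i].
Variables (m1 m2 : {measure set T -> \bar R}).
Hypothesis mE : m1 = m2 :> (set T -> \bar R).

Lemma eq_measure_int (f : T -> \bar R) : (\int[m1]_x f x = \int[m2]_x f x)%E.
Proof. by apply: eq_measure_integral => A mA _; exact: (congr1 (fun f => f A) mE). Qed.

Lemma eq_measure_cintegral (f : T -> C) : cintegral m1 f = cintegral m2 f.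
Proof. by rewrite /cintegral /Rintegral !eq_measure_int. Qed.

Lemma eq_measure_cintegrable (f : T -> C) : cintegrable m1 f -> cintegrable m2 f.
Proof.
move=> [/integrableP[a1 b1] /integrableP[a2 b2]].
by split; apply/integrableP; split => //; rewrite -eq_measure_int.
Qed.

End MeasureEq.

Section ComplexFubini.
Context {R : realType} {d1 d2 : measure_display} {T1 : measurableType d1} {T2 : measurableType d2}.
Local Notation C := R[i].
Variables (m1 : {measure set T1 -> \bar R}) (s1 : sigma_finite [set: T1] m1).
Variables (m2 : {sigma_finite_measure set T2 -> \bar R}).

Lemma rfubini (M : {sigma_finite_measure set T1 -> \bar R}) (f : T1 * T2 -> R) :
  (M \x m2)%E.-integrable [set: T1 * T2] (fun p => (f p)%:E) ->
  (forall x, m2.-integrable [set: T2] (fun y => (f (x, y))%:E)) ->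
  (forall y, M.-integrable [set: T1] (fun x => (f (x, y))%:E)) ->
  (\int[(M \x m2)%E]_p f p = \int[M]_x \int[m2]_y f (x, y) /\
   \int[M]_x \int[m2]_y f (x, y) = \int[m2]_y \int[M]_x f (x, y)).
Proof.
move=> hp h1 h2.
have e1 : \int[(M \x m2)%E]_p f p = \int[M]_x \int[m2]_y f (x, y).
  rewrite {1}/Rintegral -(integral12_prod_meas1 hp) /Rintegral; congr fine.
  apply: eq_integral => x _; rewrite fineK//; exact: (integrable_fin_num measurableT (h1 x)).
split => //; rewrite -e1.
rewrite {1}/Rintegral -(integral21_prod_meas1 hp) /Rintegral; congr fine.
apply: eq_integral => y _; rewrite fineK//; exact: (integrable_fin_num measurableT (h2 y)).
Qed.

Lemma cfubini (F : T1 * T2 -> C) : cmeasurable F ->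
  (\int[m1]_x \int[m2]_y (cab (F (x, y)))%:E < +oo)%E ->
  (forall x, cintegrable m2 (fun y => F (x, y))) ->
  (forall y, cintegrable m1 (fun x => F (x, y))) ->
  [/\ cintegrable (m1 \x m2)%E F,
     cintegral (m1 \x m2)%E F = cintegral m1 (fun x => cintegral m2 (fun y => F (x, y))) &
     cintegral m1 (fun x => cintegral m2 (fun y => F (x, y))) =
     cintegral m2 (fun y => cintegral m1 (fun x => F (x, y)))].
Proof.
move=> mF Ffin h1 h2; have [M ME] := sigma_finite_pack s1.
have eP : (M \x m2)%E = (m1 \x m2)%E :> (set (T1 * T2) -> \bar R).
  by apply/funext => A; exact: (eq_measure_int ME).
have cM := eq_measure_cintegral ME.
have iF : (M \x m2)%E.-integrable [set: T1 * T2] (fun p => (cab (F p))%:E).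
  apply/integrable12ltyP; first by apply/measurable_EFinP; exact: cmeasurable_cab.
  rewrite (eq_measure_int ME); apply: le_lt_trans Ffin; rewrite le_eqVlt; apply/orP; left; apply/eqP.
  by apply: eq_integral => x _; apply: eq_integral => y _; rewrite /= ger0_norm ?cab_ge0.
have [i1 i2] := cintegrableP mF iF.
have h2' y := eq_measure_cintegrable (esym ME) (h2 y).
have [a1 a2] := rfubini i1 (fun x => (h1 x).1) (fun y => (h2' y).1).
have [b1 b2] := rfubini i2 (fun x => (h1 x).2) (fun y => (h2' y).2).
split.
- by apply: (eq_measure_cintegrable eP).
- by rewrite -(eq_measure_cintegral eP) -cM; apply: Cext.
- rewrite -cM; transitivity (cintegral m2 (fun y => cintegral M (fun x => F (x, y)))); first exact: Cext.
  by apply: eq_cintegral => y; rewrite cM.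
Qed.

End ComplexFubini.

(** * The mean value property for Gaussian measures *)

Section GaussianMean.
Context {R : realType} {n : nat} (lam : {posnum R}).
Local Notation C := R[i].
Local Notation cV := 'cV[C]_n.
Local Notation Cn := (Cn R n).
Local Notation fm := (fock_measure n lam).
Local Notation leb := (@lebesgue_measure R).

Lemma scalar_unitary (a : C) : cab a = 1 -> (a%:M : 'M[C]_n) \is unitarymx.
Proof.
move=> a1; apply/unitarymxP; rewrite tr_scalar_mx map_scalar_mx -scalar_mxM.
by rewrite -[X in X%:M]/(a * a^*) mulJ_cab a1 expr1n.
Qed.

Lemma gauss_eq (u v : cV) : sqnorm u = sqnorm v -> gauss lam u = gauss lam v.
Proof. by rewrite /gauss => ->. Qed.

Lemma cintegral_gauss : cintegrable fm (fun z : Cn => (gauss lam (z : cV))%:C) /\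
  cintegral fm (fun z : Cn => (gauss lam (z : cV))%:C) = 1.
Proof.
split; last by rewrite cintegral_CR /Rintegral integral_gauss.
split => /=; last exact: integrable0.
apply: integrable_fin; [exact: measurable_gauss|by move=> z; exact: expR_ge0|].
by rewrite integral_gauss ltry.
Qed.

Lemma cab_cexp_i (t : R) : cab (cexp (0 +i* t)%C) = 1.
Proof. by rewrite cab_cexp expR0. Qed.

Lemma cmeasurable_holo (f : cV -> C) : holo f -> cmeasurable (f : Cn -> C).
Proof. by move=> hf; apply: continuous_cmeasurable; exact: holo_cont. Qed.

Lemma rcont_circle (phi : C -> C) : (forall p, cdiff_at phi p) ->
  rcont (fun t : R => phi (cexp (0 +i* t)%C)).
Proof.
move=> dphi t e e0.
have dpsi : cdiff_at (phi \o @cexp R) (0 +i* t)%C by apply: cdiff_comp => //; exact: cdiff_cexp.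
have [d d0 h] := cdiff_cont dpsi e0; exists d => // s st.
apply: h; apply: le_lt_trans (cab_le _) _.
by rewrite ReB ImB /= subrr normr0 add0r.
Qed.

(** Scalars of modulus one act unitarily and preserve both the measure and the weight, so the
    integral equals its average over the rotations [exp(it)]. After Fubini the average over [t] is
    taken first, on the complex line through [z], where [circle_mean] gives [h 0]. *)
Theorem gauss_mean (h : cV -> C) : holo h ->
  cintegrable fm (fun z : Cn => h z * (gauss lam (z : cV))%:C) ->
  cintegral fm (fun z : Cn => h z * (gauss lam (z : cV))%:C) = h 0.
Proof.
move=> hh ih; set H := (fun z : Cn => _) in ih *.
have [M ME] := sigma_finite_pack (fock_measure_sf (n := n) lam).
have cM := eq_measure_cintegral ME.
have dl (z : cV) p : cdiff_at (fun t => h (t *: z)) p.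
  have := holo_line 0 z p hh; rewrite (_ : (fun t => h (0 + t *: z)) = fun t => h (t *: z))//.
  by apply/funext => t; rewrite add0r.
have rc (z : cV) : rcont (fun t => h (cexp (0 +i* t)%C *: z) * (gauss lam z)%:C).
  move=> t e e0; have g0 : 0 < gauss lam z := expR_gt0 _.
  have q0 : 0 < e / gauss lam z by rewrite divr_gt0.
  have [d d0 hd] := rcont_circle (dl z) t q0; exists d => // s /hd.
  by rewrite ltr_pdivlMr// -mulrBl cabM cab_real ger0_norm// ltW.
have rot t : measurable_fun [set: Cn] ((fun z : cV => cexp (0 +i* t)%C *: z) : Cn -> Cn) /\
    forall A : set Cn, measurable A -> fm ((fun z : cV => cexp (0 +i* t)%C *: z) @^-1` A) = fm A.
  rewrite (_ : (fun z => _) = (fun z : cV => (cexp (0 +i* t)%C)%:M *m z)); last first.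
    by apply/funext => z; rewrite mul_scalar_mx.
  split; first exact: measurable_mulmx.
  by move=> A mA; apply: fock_unitary => //; apply: scalar_unitary; exact: cab_cexp_i.
have Hrot t (z : cV) : h (cexp (0 +i* t)%C *: z) * (gauss lam z)%:C = H (cexp (0 +i* t)%C *: z).
  rewrite /H; congr (_ * _%:C); apply: gauss_eq; rewrite -mul_scalar_mx sqnorm_unitary//.
  by apply: scalar_unitary; exact: cab_cexp_i.
have mH : cmeasurable H := cintegrable_meas ih.
have iHrot t : cintegrable fm (fun z : Cn => h (cexp (0 +i* t)%C *: (z : cV)) * (gauss lam (z : cV))%:C).
  have [mt pt] := rot t.
  rewrite (_ : (fun z => _) = (fun z : Cn => H (cexp (0 +i* t)%C *: (z : cV)))); last first.
    by apply/funext => z; exact: Hrot.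
  apply: cintegrableP; first exact: (cmeasurable_comp mt mH).
  have /integrableP[c1 c2] := cintegrable_cab ih.
  apply/integrableP; split.
    by apply/measurable_EFinP; apply: cmeasurable_cab; exact: (cmeasurable_comp mt mH).
  have := preserving_ge0_integral mt pt (F := fun z : Cn => `|(cab (H z))%:E|%E) _ (fun z => abse_ge0 _).
  move=> ->//; exact: measurableT_comp.
pose F (p : measurableTypeR R * Cn) : C := (\1_(`[0 : R, pi *+ 2[%classic) p.1)%:C *
   (h (cexp (0 +i* p.1)%C *: (p.2 : cV)) * (gauss lam (p.2 : cV))%:C).
have mrot : measurable_fun [set: measurableTypeR R * Cn]
    ((fun p => cexp (0 +i* p.1)%C *: (p.2 : cV)) : measurableTypeR R * Cn -> Cn).
  apply: measurable_to_Cn => k; under [X in cmeasurable X]eq_fun do rewrite mxE.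
  apply: cmeasurableM; last exact: (cmeasurable_comp (@measurable_snd _ _ (measurableTypeR R) Cn) (cmeasurable_coord k)).
  split.
    under eq_fun do rewrite Re_cexp expR0 mul1r /=.
    by apply: (measurableT_comp (f := @cos R)) => //; apply: continuous_measurable_fun; exact: continuous_cos.
  under eq_fun do rewrite Im_cexp expR0 mul1r /=.
  by apply: (measurableT_comp (f := @sin R)) => //; apply: continuous_measurable_fun; exact: continuous_sin.
have mF : cmeasurable F.
  apply: cmeasurableM.
    apply: cmeasurable_CR.
    have m1 : measurable_fun [set: measurableTypeR R] (\1_(`[0 : R, pi *+ 2[%classic) : measurableTypeR R -> R).
      by apply: measurable_indic; exact: measurable_itv.
    exact: (measurableT_comp m1 (@measurable_fst _ _ (measurableTypeR R) Cn)).
  rewrite (_ : (fun p => _) = (H \o (fun p => cexp (0 +i* p.1)%C *: (p.2 : cV)))); last first.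
    by apply/funext => p; exact: Hrot.
  exact: (cmeasurable_comp mrot mH).
have sl : sigma_finite [set: measurableTypeR R] leb by exact: sigma_finiteT.
have iH0 : (\int[fm]_z (cab (H z))%:E < +oo)%E.
  have /integrableP[_] := cintegrable_cab ih; apply: le_lt_trans.
  by rewrite le_eqVlt; apply/orP; left; apply/eqP; apply: eq_integral => z _ /=; rewrite ger0_norm ?cab_ge0.
have [] := cfubini sl (m2 := M) mF.
- apply: (@le_lt_trans _ _ (\int[leb]_t ((\1_(`[0 : R, pi *+ 2[%classic) t)%:E * \int[fm]_z (cab (H z))%:E))%E).
    rewrite le_eqVlt; apply/orP; left; apply/eqP; apply: eq_integral => t _.
    rewrite (eq_measure_int ME); have [mt pt] := rot t.
    have mcH : measurable_fun [set: Cn] (fun z => (cab (H z))%:E).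
      by apply/measurable_EFinP; exact: cmeasurable_cab.
    rewrite -(preserving_ge0_integral mt pt mcH) -?ge0_integralZl//.
    - apply: eq_integral => z _; rewrite -EFinM; congr EFin.
      by rewrite /F/= cabM cab_real ger0_norm// Hrot.
    - exact: (measurableT_comp mcH mt).
    - by move=> z _; rewrite lee_fin cab_ge0.
    - by move=> z; rewrite lee_fin cab_ge0.
  have I0 : (0 <= \int[fm]_z (cab (H z))%:E)%E by apply: integral_ge0 => z _; rewrite lee_fin cab_ge0.
  rewrite ge0_integralZr//; first last.
  - by apply/measurable_EFinP.
  rewrite integral_indic// setIT lte_mul_pinfty//.
  have e : leb (`[0 : R, pi *+ 2[%classic) = (pi *+ 2 - 0)%:E.
    etransitivity; first exact: (lebesgue_measure_itv `[0 : R, pi *+ 2[).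
    by rewrite /= lte_fin mulrn_wgt0// pi_gt0.
  exact: (eq_ind_r (fun x => x \is a fin_num) _ e).
- move=> t; apply: (eq_measure_cintegrable (m1 := fm) (esym ME)).
  have h1 := cintegrableZ (\1_(`[0 : R, pi *+ 2[%classic) t)%:C (iHrot t).
  by rewrite /F/=; exact: h1.
- by move=> z; exact: (cint_integrable 0 (pi *+ 2) (rc z)).
move=> _ _ E.
have eA : cintegral leb (fun t => cintegral M (fun z => F (t, z))) = (pi *+ 2 : R)%:C * cintegral fm H.
  have pi2 : 0 <= pi *+ 2 :> R by rewrite mulrn_wge0// pi_ge0.
  rewrite -[pi *+ 2]subr0 -(cint_cst _ pi2) /cint.
  apply: eq_cintegral => t; rewrite cM /F/= cintegralZ//; congr (_ * _).
  have [mt pt] := rot t.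
  rewrite -[RHS](preserving_cintegral mt pt mH); apply: eq_cintegral => z; exact: Hrot.
have eB : cintegral M (fun z => cintegral leb (fun t => F (t, z))) = (pi *+ 2 : R)%:C * h 0.
  rewrite cM.
  have e (z : Cn) : cintegral leb (fun t => F (t, z)) = (pi *+ 2 : R)%:C * h 0 * (gauss lam (z : cV))%:C.
    rewrite /F /=.
    have := circle_mean (dl z); rewrite scale0r => <-.
    rewrite mulrC /cint -cintegralZ; last exact: cint_integrable (rcont_circle (dl z)).
    by apply: eq_cintegral => t; ring.
  have [g1 g2] := cintegral_gauss.
  rewrite (eq_cintegral _ e) cintegralZ// g2 mulr1//.
move: (etrans (esym eA) (etrans E eB)) => /(congr1 (fun w => ((pi *+ 2 : R)^-1)%:C * w)).
rewrite !mulrA -!CRM mulVf ?mul1r// gt_eqF// mulrn_wgt0// pi_gt0//.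
Qed.

End GaussianMean.

(** * The Fock space *)

Section FockWeight.
Context {R : realType} {n : nat} (lam : {posnum R}).
Local Notation C := R[i].
Local Notation cV := 'cV[C]_n.
Local Notation Cn := (Cn R n).
Local Notation fm := (fock_measure n lam).
Local Notation s := ((2 * lam%:num)^-1).

Let s0 : 0 < s :> R. Proof. by rewrite invr_gt0 mulr_gt0. Qed.

Definition hgauss (z : cV) : R := expR (- (s / 2 * sqnorm z)).

Lemma gaussE (z : cV) : gauss lam z = expR (- (s * sqnorm z)).
Proof. by rewrite /gauss; congr (expR (- _)); rewrite mulrC. Qed.

Lemma hgauss_sqr z : hgauss z ^+ 2 = gauss lam z.
Proof. by rewrite gaussE /hgauss expr2 -expRD; congr expR; field. Qed.

Lemma measurable_hgauss : measurable_fun [set: Cn] (hgauss : Cn -> R).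
Proof.
apply: measurableT_comp => //; apply: measurableT_comp => //.
by apply: measurable_funM; [exact: measurable_cst|exact: measurable_sqnorm].
Qed.

(** Multiplication by the square root of the weight: an isometry of the Fock space into [L2] of the
    unweighted measure, where the [L2] lemmas apply. *)
Definition fw (f : cV -> C) : Cn -> C := fun z => f z * (hgauss z)%:C.

Lemma cmeasurable_fw (f : cV -> C) : cmeasurable (f : Cn -> C) -> cmeasurable (fw f).
Proof. by move=> mf; apply: cmeasurableM => //; apply: cmeasurable_CR; exact: measurable_hgauss. Qed.

Lemma fw_lin a (f g : cV -> C) : fw (a *: f + g) = a *: fw f + fw g.
Proof. by apply/funext => z; rewrite /fw !fctE mulrDl -mulrA. Qed.

Lemma fwM_dot (f g : cV -> C) z : fw f z * (fw g z)^* = f z * (g z)^* * (gauss lam z)%:C.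
Proof. by rewrite /fw CJM CRJ -hgauss_sqr expr2 CRM; ring. Qed.

Lemma L2dot_fw (f g : cV -> C) : L2dot fm (fw f) (fw g) =
  cintegral fm (fun z : Cn => f z * (g z)^* * (gauss lam (z : cV))%:C).
Proof. by apply: eq_cintegral => z; exact: fwM_dot. Qed.

(** A common majorant, up to constants, of the reproducing kernels, their derivatives and their
    second-order remainders in the parameter. *)
Definition envelope (b : R) (z : cV) : R := (1 + sqnorm z) * expR (b * cnrm z).

Lemma envelope_bound b : exists K : R, forall z, (envelope b z * hgauss z) ^+ 2 <=
  K * expR (- (s / 2 * sqnorm z)).
Proof.
(* From [1 + r^2 <= (1 + 8/s) exp(s r^2/8)] and [b r <= s r^2/8 + 2 b^2/s]: these spend half of the
   Gaussian exponent, and squaring gives the constant. *)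
exists ((1 + 8 / s) ^+ 2 * expR (4 * b ^+ 2 / s)) => z; rewrite /envelope /hgauss -cnrm_sqr.
set r := cnrm z; have r0 : 0 <= r := cnrm_ge0 z.
have x1 : 1 + r ^+ 2 <= (1 + 8 / s) * expR (s * r ^+ 2 / 8).
  have := expR_ge1Dx (s * r ^+ 2 / 8) => h.
  have q0 : 0 <= 8 / s by rewrite divr_ge0// ltW.
  apply: le_trans (_ : (1 + 8 / s) * (1 + s * r ^+ 2 / 8) <= _); last by rewrite ler_wpM2l//; lra.
  have -> : (1 + 8 / s) * (1 + s * r ^+ 2 / 8) = 1 + r ^+ 2 + 8 / s + s * r ^+ 2 / 8.
    by field; rewrite gt_eqF.
  have : 0 <= s * r ^+ 2 / 8 by rewrite !mulr_ge0 ?sqr_ge0// ltW.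
  lra.
have x2 : b * r <= s * r ^+ 2 / 8 + 2 * b ^+ 2 / s.
  have : 0 <= (s * r - 4 * b) ^+ 2 / (8 * s) by rewrite divr_ge0 ?sqr_ge0// mulr_ge0// ltW.
  have -> : (s * r - 4 * b) ^+ 2 / (8 * s) = s * r ^+ 2 / 8 + 2 * b ^+ 2 / s - b * r.
    by field; rewrite gt_eqF.
  lra.
apply: le_trans (_ : ((1 + 8 / s) * expR (s * r ^+ 2 / 8) * expR (s * r ^+ 2 / 8 + 2 * b ^+ 2 / s) *
   expR (- (s / 2 * r ^+ 2))) ^+ 2 <= _).
  have q1 : 0 <= 1 + r ^+ 2 by rewrite addr_ge0// sqr_ge0.
  have q2 : 0 <= 1 + 8 / s by rewrite addr_ge0// divr_ge0// ltW.
  rewrite lerXn2r ?nnegrE//; try by rewrite !mulr_ge0// expR_ge0.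
  apply: ler_wpM2r; first exact: expR_ge0.
  by apply: ler_pM; rewrite ?expR_ge0// ler_expR.
set E := 1 + 8 / s; set w := s * r ^+ 2 / 8 + (s * r ^+ 2 / 8 + 2 * b ^+ 2 / s) - s / 2 * r ^+ 2.
have -> : E * expR (s * r ^+ 2 / 8) * expR (s * r ^+ 2 / 8 + 2 * b ^+ 2 / s) * expR (- (s / 2 * r ^+ 2)) =
    E * expR w.
  by rewrite /w [expR (_ - _)]expRD [expR (s * r ^+ 2 / 8 + (_ + _))]expRD; ring.
have -> : (E * expR w) ^+ 2 = E ^+ 2 * expR (w + w) by rewrite (expRD w w); ring.
rewrite -[leRHS]mulrA -[in leRHS]expRD ler_wpM2l ?sqr_ge0// ler_expR /w; lra.
Qed.

Lemma envelope_L2 b : exists2 B : R, 0 <= B & forall (f : cV -> C) (K : R),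
  cmeasurable (f : Cn -> C) -> (forall z, cab (f z) <= K * envelope b z) ->
  L2 fm (fw f) /\ nsqd (L2dot fm) (fw f) <= K ^+ 2 * B.
Proof.
have [K0 hK0] := envelope_bound b.
have l20 : 0 < 2 * lam%:num by rewrite mulr_gt0.
pose l2 : {posnum R} := PosNum l20.
have gE z : expR (- (s / 2 * sqnorm z)) = gauss l2 (z : cV).
  by rewrite /gauss /=; congr (expR (- _)); field; rewrite gt_eqF//= .
have mg : measurable_fun [set: Cn] (gauss l2 : Cn -> R) by exact: measurable_gauss.
have ig : fm.-integrable [set: Cn] (fun z : Cn => (gauss l2 (z : cV))%:E).
  apply: integrable_fin; [exact: mg|by move=> z; exact: expR_ge0|].
  rewrite fock_measure_integral; last 2 first.
  - exact/measurable_EFinP.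
  - by move=> z; rewrite lee_fin expR_ge0.
  by rewrite integral_gauss_lebesgue -EFinM ltry.
have I0 : (0 <= \int[fm]_z (gauss l2 (z : cV))%:E)%E.
  by apply: integral_ge0 => z _; rewrite lee_fin expR_ge0.
exists (`|K0| * \int[fm]_z gauss l2 (z : cV)).
  by rewrite mulr_ge0// fine_ge0.
move=> f K mf fK.
have key z : cab (fw f z) ^+ 2 <= K ^+ 2 * `|K0| * gauss l2 (z : cV).
  rewrite cabM cab_real (ger0_norm (expR_ge0 _)) exprMn -[gauss _ _]gE.
  apply: le_trans (_ : (K * envelope b z) ^+ 2 * hgauss z ^+ 2 <= _).
    by rewrite ler_wpM2r ?sqr_ge0// lerXn2r// nnegrE ?cab_ge0// (le_trans (cab_ge0 (f z))).
  have -> : (K * envelope b z) ^+ 2 * hgauss z ^+ 2 = K ^+ 2 * (envelope b z * hgauss z) ^+ 2 by ring.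
  rewrite -mulrA ler_wpM2l ?sqr_ge0//; apply: le_trans (hK0 z) _.
  by rewrite ler_wpM2r ?expR_ge0// ler_norm.
have iK : fm.-integrable [set: Cn] (fun z : Cn => (K ^+ 2 * `|K0| * gauss l2 (z : cV))%:E).
  exact: integrableZl_fin.
have Lf : L2 fm (fw f) by apply: L2_le key iK; exact: cmeasurable_fw.
split=> //; rewrite -lee_fin L2_nsq// mulrA EFinM /Rintegral fineK; last first.
  exact: (integrable_fin_num measurableT ig).
rewrite -integralZl//; under [leRHS]eq_integral do rewrite -EFinM.
apply: ge0_le_integral => //.
- by move=> z _; rewrite lee_fin sqr_ge0.
- by case/integrableP: (L2_integrable Lf).
- by case/integrableP: iK.
- by move=> z _; rewrite lee_fin.
Qed.

Lemma fock0P (f : cV -> C^o) : fock0 lam f <-> holo (f : cV -> C) /\ L2 fm (fw f).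
Proof.
have E (h : holo (f : cV -> C)) : (\int[fm]_z (Re (dotC (f z) (f z)) * gauss lam z)%:E =
    \int[fm]_z (cab (fw f z) ^+ 2)%:E)%E.
  apply: eq_integral => z _; congr EFin.
  by rewrite /dotC mulJ_cab /fw cabM exprMn cab_real real_normK ?num_real// hgauss_sqr.
split=> [[h1 h2]|[h1 [h2 h3]]].
  have hf : holo (f : cV -> C).
    move=> z; have := h1 1 z; rewrite (_ : (fun z => _) = f)//.
    by apply/funext => w; rewrite /dotC CJ1 mulr1.
  by split => //; split; [apply: cmeasurable_fw; exact: cmeasurable_holo|rewrite -E].
split; last by rewrite E.
move=> v z; apply: (holoM h1 (holo_cst _)).
Qed.

Lemma fock0_dotE (f g : cV -> C^o) : fock0_dot lam f g = L2dot fm (fw f) (fw g).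
Proof. by apply/esym; exact: L2dot_fw. Qed.

Lemma fock0_prehilbert : prehilbert (fock0 (n := n) lam) (fock0_dot lam).
Proof.
have P := L2_prehilbert fm.
split.
- apply/fock0P; split; first exact: holo_cst.
  have -> : fw (0 : cV -> C^o) = 0 by apply/funext => z; rewrite /fw mul0r.
  exact: (ph0 P).
- move=> a f g /fock0P[hf Lf] /fock0P[hg Lg]; apply/fock0P; split.
    by apply: (holoD (holoM (holo_cst a) hf) hg).
  by rewrite fw_lin; exact: (phL P).
- move=> a f g h /fock0P[_ Lf] /fock0P[_ Lg] /fock0P[_ Lh].
  by rewrite !fock0_dotE fw_lin (ph_lin P).
- by move=> f g /fock0P[_ Lf] /fock0P[_ Lg]; rewrite !fock0_dotE (ph_sym P Lf Lg).
- by move=> f /fock0P[_ Lf]; rewrite fock0_dotE (ph_ge0 P).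
Qed.

Lemma fock0_nsq (f : cV -> C^o) : nsqd (fock0_dot lam) f = nsqd (L2dot fm) (fw f).
Proof. by rewrite /nsqd fock0_dotE. Qed.

(** The coherent state [w |-> exp(<w, a> / (2 lam))], that is, the reproducing kernel at [a]. *)
Definition kf (a : cV) : cV -> C := fun w => cexp (cVdot w (s%:C *: a)).

Lemma kfE (a w : cV) : kf a w = cexp (s%:C * cVdot w a).
Proof. by rewrite /kf (dotZr cV_prehilbert)// CRJ. Qed.

Lemma kf_holo a : holo (kf a).
Proof.
have := holo_cexp (s%:C *: a) 0; rewrite (_ : (fun z => _) = kf a)//.
by apply/funext => z; rewrite addr0.
Qed.

Lemma Re_cVdot_le (w a : cV) : `|Re (cVdot w a)| <= cnrm w * cnrm a.
Proof. exact: (le_trans (cab_Re _) (CS cV_prehilbert (f := w) (g := a) I I)). Qed.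

Lemma kf_le a (w : cV) : cab (kf a w) <= expR (s * cnrm a * cnrm w).
Proof.
rewrite kfE cab_cexp ReMC ler_expR -mulrA ler_wpM2l ?(ltW s0)//.
by rewrite mulrC (le_trans (ler_norm _))// Re_cVdot_le.
Qed.

Lemma kf_fock0 a : fock0 lam (kf a : cV -> C^o).
Proof.
apply/fock0P; split; first exact: kf_holo.
have [B _ h] := envelope_L2 (s * cnrm a).
have [] // := h (kf a) 1 (cmeasurable_holo (kf_holo a)) _.
move=> z; rewrite mul1r; apply: le_trans (kf_le a z) _; rewrite /envelope.
by rewrite ler_peMl ?expR_ge0// lerDl sqnorm_ge0.
Qed.

Lemma preserving_cintegrable (tau : Cn -> Cn) (f : Cn -> C) :
  measurable_fun [set: Cn] tau ->
  (forall A, measurable A -> fm (tau @^-1` A) = fm A) ->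
  cintegrable fm f -> cintegrable fm (fun z => f (tau z)).
Proof.
move=> mt pt cf; have mf := cintegrable_meas cf; have mft := cmeasurable_comp mt mf.
apply: cintegrableP => //; have /integrableP[c1 c2] := cintegrable_cab cf.
apply/integrableP; split; first by apply/measurable_EFinP; exact: cmeasurable_cab.
have mc : measurable_fun [set: Cn] (fun z => `|(cab (f z))%:E|)%E by exact: measurableT_comp.
by have := preserving_ge0_integral mt pt mc (fun z => abse_ge0 _) => ->.
Qed.

Lemma sqnormD (z w : cV) : sqnorm (z + w) = sqnorm z + sqnorm w + 2 * Re (cVdot z w).
Proof. by rewrite mulr_natl; exact: (nsqD cV_prehilbert (f := z) (g := w)). Qed.

Lemma translation_preserving (a : cV) :
  measurable_fun [set: Cn] ((fun z : cV => z + a) : Cn -> Cn) /\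
  forall A : set Cn, measurable A -> fm ((fun z : cV => z + a) @^-1` A) = fm A.
Proof.
split; last exact: fock_translation.
rewrite (_ : (fun z => _) = (fun z : cV => 1%:M *m z + a)); last by apply/funext => z; rewrite mul1mx.
exact: measurable_affine.
Qed.

(** Completing the square: recentring the Gaussian at [a] absorbs the antiholomorphic kernel and
    leaves a holomorphic exponential. *)
Lemma kf_shift (z a : cV) : (kf a (z + a))^* * (gauss lam (z + a))%:C =
  cexp (cVdot z (- s%:C *: a) + 0) * (gauss lam z)%:C.
Proof.
rewrite addr0 (dotZr cV_prehilbert)// CJN CRJ kfE !gaussE sqnormD cexpJ CJM CRJ.
rewrite -!cexp_CR -!cexpD (dotDl cV_prehilbert)// CJD !cVdotJ.
have -> : cVdot a a = (sqnorm a)%:C by rewrite (dot_nsq cV_prehilbert).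
have e2 : (2 * Re (cVdot z a))%:C = cVdot z a + cVdot a z.
  rewrite -(cVdotJ z a); apply: Cext; rewrite ?ReD ?ImD ?ReJ ?ImJ /= ?subrr//.
  by rewrite mulr_natl mulr2n.
rewrite !(CRN, CRM s) !CRD e2; congr cexp; ring.
Qed.

(** After translation by [a] the integrand is [h] times the Gaussian, with
    [h z = f(z + a) exp(-<z, a> / (2 lam))] holomorphic and [h 0 = f a]; [gauss_mean] concludes. *)
Theorem fock0_repr (f : cV -> C) a : fock0 lam f -> fock0_dot lam f (kf a) = f a.
Proof.
move=> Ff; have /fock0P[hf Lf] := Ff; have /fock0P[hk Lk] := kf_fock0 a.
rewrite fock0_dotE L2dot_fw; set G := (fun z : Cn => _).
have iG : cintegrable fm G.
  have := L2dot_integrable Lf Lk; congr cintegrable; apply/funext => z; exact: fwM_dot.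
have [mt pt] := translation_preserving a.
pose h z := f (z + a) * cexp (cVdot z (- s%:C *: a) + 0).
have E (z : cV) : G (z + a) = h z * (gauss lam z)%:C.
  have := congr1 (fun c : C => (f (z + a) : C) * c) (kf_shift z a).
  by rewrite /G /h !mulrA.
rewrite -(preserving_cintegral mt pt (cintegrable_meas iG)).
have iGt := preserving_cintegrable mt pt iG.
have hh : holo h.
  apply: holoM; last exact: holo_cexp.
  have h1 := holo_comp_affine a (scalar_unitary (n := n) (@cab1 R)) hf.
  suff -> : (fun z => f (z + a)) = (fun z => f (1%:M *m z + a)) by exact: h1.
  by apply/funext => z; rewrite mul1mx.
have EG : (fun z : Cn => G ((z : cV) + a)) = (fun z : Cn => h z * (gauss lam (z : cV))%:C).
  by apply/funext => z; exact: E.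
rewrite EG in iGt *; rewrite gauss_mean//.
by rewrite /h add0r (dot0l cV_prehilbert)// addr0 cexp0 mulr1.
Qed.

Lemma fock0_eval_le (f : cV -> C^o) a : fock0 lam f ->
  cab (f a) <= nrmd (fock0_dot lam) f * nrmd (fock0_dot lam) (kf a : cV -> C^o).
Proof. by move=> Ff; rewrite -(fock0_repr a Ff); exact: (CS fock0_prehilbert Ff (kf_fock0 a)). Qed.

Lemma fock0_def (f : cV -> C^o) : fock0 lam f -> nsqd (fock0_dot lam) f = 0 -> f = 0.
Proof.
move=> Ff f0; apply/funext => a; have := fock0_eval_le a Ff.
rewrite /nrmd f0 sqrtr0 mul0r => h; apply/eqP; rewrite -cab_eq0 eq_le h.
exact: cab_ge0.
Qed.

(** The kernel is differentiable in its parameter for the [L2] norm, with quadratic remainder;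
    [psi k] is its derivative in the conjugate of the coordinate [a_k], whence the conjugates of
    [h]. *)
Lemma kf_taylor a : exists psi : 'I_n -> cV -> C, exists2 M : R,
  forall k, L2 fm (fw (psi k)) & forall h, cnrm h <= 1 ->
    L2 fm (fw (kf (a + h)) - fw (kf a) - \sum_k (h k 0)^* *: fw (psi k)) /\
    nrmd (L2dot fm) (fw (kf (a + h)) - fw (kf a) - \sum_k (h k 0)^* *: fw (psi k)) <= M * cnrm h ^+ 2.
Proof.
pose psi k (w : cV) : C := s%:C * w k 0 * kf a w.
have a0 := cnrm_ge0 a.
have [B B0 hB] := envelope_L2 (s * (cnrm a + 1)).
have cs : cab (s%:C : C) = s by rewrite cab_real ger0_norm// ltW.
have mkf b : cmeasurable (kf b : Cn -> C) := cmeasurable_holo (kf_holo b).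
have mpsi k : cmeasurable (psi k : Cn -> C).
  apply: cmeasurableM => //; apply: cmeasurableM; first exact: cmeasurable_cst.
  exact: cmeasurable_coord.
exists psi, (3 * s ^+ 2 * Num.sqrt B).
  move=> k; have [] // := hB (psi k) s (mpsi k) _.
  move=> w; rewrite /psi /envelope cabM [cab (_ * w k 0)]cabM cs -mulrA ler_wpM2l ?(ltW s0)//.
  have w0 := cnrm_ge0 w; apply: ler_pM; rewrite ?cab_ge0//.
    apply: le_trans (cab_coord_le w k) _; rewrite -cnrm_sqr; nra.
  apply: le_trans (kf_le a w) _; rewrite ler_expR ler_wpM2r// ler_wpM2l ?(ltW s0)//; lra.
move=> h h1; pose rem (w : cV) : C := kf a w * (cexp (s%:C * cVdot w h) - 1 - s%:C * cVdot w h).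
have -> : fw (kf (a + h)) - fw (kf a) - \sum_k (h k 0)^* *: fw (psi k) = fw rem.
  apply/funext => w; rewrite !fctE fct_sumE /fw -mulrBl.
  rewrite (_ : \sum_k _ = kf a w * (s%:C * cVdot w h) * (hgauss w)%:C); last first.
    rewrite cVdotE !(mulr_sumr, mulr_suml); apply: eq_bigr => k _; rewrite !fctE /fw /psi.
    by rewrite -[_ *: _]/(_ * _); ring.
  rewrite -mulrBl; congr (_ * _); rewrite /rem !mulrBr mulr1; congr (_ - _ - _).
  by rewrite !kfE (dotDr cV_prehilbert)// mulrDr cexpD.
have h0 := cnrm_ge0 h.
have mrem : cmeasurable (rem : Cn -> C).
  apply: cmeasurableM => //.
  have m1 : cmeasurable (fun w : Cn => s%:C * cVdot (w : cV) h).
    apply: cmeasurableM; first exact: cmeasurable_cst.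
    under [X in cmeasurable X]eq_fun do rewrite cVdotE.
    apply: cmeasurable_sum => k; apply: cmeasurableM; [exact: cmeasurable_coord|exact: cmeasurable_cst].
  apply: cmeasurableD; last exact: cmeasurableN.
  apply: cmeasurableD; last exact: cmeasurable_cst.
  by under [X in cmeasurable X]eq_fun do rewrite -kfE; exact: mkf.
have [] := hB rem (3 * s ^+ 2 * cnrm h ^+ 2) mrem _.
  move=> w; have w0 := cnrm_ge0 w; rewrite /rem /envelope -cnrm_sqr cabM.
  set x := cab (s%:C * cVdot w h); have x0 : 0 <= x := cab_ge0 _.
  have xb : x <= s * (cnrm w * cnrm h).
    by rewrite /x cabM cs ler_wpM2l ?(ltW s0)//; exact: (CS cV_prehilbert (f := w) (g := h) I I).
  have xw : x <= s * cnrm w.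
    by apply: le_trans xb _; rewrite ler_wpM2l ?(ltW s0)// ler_piMr.
  apply: le_trans (_ : expR (s * cnrm a * cnrm w) * (3 * (x ^+ 2 * expR x)) <= _).
    by apply: ler_pM; rewrite ?cab_ge0 ?kf_le ?cexp_bound.
  apply: le_trans (_ : expR (s * cnrm a * cnrm w) * (3 * ((s * (cnrm w * cnrm h)) ^+ 2 * expR (s * cnrm w))) <= _).
    rewrite ler_wpM2l ?expR_ge0// ler_wpM2l//; apply: ler_pM; rewrite ?sqr_ge0 ?expR_ge0 ?ler_expR//.
    by rewrite lerXn2r// nnegrE !mulr_ge0// ltW.
  have -> : s * (cnrm a + 1) * cnrm w = s * cnrm a * cnrm w + s * cnrm w by ring.
  rewrite expRD; set e1 := expR _; set e2 := expR _.
  have -> : e1 * (3 * ((s * (cnrm w * cnrm h)) ^+ 2 * e2)) = (3 * s ^+ 2 * cnrm h ^+ 2) * (cnrm w ^+ 2 * (e1 * e2)) by ring.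
  rewrite ler_wpM2l ?mulr_ge0 ?sqr_ge0// ler_wpM2r ?mulr_ge0 ?expR_ge0//; lra.
move=> L2r hr; split=> //; rewrite /nrmd.
apply: le_trans (ler_wsqrtr hr) _; rewrite sqrtrM ?sqr_ge0// sqrtr_sqr ger0_norm; last by rewrite !mulr_ge0 ?sqr_ge0.
by rewrite mulrAC.
Qed.

Lemma fwB (f g : cV -> C) : fw (f - g) = fw f - fw g.
Proof. by apply/funext => z; rewrite /fw !fctE mulrBl. Qed.

(** Evaluations are bounded, so a Cauchy sequence has a pointwise limit [f], which is also its [L2]
    limit. The formula [f a = <f, kf a>] passes to the limit, and with [kf_taylor] it shows that [f]
    is holomorphic. *)
Lemma fock0_hilbert : hilbert (fock0 (n := n) lam) (fock0_dot lam).
Proof.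
have P := L2_prehilbert fm.
split; [exact: fock0_prehilbert|exact: fock0_def|].
move=> u Fu hu.
have Lu k : L2 fm (fw (u k)) by have /fock0P[] := Fu k.
have ev a : exists l : C, (fun k => u k a : C) @ \oo --> l.
  apply: ccauchy_cvg => e e0.
  pose K := nrmd (fock0_dot lam) (kf a : cV -> C^o).
  have K0 : 0 <= K := nrm_ge0 _ _.
  have e1 : 0 < e / (K + 1) by rewrite divr_gt0//; lra.
  have [|N hN] := hu ((e / (K + 1)) ^+ 2); first by rewrite exprn_gt0.
  exists N => m k Nm Nk; have D1 := phB fock0_prehilbert (Fu m) (Fu k).
  have := fock0_eval_le a D1; rewrite -/K => h; apply: le_trans h _.
  apply: le_trans (_ : e / (K + 1) * K <= _).
    rewrite ler_wpM2r// -(ger0_norm (ltW e1)) -sqrtr_sqr; apply: ler_wsqrtr; exact: hN.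
  by rewrite mulrAC ler_pdivrMr ?ler_wpM2l ?(ltW e0)//; lra.
have [f hf] := choice ev.
have cf z : (fun k => fw (u k) z) @ \oo --> fw f z.
  have := @cvgMlC _ (fun k => u k z : C) _ (hgauss z)%:C (hf z).
  by rewrite mulrC; apply: cvg_ext => k; rewrite mulrC.
have [Lf cvf] : L2 fm (fw f) /\ (fun k => nsqd (L2dot fm) (fw (u k) - fw f)) @ \oo --> (0 : R).
  apply: L2_complete => // e /hu[N hN]; exists N => m k Nm Nk.
  by rewrite -fwB -fock0_nsq; exact: hN.
have rep a : f a = L2dot fm (fw f) (fw (kf a)).
  have Lk : L2 fm (fw (kf a)) by have /fock0P[] := kf_fock0 a.
  apply: (cvg_uniqueC (hf a)).
  have := ncvg_dot P Lu Lf Lk cvf; apply: cvg_ext => k.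
  by rewrite -fock0_dotE fock0_repr.
have hof : holo f.
  move=> a; have [psi [M Lpsi hM]] := kf_taylor a.
  pose c : cV := \col_k (L2dot fm (fw f) (fw (psi k)))^*.
  apply: (@differentiable_quad _ _ f a c (nrmd (L2dot fm) (fw f) * M)) => h h1.
  have [Lr hr] := hM h h1.
  have -> : f (a + h) - f a - cVdot h c = L2dot fm (fw f)
      (fw (kf (a + h)) - fw (kf a) - \sum_k (h k 0)^* *: fw (psi k)).
    have Lk b : L2 fm (fw (kf b)) by have /fock0P[] := kf_fock0 b.
    have Ls : L2 fm (\sum_k (h k 0)^* *: fw (psi k)).
      by apply: (ph_sum P) => k _; exact: (phZ P).
    rewrite (dotBr P)//; last exact: (phB P).
    rewrite (dotBr P)// -!rep; congr (_ - _).
    rewrite (dot_sumr P)//; last by move=> k _; exact: (phZ P).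
    rewrite cVdotE; apply: eq_bigr => k _; rewrite (dotZr P)// CJK mxE CJK//.
  apply: le_trans (CS P Lf Lr) _; rewrite -mulrA ler_wpM2l//; exact: nrm_ge0.
exists f; first exact/fock0P.
apply: cvg_ext cvf => k; by rewrite fock0_nsq fwB.
Qed.

End FockWeight.

Section FockBasis.
Context {R : realType} {n : nat} (lam : {posnum R}).
Local Notation C := R[i].
Local Notation cV := 'cV[C]_n.
Local Notation Cn := (Cn R n).
Local Notation fm := (fock_measure n lam).
Local Notation s := ((2 * lam%:num)^-1).
Local Notation H0 := (fock0 (n := n) lam).
Local Notation dot0 := (fock0_dot (n := n) lam).
Local Notation kf := (kf lam).

Let s0 : 0 < s :> R. Proof. by rewrite invr_gt0 mulr_gt0. Qed.

Definition coherent_span : set (cV -> C^o) :=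
  [set f | exists r : seq (C * cV), f = \sum_(p <- r) p.1 *: (kf p.2 : cV -> C^o)].

Lemma coherent_span0 : coherent_span 0.
Proof. by exists [::]; rewrite big_nil. Qed.

Lemma coherent_span_lin (a : C) f g : coherent_span f -> coherent_span g ->
  coherent_span (a *: f + g).
Proof.
move=> [r ->] [t ->]; exists ([seq (a * p.1, p.2) | p <- r] ++ t).
rewrite big_cat big_map scaler_sumr; congr (_ + _).
by apply: eq_bigr => p _; rewrite scalerA.
Qed.

(** Kernels at a dense sequence are total because they evaluate a continuous function there. For
    independence take the kernels at [m e1]: at the points [(ln(j+1)/s) e1] they are [(j+1)^m], so a
    relation among [N + 1] of them is a polynomial of degree at most [N] with [N + 1] roots. *)
Lemma fock0_basis : (0 < n)%N -> exists2 e, orthonormal_basis H0 dot0 e &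
  forall k, coherent_span (e k).
Proof.
move=> n0; have HH := fock0_hilbert (n := n) lam; have P := hb_pre HH.
pose e1 : cV := delta_mx (Ordinal n0) 0.
pose w m : cV -> C^o := kf (m%:R *: e1).
have Dy j : H0 (kf (dense_vec j)) by exact: kf_fock0.
have [||e oe he] := basis_exists HH (y := fun j => kf (dense_vec j) : cV -> C^o) (w := w) Dy (fun m => kf_fock0 lam _).
- move=> f Ff h; apply/funext => z; apply/eqP; rewrite -cab_eq0 eq_le cab_ge0 andbT.
  apply/ler_addgt0Pr => e e0; rewrite add0r.
  have /fock0P[hf _] := Ff.
  have cf := holo_cont hf; have [d d0 hd] := cV_continuous_eps (cf z) e0.
  have [j hj] := dense_vecP z d0; rewrite cnrm_distC in hj.
  by have := hd _ hj; rewrite -(fock0_repr (dense_vec j) Ff) h sub0r cabN => /ltW.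
- move=> N c hc m mN.
  pose p := \poly_(m < N.+1) c m.
  have wE k j : w k ((ln j.+1%:R / s)%:C *: e1) = (j.+1%:R : C) ^+ k.
    rewrite /w kfE (dotZl (cV_prehilbert (n := n)))// (dotZr (cV_prehilbert (n := n)))//.
    have -> : cVdot e1 e1 = 1.
      rewrite cVdotE (bigD1 (Ordinal n0))//= big1; last first.
        by move=> i /negbTE ni; rewrite mxE ni mul0r.
      by rewrite mxE eqxx/= CJ1 mulr1 addr0.
    rewrite mulr1 -CRnat CRJ -!CRM cexp_CR.
    have -> : s * (ln j.+1%:R / s * k%:R) = k%:R * ln j.+1%:R by field; rewrite gt_eqF.
    by rewrite expRM_natl lnK ?posrE// rmorphXn /= CRnat.
  have p0 : p = 0.
    apply/eqP; apply: contraT => pn0.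
    have := max_poly_roots pn0 (rs := [seq (j.+1%:R : C) | j <- iota 0 N.+1]).
    rewrite size_map size_iota => h.
    have : (N.+1 < size p)%N.
      apply: h.
        apply/allP => x /mapP[j _ ->]; rewrite /root horner_poly.
        have := congr1 (fun f : cV -> C^o => (f ((ln j.+1%:R / s)%:C *: e1) : C)) hc.
        rewrite fct_sumE big_mkord => e; apply/eqP; rewrite -[RHS]e.
        by apply: eq_bigr => i _; rewrite -wE.
      rewrite map_inj_uniq ?iota_uniq// => i j /eqP.
      by rewrite eqr_nat => /eqP[].
    by rewrite ltnNge size_poly.
  by have := coef_poly N.+1 c m; rewrite -/p p0 coef0 mN.
exists e => //; apply: he; [exact: coherent_span0|exact: coherent_span_lin|].
move=> k; exists [:: (1, dense_vec k)]; by rewrite big_seq1 scale1r.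
Qed.

End FockBasis.

(** * Weighted compositions, the quantizer and Moyal's identity for coherent states *)

Section WeightedComposition.
Context {R : realType} {n : nat} (lam : {posnum R}).
Local Notation C := R[i].
Local Notation cV := 'cV[C]_n.
Local Notation Cn := (Cn R n).
Local Notation fm := (fock_measure n lam).
Local Notation H0 := (fock0 (n := n) lam).
Local Notation dot0 := (fock0_dot (n := n) lam).
Variables (m : cV -> C) (k : 'M[C]_n) (b : cV) (r : R).
Hypotheses (hm : holo m) (uk : k \is unitarymx).
Hypothesis mE : forall w, cab (m w) * hgauss lam w = r * hgauss lam (k *m w + b).

(** By [mE], after multiplication by the half weight the operator is [r] times composition with a
    measure-preserving affine map, up to a unimodular factor. Both [Omega0] and the operators of the
    representation have this shape. *)
Lemma wcomp_fock0 (f g : cV -> C) : H0 f -> H0 g ->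
  H0 (fun w => m w * f (k *m w + b)) /\
  dot0 (fun w => m w * f (k *m w + b)) (fun w => m w * g (k *m w + b)) =
  (r ^+ 2)%:C * dot0 f g.
Proof.
move=> /fock0P[hf Lf] /fock0P[hg Lg].
have mt : measurable_fun [set: Cn] ((fun z : cV => k *m z + b) : Cn -> Cn) by exact: measurable_affine.
have pt (A : set Cn) : measurable A -> fm ((fun z : cV => k *m z + b) @^-1` A) = fm A by exact: fock_affine.
have mf := cmeasurable_holo hf; have mg := cmeasurable_holo hg.
have ch w : cab (hgauss lam w)%:C = hgauss lam w by rewrite cab_real ger0_norm// expR_ge0.
have hT := holoM hm (holo_comp_affine b uk hf).
split.
  apply/fock0P; split; first exact: hT.
  have Lt : L2 fm (fun w : Cn => fw lam f (k *m (w : cV) + b)).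
    by have [] := preserving_L2dot mt pt Lf Lf.
  apply: (@L2_le _ _ _ _ _ (fun w : Cn => r ^+ 2 * cab (fw lam f (k *m (w : cV) + b)) ^+ 2)).
  - by apply: cmeasurable_fw; exact: cmeasurable_holo.
  - move=> w; rewrite /fw cabM cabM cabM !ch mulrAC mE le_eqVlt; apply/orP; left; apply/eqP; ring.
  - by apply: integrableZl_fin; exact: (L2_integrable Lt).
rewrite !fock0_dotE.
have iG := L2dot_integrable Lf Lg.
have [_ <-] := preserving_L2dot mt pt Lf Lg.
have Lft : L2 fm (fun w : Cn => fw lam f (k *m (w : cV) + b)) by have [] := preserving_L2dot mt pt Lf Lf.
have Lgt : L2 fm (fun w : Cn => fw lam g (k *m (w : cV) + b)) by have [] := preserving_L2dot mt pt Lg Lg.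
rewrite /L2dot -cintegralZ; last exact: (L2dot_integrable Lft Lgt).
apply: eq_cintegral => w /=; rewrite /fw.
set F := f _; set G := g _; rewrite !CJM !CRJ.
have e : m w * (m w)^* * (hgauss lam w)%:C * (hgauss lam w)%:C =
   (r ^+ 2)%:C * ((hgauss lam (k *m w + b))%:C * (hgauss lam (k *m w + b))%:C).
  by rewrite mulJ_cab -!CRM; congr (_%:C); rewrite -mulrA -!expr2 -!exprMn mE.
by rewrite [RHS](_ : _ = F * G^* * ((r ^+ 2)%:C * ((hgauss lam (k *m w + b))%:C * (hgauss lam (k *m w + b))%:C))); [rewrite -e; ring|ring].
Qed.

End WeightedComposition.

Section ScaledMeasure.
Context {R : realType} {d : measure_display} {T : measurableType d}.
Local Notation C := R[i].
Variables (mu mu' : {measure set T -> \bar R}) (c : R).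
Hypotheses (c0 : 0 < c) (mE : forall F : T -> \bar R, measurable_fun [set: T] F ->
  (forall x, 0 <= F x)%E -> (\int[mu]_x F x = c%:E * \int[mu']_x F x)%E).

Lemma scaled_integrable (h : T -> R) : mu'.-integrable [set: T] (fun x => (h x)%:E) ->
  mu.-integrable [set: T] (fun x => (h x)%:E) /\ \int[mu]_x h x = c * \int[mu']_x h x.
Proof.
move=> ih; have /integrableP[m1 m2] := ih; have i1 : mu.-integrable [set: T] (fun x => (h x)%:E).
  apply/integrableP; split => //; rewrite mE//; last exact: measurableT_comp.
  by rewrite lte_mul_pinfty ?lee_fin ?(ltW c0).
split => //; rewrite /Rintegral integralE [in RHS]integralE.
have mp := measurable_funepos m1; have mn := measurable_funeneg m1.
rewrite !mE//.
have /fin_numP h1 := integrable_pos_fin_num measurableT ih.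
have /fin_numP h2 := integrable_neg_fin_num measurableT ih.
move: (\int[mu']_x _)%E (\int[mu']_x _)%E h1 h2 => [a||] [b||] [] //= _ _ [] // _ _.
by rewrite mulrBr.
Qed.

Lemma scaled_cintegral (f : T -> C) : cintegrable mu' f ->
  cintegrable mu f /\ cintegral mu f = c%:C * cintegral mu' f.
Proof.
move=> [i1 i2]; have [j1 e1] := scaled_integrable i1; have [j2 e2] := scaled_integrable i2.
by split => //; apply: Cext; rewrite ?ReMC ?ImMC.
Qed.

Lemma scaled_L2 (f : T -> C) : L2 mu' f -> L2 mu f.
Proof.
move=> [mf ff]; split => //; rewrite mE; first by rewrite lte_mul_pinfty ?lee_fin ?(ltW c0).
  by apply/measurable_EFinP; apply: measurable_funX; exact: cmeasurable_cab.
by move=> x; rewrite lee_fin sqr_ge0.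
Qed.

End ScaledMeasure.

Section Quantizer.
Context {R : realType} {n : nat} (lam : {posnum R}).
Local Notation C := R[i].
Local Notation cV := 'cV[C]_n.
Local Notation Cn := (Cn R n).
Local Notation fm := (fock_measure n lam).
Local Notation s := ((2 * lam%:num)^-1).
Local Notation H0 := (fock0 (n := n) lam).
Local Notation dot0 := (fock0_dot (n := n) lam).
Local Notation kfl := (@kf R n).
Local Notation kf := (kf lam).
Local Notation Om := (Omega0 lam).

Let s0 : 0 < s :> R. Proof. by rewrite invr_gt0 mulr_gt0. Qed.
Let lamE : lam%:num^-1 = 2 * s :> R. Proof. by field; rewrite gt_eqF. Qed.

Definition Om_mult (z w : cV) : C :=
  2%:R ^+ n * cexp (cVdot w ((2 * s)%:C *: z) + - ((2 * s) * sqnorm z)%:C).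

Lemma Om_multE z w : Om_mult z w = 2%:R ^+ n * cexp ((2 * s)%:C * (cVdot w z - (sqnorm z)%:C)).
Proof.
by rewrite /Om_mult (dotZr cV_prehilbert)// CRJ (CRM (2 * s)) mulrBr.
Qed.

Lemma Om_shape z (f : cV -> C) :
  Om z f = fun w => Om_mult z w * f ((-1)%:M *m w + 2%:R *: z).
Proof.
apply/funext => w; rewrite /Omega0 Om_multE lamE; congr (_ * f _).
by rewrite mul_scalar_mx scaleN1r addrC.
Qed.

Lemma cab_Om_mult z w : cab (Om_mult z w) * hgauss lam w =
  2 ^+ n * hgauss lam ((-1)%:M *m w + 2%:R *: z).
Proof.
have e4 : sqnorm (2%:R *: z) = 4 * sqnorm z.
  rewrite -[sqnorm _]/(nsqd (@cVdot R n) _) (nsqZ cV_prehilbert)// -CRnat cab_real.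
  by congr (_ * _); rewrite normr_nat; ring.
rewrite Om_multE cabM cabX cab_cexp ReMC -[X in cab X ^+ _]CRnat cab_real normr_nat -mulrA; congr (_ * _).
rewrite /hgauss -expRD; congr expR; rewrite mul_scalar_mx scaleN1r sqnormD sqnormN.
rewrite e4 (dotZr cV_prehilbert)// (dotNl cV_prehilbert)// -[X in X^*]CRnat CRJ ReMC ReN ReB /=.
by field; rewrite gt_eqF.
Qed.

Lemma unitary_N1 : ((-1)%:M : 'M[C]_n) \is unitarymx.
Proof. by apply: scalar_unitary; rewrite cabN cab1. Qed.

Lemma Om_mult_holo z : holo (Om_mult z).
Proof. by apply: (holoM (holo_cst _)); exact: holo_cexp. Qed.

Lemma Om_fock0 z f : H0 f -> H0 (Om z f).
Proof.
move=> Ff; have [] := wcomp_fock0 (Om_mult_holo z) unitary_N1 (cab_Om_mult z) Ff Ff.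
by rewrite -Om_shape.
Qed.

Lemma Om_iso z f g : H0 f -> H0 g -> dot0 (Om z f) (Om z g) = ((2 ^+ n) ^+ 2)%:C * dot0 f g.
Proof.
move=> Ff Fg; have [_] := wcomp_fock0 (Om_mult_holo z) unitary_N1 (cab_Om_mult z) Ff Fg.
by rewrite -!Om_shape.
Qed.

Lemma Om_lin z (a : C) (f g : cV -> C^o) : Om z (a *: f + g) = a *: Om z f + Om z g.
Proof. by apply/funext => w; rewrite /Omega0 !fctE mulrDr -[a *: _]/(a * _) -[a *: _]/(a * _) mulrCA. Qed.

Lemma Om_op z : is_operator H0 (Om z).
Proof. by split; [exact: Om_fock0|move=> a f g _ _; exact: Om_lin]. Qed.

Lemma Om_inv z (f : cV -> C^o) : Om z (Om z f) = ((2 ^+ n) ^+ 2)%:C *: f.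
Proof.
apply/funext => w; rewrite /Omega0 !fctE -[_ *: f w]/(_ * (f w : C)).
rewrite (_ : 2%:R *: z - (2%:R *: z - w) = w); last by rewrite opprB addrC subrK.
rewrite mulrA; congr (_ * _).
rewrite mulrACA -cexpD -mulrDr -[cdot _ _]/(cVdot w z) -[cdot (_ - _) _]/(cVdot (2%:R *: z - w) z).
rewrite (dotBl cV_prehilbert)// (dotZl cV_prehilbert)// (dot_nsq cV_prehilbert (f := z) I).
rewrite -[nsqd _ z]/(sqnorm z) [X in cexp (_ * X)](_ : _ = 0) ?mulr0 ?cexp0 ?mulr1; last by ring.
by rewrite rmorphXn rmorphXn /= CRnat expr2.
Qed.

Let P := @fock0_prehilbert R n lam.

(** [2^-n Om] is an isometric involution, hence self-adjoint. *)
Lemma Om_sym z f g : H0 f -> H0 g -> dot0 (Om z f) g = dot0 f (Om z g).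
Proof.
move=> Ff Fg; have c0 : ((2 ^+ n) ^+ 2 : R) != 0 by rewrite !expf_neq0.
have := Om_iso z (Om_fock0 z Ff) Fg; rewrite Om_inv (dotZl P)//; last exact: Om_fock0.
by move=> /mulfI e; apply/esym/e; apply/eqP => /(congr1 (@complex.Re R)) /= /eqP; rewrite (negbTE c0).
Qed.

Lemma Om_nrm z f : H0 f -> nrmd dot0 (Om z f) = 2 ^+ n * nrmd dot0 f.
Proof.
move=> Ff; rewrite /nrmd /nsqd Om_iso// ReMC sqrtrM ?sqr_ge0// sqrtr_sqr ger0_norm//.
Qed.

Definition symb0 (v u : cV -> C^o) : Cn -> C := fun z => dot0 (Om z v) u.

Lemma lam4_gt0 : 0 < lam%:num / 4. Proof. by rewrite divr_gt0. Qed.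
(** The symbol of a pair of coherent states carries [exp(-|z|^2 / lam)]; this is the half weight of
    the Fock space of parameter [lam / 4], and a product of two symbols carries its full weight. *)
Definition lam4 : {posnum R} := PosNum lam4_gt0.

Lemma fock_measure_lam4 (F : Cn -> \bar R) : measurable_fun [set: Cn] F -> (forall x, 0 <= F x)%E ->
  (\int[fm]_x F x = ((4 ^- n)%:E * \int[fock_measure n lam4]_x F x))%E.
Proof.
move=> mF F0; rewrite !fock_measure_integral// muleA -EFinM; congr (_%:E * _)%E.
rewrite -invfM -exprMn; congr (_^-1); congr (_ ^+ _) => /=; by field.
Qed.

Definition kpair (a b : cV) : cV -> C :=
  fun z => cexp (cVdot z ((2 * s)%:C *: a)) * (cexp (cVdot z ((2 * s)%:C *: b)))^*.

Lemma kpairE a b z : kpair a b z = cexp ((2 * s)%:C * (cVdot z a + cVdot b z)).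
Proof.
rewrite /kpair !(dotZr cV_prehilbert)// cexpJ CJM cVdotJ !CRJ -cexpD.
by rewrite mulrDr.
Qed.

Lemma symb0_kf a b z : symb0 (kf a) (kf b) z =
  2%:R ^+ n * cexp (- (s%:C * cVdot b a)) * fw lam4 (kpair a b) z.
Proof.
rewrite /symb0 fock0_repr; last exact: (Om_fock0 z (kf_fock0 lam a)).
rewrite Om_shape Om_multE kfE /fw kpairE -[LHS]mulrA -[RHS]mulrA; congr (_ * _).
rewrite -cexp_CR -!cexpD; congr cexp.
rewrite mul_scalar_mx scaleN1r (dotDl cV_prehilbert)// (dotNl cV_prehilbert)// (dotZl cV_prehilbert)//.
have -> : (- ((2 * lam4%:num)^-1 / 2 * sqnorm z))%:C = - ((2 * s)%:C * (sqnorm z)%:C) :> C.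
  by rewrite -CRM -CRN; congr (_%:C); rewrite /=; field; rewrite gt_eqF.
by rewrite (CRM 2) CRnat; move: (s%:C) => sc; ring.
Qed.

Lemma kpair_L2 a b : L2 (fock_measure n lam4) (fw lam4 (kpair a b)).
Proof.
have ce c : cmeasurable (fun z : Cn => cexp (cVdot (z : cV) c)).
  have := cmeasurable_holo (holo_cexp c 0); rewrite (_ : (fun z => _) = (fun z => cexp (cVdot z c)))//.
  by apply/funext => z; rewrite addr0.
have [B _ hB] := envelope_L2 (n := n) lam4 (2 * s * (cnrm a + cnrm b)).
have [] // := hB (kpair a b) 1 _ _.
  by apply: cmeasurableM; [exact: ce|apply: cmeasurableJ; exact: ce].
move=> z; rewrite mul1r /envelope kpairE cab_cexp ReMC.
apply: le_trans (_ : expR (2 * s * (cnrm a + cnrm b) * cnrm z) <= _).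
  rewrite ler_expR -mulrA ler_wpM2l ?mulr_ge0 ?(ltW s0)// ReD mulrDl.
  apply: lerD; apply: le_trans (ler_norm _) _; rewrite ?[cnrm a * _]mulrC; exact: Re_cVdot_le.
by rewrite ler_peMl ?expR_ge0// lerDl sqnorm_ge0.
Qed.

(** Conjugation exchanges the holomorphic and antiholomorphic factors; regrouping them gives a
    kernel times a conjugate kernel in the Fock space of parameter [lam / 4]. *)
Lemma kpairM a b c d z : kpair a b z * (kpair c d z)^* =
  kfl lam4 (2%:R^-1 *: (a + d)) z * (kfl lam4 (2%:R^-1 *: (b + c)) z)^*.
Proof.
rewrite !kpairE !kfE !cexpJ -!cexpD; congr cexp.
rewrite !(CJM, CJD, cVdotJ, CRJ) !(dotZr cV_prehilbert)// !(dotDr cV_prehilbert)//.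
have -> : (2 * lam4%:num)^-1 = 4 * s :> R by rewrite /=; field; rewrite gt_eqF.
have -> : (2%:R^-1 : C)^* = 2%:R^-1 by rewrite -CRnat -fmorphV CRJ.
rewrite (dotZl cV_prehilbert)// (dotDl cV_prehilbert)// (CRM 2) (CRM 4) !CRnat.
by move: (s%:C) => sc; field.
Qed.

(** By [kpairM] and the reproducing property the integral is the kernel of parameter [lam / 4] at
    [((b + c)/2, (a + d)/2)]. The factor [4^-n] between the two measures cancels the two factors
    [2^n] of the quantizers; in the exponent the terms [<b, a>] and [<c, d>] cancel against the
    constants of the symbols, leaving [<c, a>] and [<b, d>]. *)
Lemma moyal_kf a b c d : [/\ L2 fm (symb0 (kf a) (kf b)), L2 fm (symb0 (kf c) (kf d)) &
  L2dot fm (symb0 (kf a) (kf b)) (symb0 (kf c) (kf d)) =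
  dot0 (kf a) (kf c) * (dot0 (kf b) (kf d))^*].
Proof.
have n0 : (0 : R) < 4 ^- n by rewrite invr_gt0 exprn_gt0.
have P4 := L2_prehilbert (fock_measure n lam4).
pose al (a b : cV) : C := 2%:R ^+ n * cexp (- (s%:C * cVdot b a)).
have sE a' b' : symb0 (kf a') (kf b') = al a' b' *: fw lam4 (kpair a' b').
  by apply/funext => z; rewrite symb0_kf.
have Lk a' b' := kpair_L2 a' b'.
have Ls a' b' : L2 fm (symb0 (kf a') (kf b')).
  by rewrite sE; apply: (scaled_L2 n0 fock_measure_lam4); exact: (phZ P4).
split => //.
have [_ e] := scaled_cintegral n0 fock_measure_lam4 (L2dot_integrable (phZ P4 (al a b) (Lk a b)) (phZ P4 (al c d) (Lk c d))).
rewrite !sE; etransitivity; first exact: e.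
rewrite -[cintegral _ _]/(L2dot (fock_measure n lam4) _ _) (dotZl P4)//; last exact: (phZ P4).
rewrite (dotZr P4)// L2dot_fw.
have -> : cintegral (fock_measure n lam4) (fun z => kpair a b z * (kpair c d z)^* * (gauss lam4 (z : cV))%:C) =
   kfl lam4 (2%:R^-1 *: (a + d)) (2%:R^-1 *: (b + c)).
  rewrite -(fock0_repr _ (kf_fock0 lam4 _)) fock0_dotE L2dot_fw.
  by apply: eq_cintegral => z; rewrite kpairM.
rewrite !fock0_repr; try exact: kf_fock0.
rewrite /al !kfE (CJM (2%:R ^+ n) (cexp _)) !cexpJ.
have -> : (2%:R ^+ n : C)^* = 2%:R ^+ n by rewrite -CRnat -rmorphXn CRJ.
have -> : (4 ^- n)%:C * (2%:R ^+ n * cexp (- (s%:C * cVdot b a)) * (2%:R ^+ n * cexp (- (s%:C * cVdot d c))^* *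
   cexp ((2 * lam4%:num)^-1%:C * cVdot (2%:R^-1 *: (b + c)) (2%:R^-1 *: (a + d))))) =
   cexp (- (s%:C * cVdot b a)) * cexp (- (s%:C * cVdot d c))^* *
   cexp ((2 * lam4%:num)^-1%:C * cVdot (2%:R^-1 *: (b + c)) (2%:R^-1 *: (a + d))).
  rewrite [LHS](_ : _ = ((4 ^- n)%:C * (2%:R ^+ n * 2%:R ^+ n)) * (cexp (- (s%:C * cVdot b a)) * cexp (- (s%:C * cVdot d c))^* *
   cexp ((2 * lam4%:num)^-1%:C * cVdot (2%:R^-1 *: (b + c)) (2%:R^-1 *: (a + d))))); last by ring.
  rewrite (_ : (4 ^- n)%:C * (2%:R ^+ n * 2%:R ^+ n) = 1) ?mul1r//.
  have -> : (2%:R ^+ n : C) = (2%:R ^+ n : R)%:C by rewrite rmorphXn /= CRnat.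
  by rewrite -!CRM -exprMn -natrM mulVf// expf_neq0.
have -> : (2 * lam4%:num)^-1 = 4 * s :> R by rewrite /=; field; rewrite gt_eqF.
rewrite -!cexpD; congr cexp.
rewrite (dotZl cV_prehilbert)// !(dotZr cV_prehilbert)// !(dotDr cV_prehilbert)// !(dotDl cV_prehilbert)//.
have -> : (2%:R^-1 : C)^* = 2%:R^-1 by rewrite -CRnat -fmorphV CRJ.
rewrite !(CJN, CJM, CRJ, cVdotJ) (CRM 4) !CRnat.
by move: (s%:C) => sc; field.
Qed.

End Quantizer.

(** * The Weyl calculus of an abstract quantizer *)

Section NuclearComposition.
Context {R : realType} {E : lmodType R[i]}.
Local Notation C := R[i].
Context {D : set E} {dot : E -> E -> C} (H : hilbert D dot).
Local Notation "'[ f , g ]" := (dot f g) (format "''[' f ,  g ]").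
Local Notation nsq := (nsqd dot).
Let P := hb_pre H.

(** The composite is nuclear with the adjoint of [B] applied to [u_k], which stays square summable
    because that adjoint is bounded. *)
Lemma nuclear_comp e A B u v : orthonormal_basis D dot e -> nuclear (D := D) (dot := dot) A u v -> bounded_operator D dot B ->
  exists2 t : C, series (fun k => '[B (v k), u k]) @ \oo --> t & is_trace D dot (A \o B) t.
Proof.
move=> oe [Du Dv cu cv hA] bB; have [Bs adj] := adjoint_exists H oe bB.
have [[DBs lBs] [M hM]] := bounded_adjoint H bB adj; have [_ hB] := adj; have [[DB _] _] := bB.
have cBu : cvgn (series (fun k => nsq (Bs (u k)))).
  apply: (@series_le_cvg _ _ (fun k => `|M| * nsq (u k))).
  - by move=> k; apply: (nsq_ge0 P); exact: DBs.
  - move=> k; apply: le_trans (hM _ (Du k)) _.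
    by rewrite ler_wpM2r ?ler_norm//; exact: (nsq_ge0 P).
  - apply/cvg_ex; exists (`|M| * limn (series (fun k => nsq (u k)))).
    have h : (fun m => `|M| * series (fun k => nsq (u k)) m) @ \oo --> `|M| * limn (series (fun k => nsq (u k))).
      exact: (cvgM (cvg_cst _) cu).
    by apply: cvg_ext h => m; rewrite /series/= mulr_sumr.
have NAB : nuclear (D := D) (dot := dot) (A \o B) (fun k => Bs (u k)) v.
  split; [by move=> k; exact: DBs|exact: Dv|exact: cBu|exact: cv|].
  move=> f g Df Dg; have := hA (B f) g (DB _ Df) Dg; apply: cvg_ext => n /=.
  by apply: eq_bigr => k _; rewrite hB.
have [t ht] := nuc_tr_ex H (nuc_u NAB) Dv cBu cv.
exists t; last exact: (nuclear_trace H NAB ht).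
by apply: cvg_ext ht => n; apply: eq_bigr => k _; rewrite hB.
Qed.

End NuclearComposition.

Section L2Sequences.
Context {R : realType} {d : measure_display} {T : measurableType d}.
Local Notation C := R[i].
Variable mu : {measure set T -> \bar R}.

Lemma L2_limit (F : nat -> T -> C) f (b : nat -> R) : (forall n, L2 mu (F n)) ->
  (forall x, F ^~ x @ \oo --> f x) -> (forall m p, nrmd (L2dot mu) (F m - F p) <= b m + b p) ->
  b @ \oo --> (0 : R) ->
  L2 mu f /\ (fun n => nsqd (L2dot mu) (F n - f)) @ \oo --> (0 : R).
Proof.
move=> LF cF hb b0; have P := L2_prehilbert mu; apply: L2_complete => // e e0.
have e2 : 0 < Num.sqrt e / 2 by rewrite divr_gt0// sqrtr_gt0.
have /cvgr0Pnorm_le/(_ _ e2)[N _ hN] := b0.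
exists N => m p Nm Np; rewrite -(nrm_sqr P); last exact: (phB P).
rewrite -[leRHS](sqr_sqrtr (ltW e0)) lerXn2r ?nnegrE ?sqrtr_ge0//.
apply: le_trans (hb m p) _; have := hN m Nm; have := hN p Np => /= h1 h2.
have := ler_norm (b m); have := ler_norm (b p); lra.
Qed.

End L2Sequences.

(* A family of operators whose symbols satisfy Moyal's identity on coherent
   states; [quantizer_moyal] extends it to the whole space by density. *)
Section Quantizer.
Context {R : realType} {E : lmodType R[i]} {d : measure_display} {T : measurableType d}.
Local Notation C := R[i].
Context {D : set E} {dot : E -> E -> C} (H : hilbert D dot).
Variables (mu : {measure set T -> \bar R}) (Om : T -> E -> E) (c : R).
Local Notation "'[ f , g ]" := (dot f g) (format "''[' f ,  g ]").
Local Notation nsq := (nsqd dot).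
Local Notation nrm := (nrmd dot).
Local Notation L2d := (L2dot mu).
Hypotheses (Om_op : forall z, is_operator D (Om z))
  (Om_herm : forall z f g, D f -> D g -> '[Om z f, g] = '[f, Om z g])
  (Om_le : forall z f, D f -> nrm (Om z f) <= c * nrm f) (c0 : 0 <= c).
Let P := hb_pre H.
Let PL := L2_prehilbert mu.

Definition qsymb (v u : E) (z : T) : C := '[Om z v, u].
Local Notation S := qsymb.

Let DOm z f : D f -> D (Om z f). Proof. by have [h _] := Om_op z; exact: h. Qed.
Local Hint Resolve DOm : core.

Lemma qsymb_linl (a : C) v w u : D v -> D w -> D u -> S (a *: v + w) u = a *: S v u + S w u.
Proof.
move=> Fv Fw Fu; apply/funext => z; have [_ h] := Om_op z.
rewrite /qsymb h// (ph_lin P) //; exact: DOm.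
Qed.

Lemma qsymb_linr (a : C) v w u : D v -> D w -> D u -> S u (a *: v + w) = a^* *: S u v + S u w.
Proof.
move=> Fv Fw Fu; apply/funext => z; rewrite /qsymb (dotDr P) ?(dotZr P)//; first exact: DOm.
- exact: (phZ P).
- exact: DOm.
Qed.

Lemma qsymb_suml I (r : seq I) (b : I -> C) (F : I -> E) u : (forall i, D (F i)) -> D u ->
  S (\sum_(i <- r) b i *: F i) u = \sum_(i <- r) b i *: S (F i) u.
Proof.
move=> FF Fu; elim: r => [|i r IH].
  by rewrite !big_nil; apply/funext => z; rewrite /qsymb (op0 H (Om_op z)) (dot0l P).
by rewrite !big_cons qsymb_linl// ?IH//; apply: (ph_sum P) => j _; exact: (phZ P).
Qed.

Lemma qsymb_sumr I (r : seq I) (b : I -> C) (F : I -> E) u : (forall i, D (F i)) -> D u ->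
  S u (\sum_(i <- r) b i *: F i) = \sum_(i <- r) (b i)^* *: S u (F i).
Proof.
move=> FF Fu; elim: r => [|i r IH].
  by rewrite !big_nil; apply/funext => z; rewrite /qsymb (dot0r P)//; exact: DOm.
by rewrite !big_cons qsymb_linr// ?IH//; apply: (ph_sum P) => j _; exact: (phZ P).
Qed.

Lemma qsymb_le v u z : D v -> D u -> cab (S v u z) <= c * (nrm v * nrm u).
Proof.
move=> Fv Fu; apply: le_trans (CS P (DOm z Fv) Fu) _.
rewrite mulrA; exact: (ler_wpM2r (nrm_ge0 _ _) (Om_le z Fv)).
Qed.

Lemma qsymb_sym v u z : D v -> D u -> S u v z = (S v u z)^*.
Proof. by move=> Fv Fu; rewrite /qsymb Om_herm// (ph_sym P)//; exact: DOm. Qed.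

Lemma Om_bounded z : bounded_operator D dot (Om z).
Proof.
split; first exact: Om_op.
exists (c ^+ 2) => f Df; rewrite -/(nsq f) -/(nsq (Om z f)) -!(nrm_sqr P)//; last exact: DOm.
rewrite -exprMn lerXn2r ?nnegrE ?nrm_ge0//; last exact: Om_le.
by rewrite mulr_ge0 ?nrm_ge0.
Qed.

Context {I : Type} (k : I -> E).
Hypotheses (Dk : forall a, D (k a)) (moyal_k : forall a1 a2 a3 a4, L2 mu (S (k a1) (k a2)) /\
  L2d (S (k a1) (k a2)) (S (k a3) (k a4)) = '[k a1, k a3] * '[k a2, k a4]^*).

Definition lspan : set E := [set f | exists r : seq (C * I), f = \sum_(p <- r) p.1 *: k p.2].

Lemma lspan_sum J (r : seq J) (b : J -> C) (F : J -> E) : (forall i, lspan (F i)) ->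
  lspan (\sum_(i <- r) b i *: F i).
Proof.
move=> h; elim: r => [|i r [s IH]]; first by rewrite big_nil; exists [::]; rewrite big_nil.
rewrite big_cons IH; have [t ->] := h i; exists ([seq (b i * p.1, p.2) | p <- t] ++ s).
rewrite big_cat big_map scaler_sumr; congr (_ + _).
by apply: eq_bigr => p _; rewrite scalerA.
Qed.

Lemma lspan_B f g : lspan f -> lspan g -> lspan (f - g).
Proof.
move=> Lf Lg; have := @lspan_sum bool [:: true; false] (fun b => if b then 1 else -1) (fun b => if b then f else g).
by rewrite !big_cons big_nil scale1r scaleN1r addr0; apply; case.
Qed.

Lemma lspan_D f : lspan f -> D f.
Proof. by move=> [r ->]; apply: (ph_sum P) => p _; exact: (phZ P). Qed.

Lemma moyal_span f1 f2 f3 f4 : lspan f1 -> lspan f2 -> lspan f3 -> lspan f4 ->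
  L2 mu (S f1 f2) /\ L2d (S f1 f2) (S f3 f4) = '[f1, f3] * '[f2, f4]^*.
Proof.
have Lk a b : L2 mu (S (k a) (k b)) by have [] := moyal_k a b a b.
have FZ (p : C * I) : D (p.1 *: k p.2) by exact: (phZ P).
have Fs (r : seq (C * I)) : D (\sum_(p <- r) p.1 *: k p.2).
  by apply: (ph_sum P) => p _.
have SE (r t : seq (C * I)) : S (\sum_(p <- r) p.1 *: k p.2) (\sum_(q <- t) q.1 *: k q.2) =
    \sum_(p <- r) p.1 *: \sum_(q <- t) (q.1)^* *: S (k p.2) (k q.2).
  by rewrite qsymb_suml//; apply: eq_bigr => p _; rewrite qsymb_sumr.
have Li (t : seq (C * I)) a : L2 mu (\sum_(q <- t) (q.1)^* *: S (k a) (k q.2)).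
  by apply: (ph_sum PL) => q _; exact: (phZ PL).
move=> [r1 ->] [r2 ->] [r3 ->] [r4 ->]; rewrite !SE; split.
  by apply: (ph_sum PL) => p _; exact: (phZ PL).
have Lo (r t : seq (C * I)) : L2 mu (\sum_(p <- r) p.1 *: \sum_(q <- t) (q.1)^* *: S (k p.2) (k q.2)).
  by apply: (ph_sum PL) => p _; exact: (phZ PL).
rewrite (dot_suml PL)//; last by move=> p _; exact: (phZ PL).
rewrite (dot_suml P)//; rewrite mulr_suml; apply: eq_bigr => p1 _.
rewrite (dotZl PL)// (dotZl P)// -mulrA; congr (_ * _).
rewrite (dot_sumr PL)//; last by move=> p _; exact: (phZ PL).
rewrite (dot_sumr P)//; rewrite mulr_suml; apply: eq_bigr => p3 _.
rewrite (dotZr PL)// (dotZr P)// -mulrA; congr (_ * _).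
rewrite (dot_suml PL)//; last by move=> p _; exact: (phZ PL).
rewrite (dot_suml P)// CJ_sum mulr_sumr; apply: eq_bigr => p2 _.
rewrite (dotZl PL)// (dotZl P)// CJM mulrCA; congr (_ * _).
rewrite (dot_sumr PL)//; last by move=> p _; exact: (phZ PL).
rewrite (dot_sumr P)// CJ_sum mulr_sumr; apply: eq_bigr => p4 _.
rewrite (dotZr PL)// (dotZr P)// CJM CJK mulrCA; congr (_ * _).
by have [_ ->] := moyal_k p1.2 p2.2 p3.2 p4.2.
Qed.

Variable e : nat -> E.
Hypotheses (oe : orthonormal_basis D dot e) (ce : forall k, lspan (e k)).
Local Notation proj := (onbproj dot e).

Lemma proj_span m v : lspan (proj m v).
Proof. exact: lspan_sum. Qed.

Lemma qsymb_nrm_span f g : lspan f -> lspan g -> nrmd L2d (S f g) = nrm f * nrm g.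
Proof.
move=> cf cg; have [_ e1] := moyal_span cf cg cf cg.
have Ff := lspan_D cf; have Fg := lspan_D cg.
rewrite /nrmd /nsqd e1 (dot_nsq P Ff) (dot_nsq P Fg) CRJ -CRM /= sqrtrM//.
exact: (nsq_ge0 P).
Qed.

Lemma nrm_proj_cvg v : D v -> (fun m => nrm (proj m v - v)) @ \oo --> (0 : R).
Proof. by move=> Fv; apply: nsq_ncvg; exact: (onb_cvg H oe). Qed.

(** On the span [qsymb_nrm_span] gives the [L2] norm of a symbol exactly, so the symbols of the
    projections are Cauchy; boundedness of the quantizer gives their pointwise limit, which
    identifies the [L2] limit. *)
Lemma qsymb_cvg v u : D v -> D u ->
  L2 mu (S v u) /\ (fun m => nsqd L2d (S (proj m v) (proj m u) - S v u)) @ \oo --> (0 : R).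
Proof.
move=> Fv Fu; have Fp m w : D w -> D (proj m w) by move=> _; exact: (onbproj_D H oe).
pose b m := nrm (proj m v - v) * nrm u + nrm v * nrm (proj m u - u).
have b0 : b @ \oo --> (0 : R).
  have h1 := nrm_proj_cvg Fv; have h2 := nrm_proj_cvg Fu.
  have h3 : (fun m => nrm (proj m v - v) * nrm u) @ \oo --> (0 * nrm u : R).
    exact: (cvgM h1 (cvg_cst _)).
  have h4 : (fun m => nrm v * nrm (proj m u - u)) @ \oo --> (nrm v * 0 : R).
    exact: (cvgM (cvg_cst _) h2).
  have := cvgD h3 h4; rewrite mul0r mulr0 addr0; exact.
have subl f g h : D f -> D g -> D h -> S (f - g) h = S f h - S g h.
  by move=> Ff Fg Fh; rewrite addrC -scaleN1r qsymb_linl// scaleN1r addrC.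
have subr f g h : D f -> D g -> D h -> S h (f - g) = S h f - S h g.
  by move=> Ff Fg Fh; rewrite addrC -scaleN1r qsymb_linr// CJN CJ1 scaleN1r addrC.
apply: (@L2_limit _ _ _ _ _ _ b) => //.
- by move=> m; have [] := moyal_span (proj_span m v) (proj_span m u) (proj_span m v) (proj_span m u).
- move=> z; apply: (@cvg0C_le _ _ _ _ _ _ (fun m => c * b m)) => [m|].
    have -> : S (proj m v) (proj m u) z - S v u z = S (proj m v - v) (proj m u) z + S v (proj m u - u) z.
      by rewrite (subl _ _ _ (Fp m v Fv) Fv (Fp m u Fu)) (subr _ _ _ (Fp m u Fu) Fu Fv) !fctE addrA subrK.
    apply: le_trans (cabD _ _) _; rewrite /b mulrDr; apply: lerD.
      apply: le_trans (qsymb_le _ _ _) _ => //; [by apply: (phB P) => //; exact: Fp|exact: Fp|].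
      by rewrite ler_wpM2l// ler_wpM2l ?nrm_ge0// (nrm_onbproj H oe).
    by apply: qsymb_le => //; apply: (phB P) => //; exact: Fp.
  by rewrite -(mulr0 c); apply: cvgM => //; exact: cvg_cst.
- move=> m p; have cB w := lspan_B (proj_span m w) (proj_span p w).
  have -> : S (proj m v) (proj m u) - S (proj p v) (proj p u) =
     S (proj m v - proj p v) (proj m u) + S (proj p v) (proj m u - proj p u).
    by rewrite (subl _ _ _ (Fp m v Fv) (Fp p v Fv) (Fp m u Fu)) (subr _ _ _ (Fp m u Fu) (Fp p u Fu) (Fp p v Fv)) addrA subrK.
  apply: le_trans (nrmD PL _ _) _.
  + by have [] := moyal_span (cB v) (proj_span m u) (cB v) (proj_span m u).
  + by have [] := moyal_span (proj_span p v) (cB u) (proj_span p v) (cB u).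
  rewrite (qsymb_nrm_span (cB v) (proj_span m u)) (qsymb_nrm_span (proj_span p v) (cB u)).
  have tri w : D w -> nrm (proj m w - proj p w) <= nrm (proj m w - w) + nrm (proj p w - w).
    move=> Fw; rewrite -[nrm (proj p w - w)](nrmN P); last by apply: (phB P) => //; exact: Fp.
    have -> : proj m w - proj p w = (proj m w - w) + - (proj p w - w) by rewrite opprB addrA subrK.
    apply: (nrmD P); last apply: (phN P); by apply: (phB P) => //; exact: Fp.
  have t1 := tri v Fv; have t2 := tri u Fu.
  have n1 := nrm_onbproj H oe m Fu; have n2 := nrm_onbproj H oe p Fv.
  rewrite /b.
  apply: le_trans (lerD (ler_wpM2l (nrm_ge0 _ _) n1) (ler_wpM2r (nrm_ge0 _ _) n2)) _.
  apply: le_trans (lerD (ler_wpM2r (nrm_ge0 _ _) t1) (ler_wpM2l (nrm_ge0 _ _) t2)) _.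
  by rewrite le_eqVlt; apply/orP; left; apply/eqP; ring.
Qed.

Theorem quantizer_moyal v u v' u' : D v -> D u -> D v' -> D u' ->
  L2 mu (S v u) /\ L2d (S v u) (S v' u') = '[v, v'] * '[u, u']^*.
Proof.
move=> Fv Fu Fv' Fu'; have [L1 c1] := qsymb_cvg Fv Fu; have [L2' c2] := qsymb_cvg Fv' Fu'.
split => //.
have Fp m w : D (proj m w) by exact: (onbproj_D H oe).
have Lp m f g : L2 mu (S (proj m f) (proj m g)).
  by have [] := moyal_span (proj_span m f) (proj_span m g) (proj_span m f) (proj_span m g).
have key p : L2d (S v u) (S (proj p v') (proj p u')) = '[v, proj p v'] * '[u, proj p u']^*.
  apply: (cvg_uniqueC (ncvg_dot PL (fun m => Lp m v u) L1 (Lp p v' u') c1)).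
  have h1 := ncvg_dot P (Fp ^~ v) Fv (Fp p v') (onb_cvg H oe Fv).
  have h2 := cvgJn (ncvg_dot P (Fp ^~ u) Fu (Fp p u') (onb_cvg H oe Fu)).
  have h3 : (fun m => '[proj m v, proj p v'] * '[proj m u, proj p u']^*) @ \oo -->
      '[v, proj p v'] * '[u, proj p u']^* by exact: (cvgM h1 h2).
  apply: cvg_ext h3 => m.
  by have [_ ->] := moyal_span (proj_span m v) (proj_span m u) (proj_span p v') (proj_span p u').
apply: (cvg_uniqueC (ncvg_dotr PL (fun m => Lp m v' u') L2' L1 c2)).
have h1 := ncvg_dotr P (Fp ^~ v') Fv' Fv (onb_cvg H oe Fv').
have h2 := cvgJn (ncvg_dotr P (Fp ^~ u') Fu' Fu (onb_cvg H oe Fu')).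
have h3 : (fun m => '[v, proj m v'] * '[u, proj m u']^*) @ \oo --> '[v, v'] * '[u, u']^*.
  exact: (cvgM h1 h2).
by apply: cvg_ext h3 => m; rewrite key.
Qed.

Definition qW (A : E -> E) (z : T) : C := trace_op D dot (A \o Om z).

Lemma qW_series A u v z : nuclear (D := D) (dot := dot) A u v ->
  series (fun j => S (v j) (u j) z) @ \oo --> qW A z /\ is_trace D dot (A \o Om z) (qW A z).
Proof.
move=> N; have [t h1 h2] := nuclear_comp H oe N (Om_bounded z).
by rewrite /qW (trace_opE oe h2).
Qed.

Lemma nuclear_adjoint A B u v : nuclear (D := D) (dot := dot) A u v ->
  is_adjoint D dot D dot A B -> nuclear (D := D) (dot := dot) B v u.
Proof.
move=> [Du Dv cu cv hA] [DB hB]; split; [exact: Dv|exact: Du|exact: cv|exact: cu|] => f g Df Dg.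
rewrite (ph_sym P (f := g))//; last exact: DB.
rewrite -hB//; have := cvgJn (hA g f Dg Df); apply: cvg_ext => m.
rewrite /series/= CJ_sum; apply: eq_bigr => j _.
by rewrite CJM -!(ph_sym P)// mulrC.
Qed.

Lemma qW_adjoint A B u v z : nuclear (D := D) (dot := dot) A u v ->
  is_adjoint D dot D dot A B -> qW B z = (qW A z)^*.
Proof.
move=> N adj; have [h1 _] := qW_series z N; have [h2 _] := qW_series z (nuclear_adjoint N adj).
apply: (cvg_uniqueC h2); apply: cvg_ext (cvgJn h1) => m.
rewrite /series/= CJ_sum; apply: eq_bigr => j _.
by rewrite -qsymb_sym//; [exact: (nuc_v N)|exact: (nuc_u N)].
Qed.

Lemma qW_lin (a : C) A B u v u' v' : nuclear (D := D) (dot := dot) A u v ->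
  nuclear (D := D) (dot := dot) B u' v' -> is_operator D A -> is_operator D B ->
  qW (a *: A + B) = a *: qW A + qW B.
Proof.
move=> NA NB [oA _] [oB _]; apply/funext => z; apply: (trace_opE oe) => e' oe'.
have [_ /(_ _ oe') h1] := qW_series z NA; have [_ /(_ _ oe') h2] := qW_series z NB.
have h3 : (fun m => a * series (fun j => '[(A \o Om z) (e' j), e' j]) m + series (fun j => '[(B \o Om z) (e' j), e' j]) m) @ \oo --> a * qW A z + qW B z.
  exact: (cvgD (cvgMlC (c := a) h1) h2).
apply: cvg_ext h3 => m.
rewrite /series/= mulr_sumr -big_split/=; apply: eq_bigr => j _.
have De := onbD oe' j.
by rewrite (ph_lin P)//; [exact/oA/DOm|exact/oB/DOm].
Qed.

Lemma qW_ext A B : (forall f, D f -> A f = B f) -> qW A = qW B.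
Proof.
move=> h; apply/funext => z; congr (xget _ _).
apply/seteqP; split => t ht e' oe'; have := ht e' oe'; apply: cvg_ext => m;
  apply: eq_bigr => j _; have De := onbD oe' j; rewrite /= h//; exact: DOm.
Qed.

Lemma qW_unitary U Ui A u v z z' : nuclear (D := D) (dot := dot) A u v ->
  is_operator D A ->
  (forall f, D f -> D (U f)) -> (forall f, D f -> D (Ui f)) ->
  (forall f g, D f -> D g -> '[U f, g] = '[f, Ui g]) ->
  (forall f g, D f -> D g -> '[U f, U g] = '[f, g]) ->
  (forall f, D f -> Om z (U f) = U (Om z' f)) ->
  nuclear (D := D) (dot := dot) (U \o A \o Ui) (fun j => U (u j)) (fun j => U (v j)) /\
  qW (U \o A \o Ui) z = qW A z'.
Proof.
move=> N [oA _] DU DUi UUi UU UOm; have [Du Dv cu cv hA] := N.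
have nU f : D f -> nsq (U f) = nsq f by move=> Df; rewrite /nsqd UU.
have N' : nuclear (D := D) (dot := dot) (U \o A \o Ui) (fun j => U (u j)) (fun j => U (v j)).
  split; [by move=> j; exact: DU|by move=> j; exact: DU| | |].
  - by rewrite (_ : (fun j => _) = fun j => nsq (u j))//; apply/funext => j; rewrite nU.
  - by rewrite (_ : (fun j => _) = fun j => nsq (v j))//; apply/funext => j; rewrite nU.
  - move=> f g Df Dg /=; rewrite UUi//; last exact/oA/DUi.
    have := hA (Ui f) (Ui g) (DUi _ Df) (DUi _ Dg); apply: cvg_ext => m.
    apply: eq_bigr => j _; rewrite -UUi//; congr (_ * _).
    by rewrite (ph_sym P (f := U (u j)))// ?UUi//; [rewrite -(ph_sym P)//; exact: DUi|exact: DU].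
split => //; have [h1 _] := qW_series z N'; have [h2 _] := qW_series z' N.
apply: (cvg_uniqueC h1); apply: cvg_ext h2 => m.
by apply: eq_bigr => j _; rewrite /qsymb UOm// UU//; exact: DOm.
Qed.

(** The symbol of a nuclear operator is a series of rank-one symbols of [L2] norms [|v_j| |u_j|],
    which are summable. *)
Lemma qW_L2 A u v : nuclear (D := D) (dot := dot) A u v -> L2 mu (qW A) /\
  (fun N => nsqd L2d (\sum_(0 <= j < N) S (v j) (u j) - qW A)) @ \oo --> (0 : R).
Proof.
move=> N; have [Du Dv cu cv _] := N.
have LS j : L2 mu (S (v j) (u j)) by have [] := quantizer_moyal (Dv j) (Du j) (Dv j) (Du j).
pose t := series (fun j => nrm (v j) * nrm (u j)).
have ct : cvgn t := nrmM_cvg H Dv Du cv cu.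
have nt : nondecreasing_seq t.
  by apply: nondecreasing_series => j _ _; rewrite mulr_ge0 ?nrm_ge0.
have tl m : t m <= limn t by exact: nondecreasing_cvgn_le.
have nS j : nrmd L2d (S (v j) (u j)) = nrm (v j) * nrm (u j).
  have [_ e1] := quantizer_moyal (Dv j) (Du j) (Dv j) (Du j).
  rewrite /nrmd /nsqd e1 (dot_nsq P (Dv j)) (dot_nsq P (Du j)) CRJ -CRM /= sqrtrM//.
  exact: (nsq_ge0 P).
have LF m p : L2 mu (\sum_(m <= j < p) S (v j) (u j)) by exact: (ph_sum PL).
have nF m p : (m <= p)%N -> nrmd L2d (\sum_(m <= j < p) S (v j) (u j)) <= t p - t m.
  move=> mp; have -> : t p - t m = \sum_(m <= j < p) nrm (v j) * nrm (u j).
    by rewrite /t /series/= (big_cat_nat (leq0n m) mp)/= addrAC subrr add0r.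
  have n0 : nrmd L2d 0 = 0 by rewrite /nrmd /nsqd (dot0l PL (ph0 PL)) /= sqrtr0.
  elim: p mp => [|p IH] mp; first by rewrite !big_geq// n0.
  move: mp; rewrite leq_eqVlt => /orP[/eqP->|mp].
    by rewrite !big_geq// n0.
  rewrite !big_nat_recr//=; apply: le_trans (nrmD PL (LF _ _) (LS _)) _.
  by rewrite nS lerD2r IH.
apply: (@L2_limit _ _ _ _ _ _ (fun m => limn t - t m)) => //.
- move=> z; have [h _] := qW_series z N; apply: cvg_ext h => m.
  by rewrite /series/= fct_sumE.
- move=> m p; wlog mp : m p / (p <= m)%N => [hw|].
    have [pm|/ltnW mp] := leqP p m; first exact: hw.
    rewrite [leRHS]addrC -[X in nrmd _ X]opprB (nrmN PL); [exact: hw|exact: (phB PL)].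
  have -> : \sum_(0 <= j < m) S (v j) (u j) - \sum_(0 <= j < p) S (v j) (u j) = \sum_(p <= j < m) S (v j) (u j).
    by rewrite (big_cat_nat (leq0n p) mp)/= addrAC subrr add0r.
  by apply: le_trans (nF _ _ mp) _; have := tl m; have := tl p; lra.
- have h : (fun m => limn t - t m) @ \oo --> limn t - limn t by exact: (cvgB (cvg_cst _) ct).
  by rewrite subrr in h.
Qed.

(** The conjugate of the symbol of [B] is the symbol of its adjoint, so the bilinear integral
    becomes an inner product. Expanding both symbols, [quantizer_moyal] gives the terms
    [<v_j, u'_i> <v'_i, u_j>]; their sum over [i] is [<B v_j, u_j>], and the sum of these is the
    trace. *)
Theorem qW_trace A B u v u' v' : nuclear (D := D) (dot := dot) A u v ->
  nuclear (D := D) (dot := dot) B u' v' -> bounded_operator D dot B ->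
  [/\ L2 mu (qW A), L2 mu (qW B), is_trace D dot (A \o B) (L2d (qW A) (fun z => (qW B z)^*)) &
    series (fun j => '[B (v j), u j]) @ \oo --> L2d (qW A) (fun z => (qW B z)^*)].
Proof.
move=> NA NB bB; have [Bs adj] := adjoint_exists H oe bB.
have NBs := nuclear_adjoint NB adj.
have -> : (fun z => (qW B z)^*) = qW Bs by apply/funext => z; rewrite (qW_adjoint z NB adj).
have [LA cA] := qW_L2 NA; have [LB cB] := qW_L2 NBs; have [LB' _] := qW_L2 NB.
have [Du Dv _ _ _] := NA; have [Du' Dv' _ _ hB] := NB.
have [[DB _] _] := bB.
have [t h1 h2] := nuclear_comp H oe NA bB.
suff -> : L2d (qW A) (qW Bs) = t by [].
have LS f g : D f -> D g -> L2 mu (S f g) by move=> Df Dg; have [] := quantizer_moyal Df Dg Df Dg.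
have LF N : L2 mu (\sum_(0 <= j < N) S (v j) (u j)) by apply: (ph_sum PL) => j _; exact: LS.
have LG N : L2 mu (\sum_(0 <= j < N) S (u' j) (v' j)) by apply: (ph_sum PL) => j _; exact: LS.
apply: (cvg_uniqueC (ncvg_dot PL LF LA LB cA)); apply: cvg_ext h1 => N.
apply/esym; apply: (cvg_uniqueC (ncvg_dotr PL LG LB (LF N) cB)).
have := cvg_sumC (K := N) (fun j => hB _ _ (Dv j) (Du j)); apply: cvg_ext => M.
rewrite (dot_suml PL)//; last by move=> j _; exact: LS.
apply: eq_bigr => j _; rewrite (dot_sumr PL)//; [|by move=> i _; exact: LS|exact: LS].
apply: eq_bigr => i _; have [_ ->] := quantizer_moyal (Dv j) (Du j) (Du' i) (Dv' i).
by rewrite -(ph_sym P).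
Qed.

End Quantizer.

(** * Tensor products with a finite-dimensional space *)

Section ProductIntegral.
Context {R : realType} {d1 d2 : measure_display} {T1 : measurableType d1} {T2 : measurableType d2}.
Local Notation C := R[i].
Variables (m1 : {measure set T1 -> \bar R}) (s1 : sigma_finite [set: T1] m1).
Variables (m2 : {sigma_finite_measure set T2 -> \bar R}).

Lemma cintegral_product (f : T1 -> C) (g : T2 -> C) : cintegrable m1 f -> cintegrable m2 g ->
  cintegrable (m1 \x m2)%E (fun p => f p.1 * g p.2) /\
  cintegral (m1 \x m2)%E (fun p => f p.1 * g p.2) = cintegral m1 f * cintegral m2 g.
Proof.
move=> fi gi; have If := cintegrable_cab fi; have Ig := cintegrable_cab gi.
have [||x|y|h1 h2 _] := @cfubini _ _ _ _ _ _ s1 m2 (fun p => f p.1 * g p.2).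
- apply: cmeasurableM.
    by apply: (cmeasurable_comp (f := f)); [exact: measurable_fst|exact: (cintegrable_meas fi)].
  by apply: (cmeasurable_comp (f := g)); [exact: measurable_snd|exact: (cintegrable_meas gi)].
- pose J := (\int[m2]_y cab (g y))%R.
  have e1 x : (\int[m2]_y (cab (f x * g y))%:E = (J * cab (f x))%:E)%E.
    under eq_integral => y _ do rewrite cabM EFinM.
    rewrite integralZl//.
    rewrite mulrC EFinM; congr (_ * _)%E.
    by rewrite /J /Rintegral fineK//; exact: (integrable_fin_num measurableT Ig).
  under eq_integral => x _ do rewrite /= e1.
  by have /integrable_lty := integrableZl_fin J If; apply.
- exact: (cintegrableZ (f x) gi).
- by have := cintegrableZ (g y) fi; congr cintegrable; apply/funext => z; rewrite mulrC.
- split => //; rewrite h2.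
  under [in LHS]eq_cintegral => x do rewrite /= (cintegralZ _ gi) mulrC.
  by rewrite cintegralZ// mulrC.
Qed.

End ProductIntegral.

(** * Orthogonal sums of copies of a Hilbert space and their block operators *)

Section HilbertSum.
Context {R : realType} {E F : lmodType R[i]}.
Local Notation C := R[i].
Context {D : set E} {dot : E -> E -> C} (H : hilbert D dot).
Context {DF : set F} {dotF : F -> F -> C} {m : nat}.
Variables (comp : 'I_m -> F -> E) (tens : 'I_m -> E -> F).

(** [F] as the tensor product of [E] with an [m]-dimensional space carrying an orthonormal basis:
    [comp i] takes the coefficient at the [i]-th basis vector, [tens i] tensors with it. *)
Record hilbert_sum : Prop := HilbertSum {
  hs_dom : forall (a : C) f g, DF f -> DF g -> DF (a *: f + g);
  hs_compD : forall i f, DF f -> D (comp i f);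
  hs_compL : forall i (a : C) f g, DF f -> DF g -> comp i (a *: f + g) = a *: comp i f + comp i g;
  hs_tensD : forall i f, D f -> DF (tens i f);
  hs_tensL : forall i (a : C) f g, D f -> D g -> tens i (a *: f + g) = a *: tens i f + tens i g;
  hs_compK : forall i j f, D f -> comp i (tens j f) = (i == j)%:R *: f;
  hs_tensK : forall f, DF f -> f = \sum_i tens i (comp i f);
  hs_dotF : forall f g, DF f -> DF g -> dotF f g = \sum_i dot (comp i f) (comp i g) }.

Hypothesis (S : hilbert_sum) (m0 : (0 < m)%N).
Let P := hb_pre H.
Local Notation nsq := (nsqd dot).

Let i0 : 'I_m := Ordinal m0.
Let cD := hs_compD S.
Let tD := hs_tensD S.

Lemma hs_tens0 i : tens i 0 = 0.
Proof.
have h := hs_tensL S i 1 (ph0 P) (ph0 P); rewrite scaler0 addr0 scale1r in h.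
by apply: (addrI (tens i 0)); rewrite addr0 -h.
Qed.

Lemma hs_DF0 : DF 0.
Proof. by rewrite -(hs_tens0 i0); apply: tD; exact: (ph0 P). Qed.

Lemma hs_prehilbert : prehilbert DF dotF.
Proof.
split; [exact: hs_DF0|exact: (hs_dom S)| | |].
- move=> a f g h Df Dg Dh; have Dfg := hs_dom S a Df Dg.
  rewrite !(hs_dotF S)// mulr_sumr -big_split; apply: eq_bigr => i _ /=.
  by rewrite (hs_compL S)// (ph_lin P)//; exact: cD.
- move=> f g Df Dg; rewrite !(hs_dotF S)// CJ_sum; apply: eq_bigr => i _.
  by rewrite (ph_sym P)//; exact: cD.
- by move=> f Df; rewrite (hs_dotF S)//; apply: sumr_ge0 => i _; apply: (ph_ge0 P); exact: cD.
Qed.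
Local Notation PF := hs_prehilbert.

Lemma hs_compB i f g : DF f -> DF g -> comp i (f - g) = comp i f - comp i g.
Proof.
by move=> Df Dg; rewrite addrC -scaleN1r (hs_compL S)// scaleN1r addrC.
Qed.

Lemma hs_tens_sum i (h : 'I_m -> E) : (forall j, D (h j)) -> tens i (\sum_j h j) = \sum_j tens i (h j).
Proof.
move=> Dh; suff [] : D (\sum_j h j) /\ tens i (\sum_j h j) = \sum_j tens i (h j) by [].
elim/big_rec2: _ => [|j x y _ [Dx ex]]; first by split; [exact: (ph0 P)|exact: hs_tens0].
have := hs_tensL S i 1 (Dh j) Dx; rewrite !scale1r => ->.
by rewrite ex; split => //; exact: (phD P).
Qed.

Lemma hs_comp_sum i (h : 'I_m -> F) : (forall j, DF (h j)) -> comp i (\sum_j h j) = \sum_j comp i (h j).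
Proof.
move=> Dh; suff [] : DF (\sum_j h j) /\ comp i (\sum_j h j) = \sum_j comp i (h j) by [].
elim/big_rec2: _ => [|j x y _ [Dx ex]].
  by split; [exact: hs_DF0|have := hs_compB i hs_DF0 hs_DF0; rewrite !subrr].
have := hs_compL S i 1 (Dh j) Dx; rewrite !scale1r => ->.
by rewrite ex; split => //; exact: (phD PF).
Qed.

Lemma hs_nsq f : DF f -> nsqd dotF f = \sum_i nsq (comp i f).
Proof. by move=> Df; rewrite /nsqd (hs_dotF S)// Re_sum. Qed.

Lemma hs_nsq_le i f : DF f -> nsq (comp i f) <= nsqd dotF f.
Proof.
move=> Df; rewrite hs_nsq// (bigD1 i)//= lerDl; apply: sumr_ge0 => j _.
by apply: (nsq_ge0 P); exact: cD.
Qed.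

Lemma hs_dot_tens i f g : DF f -> D g -> dotF f (tens i g) = dot (comp i f) g.
Proof.
move=> Df Dg; rewrite (hs_dotF S)//; last exact: tD.
rewrite (bigD1 i)//= (hs_compK S)// eqxx scale1r big1 ?addr0// => j ji.
by rewrite (hs_compK S)// (negbTE ji) scale0r (dot0r P)//; exact: cD.
Qed.

Lemma hs_tens_dot i f g : DF f -> D g -> dotF (tens i g) f = dot g (comp i f).
Proof.
by move=> Df Dg; rewrite (ph_sym PF Df (tD i Dg)) hs_dot_tens// -(ph_sym P)//; exact: cD.
Qed.

Lemma hs_hilbert : hilbert DF dotF.
Proof.
split; first exact: PF.
- move=> f Df f0; rewrite (hs_tensK S Df) big1// => i _.
  rewrite (hb_def H (cD i Df)) ?hs_tens0//; apply/eqP.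
  by rewrite eq_le (nsq_ge0 P (cD i Df)) andbT -f0 hs_nsq_le.
- move=> u Du cu; have [|g hg] := @choice _ _ (fun i g => D g /\ (fun k => nsq (comp i (u k) - g)) @ \oo --> (0 : R)).
    move=> i; have [||g Dg hg] := @hb_cplt _ _ _ _ H (fun k => comp i (u k)).
    + by move=> k; exact: cD.
    + move=> e e0; have [N hN] := cu e e0; exists N => a b Na Nb.
      by apply: le_trans (hN a b Na Nb); rewrite -hs_compB//; apply: hs_nsq_le; exact: (phB PF).
    + by exists g.
  have Dt i : DF (tens i (g i)) by apply: tD; have [] := hg i.
  have Df : DF (\sum_i tens i (g i)) by apply: (ph_sum PF) => i _.
  exists (\sum_i tens i (g i)) => //.
  have -> : (fun k => nsqd dotF (u k - \sum_i tens i (g i))) =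
      fun k => \sum_(i <- index_enum 'I_m) nsq (comp i (u k) - g i).
    apply/funext => k; rewrite hs_nsq; last exact: (phB PF).
    apply: eq_bigr => i _; rewrite hs_compB//; congr (nsq (_ - _)).
    have Dg j : D (g j) by have [] := hg j.
    rewrite hs_comp_sum// (bigD1 i)//= (hs_compK S)// eqxx scale1r big1 ?addr0// => j ji.
    by rewrite (hs_compK S)// eq_sym (negbTE ji) scale0r.
  rewrite -[X in _ --> X](_ : \sum_(i <- index_enum 'I_m) (0 : R) = 0); last by rewrite big1.
  by apply: cvg_sum_seq => i; have [] := hg i.
Qed.

(** Euclidean division by [m] enumerates the pairs of a basis index of [E] and a copy. *)
Lemma hs_basis e : orthonormal_basis D dot e -> orthonormal_basis DF dotF
  (fun k => tens (Ordinal (ltn_pmod k m0)) (e (k %/ m)%N)).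
Proof.
move=> oe; have De := onbD oe; have [_ oo tot] := oe; split.
- by move=> k; exact: tD.
- move=> j k; rewrite hs_dot_tens//; last exact: tD.
  rewrite (hs_compK S)// (dotZl P)// oo -natrM mulnb; congr (_%:R); congr nat_of_bool.
  apply/andP/eqP => [[/eqP[h1] /eqP h2]|->]; last by rewrite !eqxx.
  by rewrite (divn_eq j m) (divn_eq k m) h2 h1.
- move=> f Df h; rewrite (hs_tensK S Df) big1// => i _.
  rewrite (tot (comp i f)) ?hs_tens0//; first exact: cD.
  move=> k; have := h (k * m + i)%N; rewrite hs_dot_tens//.
  rewrite divnMDl// (divn_small (ltn_ord i)) addn0; congr (dot (comp _ _) _ = _).
  by apply: val_inj => /=; rewrite modnMDl modn_small.
Qed.

Definition block (A : F -> F) (i j : 'I_m) : E -> E := comp i \o A \o tens j.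

Lemma block_op A i j : is_operator DF A -> is_operator D (block A i j).
Proof.
move=> [DA lA]; split => [f Df|a f g Df Dg]; first by apply/cD/DA/tD.
have Df' := tD j Df; have Dg' := tD j Dg.
by rewrite /block/= (hs_tensL S)// lA// (hs_compL S)//; exact: DA.
Qed.

Lemma block_nuclear A i j u v : is_operator DF A -> nuclear (D := DF) (dot := dotF) A u v ->
  nuclear (D := D) (dot := dot) (block A i j) (fun k => comp j (u k)) (fun k => comp i (v k)).
Proof.
move=> [DA lA] [Du Dv cu cv hA].
have sub (w : nat -> F) l : (forall k, DF (w k)) -> cvgn (series (fun k => nsqd dotF (w k))) ->
    cvgn (series (fun k => nsq (comp l (w k)))).
  move=> Dw cw; apply: (@series_le_cvg _ _ (fun k => nsqd dotF (w k))) => // k.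
  - by apply: (nsq_ge0 P); exact: cD.
  - exact: hs_nsq_le.
split; [by move=> k; exact: cD|by move=> k; exact: cD|exact: sub|exact: sub|].
move=> f g Df Dg; have Df' := tD j Df; have Dg' := tD i Dg.
rewrite /block/= -hs_dot_tens//; last exact: DA.
have := hA _ _ Df' Dg'; apply: cvg_ext => n; apply: eq_bigr => k _.
by rewrite hs_tens_dot// hs_dot_tens.
Qed.

Lemma blockK A f : is_operator DF A -> DF f -> A f = \sum_i \sum_j tens i (block A i j (comp j f)).
Proof.
move=> oA Df; have [DA _] := oA; have HF := hs_hilbert.
have Dt j : DF (tens j (comp j f)) by apply/tD/cD.
rewrite [LHS](hs_tensK S (DA _ Df)); apply: eq_bigr => i _.
rewrite -hs_tens_sum; last by move=> j; apply/cD/DA.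
congr (tens i _); rewrite {1}(hs_tensK S Df) (op_sum HF _ oA)// hs_comp_sum//.
by move=> j; exact: DA.
Qed.

End HilbertSum.

Section TensorSymbol.
Context {R : realType} {E F : lmodType R[i]}.
Context {d1 d2 : measure_display} {T1 : measurableType d1} {T2 : measurableType d2}.
Local Notation C := R[i].
Context {D : set E} {dot : E -> E -> C} (H : hilbert D dot).
Context {DF : set F} {dotF : F -> F -> C} {m : nat} (m0 : (0 < m)%N).
Variables (comp : 'I_m -> F -> E) (tens : 'I_m -> E -> F).
Hypothesis S : hilbert_sum (D := D) (dot := dot) (DF := DF) (dotF := dotF) comp tens.
Variables (mu : {measure set T1 -> \bar R}) (smu : sigma_finite [set: T1] mu) (Om : T1 -> E -> E) (c : R).
Variable nu : {sigma_finite_measure set T2 -> \bar R}.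
Hypotheses (Om_op : forall z, is_operator D (Om z))
  (Om_herm : forall z f g, D f -> D g -> dot (Om z f) g = dot f (Om z g))
  (Om_le : forall z f, D f -> nrmd dot (Om z f) <= c * nrmd dot f) (c0 : 0 <= c).
Context {I : Type} (k : I -> E).
Hypotheses (Dk : forall a, D (k a)) (moyal_k : forall a1 a2 a3 a4,
  L2 mu (qsymb (dot := dot) Om (k a1) (k a2)) /\
  L2dot mu (qsymb (dot := dot) Om (k a1) (k a2)) (qsymb (dot := dot) Om (k a3) (k a4)) =
    dot (k a1) (k a3) * (dot (k a2) (k a4))^*).
Variable e : nat -> E.
Hypotheses (oe : orthonormal_basis D dot e) (ce : forall j, lspan k (e j)).
Variable G : 'I_m -> 'I_m -> T2 -> C.
Hypotheses (LG : forall i j, L2 nu (G i j)) (GJ : forall i j x, (G i j x)^* = G j i x)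
  (G_onb : forall i j i' j', L2dot nu (G i j) (G i' j') = ((i == i') && (j == j'))%:R).
Local Notation qW := (qW (D := D) (dot := dot) Om).
Local Notation block := (block comp tens).
Local Notation tc := (trace_class DF dotF).
Let P := hb_pre H.
Let HF := hs_hilbert H S m0.
Let PF := hb_pre HF.
Let oF := hs_basis H S m0 oe.

Lemma qW_sum (J : Type) (r : seq J) (b : J -> C) (A : J -> E -> E) (u v : J -> nat -> E) z :
  (forall j, nuclear (D := D) (dot := dot) (A j) (u j) (v j)) -> (forall j, is_operator D (A j)) ->
  qW (fun f => \sum_(j <- r) b j *: A j f) z = \sum_(j <- r) b j * qW (A j) z.
Proof.
move=> NA oA; have DOm f : D f -> D (Om z f) by have [h _] := Om_op z; exact: h.
apply: (trace_opE oe) => e' oe'; have De := onbD oe'.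
have h : (fun N => \sum_(j <- r) b j * series (fun i => dot (A j (Om z (e' i))) (e' i)) N) @ \oo -->
    \sum_(j <- r) b j * qW (A j) z.
  apply: cvg_sum_seq => j; apply: cvgMlC.
  by have [_ h] := qW_series H Om_op Om_le c0 oe z (NA j); exact: (h e' oe').
apply: cvg_ext h => N; rewrite /series/=.
under eq_bigr => j _ do rewrite mulr_sumr.
rewrite exchange_big/=; apply: eq_bigr => i _.
have DA j : D (A j (Om z (e' i))) by have [h _] := oA j; apply/h/DOm.
rewrite (dot_suml P)//; last by move=> j _; exact: (phZ P).
by apply: eq_bigr => j _; rewrite (dotZl P).
Qed.

Lemma tc_op A : tc A -> is_operator DF A. Proof. by case=> [[]]. Qed.

Lemma tc_nuclear A : tc A -> exists u v, nuclear (D := DF) (dot := dotF) A u v.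
Proof. exact: (trace_class_nuclear HF). Qed.

(** Sums, adjoints and lifts of trace-class operators are handled on the right-hand side. *)
Lemma tc_wnuclear A : tc A <-> wnuclear (D := DF) (dot := dotF) A.
Proof.
split=> [tA|]; last exact: (wnuclear_trace_class HF oF).
by have [u [v N]] := tc_nuclear tA; apply: (nuclear_wnuclear HF _ N); have [] := tA.
Qed.

Lemma tc_lin (a : C) A B : tc A -> tc B -> tc (a *: A + B).
Proof. by move=> /tc_wnuclear hA /tc_wnuclear hB; apply/tc_wnuclear; exact: (wnuclear_lin HF). Qed.

Lemma block_bounded A i j : bounded_operator DF dotF A -> bounded_operator D dot (block A i j).
Proof.
move=> [oA [M hM]]; split; first exact: (block_op S).
have [DA _] := oA; exists `|M| => f Df; have Dt := hs_tensD S j Df.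
apply: le_trans (hs_nsq_le H S i (DA _ Dt)) _; apply: le_trans (hM _ Dt) _.
rewrite (hs_dot_tens H S)// (hs_compK S)// eqxx scale1r.
by rewrite ler_wpM2r ?ler_norm//; exact: (nsq_ge0 P).
Qed.

Lemma block_tc A i j : tc A -> trace_class D dot (block A i j).
Proof.
move=> tA; have [u [v N]] := tc_nuclear tA; have [bA _] := tA.
apply: (wnuclear_trace_class H oe); apply: (nuclear_wnuclear H _ (block_nuclear H S m0 i j (tc_op tA) N)).
exact: block_bounded.
Qed.

Definition lift i j (B : E -> E) : F -> F := tens i \o B \o comp j.

Lemma lift_tc i j B : trace_class D dot B -> tc (lift i j B).
Proof.
move=> tB; have [u [v N]] := trace_class_nuclear H tB; have [[[DB lB] [M hM]] _] := tB.
have [Du Dv cu cv hB] := N.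
have oL : is_operator DF (lift i j B).
  split => [f Df|a f g Df Dg]; first by apply/(hs_tensD S)/DB/(hs_compD S).
  have Df' := hs_compD S j Df; have Dg' := hs_compD S j Dg.
  by rewrite /lift/= (hs_compL S)// lB// (hs_tensL S)//; exact: DB.
have nt l f : D f -> nsqd dotF (tens l f) = nsqd dot f.
  move=> Df; rewrite /nsqd (hs_dot_tens H S)//; last exact: (hs_tensD S).
  by rewrite (hs_compK S)// eqxx scale1r.
apply/tc_wnuclear; apply: (nuclear_wnuclear HF (u := fun l => tens j (u l)) (v := fun l => tens i (v l))).
  split => //; exists `|M| => f Df; have Dc := hs_compD S j Df.
  rewrite -/(nsqd dotF (lift i j B f)) nt; last exact: DB.
  apply: le_trans (hM _ Dc) _; apply: (@le_trans _ _ (`|M| * nsqd dot (comp j f))).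
    by rewrite ler_wpM2r ?ler_norm//; exact: (nsq_ge0 P).
  by rewrite ler_wpM2l//; exact: (hs_nsq_le H S).
split; [by move=> l; exact: (hs_tensD S)|by move=> l; exact: (hs_tensD S)| | |].
- by rewrite (_ : (fun l => _) = fun l => nsqd dot (u l))//; apply/funext => l; rewrite nt.
- by rewrite (_ : (fun l => _) = fun l => nsqd dot (v l))//; apply/funext => l; rewrite nt.
- move=> f g Df Dg; have Dc := hs_compD S j Df; have Dc' := hs_compD S i Dg.
  rewrite /lift/= (hs_tens_dot H S m0)//; last exact: DB.
  have := hB _ _ Dc Dc'; apply: cvg_ext => N'; apply: eq_bigr => l _.
  by rewrite (hs_dot_tens H S)// (hs_tens_dot H S m0).
Qed.

Lemma tc_sum (J : Type) (r : seq J) (A : J -> F -> F) (A0 : F -> F) : (forall j, tc (A j)) -> tc A0 ->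
  tc (\sum_(j <- r) A j + A0).
Proof.
move=> tA t0; elim: r => [|j r IH]; first by rewrite big_nil add0r.
by rewrite big_cons -addrA -[A j]scale1r; exact: tc_lin.
Qed.

(* Operators are total functions, so a trace-class operator is determined by its
   blocks only up to a map [Z] vanishing on the Hilbert space. *)
Lemma tc_decompose A : tc A -> exists2 Z, tc Z /\ (forall f, DF f -> Z f = 0) &
  forall (X : Type) (W' : (F -> F) -> X -> C),
    (forall (a : C) A B, tc A -> tc B -> W' (a *: A + B) = a *: W' A + W' B) ->
    W' A = \sum_(p <- index_enum ('I_m * 'I_m)%type) W' (lift p.1 p.2 (block A p.1 p.2)) + W' Z.
Proof.
move=> tA; pose L (p : 'I_m * 'I_m) := lift p.1 p.2 (block A p.1 p.2).
have tL p : tc (L p) by apply/lift_tc/block_tc.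
pose Z : F -> F := A - \sum_(p <- index_enum ('I_m * 'I_m)%type) L p.
have tN r A0 : tc A0 -> tc (A0 - \sum_(p <- r) L p).
  move=> t0; rewrite addrC -sumrN; apply: tc_sum => // p; rewrite -[- _]addr0 -scaleN1r.
  have -> : (0 : F -> F) = (-1) *: A + A by rewrite scaleN1r addNr.
  by apply: tc_lin => //; exact: tc_lin.
have tZ : tc Z by exact: tN.
exists Z.
  split => // f Df; have [DA _] := tc_op tA.
  rewrite /Z !fctE (blockK H S m0 (tc_op tA) Df); apply/eqP; rewrite subr_eq0; apply/eqP.
  by rewrite fct_sumE pair_bigA; apply: eq_bigr.
move=> X W' lW'; have {1}-> : A = \sum_(p <- index_enum ('I_m * 'I_m)%type) L p + Z.
  by rewrite /Z addrC subrK.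
elim: (index_enum _) => [|p r IH]; first by rewrite !big_nil !add0r.
rewrite !big_cons -!addrA -IH -[L p]scale1r lW' ?scale1r//; exact: tc_sum.
Qed.

(** The only possible value on [sum_ij A_ij (x) E_ij], where [G i j] will be the [w1] symbol of the
    matrix unit [E_ij]. *)
Definition tW (A : F -> F) (p : T1 * T2) : C := \sum_i \sum_j qW (block A i j) p.1 * G i j p.2.

Lemma tW_lin (a : C) A B : tc A -> tc B -> tW (a *: A + B) = a *: tW A + tW B.
Proof.
move=> tA tB; have [u [v NA]] := tc_nuclear tA; have [u' [v' NB]] := tc_nuclear tB.
have oA := tc_op tA; have oB := tc_op tB.
apply/funext => p; rewrite /tW !fctE scaler_sumr -big_split; apply: eq_bigr => i _ /=.
rewrite scaler_sumr -big_split; apply: eq_bigr => j _ /=.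
have -> : qW (block (a *: A + B) i j) = qW (a *: block A i j + block B i j).
  apply: (qW_ext Om_op) => f Df; have Dt := hs_tensD S j Df.
  by have [DA _] := oA; have [DB _] := oB; rewrite /block/= !fctE (hs_compL S)//; [exact: DA|exact: DB].
rewrite (qW_lin H Om_op Om_le c0 oe a (block_nuclear H S m0 i j oA NA) (block_nuclear H S m0 i j oB NB) (block_op S _ _ oA) (block_op S _ _ oB)).
by rewrite !fctE mulrDl -mulrA.
Qed.

Lemma tc_adjoint A : tc A -> is_adjoint DF dotF DF dotF A (adjoint DF dotF DF dotF A).
Proof. by move=> [bA _]; apply: xgetPex; exact: (adjoint_exists HF oF bA). Qed.

Lemma tc_adj A : tc A -> tc (adjoint DF dotF DF dotF A).
Proof.
by move=> tA; apply/tc_wnuclear; apply: (wnuclear_adjoint HF _ (tc_adjoint tA)); apply/tc_wnuclear.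
Qed.

Lemma tW_adjoint A p : tc A -> tW (adjoint DF dotF DF dotF A) p = (tW A p)^*.
Proof.
move=> tA; have [DB hB] := tc_adjoint tA; have [u [v N]] := tc_nuclear tA.
have oA := tc_op tA; have [DA _] := oA.
rewrite /tW CJ_sum exchange_big; apply: eq_bigr => i _; rewrite CJ_sum; apply: eq_bigr => j _.
rewrite CJM GJ; congr (_ * _); apply: (qW_adjoint H Om_op Om_herm Om_le c0 oe p.1 (block_nuclear H S m0 i j oA N)).
split=> [f Df|f g Df Dg]; first by apply/(hs_compD S)/DB/(hs_tensD S).
have Df' := hs_tensD S j Df; have Dg' := hs_tensD S i Dg.
rewrite /block/= -(hs_dot_tens H S)//; last exact: DA.
by rewrite hB// (hs_tens_dot H S m0)//; exact: DB.
Qed.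

Lemma tW_trace A B : tc A -> tc B -> cintegrable (mu \x nu)%E (fun p => tW A p * tW B p) /\
  cintegral (mu \x nu)%E (fun p => tW A p * tW B p) = trace_op DF dotF (A \o B).
Proof.
move=> tA tB; have [u [v NA]] := tc_nuclear tA; have [u' [v' NB]] := tc_nuclear tB.
have oA := tc_op tA; have oB := tc_op tB; have [bB _] := tB; have [DB _] := oB.
have [Du Dv _ _ _] := NA.
pose a i j z := qW (block A i j) z; pose b i j z := qW (block B i j) z.
have qt i j i' j' := qW_trace H Om_op Om_herm Om_le c0 Dk moyal_k oe ce
  (block_nuclear H S m0 i j oA NA) (block_nuclear H S m0 i' j' oB NB) (block_bounded i' j' bB).
have La i j : L2 mu (a i j) by have [] := qt i j i j.
have Lb i j : L2 mu (b i j) by have [] := qt i j i j.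
pose t i j := L2dot mu (a j i) (fun z => (b i j z)^*).
have tE i j : cintegral mu (fun z => a j i z * b i j z) = t i j.
  by rewrite /t /L2dot; apply: eq_cintegral => z; rewrite CJK.
have GE i j i' j' : cintegral nu (fun x => G i j x * G i' j' x) = ((i == j') && (j == i'))%:R.
  by rewrite -G_onb; apply: eq_cintegral => x; rewrite GJ.
(* The trace of [A \o B] is [sum_ij Tr(A_ji B_ij)]: each [<B v_l, u_l>] of the nuclear series splits
   along the blocks of [B]. *)
have trE : is_trace DF dotF (A \o B) (\sum_i \sum_j t i j).
  have [s h1 h2] := nuclear_comp HF oF NA bB.
  suff -> : \sum_i \sum_j t i j = s by [].
  have h : (fun N => \sum_(i <- index_enum 'I_m) \sum_(j <- index_enum 'I_m)
      series (fun l => dot (block B i j (comp j (v l))) (comp i (u l))) N) @ \oo -->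
      \sum_(i <- index_enum 'I_m) \sum_(j <- index_enum 'I_m) t i j.
    apply: cvg_sum_seq => i; apply: cvg_sum_seq => j.
    by have [_ _ _ h] := qt j i i j; exact: h.
  apply: (cvg_uniqueC h); apply: cvg_ext h1 => N.
  under [RHS]eq_bigr => i _ do rewrite /series/= exchange_big.
  rewrite exchange_big; apply: eq_bigr => l _ /=.
  have Dc j : D (comp j (v l)) by exact: (hs_compD S).
  have DBl i j : D (block B i j (comp j (v l))) by have [h' _] := block_op S i j oB; exact: h'.
  rewrite (hs_dotF S); [|exact: DB|exact: Du]; apply: eq_bigr => i _.
  rewrite -(dot_suml P)//; last exact: (hs_compD S).
  congr (dot _ _); rewrite (blockK H S m0 oB (Dv l)).
  rewrite (hs_comp_sum H S m0); last first.
    by move=> i'; apply: (ph_sum PF) => j _; apply: (hs_tensD S).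
  rewrite (bigD1 i)//= (hs_comp_sum H S m0); last by move=> j; exact: (hs_tensD S).
  rewrite [X in _ + X]big1 ?addr0.
    by apply: eq_bigr => j _; rewrite (hs_compK S)// eqxx scale1r.
  move=> i' ii'; rewrite (hs_comp_sum H S m0); last by move=> j; exact: (hs_tensD S).
  by rewrite big1// => j _; rewrite (hs_compK S)// eq_sym (negbTE ii') scale0r.
rewrite (trace_opE oF trE).
pose f (q : ('I_m * 'I_m) * ('I_m * 'I_m)) (p : T1 * T2) :=
  (a q.1.1 q.1.2 p.1 * b q.2.1 q.2.2 p.1) * (G q.1.1 q.1.2 p.2 * G q.2.1 q.2.2 p.2).
have fE : (fun p => tW A p * tW B p) = fun p => \sum_(q <- index_enum _) f q p.
  apply/funext => p; rewrite /tW !pair_bigA/= mulr_suml -(pair_bigA _ (fun q1 q2 => f (q1, q2) p))/=.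
  apply: eq_bigr => q1 _; rewrite mulr_sumr; apply: eq_bigr => q2 _.
  by rewrite /f/= mulrACA.
have fI q : cintegrable (mu \x nu)%E (f q) /\ cintegral (mu \x nu)%E (f q) =
    cintegral mu (fun z => a q.1.1 q.1.2 z * b q.2.1 q.2.2 z) * ((q.1.1 == q.2.2) && (q.1.2 == q.2.1))%:R.
  rewrite -GE; apply: (cintegral_product smu (f := fun z => a q.1.1 q.1.2 z * b q.2.1 q.2.2 z)
    (g := fun x => G q.1.1 q.1.2 x * G q.2.1 q.2.2 x)); exact: L2M_integrable.
have [h1 h2] := cintegrable_sum (index_enum _) (fun q => (fI q).1).
rewrite fE; split => //; rewrite h2.
under eq_bigr => q _ do rewrite (fI q).2.
rewrite -(pair_bigA _ (fun q1 q2 => cintegral mu (fun z => a q1.1 q1.2 z * b q2.1 q2.2 z) * ((q1.1 == q2.2) && (q1.2 == q2.1))%:R))/=.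
rewrite exchange_big [RHS]pair_bigA; apply: eq_bigr => -[i j] _ /=.
(* [G i j] integrates against [G i' j'] to 1 exactly for transposed indices, which selects the
   products of blocks occurring in the trace. *)
rewrite (bigD1 (j, i))//= !eqxx mulr1 tE big1 ?addr0// => -[i' j'] /= ne.
by rewrite -xpair_eqE (negbTE ne) mulr0.
Qed.

(** The trace formula applied to [Z = A - B] and its adjoint: a zero symbol gives
    [sum_l |Z e_l|^2 = 0] along a basis. As [Z] has an adjoint, vanishing on the basis means
    vanishing on the space. *)
Lemma tW_injective A B : tc A -> tc B -> tW A = tW B -> forall f, DF f -> A f = B f.
Proof.
move=> tA tB AB; pose Z := (-1) *: B + A; have tZ : tc Z by exact: tc_lin.
have W0 : tW Z = 0 by rewrite tW_lin// AB scaleN1r addNr.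
have [DB hB] := tc_adjoint tZ; pose Zs := adjoint DF dotF DF dotF Z.
have oZ := tc_op tZ; have [DZ _] := oZ.
have [_ tr] := tW_trace (tc_adj tZ) tZ.
have [uu [vv NZ]] := tc_nuclear (tc_adj tZ); have [bZ _] := tZ.
have [s _ hs] := nuclear_comp HF oF NZ bZ.
have s0 : s = 0.
  rewrite -(trace_opE oF hs) -tr -[RHS](cintegral0 (mu \x nu)%E); apply: eq_cintegral => p.
  by rewrite W0 mulr0.
have De := onbD oF; pose eF k := tens (Ordinal (ltn_pmod k m0)) (e (k %/ m)%N).
have cs : series (fun l => dotF (Zs (Z (eF l))) (eF l)) @ \oo --> (0 : C).
  by have := hs _ oF; rewrite s0.
have Ze j : Z (eF j) = 0.
  apply: (hb_def HF (DZ _ (De j))); apply/eqP; rewrite eq_le (nsq_ge0 PF (DZ _ (De j))) andbT.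
  have cr : series (fun l => nsqd dotF (Z (eF l))) @ \oo --> (0 : R).
    have [h' _] := (cvgC_ReIm _ _).1 cs; apply: cvg_ext h' => N; rewrite /series/= Re_sum; apply: eq_bigr => l _.
    rewrite /nsqd (hB _ _ (De l) (DZ _ (De l))).
    by rewrite (ph_sym PF (De l) (DB _ (DZ _ (De l)))) ReJ.
  apply: (@le_trans _ _ (series (fun l => nsqd dotF (Z (eF l))) j.+1)).
    rewrite /series/= big_nat_recr//= lerDr; apply: sumr_ge0 => l _; apply: (nsq_ge0 PF); exact/DZ/De.
  rewrite -(cvg_lim _ cr)//; apply: nondecreasing_cvgn_le; last by apply/cvg_ex; exists 0.
  by apply: nondecreasing_series => l _ _; apply: (nsq_ge0 PF); exact/DZ/De.
move=> f Df; apply/eqP; rewrite -subr_eq0.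
have -> : A f - B f = Z f by rewrite /Z !fctE scaleN1r addrC.
have [_ _ tot] := oF; apply/eqP; apply: (hb_def HF (DZ _ Df)).
rewrite /nsqd hB//; last exact: DZ.
rewrite -/Zs (tot (Zs (Z f))); [by rewrite (dot0r PF)|exact/DB/DZ|] => j.
rewrite (ph_sym PF (f := eF j)); [|exact: De|exact/DB/DZ].
by rewrite -(hB _ _ (De j) (DZ _ Df)) Ze (dot0l PF (DZ _ Df)) CJ0.
Qed.

Variables (U Ui : F -> F) (U0 U0i : E -> E) (r : 'I_m -> 'I_m -> C).
Hypotheses (DU : forall f, DF f -> DF (U f)) (DUi : forall f, DF f -> DF (Ui f))
  (DU0 : forall f, D f -> D (U0 f)) (DU0i : forall f, D f -> D (U0i f))
  (oU0 : forall (a : C) f g, D f -> D g -> U0 (a *: f + g) = a *: U0 f + U0 g)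
  (oU0i : forall (a : C) f g, D f -> D g -> U0i (a *: f + g) = a *: U0i f + U0i g)
  (UU0 : forall f g, D f -> D g -> dot (U0 f) g = dot f (U0i g))
  (UU0' : forall f g, D f -> D g -> dot (U0 f) (U0 g) = dot f g)
  (compU : forall i f, DF f -> comp i (U f) = \sum_k r i k *: U0 (comp k f))
  (compUi : forall j l f, D f -> comp l (Ui (tens j f)) = (r j l)^* *: U0i f).

(** [U] is [U0] tensored with the matrix [r], so the block [(i, j)] of the conjugate of [A] is
    [sum_kl r_ik conj(r_jl) U0 A_kl U0^-1]. The last hypothesis is the covariance of the
    finite-dimensional calculus on matrix units. *)
Lemma tW_covariant A z x z' x' : tc A -> (forall f, D f -> Om z (U0 f) = U0 (Om z' f)) ->
  (forall k l, \sum_i \sum_j r i k * (r j l)^* * G i j x = G k l x') ->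
  tW (U \o A \o Ui) (z, x) = tW A (z', x').
Proof.
move=> tA hOm hG; have [u [v N]] := tc_nuclear tA; have oA := tc_op tA; have [DA _] := oA.
pose B (p : 'I_m * 'I_m) := U0 \o block A p.1 p.2 \o U0i.
have oB p : is_operator D (B p).
  have [Db lb] := block_op S p.1 p.2 oA; split => [f Df|a f g Df Dg]; first exact/DU0/Db/DU0i.
  by rewrite /B/= oU0i// lb ?oU0//; [exact/Db/DU0i|exact/Db/DU0i|exact: DU0i|exact: DU0i].
have qu p := qW_unitary H Om_op Om_le c0 oe (block_nuclear H S m0 p.1 p.2 oA N)
  (block_op S p.1 p.2 oA) DU0 DU0i UU0 UU0' hOm.
have key i j : qW (block (U \o A \o Ui) i j) z =
    \sum_(p <- index_enum _) r i p.1 * (r j p.2)^* * qW (block A p.1 p.2) z'.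
  under eq_bigr => p _ do rewrite -(qu p).2.
  rewrite -(qW_sum (index_enum _) (fun p => r i p.1 * (r j p.2)^*) z (fun p => (qu p).1) oB).
  apply: (congr1 (fun f => f z)); apply: (qW_ext Om_op) => f Df.
  have Dt := hs_tensD S j Df; have DUt := DUi Dt; rewrite /block/= compU; last exact: DA.
  rewrite -(pair_bigA _ (fun k l => (r i k * (r j l)^*) *: B (k, l) f))/=.
  apply: eq_bigr => a _; rewrite (blockK H S m0 oA DUt).
  have Db i1 j1 h : D h -> D (block A i1 j1 h) by have [h' _] := block_op S i1 j1 oA; exact: h'.
  have Dc j1 : D (comp j1 (Ui (tens j f))) by exact: (hs_compD S).
  have Dtb i1 j1 : DF (tens i1 (block A i1 j1 (comp j1 (Ui (tens j f))))) by apply: (hs_tensD S); exact: Db.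
  rewrite (hs_comp_sum H S m0); last by move=> i1; apply: (ph_sum PF).
  rewrite (bigD1 a)//= (hs_comp_sum H S m0)// [X in _ + X]big1 ?addr0; last first.
    move=> i1 ai; rewrite (hs_comp_sum H S m0)// big1// => j1 _.
    by rewrite (hs_compK S) 1?eq_sym ?(negbTE ai) ?scale0r//; exact: Db.
  have oU : is_operator D U0 by split.
  have oUi : is_operator D U0i by split.
  rewrite (op_sum H _ oU); last by move=> j1 _; apply: (hs_compD S).
  rewrite scaler_sumr; apply: eq_bigr => b _; rewrite (hs_compK S) ?eqxx ?scale1r; last exact: Db.
  rewrite compUi// (opZ H _ (block_op S a b oA)); last exact: DU0i.
  by rewrite (opZ H _ oU) ?scalerA//; apply/Db/DU0i.
rewrite /tW/= pair_bigA/=.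
under eq_bigr => p _ do rewrite key mulr_suml.
rewrite exchange_big/= [RHS]pair_bigA/=; apply: eq_bigr => q _.
rewrite -hG pair_bigA/= mulr_sumr; apply: eq_bigr => p _.
by rewrite -mulrA mulrCA.
Qed.

End TensorSymbol.

Section FiniteOnb.
Context {R : realType} (V : vectType R[i]) (dotV : {dot V for Num.conj}).
Local Notation C := R[i].

Lemma dotV_prehilbert : prehilbert [set: V] dotV.
Proof.
split; [by []|by []| | |].
- by move=> a f g h _ _ _; rewrite linearPl.
- by move=> f g _ _; rewrite hermC expr0 mul1r.
- by move=> f _; exact: dnorm_ge0.
Qed.
Local Notation P := dotV_prehilbert.

Lemma dotV_def v : nsqd dotV v = 0 -> v = 0.
Proof.
move=> v0; apply/eqP; rewrite -(dnorm_eq0 dotV) (dot_nsq P)// v0.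
by rewrite eqxx.
Qed.

Lemma onbV_exists : (fullv : {vspace V}) != 0%VS -> exists m (b : 'I_m -> V), [/\ (0 < m)%N,
  forall i j, dotV (b i) (b j) = (i == j)%:R & forall v, v = \sum_i dotV v (b i) *: b i].
Proof.
move=> V0; pose N := \dim {:V}; pose y k : V := (vbasis {:V})`_k.
pose q := gs (dot := dotV) y; pose nz := gs_nz (dot := dotV) y.
have Dy k : [set: V] (y k) by [].
have oq := gs_qorthon P Dy.
pose r := [seq k <- iota 0 N | nz k]; pose b (i : 'I_(size r)) := q (nth 0%N r i).
have ur : uniq r by rewrite filter_uniq// iota_uniq.
have ob i j : dotV (b i) (b j) = (i == j)%:R.
  rewrite /b oq nth_uniq//; have : nth 0%N r i \in r by rewrite mem_nth.
  by rewrite mem_filter => /andP[]; rewrite /nz => -> _; rewrite andbT.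
have full v : v = \sum_i dotV v (b i) *: b i.
  have yE (k : 'I_N) : (vbasis {:V})`_k = \sum_i dotV (vbasis {:V})`_k (b i) *: b i.
    rewrite -/(y k); have := gs_span_lt P Dy (ltn_ord k) => /dotV_def/eqP; rewrite subr_eq0 => /eqP {1}->.
    rewrite /index_iota subn0 (bigID nz)/= -big_filter -/r addrC big1 ?add0r; last first.
      move=> j nj; have : q j = 0 by apply: dotV_def; rewrite /nsqd oq eqxx/= -/nz (negbTE nj).
      by rewrite /q => ->; rewrite scaler0.
    by rewrite (big_nth 0%N) big_mkord.
  rewrite {1 2}(coord_vbasis (memvf v)).
  under [RHS]eq_bigr => i _ do rewrite linear_sumlz/= scaler_suml.
  rewrite exchange_big/=; apply: eq_bigr => k _; rewrite {1}(yE k) scaler_sumr.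
  by apply: eq_bigr => i _; rewrite scalerA linearZl_LR.
exists (size r), b; split => //; rewrite lt0n; apply: contra V0 => /eqP r0.
apply/eqP/vspaceP => v; rewrite memvf memv0 (full v) big1 ?eqxx// => -[i hi].
by have := hi; rewrite {1}r0.
Qed.

End FiniteOnb.

Section FockTensor.
Context {R : realType} {n : nat} (lam : {posnum R}) (V : vectType R[i]) (dotV : {dot V for Num.conj}).
Local Notation C := R[i].
Local Notation cV := 'cV[C]_n.
Local Notation Cn := (Cn R n).
Local Notation fm := (fock_measure n lam).
Local Notation H0 := (fock0 (n := n) lam).
Local Notation dot0 := (fock0_dot (n := n) lam).
Local Notation HV := (fockV (n := n) lam dotV).
Local Notation dotF := (fockV_dot (n := n) lam dotV).
Variables (m : nat) (b : 'I_m -> V).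
Hypotheses (ob : forall i j, dotV (b i) (b j) = (i == j)%:R)
  (fb : forall v, v = \sum_i dotV v (b i) *: b i).
Let P := dotV_prehilbert dotV.

Definition fcomp (i : 'I_m) (f : cV -> V) : cV -> C^o := fun z => dotV (f z) (b i).
Definition ftens (i : 'I_m) (f : cV -> C^o) : cV -> V := fun z => f z *: b i.

Lemma onbV_dot u v : dotV u v = \sum_i dotV u (b i) * (dotV v (b i))^*.
Proof.
rewrite {1}(fb v) linear_sumr; apply: eq_bigr => i _.
by rewrite linearZr_LR/= mulrC.
Qed.

Lemma onbV_sqr v : Re (dotV v v) = \sum_i cab (dotV v (b i)) ^+ 2.
Proof. by rewrite onbV_dot Re_sum; apply: eq_bigr => i _; rewrite mulJ_cab. Qed.

Lemma fcomp_fw f z : Re (dotV (f z) (f z)) * gauss lam z = \sum_i cab (fw lam (fcomp i f) z) ^+ 2.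
Proof.
rewrite onbV_sqr mulr_suml; apply: eq_bigr => i _.
by rewrite /fw cabM cab_real exprMn real_normK ?num_real// hgauss_sqr.
Qed.

Lemma fockVP f : HV f <-> forall i, H0 (fcomp i f).
Proof.
split=> [[hf If] i|h].
  have hi : holo (fcomp i f : cV -> C) by exact: hf.
  apply/fock0P; split => //; split; first by apply: cmeasurable_fw; exact: cmeasurable_holo.
  apply: le_lt_trans If; apply: ge0_le_integral => //.
  - by move=> z _; rewrite lee_fin sqr_ge0.
  - apply/measurable_EFinP; apply: measurable_funX; apply: cmeasurable_cab.
    by apply: cmeasurable_fw; exact: cmeasurable_holo.
  - apply/measurable_EFinP; rewrite (_ : (fun z => _) = fun z : Cn => \sum_j cab (fw lam (fcomp j f) z) ^+ 2); last first.
      by apply/funext => z; rewrite fcomp_fw.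
    apply: measurable_sum => j; apply: measurable_funX; apply: cmeasurable_cab.
    by apply: cmeasurable_fw; apply: cmeasurable_holo; exact: hf.
  - by move=> z _; rewrite lee_fin fcomp_fw (bigD1 i)//= lerDl; apply: sumr_ge0 => j _; rewrite sqr_ge0.
have hh i : holo (fcomp i f : cV -> C) by have /fock0P[] := h i.
have L i : L2 fm (fw lam (fcomp i f)) by have /fock0P[] := h i.
split=> [v z|].
  have -> : (fun z => dotV (f z) v) = fun z => \sum_i (dotV v (b i))^* * fcomp i f z.
    by apply/funext => w; rewrite onbV_dot; apply: eq_bigr => i _; rewrite mulrC.
  elim: (index_enum _) => [|i r IH].
    by under eq_fun => w do rewrite big_nil; exact: (holo_cst (n := n) 0 z).
  under eq_fun => w do rewrite big_cons.
  by apply: differentiableD => //; exact: (holoM (holo_cst (n := n) _) (hh i) z).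
have E : (fun z : Cn => (Re (dotV (f z) (f z)) * gauss lam z)%:E) =
    fun z : Cn => (\sum_(i <- index_enum _) cab (fw lam (fcomp i f) z) ^+ 2)%:E.
  by apply/funext => z; rewrite fcomp_fw.
rewrite E; have : fm.-integrable [set: Cn] (fun z : Cn => (\sum_(i <- index_enum _) cab (fw lam (fcomp i f) z) ^+ 2)%:E).
  under eq_fun => z do rewrite -sumEFin.
  by apply: integrable_sum => // i _; exact: L2_integrable.
move=> /integrableP[_]; apply: le_lt_trans; rewrite le_eqVlt; apply/orP; left; apply/eqP.
apply: eq_integral => z _ /=; rewrite ger0_norm//.
by apply: sumr_ge0 => j _; rewrite sqr_ge0.
Qed.

Lemma fcompL i (a : C) f g : fcomp i (a *: f + g) = a *: fcomp i f + fcomp i g.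
Proof. by apply/funext => z; rewrite /fcomp !fctE linearPl. Qed.

Lemma fcompK i j f : fcomp i (ftens j f) = (i == j)%:R *: f.
Proof. by apply/funext => z; rewrite /fcomp /ftens linearZl_LR/= ob mulrC eq_sym. Qed.

Lemma fock_sum : hilbert_sum (D := H0) (dot := dot0) (DF := HV) (dotF := dotF) fcomp ftens.
Proof.
have P0 := fock0_prehilbert (n := n) lam.
have Dc i f : HV f -> H0 (fcomp i f) by move=> /fockVP; exact.
split.
- by move=> a f g /fockVP hf /fockVP hg; apply/fockVP => i; rewrite fcompL; exact: (phL P0).
- exact: Dc.
- by move=> i a f g _ _; exact: fcompL.
- by move=> i f Df; apply/fockVP => j; rewrite fcompK; exact: (phZ P0).
- by move=> i a f g _ _; apply/funext => z; rewrite /ftens !fctE scalerDl scalerA.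
- by move=> i j f _; exact: fcompK.
- by move=> f _; apply/funext => z; rewrite fct_sumE [LHS]fb.
- move=> f g Df Dg.
  have Lf i : L2 fm (fw lam (fcomp i f)) by have /fock0P[] := Dc i f Df.
  have Lg i : L2 fm (fw lam (fcomp i g)) by have /fock0P[] := Dc i g Dg.
  have [_ h] := cintegrable_sum (index_enum _) (fun i => L2dot_integrable (Lf i) (Lg i)).
  rewrite /fockV_dot /fock_dot.
  have -> : (fun z : Cn => dotV (f z) (g z) * (gauss lam z)%:C) =
      fun z => \sum_(i <- index_enum _) fw lam (fcomp i f) z * (fw lam (fcomp i g) z)^*.
    apply/funext => z; rewrite onbV_dot mulr_suml; apply: eq_bigr => i _.
    by rewrite fwM_dot.
  by rewrite h; apply: eq_bigr => i _; rewrite fock0_dotE.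
Qed.

End FockTensor.

(** * The scalar Weyl calculus *)

Section HeisenbergOperators.
Context {R : realType} {n : nat} (lam : {posnum R}).
Local Notation C := R[i].
Local Notation cV := 'cV[C]_n.
Local Notation s := ((2 * lam%:num)^-1).
Local Notation H0 := (fock0 (n := n) lam).
Local Notation dot0 := (fock0_dot (n := n) lam).
Local Notation Om := (Omega0 lam).

Let s0 : 0 < s :> R. Proof. by rewrite invr_gt0 mulr_gt0. Qed.
Let lamE : lam%:num^-1 = 2 * s :> R. Proof. by field; rewrite gt_eqF. Qed.

Lemma invmx_is_unitary (k : 'M[C]_n) : k \is unitarymx -> invmx k \is unitarymx.
Proof. by move=> uk; rewrite invmx_unitary// trmxC_unitary. Qed.

Lemma cVdot_unitary (k : 'M[C]_n) (u v : cV) : k \is unitarymx -> cVdot (k *m u) (k *m v) = cVdot u v.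
Proof.
move=> uk; have h w := sqnorm_unitary w uk.
have Rh x y : Re (cVdot (k *m x) (k *m y)) = Re (cVdot x y).
  have := h (x + y); rewrite mulmxDr !sqnormD !h => /addrI.
  by apply: mulfI.
apply: Cext; first exact: Rh.
have := Rh ('i *: u) v; rewrite -scalemxAr !(dotZl cV_prehilbert)// !ReM /= !mul0r !sub0r !mul1r.
by move=> /oppr_inj.
Qed.

(** With [a = i lam z0] and [th = lam c0], the exponent is that of [motion_rep]: [-s <z, a>] is
    [(i/2)] times the product of [z] with the conjugate of [z0], and
    [(s/2) |a|^2 = (lam/4) |z0|^2]. *)
Definition heis_mult (th : R) (a z : cV) : C :=
  cexp (cVdot z ((- s)%:C *: a) + ('i * th%:C - (s / 2 * sqnorm a)%:C)).

(* The scalar part of [motion_rep], with [a = i lam z0]. *)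
Definition heis_op (th : R) (a : cV) (k : 'M[C]_n) (f : cV -> C^o) : cV -> C^o :=
  fun z => heis_mult th a z * f (invmx k *m (z + a)).

Lemma heis_multE th a z : heis_mult th a z =
  cexp (- (s%:C * cVdot z a) + ('i * th%:C - (s / 2 * sqnorm a)%:C)).
Proof. by rewrite /heis_mult (dotZr cV_prehilbert)// CRJ rmorphN mulNr. Qed.

Lemma cab_heis_mult th a (k : 'M[C]_n) w : k \is unitarymx -> cab (heis_mult th a w) * hgauss lam w =
  1 * hgauss lam (k *m w + k *m a).
Proof.
move=> uk; rewrite -mulmxDr mul1r {2}/hgauss sqnorm_unitary// sqnormD heis_multE cab_cexp.
rewrite /hgauss -expRD; congr expR.
rewrite ReD ReN ReMC ReB ReM /=; move: (Re _) (sqnorm w) (sqnorm a) => x y t.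
by field; rewrite gt_eqF.
Qed.

Lemma heis_opE th a k (f : cV -> C^o) : heis_op th a k f =
  (fun w => heis_mult th a w * f (invmx k *m w + invmx k *m a)).
Proof. by apply/funext => w; rewrite /heis_op mulmxDr. Qed.

Lemma heis_op_iso th a k f g : k \is unitarymx -> H0 f -> H0 g ->
  H0 (heis_op th a k f) /\ dot0 (heis_op th a k f) (heis_op th a k g) = dot0 f g.
Proof.
move=> uk Ff Fg; have uk' : invmx k \is unitarymx by exact: invmx_is_unitary.
have hm : holo (heis_mult th a) by exact: holo_cexp.
have [] := wcomp_fock0 hm uk' (fun w => cab_heis_mult th a w uk') Ff Fg.
by rewrite -!heis_opE expr1n mul1r.
Qed.

Lemma heis_op_lin th a k (c : C) (f g : cV -> C^o) :
  heis_op th a k (c *: f + g) = c *: heis_op th a k f + heis_op th a k g.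
Proof. by apply/funext => z; rewrite /heis_op !fctE mulrDr -[c *: _]/(c * _) -[c *: _]/(c * _) mulrCA. Qed.

Lemma heis_mult_inv th a k z : k \is unitarymx ->
  heis_mult th a z * heis_mult (- th) (- (invmx k *m a)) (invmx k *m (z + a)) = 1.
Proof.
move=> uk; have uk' : invmx k \is unitarymx by exact: invmx_is_unitary.
rewrite !heis_multE -cexpD sqnormN sqnorm_unitary// (dotNr cV_prehilbert)// cVdot_unitary//.
rewrite (dotDl cV_prehilbert)// (dot_nsq cV_prehilbert (f := a) I) -[nsqd _ a]/(sqnorm a).
rewrite (rmorphN _ th) -[RHS]cexp0; congr cexp; rewrite !CRM; move: (s%:C) => sc.
have -> : (2^-1)%:C = 2^-1 :> C by rewrite fmorphV rmorph_nat.
by field.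
Qed.

Lemma heis_opK th a k f : k \is unitarymx ->
  heis_op th a k (heis_op (- th) (- (invmx k *m a)) (invmx k) f) = f.
Proof.
move=> uk; have ku := unitarymx_unit uk; apply/funext => z; rewrite /heis_op mulrA heis_mult_inv// mul1r.
by rewrite invmxK -mulmxBr addrK mulmxA mulmxV// mul1mx.
Qed.

(** For [a = i lam z0] the point [invmx k *m (z + a)] is [g^-1 . z]: this is the covariance of the
    quantizer. Arguments of [f] agree on both sides, so it reduces to an identity between exponents,
    where unitarity of [k] enters. *)
Lemma Omega0_heis th a k z (f : cV -> C^o) : k \is unitarymx ->
  Om z (heis_op th a k f) = heis_op th a k (Om (invmx k *m (z + a)) f).
Proof.
move=> uk; have uk' : invmx k \is unitarymx by exact: invmx_is_unitary.
apply/funext => w; rewrite /Omega0 /heis_op lamE.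
have -> : 2%:R *: (invmx k *m (z + a)) - invmx k *m (w + a) = invmx k *m (2%:R *: z - w + a).
  by rewrite scalemxAr -mulmxBr; congr (_ *m _); apply/matrixP => i j; rewrite !mxE; ring.
set X := _ * (cdot w _ - _); set Y := _ * (cdot _ _ - _).
suff key : cexp X * heis_mult th a (2%:R *: z - w) = heis_mult th a w * cexp Y.
  have gen (p x1 x2 x3 x4 F : C) : x1 * x3 = x4 * x2 -> p * x1 * (x3 * F) = x4 * (p * x2 * F).
    by move=> e; transitivity (p * (x1 * x3) * F); [ring|rewrite e; ring].
  exact: (gen _ _ _ _ _ _ key).
rewrite !heis_multE -!cexpD /X /Y; congr cexp.
rewrite -[cdot w _]/(cVdot w z) -[cdot _ _]/(cVdot (invmx k *m (w + a)) (invmx k *m (z + a))).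
rewrite cVdot_unitary// sqnorm_unitary//.
have sq (x : cV) : (sqnorm x)%:C = cVdot x x by rewrite (dot_nsq cV_prehilbert (f := x) I).
rewrite !sq !(dotDl cV_prehilbert, dotDr cV_prehilbert, dotNl cV_prehilbert, dotZl cV_prehilbert)//.
rewrite CRM rmorph_nat; move: (s%:C) (s / 2)%:C => sc sd.
ring.
Qed.

End HeisenbergOperators.

Section ScalarWeyl.
Context {R : realType} {n : nat} (lam : {posnum R}) (n0 : (0 < n)%N).
Local Notation C := R[i].
Local Notation cV := 'cV[C]_n.
Local Notation Cn := (Cn R n).
Local Notation fm := (fock_measure n lam).
Local Notation H0 := (fock0 (n := n) lam).
Local Notation dot0 := (fock0_dot (n := n) lam).
Local Notation kf := (kf lam : cV -> cV -> C^o).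
Local Notation Om := (Omega0 lam : Cn -> (cV -> C^o) -> cV -> C^o).

Lemma Om_le z f : H0 f -> nrmd dot0 (Om z f) <= 2 ^+ n * nrmd dot0 f.
Proof. by move=> Ff; rewrite Om_nrm. Qed.

Lemma pow2_ge0 : 0 <= 2 ^+ n :> R. Proof. by rewrite exprn_ge0. Qed.

Lemma moyal_coherent a1 a2 a3 a4 : L2 fm (qsymb (dot := dot0) Om (kf a1) (kf a2)) /\
  L2dot fm (qsymb (dot := dot0) Om (kf a1) (kf a2)) (qsymb (dot := dot0) Om (kf a3) (kf a4)) =
    dot0 (kf a1) (kf a3) * (dot0 (kf a2) (kf a4))^*.
Proof. by have [h _ e] := moyal_kf lam a1 a2 a3 a4. Qed.

Lemma fock0_onb : exists2 e, orthonormal_basis H0 dot0 e & forall j, lspan kf (e j).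
Proof. exact: fock0_basis. Qed.

Lemma W0E A : W0 lam A = qW (D := H0) (dot := dot0) Om A.
Proof. by []. Qed.

End ScalarWeyl.

(** * The Berezin calculus *)

Section EndHilbert.
Context {R : realType} (V : vectType R[i]) (dotV : {dot V for Num.conj}).
Local Notation C := R[i].
Local Notation End := ('End(V)).
Variables (m : nat) (b : 'I_m -> V).
Hypotheses (ob : forall i j, dotV (b i) (b j) = (i == j)%:R)
  (fb : forall v, v = \sum_i dotV v (b i) *: b i).
Let P := dotV_prehilbert dotV.
Local Notation adjV := (adjV dotV).
Local Notation hsd := (hs_dot dotV).

Definition rank1 (u w : V) : End := linfun (fun v => dotV v w *: u).

Lemma rank1E u w v : rank1 u w v = dotV v w *: u.
Proof.
have h : linear (fun v => dotV v w *: u) by move=> a x y /=; rewrite linearPl scalerDl scalerA.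
pose L : {linear V -> V} := HB.pack (fun v => dotV v w *: u) (GRing.isLinear.Build _ _ _ _ _ h).
by rewrite /rank1 -[fun v => _]/(L : V -> V) lfunE.
Qed.

Lemma dotV_ext u v : (forall w, dotV w u = dotV w v) -> u = v.
Proof.
move=> h; apply/eqP; rewrite -subr_eq0 -(dnorm_eq0 dotV); apply/eqP.
by rewrite linearB/= h subrr.
Qed.

Lemma adjV_P (A : End) u v : dotV (A u) v = dotV u (adjV A v).
Proof.
suff : exists B : End, forall u v, dotV (A u) v = dotV u (B v).
  by move=> /(@xgetPex _ 0 [set B : End | forall u v, dotV (A u) v = dotV u (B v)]); exact.
exists (\sum_i rank1 (b i) (A (b i))) => x y.
rewrite sum_lfunE linear_sumr /= {1}(fb x) linear_sum linear_sumlz; apply: eq_bigr => i _.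
by rewrite rank1E linearZ/= linearZl_LR linearZr_LR/= mulrC -(ph_sym P).
Qed.

Lemma adjV_P' (A : End) u v : dotV (adjV A u) v = dotV u (A v).
Proof. by rewrite (ph_sym P (f := v))// -adjV_P -(ph_sym P). Qed.

Lemma adjV_uniq (A B : End) : (forall u v, dotV (A u) v = dotV u (B v)) -> adjV A = B.
Proof. by move=> h; apply/lfunP => v; apply: dotV_ext => w; rewrite -adjV_P h. Qed.

Lemma adjVK (A : End) : adjV (adjV A) = A.
Proof. by apply: adjV_uniq => u v; rewrite adjV_P'. Qed.

Lemma adjV_rank1 u w : adjV (rank1 u w) = rank1 w u.
Proof.
by apply: adjV_uniq => x y; rewrite !rank1E linearZl_LR linearZr_LR/= mulrC -(ph_sym P).
Qed.

Lemma traceVE (A : End) : traceV A = \sum_i dotV (A (b i)) (b i).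
Proof.
have e : A = \sum_i rank1 (A (b i)) (b i).
  apply/lfunP => v; rewrite sum_lfunE {1}(fb v) linear_sum; apply: eq_bigr => i _.
  by rewrite rank1E linearZ.
rewrite {1}e /traceV /mxtrace.
have tr u w : \sum_k coord (vbasis {:V}) k (rank1 u w (vbasis {:V})`_k) = dotV u w.
  rewrite {2}(coord_vbasis (memvf u)) linear_sumlz; apply: eq_bigr => k _.
  by rewrite rank1E linearZ/= linearZl_LR mulrC.
transitivity (\sum_k \sum_i coord (vbasis {:V}) k (rank1 (A (b i)) (b i) (vbasis {:V})`_k)).
  apply: eq_bigr => k _; rewrite mxE /= mxE passmx.vecof_delta sum_lfunE linear_sum.
  by [].
by rewrite exchange_big; apply: eq_bigr => i _; rewrite tr.
Qed.

Lemma hsdE (A B : End) : hsd A B = \sum_i dotV (A (b i)) (B (b i)).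
Proof.
rewrite /hs_dot traceVE.
transitivity (\sum_i \sum_j dotV (A (b j)) (b i) * (dotV (B (b j)) (b i))^*).
  apply: eq_bigr => i _; rewrite comp_lfunE {1}(fb (adjV B (b i))) linear_sum linear_sumlz.
  apply: eq_bigr => j _; rewrite linearZ linearZl_LR/= adjV_P' mulrC; congr (_ * _).
  by rewrite -(ph_sym P).
rewrite exchange_big; apply: eq_bigr => j _.
rewrite [in RHS](fb (B (b j))) linear_sumr; apply: eq_bigr => i _.
by rewrite linearZr_LR mulrC.
Qed.

Lemma hsd_adj (A B : End) : hsd (adjV A) (adjV B) = hsd B A.
Proof.
have E X Y : hsd X Y = \sum_j \sum_i dotV (X (b j)) (b i) * (dotV (Y (b j)) (b i))^*.
  rewrite hsdE; apply: eq_bigr => j _.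
  rewrite {1}(fb (Y (b j))) linear_sumr; apply: eq_bigr => i _.
  by rewrite linearZr_LR mulrC.
rewrite !E exchange_big; apply: eq_bigr => i _; apply: eq_bigr => j _.
rewrite !adjV_P' mulrC (ph_sym P (f := A (b i)))//; congr (_ * _); last by rewrite -(ph_sym P).
Qed.

Lemma hsd_rank1 (A : End) u w : hsd A (rank1 u w) = dotV (A w) u.
Proof.
rewrite hsdE {2}(fb w) linear_sum linear_sumlz; apply: eq_bigr => i _.
by rewrite rank1E linearZr_LR linearZ linearZl_LR/= -(ph_sym P).
Qed.

Lemma hsd_prehilbert : prehilbert [set: End] hsd.
Proof.
split; [by []|by []| | |].
- move=> a f g h _ _ _; rewrite !hsdE mulr_sumr -big_split; apply: eq_bigr => i _ /=.
  by rewrite !lfunE/= !lfunE/= linearPl.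
- move=> f g _ _; rewrite !hsdE CJ_sum; apply: eq_bigr => i _; exact: (ph_sym P).
- by move=> f _; rewrite hsdE; apply: sumr_ge0 => i _; exact: (ph_ge0 P).
Qed.
Let PE := hsd_prehilbert.

Lemma End_expand (A : End) : A = \sum_i \sum_j hsd A (rank1 (b i) (b j)) *: rank1 (b i) (b j).
Proof.
apply/lfunP => v; rewrite sum_lfunE {1}(fb (A v)); apply: eq_bigr => i _.
rewrite sum_lfunE {1}(fb v) linear_sum linear_sumlz scaler_suml; apply: eq_bigr => j _.
by rewrite lfunE/= hsd_rank1 rank1E scalerA linearZ linearZl_LR mulrC.
Qed.

Lemma hsd_onb i j i' j' : hsd (rank1 (b i) (b j)) (rank1 (b i') (b j')) = ((i == i') && (j == j'))%:R.
Proof. by rewrite hsd_rank1 rank1E linearZl_LR/= !ob -natrM mulnb andbC [j' == j]eq_sym. Qed.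

Lemma hsd_hilbert : hilbert [set: End] hsd.
Proof.
pose q (p : 'I_#|{: 'I_m * 'I_m}|) := let: (i, j) := enum_val p in rank1 (b i) (b j).
apply: (@finite_basis_hilbert _ _ _ _ _ q hsd_prehilbert) => //.
- move=> p1 p2; rewrite /q -(inj_eq enum_val_inj).
  by case: (enum_val p1) (enum_val p2) => i j [i' j']; rewrite hsd_onb -xpair_eqE.
- move=> f _; rewrite {1}(End_expand f) pair_bigA/=.
  rewrite (reindex (fun p : 'I_#|{: 'I_m * 'I_m}| => enum_val p)); last by apply: onW_bij; exact: enum_val_bij.
  by apply: eq_bigr => p _; rewrite /q; case: (enum_val p).
Qed.

Lemma hsd_def (A : End) : hsd A A = 0 -> A = 0.
Proof. by move=> h; apply: (hb_def hsd_hilbert I); rewrite /nsqd h. Qed.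

Lemma hsd_ext (A B : End) : (forall X, hsd X A = hsd X B) -> A = B.
Proof.
move=> h; apply/eqP; rewrite -subr_eq0; apply/eqP/hsd_def.
by rewrite (dotBr PE)// h subrr.
Qed.

Lemma cab_dotV_le (A : End) x : dotV x x = 1 -> cab (dotV (A x) x) <= nrmd hsd A.
Proof.
move=> x1; rewrite -hsd_rank1; apply: le_trans (CS PE (f := A) (g := rank1 x x) I I) _.
rewrite [X in _ * X](_ : _ = 1) ?mulr1//.
by rewrite /nrmd /nsqd hsd_rank1 rank1E x1 scale1r x1 sqrtr1.
Qed.

(** In finite dimension an injective operator is bijective, which makes the pseudo-inverse of
    [inv_op] a two-sided inverse. *)
Lemma End_inv_op (S : End -> End) : is_operator [set: End] S -> (forall f, S f = 0 -> f = 0) ->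
  (forall f, S (inv_op [set: End] S f) = f) /\ (forall f, inv_op [set: End] S (S f) = f).
Proof.
move=> [_ lS] inj; have iS : injective S.
  move=> f g e; apply/eqP; rewrite -subr_eq0; apply/eqP/inj.
  have := lS (-1) g f I I; rewrite !scaleN1r addrC => ->.
  by rewrite e addNr.
have hl : linear S by move=> a x y; exact: lS.
pose L : {linear End -> End} := HB.pack S (GRing.isLinear.Build _ _ _ _ _ hl).
have k0 : lker (linfun L) == 0%VS.
  rewrite -subv0; apply/subvP => v; rewrite memv_ker lfunE => /eqP /inj ->; exact: mem0v.
have surj f : exists g, S g = f.
  exists ((linfun L)^-1%VF f); have := lker0_lfunVK k0 f; by rewrite lfunE.
split => f.
  apply: pinvK; apply/mem_set; have [g hg] := surj f; by exists g.
by apply: pinvKV; [move=> x y _ _; exact: iS|exact: in_setT].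
Qed.

End EndHilbert.

(** * Berezin symbols and the map [w1] *)

Section BerezinCalculus.
Context {R : realType} {n : nat} (K : unitary_subgroup R n).
Context (V : vectType R[i]) (dotV : {dot V for Num.conj}).
Local Notation C := R[i].
Local Notation End := ('End(V)).
Variables (m : nat) (b : 'I_m -> V).
Hypotheses (ob : forall i j, dotV (b i) (b j) = (i == j)%:R)
  (fb : forall v, v = \sum_i dotV v (b i) *: b i).
Variables (rho : 'M[C]_n -> End) (hrho : unitary_irrep K dotV rho).
Variables (phi0 : 'M[C]_n -> R) (e0 : V) (hassoc : associated K dotV rho phi0 e0).
Local Notation orb := (orbit_space K phi0).
Local Notation s1 := (@berezin R n K V dotV rho phi0 e0).
Let P := dotV_prehilbert dotV.

Lemma rho1 v : rho 1%:M v = v.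
Proof. by have [[-> _] _ _ _ _] := hrho; rewrite lfunE. Qed.

Lemma rhoM k l v : K k -> K l -> rho (k *m l) v = rho k (rho l v).
Proof. by have [[_ h] _ _ _ _] := hrho => Kk Kl; rewrite h// lfunE. Qed.

Lemma rhoU k u v : K k -> dotV (rho k u) (rho k v) = dotV u v.
Proof. by have [_ h _ _ _] := hrho => Kk; exact: h. Qed.

Lemma Kunit k : K k -> k \in unitmx. Proof. by move=> /usub_unitary; exact: unitarymx_unit. Qed.

Lemma rhoV k v : K k -> rho (invmx k) (rho k v) = v.
Proof. by move=> Kk; rewrite -rhoM// ?mulVmx ?rho1//; [exact: Kunit|exact: usubV]. Qed.

Lemma rhoV' k v : K k -> rho k (rho (invmx k) v) = v.
Proof. by move=> Kk; rewrite -rhoM// ?mulmxV ?rho1//; [exact: Kunit|exact: usubV]. Qed.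

Lemma coadM k l phi : K k -> K l -> coad (k *m l) phi = coad k (coad l phi).
Proof.
move=> Kk Kl; apply/funext => X; rewrite /coad.
have uk := usub_unitary Kk; have ul := usub_unitary Kl.
by rewrite !invmx_unitary ?mul_unitarymx// trmx_mul map_mxM !mulmxA.
Qed.

Lemma coad1 phi : coad 1%:M phi = phi :> ('M[C]_n -> R).
Proof. by apply/funext => X; rewrite /coad invmx1 mul1mx mulmx1. Qed.

Lemma orb_rep (phi : orb) : exists2 k, K k & val phi = coad k phi0.
Proof. by have := set_mem (valP phi). Qed.

Lemma e0_norm k : K k -> dotV (rho k e0) (rho k e0) = 1.
Proof. by move=> Kk; rewrite rhoU//; have [] := hassoc. Qed.

Lemma coad_line k l : K k -> K l -> (coad k phi0 = coad l phi0 <-> exists c : C, rho k e0 = c *: rho l e0).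
Proof.
move=> Kk Kl; have [_ _ st] := hassoc; have Kl' := usubV Kl; have Klk := usubM Kl' Kk.
have ul := Kunit Kl.
split=> [e|[c e]].
  have /(st _ Klk)[c hc] : coad (invmx l *m k) phi0 = phi0.
    by rewrite coadM// e -coadM// mulVmx// coad1.
  exists c; have <- : rho l (c *: e0) = c *: rho l e0 by rewrite linearZ.
  by rewrite -hc -(rhoM _ Kl Klk) mulmxA mulmxV// mul1mx.
have : coad (invmx l *m k) phi0 = phi0.
  by apply/(st _ Klk); exists c; rewrite rhoM// e linearZ/= rhoV.
rewrite coadM// => /(congr1 (coad l)); by rewrite -coadM// mulmxV// coad1.
Qed.

(** Two representatives [k] of a point of the orbit have proportional vectors [rho k e0], by
    [coad_line], and the factor has modulus one, so it drops out of the symbol. *)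
Lemma berezinE (A : End) (phi : orb) k : K k -> val phi = coad k phi0 ->
  s1 A phi = dotV (A (rho k e0)) (rho k e0).
Proof.
move=> Kk pk; rewrite /berezin; set l := xget _ _.
have [Kl pl] : K l /\ val phi = coad l phi0.
  by apply: (@xgetPex _ 1%:M [set k | K k /\ val phi = coad k phi0]); exists k.
have /(coad_line Kl Kk)[c e] : coad l phi0 = coad k phi0 by rewrite -pl.
rewrite e [A _]linearZ (dotZl P)// (dotZr P)// mulrA.
have := e0_norm Kl; rewrite e (dotZl P)// (dotZr P)// (e0_norm Kk) mulr1 => ->.
by rewrite mul1r.
Qed.

Lemma berezin_lin (a : C) A B : s1 (a *: A + B) = a *: s1 A + s1 B.
Proof. by apply/funext => phi; rewrite /berezin !fctE !lfunE/= !lfunE/= linearPl. Qed.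

Lemma berezin_sum I (r : seq I) (F : I -> End) : s1 (\sum_(i <- r) F i) = \sum_(i <- r) s1 (F i).
Proof.
elim: r => [|i r IH].
  rewrite !big_nil; have := berezin_lin (-1) 0 0; rewrite scaler0 addr0 => ->.
  by rewrite scaleN1r addNr.
by rewrite !big_cons -IH -[F i]scale1r berezin_lin !scale1r.
Qed.

Lemma berezin_adj A phi : s1 (adjV dotV A) phi = (s1 A phi)^*.
Proof. by have [k Kk pk] := orb_rep phi; rewrite !(berezinE _ Kk pk) (adjV_P' fb) (ph_sym P). Qed.

Definition Ad (k : 'M[C]_n) (A : End) : End := (rho k \o A \o rho (invmx k))%VF.

Lemma AdE k A v : Ad k A v = rho k (A (rho (invmx k) v)).
Proof. by rewrite /Ad !comp_lfunE. Qed.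

Lemma AdK k A : K k -> Ad (invmx k) (Ad k A) = A.
Proof. by move=> Kk; apply/lfunP => v; rewrite !AdE invmxK !rhoV. Qed.

Lemma AdK' k A : K k -> Ad k (Ad (invmx k) A) = A.
Proof. by move=> Kk; rewrite -{1}(invmxK k) AdK//; exact: usubV. Qed.

Lemma Ad_lin k (a : C) A B : Ad k (a *: A + B) = a *: Ad k A + Ad k B.
Proof. by apply/lfunP => v; rewrite AdE !(add_lfunE, scale_lfunE) !AdE linearP. Qed.

Lemma berezin_Ad k A phi : K k -> s1 (Ad k A) phi = s1 A (coad_orbit (invmx k) phi).
Proof.
move=> Kk; have Kk' := usubV Kk; have [l Kl pl] := orb_rep phi.
rewrite (berezinE _ Kl pl) (berezinE _ (usubM Kk' Kl)); last by rewrite val_coad_orbit// coadM// pl.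
by rewrite !rhoM// AdE -[RHS](rhoU _ _ Kk) !rhoV'.
Qed.

Lemma measurable_orb_val X : measurable_fun [set: orb] (fun phi : orb => val phi X).
Proof.
by move=> _ B mB; rewrite setTI; apply: sub_gen_smallest; exists X, B.
Qed.

Lemma measurable_coad_orbit k : K k -> measurable_fun [set: orb] (coad_orbit k : orb -> orb).
Proof.
move=> Kk; have := @measurability _ _ orb orb [set: orb] (coad_orbit k) (@orbit_cylinders R n K phi0) erefl; apply.
move=> A [B [X [D [mD ->]] <-]]; apply: sub_gen_smallest; exists (invmx k *m X *m k), D; split => //.
by rewrite setTI; apply/seteqP; split => phi /=; rewrite val_coad_orbit.
Qed.

Hypothesis hmeas : forall A, cmeasurable (s1 A).
Hypothesis hinj : injective s1.
Variable nu : {finite_measure set orb -> \bar R}.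
Hypotheses (hnu0 : nu [set: orb] <> 0%E)
  (hnu : forall k (X : set orb), K k -> measurable X -> nu (coad_orbit k @^-1` X) = nu X).
Local Notation hsd := (hs_dot dotV).
Let PE := hsd_prehilbert fb.
Let PL := L2_prehilbert nu.
Local Notation Ld := (L2dot nu).
Local Notation D := [set: End].

Lemma cab_berezin A phi : cab (s1 A phi) <= nrmd hsd A.
Proof.
by have [k Kk pk] := orb_rep phi; rewrite (berezinE _ Kk pk); apply: (cab_dotV_le fb); exact: e0_norm.
Qed.

Lemma berezin_L2 A : L2 nu (s1 A).
Proof.
apply: (@L2_le _ _ _ _ _ (fun=> nrmd hsd A ^+ 2)) => //.
  by move=> phi; rewrite lerXn2r ?nnegrE ?cab_ge0 ?nrm_ge0//; exact: cab_berezin.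
exact: finite_measure_integrable_cst.
Qed.

Lemma berezin_L2_bound : exists M : R, forall A, nsqd Ld (s1 A) <= M * nsqd hsd A.
Proof.
exists (fine (nu [set: orb])) => A; rewrite -lee_fin L2_nsq; last exact: berezin_L2.
rewrite mulrC -(nrm_sqr PE)// EFinM fineK; last exact: fin_num_measure.
rewrite -integral_cst//; apply: ge0_le_integral => //.
- by move=> phi _; rewrite lee_fin sqr_ge0.
- by apply/measurable_EFinP; apply: measurable_funX; exact: cmeasurable_cab.
- by move=> phi _; rewrite lee_fin lerXn2r ?nnegrE ?cab_ge0 ?nrm_ge0//; exact: cab_berezin.
Qed.

Local Notation Gr := (berezin_gram dotV rho e0 nu).

(** [berezin_gram] is built on a chosen adjoint, so one must be exhibited: its value at [g] has as
    coefficients on the matrix units the conjugates of the inner products of their symbols with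
    [g]. *)
Lemma gram_dot f h : hsd f (Gr h) = Ld (s1 f) (s1 h).
Proof.
suff : exists B, is_adjoint D hsd (range s1) (L2_dot nu) s1 B.
  move=> /(@xgetPex _ (fun=> 0) (is_adjoint D hsd (range s1) (L2_dot nu) s1))[_ e].
  by rewrite /berezin_gram/= -e//; exists h.
exists (fun g => \sum_i \sum_j (Ld (s1 (rank1 dotV (b i) (b j))) g)^* *: rank1 dotV (b i) (b j)).
split => // A g _ [B _ <-].
rewrite [L2_dot _ _ _](_ : _ = Ld (s1 A) (s1 B))//.
rewrite {1}(End_expand fb A) berezin_sum (dot_suml PL); [|move=> i _|exact: berezin_L2]; last first.
  exact: berezin_L2.
rewrite (dot_sumr PE)//; apply: eq_bigr => i _.
rewrite berezin_sum (dot_suml PL); [|move=> j _|exact: berezin_L2]; last exact: berezin_L2.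
rewrite (dot_sumr PE)//; apply: eq_bigr => j _.
rewrite (dotZr PE)// CJK mulrC.
have := berezin_lin (hsd A (rank1 dotV (b i) (b j))) (rank1 dotV (b i) (b j)) 0.
rewrite addr0 => ->; have -> : s1 0 = 0 by have := berezin_sum [::] (fun i : nat => (0 : End)); rewrite !big_nil.
by rewrite addr0 (dotZl PL)//; exact: berezin_L2.
Qed.

Lemma gram_op : is_operator D Gr.
Proof.
split=> // a f g _ _; apply: (hsd_ext ob fb) => X.
rewrite (dotDr PE)// (dotZr PE)// !gram_dot berezin_lin (dotDr PL)//.
- by rewrite (dotZr PL)//; exact: berezin_L2.
- by apply: (phZ PL); exact: berezin_L2.
- exact: berezin_L2.
- exact: berezin_L2.
Qed.

Lemma gram_pos f : 0 <= hsd (Gr f) f.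
Proof.
rewrite (ph_sym PE (f := f))// gram_dot -(ph_sym PL); [|exact: berezin_L2..].
by apply: (ph_ge0 PL); exact: berezin_L2.
Qed.

Local Notation S := (sqrt_op D hsd Gr).

Lemma gram_sqrt : is_sqrt_op D hsd Gr S /\ forall S', is_sqrt_op D hsd Gr S' -> forall f, S' f = S f.
Proof.
have [M hM] := berezin_L2_bound.
have [|||h1 h2] := @sqrt_op_exists _ _ _ _ (hsd_hilbert ob fb) Gr M.
- exact: gram_op.
- by move=> f _; exact: gram_pos.
- move=> f _; apply: le_trans (hM f); rewrite (ph_sym PE (f := f))// ReJ gram_dot.
  by [].
- by split => // S' hS' f; exact: (h2 S' hS').
Qed.

Let oS : is_operator D S. Proof. by have [[]] := gram_sqrt. Qed.
Let SS f : S (S f) = Gr f. Proof. by have [[_ _ h] _] := gram_sqrt; exact: h. Qed.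
Let S0 f : 0 <= hsd (S f) f. Proof. by have [[_ h _] _] := gram_sqrt; exact: h. Qed.
Let Sh f g : hsd (S f) g = hsd f (S g).
Proof. by rewrite (ph_sym PE (f := S g))// (pos_herm (hsd_hilbert ob fb) oS (fun f _ => S0 f) (f := f) (g := g))// CJK. Qed.

(* A subspace of symbols vanishing almost everywhere has, being of finite
   dimension, a common zero; by transitivity, a [K]-invariant one is zero. *)
Lemma berezin_ae0 f : nsqd Ld (s1 f) = 0 -> f = 0.
Proof.
pose N : set End := [set g | nsqd Ld (s1 g) = 0].
have aeN g : N g -> {ae nu, forall phi, s1 g phi = 0}.
  move=> Ng; have Lg := berezin_L2 g; have := L2_nsq Lg; rewrite Ng => e.
  have mg : measurable_fun [set: orb] (fun x => (cab (s1 g x) ^+ 2)%:E).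
    by apply/measurable_EFinP; apply: measurable_funX; exact: cmeasurable_cab.
  have /(ae_eq_integral_abs nu measurableT mg) : (\int[nu]_x `|(cab (s1 g x) ^+ 2)%:E| = 0)%E.
    by rewrite [RHS]e; apply: eq_integral => x _; rewrite gee0_abs// lee_fin sqr_ge0.
  apply: filterS => phi /(_ I) [] /eqP; rewrite sqrf_eq0 cab_eq0 => /eqP; exact.
have N_lin (a : C) g h : N g -> N h -> N (a *: g + h).
  move=> Ng Nh; rewrite /N/= /nsqd berezin_lin; have Lg := berezin_L2 g; have Lh := berezin_L2 h.
  have La : L2 nu (a *: s1 g) by exact: (phZ PL).
  have z k : L2 nu k -> Ld (s1 g) k = 0 by move=> Lk; exact: (nsq_eq0_dotl PL).
  have z' k : L2 nu k -> Ld (s1 h) k = 0 by move=> Lk; exact: (nsq_eq0_dotl PL).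
  have Ls : L2 nu (a *: s1 g + s1 h) by exact: (phD PL).
  by rewrite (ph_lin PL)// z// z'// mulr0 addr0.
pose Q d := `[< exists U : {vspace End}, (forall g, g \in U -> N g) /\ \dim U = d >].
have N0 : N 0.
  by rewrite /N/= -[0](subrr (0 : End)) -scaleN1r addrC; have := berezin_sum [::] (fun i : nat => (0 : End));
     rewrite !big_nil scaleN1r addNr => ->; rewrite /nsqd (dot0l PL (ph0 PL)).
(* A subspace of null symbols of maximal dimension contains all of them, since any other one could
   be adjoined to it. *)
have [|d|d /asboolP[U [NU dU]] dmax] := @ex_maxnP Q (\dim {:End}).
- by exists 0%N; apply/asboolP; exists 0%VS; rewrite dimv0; split => // g; rewrite memv0 => /eqP->.
- by move=> /asboolP[U [_ <-]]; exact: dimvS (subvf U).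
have UN g : N g -> g \in U.
  move=> Ng; apply: contrapT => /negP gU.
  suff /dmax : Q (\dim (U + <[g]>)%VS).
    rewrite leqNgt -dU => /negP; apply; rewrite ltn_neqAle dimvS ?addvSl// andbT.
    apply: contra gU => /eqP e; have /eqP : U == (U + <[g]>)%VS by rewrite eqEdim addvSl e leqnn.
    by move=> e'; rewrite e'; have := memv_add (mem0v U) (memv_line g); rewrite add0r.
  apply/asboolP; exists (U + <[g]>)%VS; split => // h /memv_addP[u Uu [w /vlineP[a ->] ->]].
  by rewrite addrC; apply: N_lin => //; exact: NU.
have s10 : s1 0 = 0 by have := berezin_sum [::] (fun i : nat => (0 : End)); rewrite !big_nil.
(* Finitely many symbols vanishing almost everywhere have a common zero because [nu] is not zero. *)
have [phi hphi] : exists phi, forall i, s1 (vbasis U)`_i phi = 0.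
  have h : {ae nu, forall phi, forall i, s1 (vbasis U)`_i phi = 0}.
    apply: ae_foralln => i; apply: aeN; have [iU|iU] := ltnP i (\dim U).
      by apply: NU; apply: vbasis_mem; apply: mem_nth; rewrite size_tuple.
    by rewrite nth_default ?size_tuple.
  apply: contrapT => /forallNP no; case: h => A [mA A0 sA]; apply: hnu0.
  by apply/eqP; rewrite -measure_le0 -A0 le_measure ?inE// => phi _; apply: sA => /= h'; exact: (no phi).
have Nphi g : N g -> s1 g phi = 0.
  move=> /UN gU; rewrite (coord_vbasis gU) berezin_sum fct_sumE big1// => i _.
  have := berezin_lin (coord (vbasis U) i g) (vbasis U)`_i 0; rewrite addr0 => ->.
  by rewrite s10 !fctE hphi scaler0 addr0.
move=> Nf; apply: hinj; rewrite s10; apply/funext => psi.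
(* [h = l k^-1] carries the common zero [phi] to an arbitrary [psi]; conjugating [f] by [h^-1] stays
   among the null symbols, so its vanishing at [phi] is that of [s1 f] at [psi]. *)
have [k Kk pk] := orb_rep phi; have [l Kl pl] := orb_rep psi; have Kk' := usubV Kk.
have Kh := usubM Kl Kk'; have Kh' := usubV Kh; pose h := l *m invmx k.
have NA : N (Ad (invmx h) f).
  have E : s1 (Ad (invmx h) f) = s1 f \o coad_orbit h.
    by apply/funext => x; rewrite (berezin_Ad _ _ Kh') invmxK.
  have [_ e] := preserving_L2dot (measurable_coad_orbit Kh) (fun A mA => hnu Kh mA) (berezin_L2 f) (berezin_L2 f).
  by rewrite /N/= /nsqd E e.
transitivity (0 : C) => //.
rewrite -[RHS](Nphi _ NA) (berezin_Ad _ _ Kh') invmxK; congr (s1 f _).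
apply: val_inj; rewrite val_coad_orbit// pl pk -coadM// -mulmxA mulVmx ?mulmx1//; exact: Kunit.
Qed.

Let S_inj f : S f = 0 -> f = 0.
Proof.
move=> Sf; apply: berezin_ae0; rewrite /nsqd -gram_dot -SS Sf.
by rewrite (op0 (hsd_hilbert ob fb) oS) (dot0r PE).
Qed.

Local Notation T := (inv_op D S).
Let ST f : S (T f) = f. Proof. by have [h _] := End_inv_op oS S_inj; exact: h. Qed.
Let TS f : T (S f) = f. Proof. by have [_ h] := End_inv_op oS S_inj; exact: h. Qed.
Local Notation w := (w1 dotV rho e0 nu).

Let T_lin (a : C) f g : T (a *: f + g) = a *: T f + T g.
Proof.
have [_ lS] := oS; apply: (can_inj TS).
by rewrite lS// !ST.
Qed.

Lemma w1_lin (a : C) f g : w (a *: f + g) = a *: w f + w g.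
Proof. by rewrite /w1/= T_lin berezin_lin. Qed.

Lemma w1_sum I (r : seq I) (c : I -> C) (F : I -> End) :
  w (\sum_(i <- r) c i *: F i) = \sum_(i <- r) c i *: w (F i).
Proof.
elim: r => [|i r IH]; last by rewrite !big_cons -IH w1_lin.
by rewrite !big_nil; have := w1_lin (-1) 0 0; rewrite scaler0 addr0 => ->; rewrite scaleN1r addNr.
Qed.

Lemma w1_L2 f : L2 nu (w f).
Proof. exact: berezin_L2. Qed.

Lemma w1_isometry f g : Ld (w f) (w g) = hsd f g.
Proof. by rewrite /w1/= -gram_dot -SS -Sh !ST. Qed.

(** Conjugating [S] by [A] gives a positive square root of [Gr] again, hence [S] itself. [A] is
    either [Ad k] or the conjugate-linear adjoint, so linearity is asked of the conjugate
    [Ai \o S \o A] only. *)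
Let S_comm (A Ai : End -> End) : (forall f, Ai (A f) = f) -> (forall f, A (Ai f) = f) ->
  is_operator D (Ai \o S \o A) -> (forall f, 0 <= hsd (Ai (S (A f))) f) ->
  (forall f, Ai (Gr (A f)) = Gr f) -> forall f, T (A f) = A (T f).
Proof.
move=> AiA AAi oA pA gA; have [_ u] := gram_sqrt.
have e f : Ai (S (A f)) = S f.
  by apply: (u (Ai \o S \o A)); split; [exact: oA|by move=> g _; exact: pA|by move=> g _ /=; rewrite AAi SS gA].
by move=> f; apply: (can_inj TS); rewrite ST -[S _]AAi e ST.
Qed.

Lemma w1_adj f phi : w (adjV dotV f) phi = (w f phi)^*.
Proof.
have aK := adjVK fb; have aL (a : C) x y : adjV dotV (a *: x + y) = a^* *: adjV dotV x + adjV dotV y.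
  apply: (adjV_uniq fb) => u v; rewrite [adjV dotV]lock !(add_lfunE, scale_lfunE) -lock linearPl.
  by rewrite (dotDr P)// (dotZr P)// CJK -!(adjV_P fb).
rewrite /w1/= (S_comm (A := adjV dotV) (Ai := adjV dotV)) ?berezin_adj//.
- by split=> // a g h _ _ /=; have [_ lS] := oS; rewrite aL lS// aL CJK.
- by move=> g; rewrite -{2}(aK g) (hsd_adj fb) (ph_sym PE (f := S (adjV dotV g)))// geC0_conj.
- move=> g; apply: (hsd_ext ob fb) => X; rewrite -{1}(aK X) (hsd_adj fb) (ph_sym PE (f := adjV dotV X))//.
  rewrite !gram_dot /L2dot -cintegralJ; last by apply: L2dot_integrable; exact: berezin_L2.
  by apply: eq_cintegral => x; rewrite !berezin_adj CJM !CJK.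
Qed.

Lemma hsd_Ad k f g : K k -> hsd (Ad k f) (Ad k g) = hsd f g.
Proof.
move=> Kk; have fb' v : v = \sum_i dotV v (rho k (b i)) *: rho k (b i).
  rewrite -{1}(rhoV' v Kk) {1}(fb (rho (invmx k) v)) linear_sum; apply: eq_bigr => i _.
  by rewrite linearZ -{1}(rhoU _ _ Kk) rhoV'.
rewrite (hsdE fb') (hsdE fb); apply: eq_bigr => i _.
by rewrite !AdE !rhoV// rhoU.
Qed.

Lemma w1_Ad k f phi : K k -> w (Ad k f) phi = w f (coad_orbit (invmx k) phi).
Proof.
move=> Kk; have Kk' := usubV Kk; have hA x y : hsd (Ad (invmx k) x) y = hsd x (Ad k y).
  by rewrite -[RHS](hsd_Ad _ _ Kk') AdK.
rewrite /w1/= (S_comm (A := Ad k) (Ai := Ad (invmx k))) ?berezin_Ad//.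
- by move=> x; rewrite AdK.
- by move=> x; rewrite AdK'.
- by split=> // a g h _ _ /=; have [_ lS] := oS; rewrite Ad_lin lS// Ad_lin.
- by move=> g; rewrite hA.
- move=> g; apply: (hsd_ext ob fb) => X; rewrite -[LHS](hsd_Ad _ _ Kk) AdK'// !gram_dot.
  have E x : s1 (Ad k x) = s1 x \o coad_orbit (invmx k) by apply/funext => y; rewrite berezin_Ad.
  rewrite !E.
  by have [_ ->] := preserving_L2dot (measurable_coad_orbit Kk') (fun A mA => hnu Kk' mA) (berezin_L2 X) (berezin_L2 g).
Qed.

End BerezinCalculus.

(** * The motion group *)

Section MotionOperators.
Context {R : realType} {n : nat} (lam : {posnum R}) (K : unitary_subgroup R n).
Context (V : vectType R[i]) (dotV : {dot V for Num.conj}).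
Local Notation C := R[i].
Local Notation cV := 'cV[C]_n.
Variables (rho : 'M[C]_n -> 'End(V)) (hrho : unitary_irrep K dotV rho).
Variables (m : nat) (b : 'I_m -> V).
Hypotheses (ob : forall i j, dotV (b i) (b j) = (i == j)%:R)
  (fb : forall v, v = \sum_i dotV v (b i) *: b i).
Local Notation pi := (motion_rep lam rho).
Local Notation HV := (fockV (n := n) lam dotV).
Local Notation H0 := (fock0 (n := n) lam).
Local Notation dot0 := (fock0_dot (n := n) lam).
Local Notation fcomp := (fcomp (n := n) dotV b).
Local Notation ftens := (ftens (n := n) b).
Let P := dotV_prehilbert dotV.
Let P0 := fock0_prehilbert (n := n) lam.

Definition shift_of (g : motion R n) : cV := ('i * (lam%:num)%:C) *: mz g.
Definition heis_of (g : motion R n) := heis_op lam (lam%:num * mc g) (shift_of g) (mk g).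

Lemma motion_repE g f z : pi g f z = heis_mult lam (lam%:num * mc g) (shift_of g) z *:
  rho (mk g) (f (invmx (mk g) *m (z + shift_of g))).
Proof.
rewrite /motion_rep heis_multE; congr (cexp _ *: _).
have l0 : (lam%:num)%:C != 0 :> C by rewrite (inj_eq (@complexI R)) gt_eqF.
have -> : cdot (zbar (mz g)) z = cVdot z (mz g).
  by rewrite /cdot cVdotE; apply: eq_bigr => i _; rewrite mxE mulrC.
have -> : sqnorm (shift_of g) = lam%:num ^+ 2 * sqnorm (mz g).
  rewrite -[LHS]/(nsqd (@cVdot R n) _) (nsqZ cV_prehilbert)//.
  by rewrite cabM cab_i mul1r cab_real real_normK ?num_real.
rewrite /shift_of (dotZr cV_prehilbert)// CJM CRJ.
have -> : ('i : C)^* = - 'i by rewrite conjCi.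
rewrite !CRM fmorphV rmorphM rmorph_nat /= ?rmorphXn /=.
have -> : (2^-1)%:C = 2^-1 :> C by rewrite fmorphV rmorph_nat.
move: l0 (cVdot _ _) (sqnorm _)%:C (mc g)%:C; move: (lam%:num)%:C => l l0 x y t.
by field.
Qed.

Lemma comp_pi g i f : fcomp i (pi g f) =
  \sum_k dotV (rho (mk g) (b k)) (b i) *: heis_of g (fcomp k f).
Proof.
apply/funext => z; rewrite fct_sumE /fcomp motion_repE linearZl_LR/=.
rewrite {1}(fb (f _)) linear_sum linear_sumlz mulr_sumr; apply: eq_bigr => k _.
rewrite linearZ linearZl_LR/=.
have gen (x y t : C) : x * (y * t) = t * (x * y) by ring.
exact: gen.
Qed.

Lemma piK g f : motion_group K g -> pi g (pi (motion_inv g) f) = f.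
Proof.
move=> Kg; have uk := usub_unitary Kg; apply/funext => z; rewrite !motion_repE.
have -> : shift_of (motion_inv g) = - (invmx (mk g) *m shift_of g).
  by rewrite /shift_of /= scalerN -scalemxAr.
rewrite /= mulrN linearZ/= scalerA heis_mult_inv// scale1r (rhoV' hrho)//.
congr (f _); rewrite invmxK -mulmxBr addrK mulmxA mulmxV ?mul1mx//; exact: unitarymx_unit.
Qed.

Lemma motion_invK (g : motion R n) : motion_group K g -> motion_inv (motion_inv g) = g.
Proof.
move=> Kg; case: g Kg => z0 c k Kk; rewrite /motion_inv /= invmxK opprK mulmxN opprK mulmxA mulmxV ?mul1mx//.
exact: (unitarymx_unit (usub_unitary Kk)).
Qed.

Lemma motion_group_inv (g : motion R n) : motion_group K g -> motion_group K (motion_inv g).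
Proof. exact: usubV. Qed.

Lemma piK' g f : motion_group K g -> pi (motion_inv g) (pi g f) = f.
Proof.
move=> Kg; rewrite -{2}(motion_invK Kg); apply: piK; exact: motion_group_inv.
Qed.

Lemma heis_of_iso g f h : motion_group K g -> H0 f -> H0 h ->
  H0 (heis_of g f) /\ dot0 (heis_of g f) (heis_of g h) = dot0 f h.
Proof. by move=> /usub_unitary; exact: heis_op_iso. Qed.

Lemma heis_of_inv g f : motion_group K g -> heis_of g (heis_of (motion_inv g) f) = f.
Proof.
move=> Kg; rewrite /heis_of.
have -> : shift_of (motion_inv g) = - (invmx (mk g) *m shift_of g).
  by rewrite /shift_of /= scalerN -scalemxAr.
rewrite /= mulrN; exact: (heis_opK _ _ _ _ (usub_unitary Kg)).
Qed.

Lemma pi_fockV g f : motion_group K g -> HV f -> HV (pi g f).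
Proof.
move=> Kg /(fockVP lam fb) h; apply/(fockVP lam fb) => i; rewrite comp_pi.
by apply: (ph_sum P0) => k _; apply: (phZ P0); have [] := heis_of_iso Kg (h k) (h k).
Qed.

Lemma inv_op_pi g f : motion_group K g -> HV f -> inv_op HV (pi g) f = pi (motion_inv g) f.
Proof.
move=> Kg Hf; have Kg' := motion_group_inv Kg; rewrite -{1}(piK f Kg).
apply: pinvKV; last by apply/mem_set; exact: pi_fockV.
by move=> x y _ _ e; rewrite -(piK' x Kg) e piK'.
Qed.

End MotionOperators.

(** * Construction of the correspondence *)

Section Assembly.
Variables (R : realType) (n : nat) (hn : (0 < n)%N) (lam : {posnum R})
  (K : unitary_subgroup R n) (V : vectType R[i]) (dotV : {dot V for Num.conj})
  (rho : 'M[R[i]]_n -> 'End(V)) (hrho : unitary_irrep K dotV rho)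
  (phi0 : 'M[R[i]]_n -> R) (e0 : V) (hassoc : associated K dotV rho phi0 e0)
  (hinj : injective (@berezin R n K V dotV rho phi0 e0))
  (hmeas : forall A, cmeasurable (@berezin R n K V dotV rho phi0 e0 A))
  (nu : {finite_measure set (orbit_space K phi0) -> \bar R})
  (hnu0 : nu [set: orbit_space K phi0] <> 0%E)
  (hnu : forall k (X : set (orbit_space K phi0)), K k -> measurable X ->
    nu (coad_orbit k @^-1` X) = nu X).
Local Notation C := R[i].
Local Notation cV := 'cV[C]_n.
Local Notation Cn := (Cn R n).
Local Notation orb := (orbit_space K phi0).
Local Notation fm := (fock_measure n lam).
Local Notation pi := (motion_rep lam rho).
Local Notation HV := (fockV (n := n) lam dotV).
Local Notation dotF := (fockV_dot (n := n) lam dotV).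
Local Notation H0 := (fock0 (n := n) lam).
Local Notation dot0 := (fock0_dot (n := n) lam).
Local Notation kf := (kf lam : cV -> cV -> C^o).
Local Notation Om := (Omega0 lam : Cn -> (cV -> C^o) -> cV -> C^o).
Local Notation w := (w1 dotV rho e0 nu).
Let P := dotV_prehilbert dotV.
Let HH := fock0_hilbert (n := n) lam.

(** The action is a product map: on sections it is the invariance of [nu], and then that of the Fock
    measure under a unitary affine map. *)
Lemma motion_act_invariant g (X : set (Cn * orb)) : motion_group K g -> measurable X ->
  measurable (motion_act lam g @^-1` X) /\ (fm \x nu)%E (motion_act lam g @^-1` X) = (fm \x nu)%E X.
Proof.
move=> Kg mX; have uk := usub_unitary Kg.
pose tau (z : Cn) : Cn := mk g *m (z : cV) + (- (('i * (lam%:num)%:C) *: mz g)).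
have mt : measurable_fun [set: Cn] tau by exact: measurable_affine.
have pt (A : set Cn) : measurable A -> fm (tau @^-1` A) = fm A by exact: fock_affine.
have mc := measurable_coad_orbit Kg (phi0 := phi0).
have ma : measurable_fun [set: Cn * orb] (motion_act lam g : Cn * orb -> Cn * orb).
  apply/measurable_fun_pair.
    exact: (measurableT_comp mt measurable_fst).
  exact: (measurableT_comp mc measurable_snd).
split; first by rewrite -[X in measurable X]setTI; exact: ma.
have mF : measurable_fun [set: Cn] (nu \o xsection X) by exact: measurable_fun_xsection.
rewrite -[RHS]/(\int[fm]_z (nu \o xsection X) z)%E -(preserving_ge0_integral mt pt mF); last first.
  by move=> z; exact: measure_ge0.
apply: eq_integral => z _ /=.
rewrite -(hnu Kg (measurable_xsection (tau z) mX)); congr (nu _).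
Qed.

Theorem weyl_correspondence : exists W : ((cV -> V) -> cV -> V) -> Cn * orb -> C,
    [/\ is_weyl_map lam dotV rho e0 nu W,
        forall W', is_weyl_map lam dotV rho e0 nu W' ->
          forall A, trace_class HV dotF A -> W' A = W A
      & stratonovich_weyl HV dotF (motion_group K) (@motion_inv R n) pi
          (@motion_act R n lam K phi0) (fm \x nu)%E W].
Proof.
have [m [b [m0 ob fb]]] : exists m (b : 'I_m -> V), [/\ (0 < m)%N,
  forall i j, dotV (b i) (b j) = (i == j)%:R & forall v, v = \sum_i dotV v (b i) *: b i].
  by apply: onbV_exists; have [] := hrho.
have [e oe ce] := fock0_onb lam hn.
pose E i j := rank1 dotV (b i) (b j); pose G i j := w (E i j).
have S := @fock_sum R n lam V dotV m b ob fb; have smu := @fock_measure_sf R n lam.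
pose W := tW (D := H0) (dot := dot0) (fcomp dotV b) (ftens b) Om G.
have Oop z : is_operator H0 (Om z) by exact: Om_op.
have Oh z f g : H0 f -> H0 g -> dot0 (Om z f) g = dot0 f (Om z g) by exact: Om_sym.
have Ole z f : H0 f -> nrmd dot0 (Om z f) <= 2 ^+ n * nrmd dot0 f by exact: Om_le.
have c0 : 0 <= 2 ^+ n :> R by exact: pow2_ge0.
have Dk a : H0 (kf a) by exact: kf_fock0.
have mk4 := @moyal_coherent R n lam.
have LG i j : L2 nu (G i j) by exact: w1_L2.
have GJ i j x : (G i j x)^* = G j i x.
  by rewrite /G -(w1_adj ob fb hrho hassoc hmeas hinj hnu0 hnu) /E (adjV_rank1 fb).
have Gonb i j i' j' : L2dot nu (G i j) (G i' j') = ((i == i') && (j == j'))%:R.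
  by rewrite (w1_isometry ob fb hrho hassoc hmeas hinj hnu0 hnu) (hsd_onb ob fb).
have Wlin : forall (a : C) A B, trace_class HV dotF A -> trace_class HV dotF B ->
    W (a *: A + B) = a *: W A + W B.
  by move=> a A B tA tB; exact: (tW_lin HH m0 S Oop Ole c0 oe G a tA tB).
have wexp A : w A = \sum_i \sum_j dotV (A (b j)) (b i) *: G i j.
  rewrite {1}(End_expand fb A) pair_bigA/= (w1_sum ob fb hrho hassoc hmeas hinj hnu0 hnu) pair_bigA.
  by apply: eq_bigr => p _; rewrite (hsd_rank1 fb).
have Wt : forall A0 A1 A, trace_class H0 dot0 A0 ->
    trace_class HV dotF A -> is_tensor lam A0 A1 A ->
    forall z phi, W A (z, phi) = W0 lam A0 z * w A1 phi.
  move=> A0 A1 A t0 tA hA z phi; have [u [v N0]] := trace_class_nuclear HH t0.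
  have o0 : is_operator H0 A0 by case: t0 => -[].
  have qE i j : qW (D := H0) (dot := dot0) Om (block (fcomp dotV b) (ftens b) A i j) z =
      dotV (A1 (b j)) (b i) * W0 lam A0 z.
    (* [qW_sum] over a one-element list takes the scalar out of the trace. *)
    have := qW_sum HH Oop Ole c0 oe [:: tt] (fun=> dotV (A1 (b j)) (b i)) z (fun=> N0) (fun=> o0).
    rewrite big_seq1 W0E => <-; apply: (congr1 (fun f => f z)); apply: (qW_ext Oop) => f Df.
    rewrite big_seq1 /block/= /ftens (hA f (b j) Df); apply/funext => y.
    by rewrite /fcomp linearZl_LR/= mulrC.
  rewrite /W /tW/= wexp fct_sumE mulr_sumr; apply: eq_bigr => i _.
  rewrite fct_sumE mulr_sumr; apply: eq_bigr => j _; rewrite qE.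
  by rewrite fctE mulrAC mulrC mulrA.
have lift_tensor i j B : is_operator H0 B ->
    is_tensor lam B (E i j) (lift (fcomp dotV b) (ftens b) i j B).
  move=> oB f v Df; rewrite /lift/=.
  have -> : fcomp dotV b j (fun z => f z *: v) = dotV v (b j) *: f.
    by apply/funext => z; rewrite /fcomp linearZl_LR/= mulrC.
  rewrite (opZ HH _ oB)//; apply/funext => z.
  by rewrite /ftens /E rank1E scalerA mulrC.
exists W; split; first by split.
- move=> W' [W'lin W't] A tA.
  have [Z [tZ Z0] dec] := tc_decompose HH m0 S oe tA.
  rewrite (dec _ W' W'lin) (dec _ W Wlin); congr (_ + _).
    apply: eq_bigr => -[i j] _ /=; apply/funext => -[z phi].
    have tB := block_tc HH m0 S oe i j tA; have tL := lift_tc HH m0 S oe i j tB.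
    have oB : is_operator H0 (block (fcomp dotV b) (ftens b) A i j) by case: tB => -[].
    by rewrite (W't _ _ _ tB tL (lift_tensor i j _ oB)) (Wt _ _ _ tB tL (lift_tensor i j _ oB)).
  (* The residual [Z] vanishes on the Hilbert space, so it is the tensor of any operator with the
     zero endomorphism; the product rule fixes its value under both maps. *)
  apply/funext => -[z phi]; have tB := block_tc HH m0 S oe (Ordinal m0) (Ordinal m0) tZ.
  have tens0 : is_tensor lam (block (fcomp dotV b) (ftens b) Z (Ordinal m0) (Ordinal m0)) 0 Z.
    move=> f v Df; rewrite Z0; first by apply/funext => y; rewrite lfunE/= scaler0.
    apply/(fockVP lam fb) => i.
    have -> : fcomp dotV b i (fun z => f z *: v) = dotV v (b i) *: f.
      by apply/funext => y; rewrite /fcomp linearZl_LR/= mulrC.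
    exact: (phZ (hb_pre HH)).
  by rewrite (W't _ _ _ tB tZ tens0) (Wt _ _ _ tB tZ tens0).
- split.
  + by move=> g X; exact: motion_act_invariant.
  + exact: Wlin.
  + move=> A B tA tB; exact: (tW_injective HH m0 S smu Oop Oh Ole c0 Dk mk4 oe ce LG GJ Gonb tA tB).
  + move=> A tA p; exact: (tW_adjoint HH m0 S Oop Oh Ole c0 oe GJ p tA).
  + move=> g A Kg tA [z phi].
    have Kg' := motion_group_inv Kg; have oA : is_operator HV A by case: tA => -[].
    pose r i k := dotV (rho (mk g) (b k)) (b i).
    have hi f h : H0 f -> H0 h -> dot0 (heis_of lam g f) h = dot0 f (heis_of lam (motion_inv g) h).
      move=> Df Dh; have [Dh' _] := heis_of_iso Kg' Dh Dh.
      by rewrite -{1}(heis_of_inv lam h Kg); have [_ ->] := heis_of_iso Kg Df Dh'.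
    have -> : motion_act lam (motion_inv g) (z, phi) =
        (invmx (mk g) *m ((z : cV) + shift_of lam g), coad_orbit (invmx (mk g)) phi).
      rewrite /motion_act /shift_of/=; congr (_, _).
      by rewrite scalerN opprK mulmxDr scalemxAr.
    apply: (tW_covariant HH m0 S Oop Ole c0 oe (U0 := heis_of lam g)
      (U0i := heis_of lam (motion_inv g)) (r := r) (G := G)).
    * by move=> f Df; rewrite (inv_op_pi hrho fb Kg Df); exact: (pi_fockV rho fb Kg' Df).
    * by move=> f Df; have [] := heis_of_iso Kg Df Df.
    * by move=> f Df; have [] := heis_of_iso Kg' Df Df.
    * by move=> a f h _ _; exact: heis_op_lin.
    * by move=> a f h _ _; exact: heis_op_lin.
    * exact: hi.
    * by move=> f h Df Dh; have [] := heis_of_iso Kg Df Dh.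
    * by move=> i f _; exact: (comp_pi lam rho fb).
    * move=> j l f Df; rewrite (inv_op_pi hrho fb Kg); last exact: (hs_tensD S).
      rewrite (comp_pi lam rho fb) (bigD1 j)//= (hs_compK S)// eqxx scale1r big1 ?addr0.
        by congr (_ *: _); rewrite /r -(ph_sym P)// -[RHS](rhoU hrho _ _ (usubV Kg)) (rhoV hrho).
      move=> i ij; rewrite (hs_compK S)// (negbTE ij) scale0r.
      have := heis_op_lin lam (lam%:num * mc (motion_inv g)) (shift_of lam (motion_inv g)) (mk (motion_inv g)) (-1) 0 0.
      by rewrite scaler0 addr0 /heis_of => ->; rewrite scaleN1r addNr scaler0.
    * exact: tA.
    * by move=> f _; exact: (Omega0_heis lam _ _ _ _ (usub_unitary Kg)).
    (* Covariance of [w1] at the matrix unit [E k l]: the coefficients of [Ad] of it on the matrix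
       units are the products of entries of [rho] in [r]. *)
    * move=> k l; rewrite /G -(w1_Ad ob fb hrho hassoc hmeas hinj hnu0 hnu (E k l) phi Kg).
      rewrite wexp fct_sumE; apply: eq_bigr => i _; rewrite fct_sumE; apply: eq_bigr => j _.
      rewrite fctE; congr (_ * _); rewrite AdE /E rank1E linearZ/= linearZl_LR/= mulrC.
      by congr (_ * _); rewrite /r -(ph_sym P)// -[RHS](rhoU hrho _ _ Kg) (rhoV' hrho).
  + by move=> A B tA tB; exact: (tW_trace HH m0 S smu Oop Oh Ole c0 Dk mk4 oe ce LG GJ Gonb tA tB).
Qed.

End Assembly.

(** * One-parameter groups and measurability of Berezin symbols *)

Section ExpSums.
Context {F : numFieldType}.

Definition expc (s : F) (j : nat) : F := (j`!%:R)^-1 * s ^+ j.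

Lemma triangular_sum (G : nat -> nat -> F) N :
  \sum_(0 <= m < N) \sum_(0 <= i < m.+1) G (m - i)%N i =
  \sum_(0 <= a < N) \sum_(0 <= b < N | (a + b < N)%N) G a b.
Proof.
transitivity (\sum_(0 <= m < N) \sum_(0 <= i < N | (i < m.+1)%N) G (m - i)%N i).
  by apply: eq_big_nat => m /andP[_ mN]; rewrite (big_nat_widen _ _ N).
rewrite (exchange_big_dep_nat xpredT)//= [RHS](exchange_big_dep_nat xpredT)//=.
apply: eq_big_nat => i /andP[_ iN].
transitivity (\sum_(0 <= a < N - i) G a i).
  transitivity (\sum_(i <= m < N) G (m - i)%N i).
    by rewrite [RHS](big_nat_widenl i 0)//; apply: eq_bigl => m.
  have -> : \sum_(i <= m < N) G (m - i)%N i = \sum_(0 + i <= m < N) G (m - i)%N i by rewrite add0n.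
  by rewrite big_addn; apply: eq_bigr => a _; rewrite addnK.
rewrite [RHS](_ : _ = \sum_(0 <= a < N | (a < N - i)%N) G a i).
  by rewrite [LHS](big_nat_widen _ _ N) ?leq_subr//.
by apply: eq_bigl => a; rewrite ltn_subRL addnC.
Qed.

Lemma expcD (s t : F) m : expc (s + t) m = \sum_(0 <= i < m.+1) expc s (m - i) * expc t i.
Proof.
rewrite /expc exprDn mulr_sumr big_mkord; apply: eq_bigr => i _.
have im : (i <= m)%N by rewrite -ltnS.
have f0 k : (k`!%:R : F) != 0 by rewrite pnatr_eq0 -lt0n fact_gt0.
rewrite -mulr_natr -(bin_fact im) !natrM.
have b0 : ('C(m, i)%:R : F) != 0 by rewrite pnatr_eq0 -lt0n bin_gt0.
by field; rewrite !f0 b0.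
Qed.

(** The product of two partial sums differs from the partial sum of the Cauchy product by the terms
    of the square [a, b < N] with [a + b >= N]. The sequence [x] stands for the powers, of a matrix
    or of a norm. *)
Lemma exp_sumD (x : nat -> F) s t N :
  \sum_(0 <= a < N) \sum_(0 <= b < N) expc s a * expc t b * x (a + b)%N -
  \sum_(0 <= m < N) expc (s + t) m * x m =
  \sum_(0 <= a < N) \sum_(0 <= b < N | (N <= a + b)%N) expc s a * expc t b * x (a + b)%N.
Proof.
have -> : \sum_(0 <= m < N) expc (s + t) m * x m =
    \sum_(0 <= a < N) \sum_(0 <= b < N | (a + b < N)%N) expc s a * expc t b * x (a + b)%N.
  rewrite -(triangular_sum (fun a b => expc s a * expc t b * x (a + b)%N)).
  apply: eq_bigr => m _; rewrite expcD mulr_suml; apply: eq_big_nat => i /andP[_ im].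
  by rewrite subnK.
rewrite -sumrB; apply: eq_bigr => a _.
rewrite [X in X - _](bigID (fun b => (a + b < N)%N))/= addrAC subrr add0r.
by apply: eq_bigl => b; rewrite -leqNgt.
Qed.

End ExpSums.

Lemma cvg_mx {R : realType} {m n : nat} (T : Type) (F : set_system T) {FF : Filter F}
    (u : T -> 'M[R[i]]_(m, n)) (l : 'M[R[i]]_(m, n)) :
  (forall a b, (fun x => u x a b) @ F --> l a b) -> u @ F --> l.
Proof.
move=> h; apply/cvg_ballP => e e0.
have : \forall x \near F, forall p : 'I_m * 'I_n, ball (l p.1 p.2) e (u x p.1 p.2).
  by apply: filter_forall => -[a b] /=; have /cvg_ballP := h a b; apply.
by apply: filterS => x hx; split => // a b; exact: (hx (a, b)).
Qed.

(** * The matrix exponential *)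

Section MatrixExponential.
Context {R : realType} {n : nat}.
Local Notation C := R[i].
Local Notation M := 'M[C]_n.
Implicit Types (X Y : M).

Definition mxsum X : R := \sum_a \sum_b cab (X a b).

Lemma mxsum_ge0 X : 0 <= mxsum X.
Proof. by apply: sumr_ge0 => a _; apply: sumr_ge0 => b _; exact: cab_ge0. Qed.

Lemma mxpow_le X j a b : cab ((X ^+ j) a b) <= mxsum X ^+ j.
Proof.
elim: j a b => [|j IH] a b.
  rewrite !expr0 mxE; case: (a == b); first by rewrite cab1.
  by rewrite (_ : cab 0 = 0) ?ler01//; apply/eqP; rewrite cab_eq0.
rewrite exprSr [X in cab X]mxE exprSr.
apply: le_trans (cab_sum _ _ _) _.
apply: (@le_trans _ _ (\sum_c mxsum X ^+ j * cab (X c b))).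
  by apply: ler_sum => c _; rewrite cabM ler_wpM2r ?cab_ge0.
rewrite -mulr_sumr ler_wpM2l ?exprn_ge0 ?mxsum_ge0// /mxsum; apply: ler_sum => c _.
by rewrite (bigD1 b)//= lerDl; apply: sumr_ge0 => d _; exact: cab_ge0.
Qed.

Lemma scalemx_exp (s : C) X j : (s *: X) ^+ j = s ^+ j *: X ^+ j.
Proof.
elim: j => [|j IH]; first by rewrite !expr0 scale1r.
rewrite !exprSr IH -[LHS]/((s ^+ j *: X ^+ j) *m (s *: X)) -scalemxAl -scalemxAr scalerA.
by rewrite -mulrC.
Qed.

Lemma cab_expc (s : C) j : cab (expc s j) = expc (cab s) j.
Proof.
rewrite /expc cabM cabX; congr (_ * _).
rewrite -[j`!%:R](rmorph_nat (@real_complex R)) -fmorphV cab_real ger0_norm//.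
Qed.

Lemma expc_cvg (x : R) : series (expc x) @ \oo --> expR x.
Proof.
have := is_cvg_series_exp_coeff x => h; have -> : expc x = exp_coeff x.
  by apply/funext => j; rewrite /expc /exp_coeff/= mulrC.
exact: h.
Qed.

Arguments expc_cvg : clear implicits.

Lemma expc_ge0 (x : R) j : 0 <= x -> 0 <= expc x j.
Proof. by move=> x0; rewrite /expc mulr_ge0 ?invr_ge0 ?exprn_ge0. Qed.

Lemma expm_entry (s : C) X a b :
  series (fun j => expc s j * (X ^+ j) a b : C) @ \oo --> expm (s *: X) a b.
Proof.
have h (c d : 'I_n) : exists l : C, series (fun j => expc s j * (X ^+ j) c d : C) @ \oo --> l.
  apply: abs_cvgC; apply: (@series_le_cvg _ _ (expc (cab s * mxsum X))).
  - by move=> j; exact: cab_ge0.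
  - move=> j; rewrite cabM cab_expc {2}/expc exprMn mulrA -/(expc (cab s) j).
    by rewrite ler_wpM2l ?mxpow_le// expc_ge0// cab_ge0.
  - by apply/cvg_ex; exists (expR (cab s * mxsum X)); exact: expc_cvg.
have hc c : exists f : 'I_n -> C, forall d, series (fun j => expc s j * (X ^+ j) c d : C) @ \oo --> f d.
  by have [f hf] := choice (h c); exists f.
have [l hl] := choice hc.
have cv : series (fun j => (j`!%:R)^-1 *: (s *: X) ^+ j) @ \oo --> (\matrix_(c, d) l c d : M).
  apply: cvg_mx => c d; rewrite mxE; apply: cvg_ext (hl c d) => N.
  rewrite /series/= summxE; apply: eq_bigr => j _.
  by rewrite scalemx_exp !mxE mulrA.
by rewrite /expm (cvg_lim (@norm_hausdorff _ M) cv) ?mxE//; exact: hl.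
Qed.

Arguments expm_entry : clear implicits.

Lemma expm_partial (s : C) X N a b :
  (\sum_(0 <= j < N) expc s j *: X ^+ j) a b = \sum_(0 <= j < N) expc s j * (X ^+ j) a b.
Proof. by rewrite summxE; apply: eq_bigr => j _; rewrite mxE. Qed.

(** By [exp_sumD] the error of the Cauchy product is dominated entrywise by the scalar error for
    [|s| mxsum X] and [|t| mxsum X], which tends to 0 by the addition formula of the real
    exponential. *)
Theorem expmD (s t : C) X : expm ((s + t) *: X) = expm (s *: X) *m expm (t *: X).
Proof.
apply/matrixP => a b; pose E (u : C) (N : nat) : M := \sum_(0 <= j < N) expc u j *: X ^+ j.
have cE (u : C) c d : (fun N => E u N c d) @ \oo --> expm (u *: X) c d.
  by apply: cvg_ext (expm_entry u X c d) => N; rewrite /E expm_partial.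
have cP : (fun N => (E s N *m E t N) a b) @ \oo --> (expm (s *: X) *m expm (t *: X)) a b.
  rewrite mxE; have h : (fun N => \sum_(c <- index_enum 'I_n) E s N a c * E t N c b) @ \oo -->
      \sum_(c <- index_enum 'I_n) expm (s *: X) a c * expm (t *: X) c b.
    by apply: cvg_sum_seq => c; exact: (cvgM (cE s a c) (cE t c b)).
  by apply: cvg_ext h => N; rewrite mxE.
apply: (cvg_uniqueC (cE (s + t) a b)).
pose x := cab s * mxsum X; pose y := cab t * mxsum X.
pose e (z : R) N : R := series (expc z) N.
have ce : (fun N => e x N * e y N - e (x + y) N) @ \oo --> (0 : R).
  have h : (fun N => e x N * e y N - e (x + y) N) @ \oo --> expR x * expR y - expR (x + y).
    exact: (cvgB (cvgM (expc_cvg x) (expc_cvg y)) (expc_cvg (x + y))).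
  by rewrite expRD subrr in h.
have d0 : (fun N => (E s N *m E t N) a b - E (s + t) N a b) @ \oo --> (0 : C).
  apply: (@cvg0C_le _ _ _ _ _ _ (fun N => e x N * e y N - e (x + y) N)) => // N.
  rewrite subr0; pose g j := (X ^+ j) a b.
  have -> : (E s N *m E t N) a b = \sum_(0 <= p < N) \sum_(0 <= q < N) expc s p * expc t q * g (p + q)%N.
    rewrite mulmx_suml summxE; apply: eq_bigr => p _; rewrite mulmx_sumr summxE; apply: eq_bigr => q _.
    by rewrite -scalemxAl -scalemxAr scalerA mxE /g exprD.
  rewrite {1}/E expm_partial exp_sumD.
  have eE z : e z N = \sum_(0 <= j < N) expc z j by [].
  have eM u v : expc (u * mxsum X) v = expc u v * mxsum X ^+ v by rewrite /expc exprMn mulrA.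
  have -> : e x N * e y N - e (x + y) N =
     \sum_(0 <= p < N) \sum_(0 <= q < N | (N <= p + q)%N) expc (cab s) p * expc (cab t) q * mxsum X ^+ (p + q).
    rewrite -exp_sumD; congr (_ - _).
      rewrite !eE mulr_suml; apply: eq_bigr => p _; rewrite mulr_sumr; apply: eq_bigr => q _.
      by rewrite /x /y !eM exprD mulrACA.
    by rewrite eE /x /y -mulrDl; apply: eq_bigr => p _; rewrite eM.
  apply: le_trans (cab_sum _ _ _) _; apply: ler_sum => p _.
  apply: le_trans (cab_sum _ _ _) _; apply: ler_sum => q _.
  rewrite (cabM (expc s p * expc t q)) (cabM (expc s p)) !cab_expc; apply: ler_wpM2l (mxpow_le _ _ _ _).
  by apply: mulr_ge0; apply: expc_ge0; exact: cab_ge0.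
have h : (fun N => (E s N *m E t N) a b - ((E s N *m E t N) a b - E (s + t) N a b)) @ \oo -->
    (expm (s *: X) *m expm (t *: X)) a b - 0 by exact: (cvgB cP d0).
by rewrite subr0 in h; apply: cvg_ext h => N; rewrite opprB addrC subrK.
Qed.

(** The zeroth term of the series is the identity, so partial sums are shifted by one to cancel it
    on both sides. *)
Lemma expm_bound (s : C) X a b :
  cab (expm (s *: X) a b - (a == b)%:R) <= expR (cab s * mxsum X) - 1.
Proof.
have c1 : (fun N => cab (series (fun j => expc s j * (X ^+ j) a b : C) N.+1 - (a == b)%:R)) @ \oo -->
    cab (expm (s *: X) a b - (a == b)%:R).
  apply: cvg_cabn; apply: cvgB; last exact: cvg_cst.
  by rewrite (cvg_shiftS (series _)); exact: expm_entry.
have c2 : (fun N => series (expc (cab s * mxsum X)) N.+1 - 1) @ \oo --> expR (cab s * mxsum X) - 1.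
  apply: cvgB; last exact: cvg_cst.
  by rewrite (cvg_shiftS (series _)); exact: expc_cvg.
rewrite -(cvg_lim _ c1)// -(cvg_lim _ c2)//; apply: ler_lim.
- by apply/cvg_ex; exists (cab (expm (s *: X) a b - (a == b)%:R)).
- by apply/cvg_ex; exists (expR (cab s * mxsum X) - 1).
apply: nearW => N; rewrite /series/= !big_nat_recl//=.
have e0 (F : numFieldType) (z : F) : expc z 0 = 1 by rewrite /expc fact0 invr1 mul1r.
rewrite !e0 mul1r expr0 mxE addrC addKr addrC addKr.
apply: le_trans (cab_sum _ _ _) _; apply: ler_sum => j _.
rewrite cabM cab_expc {2}/expc exprMn mulrA -/(expc (cab s) j.+1).
by rewrite ler_wpM2l ?mxpow_le// expc_ge0// cab_ge0.
Qed.

Lemma expm0 X : expm (0 *: X) = 1%:M.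
Proof.
apply/matrixP => a b; rewrite mxE; apply/eqP; rewrite -subr_eq0 -cab_eq0 eq_le cab_ge0 andbT.
apply: le_trans (expm_bound 0 X a b) _.
by rewrite (_ : cab 0 = 0) ?mul0r ?expR0 ?subrr//; apply/eqP; rewrite cab_eq0.
Qed.

Lemma expm_conj (s : C) X k : k \in unitmx ->
  expm (s *: (invmx k *m X *m k)) = invmx k *m expm (s *: X) *m k.
Proof.
move=> uk; have pw j : (invmx k *m X *m k : M) ^+ j = invmx k *m X ^+ j *m k.
  elim: j => [|j IH]; first by rewrite !expr0 -[1]/(1%:M) mulmx1 mulVmx.
  rewrite !exprSr IH -[LHS]/(invmx k *m X ^+ j *m k *m (invmx k *m X *m k)).
  by rewrite -[X ^+ j * X]/(X ^+ j *m X) !mulmxA mulmxK.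
apply/matrixP => a b; apply: (cvg_uniqueC (expm_entry s (invmx k *m X *m k) a b)).
have h : (fun N => \sum_(d <- index_enum 'I_n) (\sum_(c <- index_enum 'I_n) invmx k a c * series (fun j => expc s j * (X ^+ j) c d : C) N) * k d b) @ \oo -->
    \sum_(d <- index_enum 'I_n) (\sum_(c <- index_enum 'I_n) invmx k a c * expm (s *: X) c d) * k d b.
  apply: cvg_sum_seq => d; apply: cvgM; last exact: cvg_cst.
  by apply: cvg_sum_seq => c; apply: cvgMlC; exact: expm_entry.
rewrite mxE; under eq_bigr => d _ do rewrite mxE.
apply: cvg_ext h => N; rewrite -[RHS]expm_partial.
have -> : \sum_(0 <= j < N) expc s j *: (invmx k *m X *m k : M) ^+ j =
    invmx k *m (\sum_(0 <= j < N) expc s j *: X ^+ j) *m k.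
  rewrite mulmx_sumr mulmx_suml; apply: eq_bigr => j _.
  by rewrite pw -scalemxAr -scalemxAl.
rewrite mxE; apply: eq_bigr => d _; rewrite mxE; congr (_ * _); apply: eq_bigr => c _.
by rewrite expm_partial.
Qed.

End MatrixExponential.

Section RealCalculus.
Context {R : realType}.
Local Notation mu := (@lebesgue_measure R).

Lemma is_derive_bsum (I : Type) (r : seq I) (f : I -> R -> R) (df : I -> R) (t : R) :
  (forall i, is_derive t 1 (f i) (df i)) ->
  is_derive t 1 (fun s => \sum_(i <- r) f i s) (\sum_(i <- r) df i).
Proof.
move=> h; elim: r => [|i r IH].
  rewrite big_nil (_ : (fun s => _) = cst 0); last by apply/funext => s; rewrite big_nil.
  exact: is_derive_cst.
rewrite big_cons (_ : (fun s => _) = f i \+ (fun s => \sum_(i <- r) f i s)); last first.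
  by apply/funext => s; rewrite big_cons.
exact: is_deriveD.
Qed.

Lemma mvt_segment0 (f df : R -> R) (h : R) : 0 <= h ->
  (forall x : R, 0 <= x <= h -> is_derive x 1 f (df x)) ->
  exists2 c, 0 <= c <= h & f h - f 0 = df c * h.
Proof.
move=> h0 d; have cf : {within `[0, h], continuous f}.
  apply: derivable_within_continuous => x; rewrite in_itv/= => xh; by have [] := d x xh.
have d' (x : R) : x \in `]0, h[ -> is_derive x 1 f (df x).
  by rewrite in_itv/= => /andP[x0 xh]; apply: d; rewrite !ltW.
have [c] := MVT_segment h0 d' cf.
by rewrite in_itv/= subr0 => ch e; exists c.
Qed.

(** The base point [-1] puts [0], and [h + t] for [0 <= h <= 1/2] and [|t| < 1/2], inside the
    interval where the fundamental theorem is used. *)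
Definition prim (f : R -> R) (x : R) : R := \int[mu]_(t in `[-1, x]) f t.

Lemma prim_derive (f : R -> R) (x : R) : continuous f -> -1 < x < 2 -> is_derive x 1 (prim f) (f x).
Proof.
move=> cf /andP[x1 x2].
have fi : mu.-integrable `[-1, 2] (EFin \o f).
  by apply: continuous_compact_integrable; [exact: segment_compact|exact: continuous_subspaceT].
have [d e] := continuous_FTC1_closed x2 fi x1 (cf x).
by rewrite /prim -e derive1E; exact: (DeriveDef d).
Qed.

End RealCalculus.

(** * Continuous unitary one-parameter groups are differentiable *)

Section OneParameterGroup.
Context {R : realType} (V : vectType R[i]) (dotV : {dot V for Num.conj}).
Local Notation C := R[i].
Local Notation End := ('End(V)).
Variables (m : nat) (b : 'I_m -> V).
Hypotheses (ob : forall i j, dotV (b i) (b j) = (i == j)%:R)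
  (fb : forall v, v = \sum_i dotV v (b i) *: b i).
Let P := dotV_prehilbert dotV.
Variable Gam : R -> End.
Hypotheses (Gam0 : forall u, Gam 0 u = u)
  (GamD : forall s t u, Gam (s + t) u = Gam s (Gam t u))
  (GamU : forall t u v, dotV (Gam t u) (Gam t v) = dotV u v)
  (Gam_cont : forall u v, dotV (Gam t u) v @[t --> (0 : R)] --> dotV u v).

Lemma GamN t u v : dotV (Gam t u) v = dotV u (Gam (- t) v).
Proof. by rewrite -(GamU (- t)) -GamD addNr Gam0. Qed.

Definition phi u v (t : R) : R := Re (dotV (Gam t u) v).

Lemma phi_cont u v : continuous (phi u v).
Proof.
move=> t; have -> : phi u v = (fun s => Re (dotV (Gam s u) (Gam (- t) v))) \o (fun s => s - t).
  by apply/funext => s; rewrite /phi/= -GamN -GamD addrC subrK.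
have h : (fun s => Re (dotV (Gam s u) (Gam (- t) v))) @ (0 : R) --> Re (dotV u (Gam (- t) v)).
  by have [] := (cvgC_ReIm _ _).1 (@Gam_cont u (Gam (- t) v)).
have hc : (fun s => s - t) @ t --> (0 : R).
  rewrite -[X in _ --> X](subrr t); apply: cvgB; [exact: cvg_id|exact: cvg_cst].
by rewrite /continuous_at /= subrr Gam0; exact: (cvg_comp _ _ hc h).
Qed.

Definition zprim i j (t : R) : C :=
  (prim (phi (b j) (b i)) t +i* prim (phi (b j) ('i *: b i)) t)%C.

(** The operator integral of [Gam] from [-1] to [t], computed on matrix coefficients. *)
Definition Gprim (t : R) : End := \sum_i \sum_j zprim i j t *: rank1 dotV (b i) (b j).

Lemma Im_dotV u v : Im (dotV u v) = Re (dotV u ('i *: v)).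
Proof.
rewrite (dotZr P)// conjCi; case: (dotV u v) => x y /=.
by ring.
Qed.

Lemma Gprim_dot t u v : dotV (Gprim t u) v = \sum_i \sum_j zprim i j t * (dotV u (b j) * dotV (b i) v).
Proof.
rewrite sum_lfunE linear_sumlz; apply: eq_bigr => i _; rewrite sum_lfunE linear_sumlz.
by apply: eq_bigr => j _; rewrite scale_lfunE rank1E linearZl_LR/= linearZl_LR/=.
Qed.

Lemma phiE u v t : dotV (Gam t u) v = \sum_i \sum_j dotV (Gam t (b j)) (b i) *
  (dotV u (b j) * dotV (b i) v).
Proof.
rewrite {1}(fb (Gam t u)) linear_sumlz; apply: eq_bigr => i _; rewrite linearZl_LR/=.
rewrite {1}(fb u) linear_sum linear_sumlz mulr_suml; apply: eq_bigr => j _.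
by rewrite linearZ/= linearZl_LR/= mulrAC mulrC.
Qed.

Lemma phi_cpx u v t : dotV (Gam t u) v = (phi u v t +i* phi u ('i *: v) t)%C.
Proof. by apply: Cext => //=; rewrite /phi -Im_dotV. Qed.

Lemma Gprim_derive u v (t : R) : -1 < t < 2 -> is_derive t 1 (fun s => Re (dotV (Gprim s u) v)) (phi u v t).
Proof.
move=> t12; rewrite /phi phiE Re_sum.
under eq_fun => s do rewrite Gprim_dot Re_sum.
apply: is_derive_bsum => i; rewrite Re_sum; under eq_fun => s do rewrite Re_sum.
apply: is_derive_bsum => j; rewrite phi_cpx; move: (dotV u (b j) * dotV (b i) v) => [x y].
have d1 := prim_derive (@phi_cont (b j) (b i)) t12.
have d2 := prim_derive (@phi_cont (b j) ('i *: b i)) t12.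
rewrite [X in is_derive _ _ X _](_ : _ = x *: prim (phi (b j) (b i)) + (- y) *: prim (phi (b j) ('i *: b i))).
  have := is_deriveD (is_deriveZ x d1) (is_deriveZ (- y) d2).
  have -> // : x *: phi (b j) (b i) t + (- y) *: phi (b j) ('i *: b i) t =
      Re ((phi (b j) (b i) t +i* phi (b j) ('i *: b i) t)%C * (x +i* y)%C).
  rewrite -![_ *: _]/(_ * _); move: (phi _ _ _) (phi _ _ _) => p q /=; ring.
apply/funext => s; rewrite /zprim -[RHS]/(x * prim (phi (b j) (b i)) s + - y * prim (phi (b j) ('i *: b i)) s).
move: (prim _ _) (prim _ _) => p q /=; ring.
Qed.

(** The identity of [Gam t] applied to the integral of [Gam] over [[0, h]] with its integral over
    [[t, h + t]]: both sides vanish at [h = 0] and have the same derivative in [h] by the group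
    law. *)
Lemma Gprim_shift (h t : R) u v : 0 <= h <= 1 / 2 -> -(1 / 2) < t < 1 / 2 ->
  Re (dotV (Gam t ((Gprim h - Gprim 0) u)) v) =
  Re (dotV (Gprim (h + t) u) v) - Re (dotV (Gprim t u) v).
Proof.
move=> /andP[h0 h1] /andP[t0 t1]; rewrite GamN.
pose f s := Re (dotV (Gprim s u) (Gam (- t) v)) - Re (dotV (Gprim (s + t) u) v).
have df x : 0 <= x <= h -> is_derive x 1 f ((fun=> 0) x).
  move=> /andP[x0 xh]; have d1 : is_derive x 1 (fun s => Re (dotV (Gprim s u) (Gam (- t) v))) (phi u (Gam (- t) v) x).
    by apply: Gprim_derive; apply/andP; split; lra.
  have d2 : is_derive x 1 (fun s => Re (dotV (Gprim (s + t) u) v)) (phi u v (x + t)).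
    have d3 : is_derive (x + t) 1 (fun s => Re (dotV (Gprim s u) v)) (phi u v (x + t)).
      by apply: Gprim_derive; apply/andP; split; lra.
    have d4 : is_derive x 1 (fun s : R => s + t) 1.
      by apply: is_derive_eq; rewrite addr0.
    have := is_derive1_comp (g := fun s : R => s + t) d3 d4; rewrite mulr1; exact.
  have := is_deriveB d1 d2; rewrite /phi -GamN -GamD (addrC t) subrr; exact.
have [c _] := mvt_segment0 h0 df; rewrite mul0r /f add0r => /eqP; rewrite subr_eq0 => /eqP e.
rewrite add_lfunE opp_lfunE (dotBl P)// ReB; move: e; lra.
Qed.

Lemma phi_lower (e : R) c u : (forall i j, cab (dotV (Gam c (b j)) (b i) - (i == j)%:R) <= e) ->
  (1 - e * (m * m)%:R) * nsqd dotV u <= phi u u c.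
Proof.
move=> h; have E : dotV (Gam c u) u - dotV u u =
    \sum_i \sum_j dotV u (b j) * (dotV u (b i))^* * (dotV (Gam c (b j)) (b i) - (i == j)%:R).
  rewrite -{3}(Gam0 u) !phiE -sumrB; apply: eq_bigr => i _; rewrite -sumrB; apply: eq_bigr => j _.
  by rewrite Gam0 ob -mulrBl mulrC (ph_sym P (f := u))// [j == i]eq_sym.
have bd : cab (dotV (Gam c u) u - dotV u u) <= e * (m * m)%:R * nsqd dotV u.
  have ub i : cab (dotV u (b i)) <= nrmd dotV u.
    apply: le_trans (CS P (f := u) (g := b i) I I) _.
    by rewrite [X in _ * X](_ : _ = 1) ?mulr1// /nrmd /nsqd ob eqxx sqrtr1.
  rewrite E; apply: (@le_trans _ _ (\sum_(i < m) \sum_(j < m) e * nsqd dotV u)); last first.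
    by rewrite !sumr_const !card_ord -mulrnA -[leLHS]mulr_natr mulrAC.
  have csum (J : Type) (r : seq J) (g : J -> C) : cab (\sum_(i <- r) g i) <= \sum_(i <- r) cab (g i).
    elim: r => [|i r IH]; first by rewrite !big_nil (_ : cab 0 = 0)//; apply/eqP; rewrite cab_eq0.
    by rewrite !big_cons; apply: le_trans (cabD _ _) _; rewrite lerD2l.
  apply: le_trans (csum _ _ _) _; apply: ler_sum => i _.
  apply: le_trans (csum _ _ _) _; apply: ler_sum => j _.
  rewrite cabM mulrC; apply: ler_pM; [exact: cab_ge0|exact: cab_ge0|exact: h|].
  rewrite cabM cabJ -(nrm_sqr P (f := u) I) expr2.
  by apply: ler_pM; [exact: cab_ge0|exact: cab_ge0|exact: ub|exact: ub].
have r1 := cab_Re (dotV (Gam c u) u - dotV u u).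
have := le_trans r1 bd; rewrite ReB -/(phi u u c) -/(nsqd dotV u) ler_norml => /andP[+ _].
move: (nsqd _ _) (phi _ _ _) => x y; lra.
Qed.

(** For small [h] the integral [N] of [Gam] over [[0, h]] is invertible, as [Re <N u, u>] is [h]
    times a value of [Re <Gam c u, u>], positive for nonzero [u] by [phi_lower]. With [w = N u],
    [Gprim_shift] writes [Gam t w] as a difference of primitives, hence differentiable, with
    derivative [(Gam h - 1) u] at 0. *)
Theorem Gam_generator : exists D : End, forall w v,
  is_derive (0 : R) 1 (fun t => Re (dotV (Gam t w) v)) (Re (dotV (D w) v)).
Proof.
(* Ensures [e m^2 < 1], which makes the constant of [phi_lower] positive. *)
pose e : R := (2 * (m * m)%:R + 1)^-1.
have m0 : 0 <= (m * m)%:R :> R by [].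
have e0 : 0 < e by rewrite invr_gt0; move: m0; lra.
have em : e * (m * m)%:R < 1.
  by rewrite mulrC ltr_pdivrMr ?mul1r; move: m0; lra.
have nr : \forall t \near (0 : R), forall p : 'I_m * 'I_m,
    cab (dotV (Gam t (b p.2)) (b p.1) - (p.1 == p.2)%:R) <= e.
  apply: (filter_forall (nbhs_filter (0 : R))) => -[i j] /=.
  have /cvgCP/cvgr0Pnorm_le/(_ _ e0) := @Gam_cont (b j) (b i).
  by apply: filterS => t; rewrite ob eq_sym ger0_norm// cab_ge0.
have [d d0 hd] := (nbhs_ballP _ _).1 nr.
pose h := Num.min (d / 2) (1 / 2).
have h0 : 0 < h by rewrite lt_min !divr_gt0.
have h1 : h <= 1 / 2 by rewrite ge_min lexx orbT.
have hd2 : h <= d / 2 by rewrite ge_min lexx.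
pose N := Gprim h - Gprim 0.
have NE u : Re (dotV (N u) u) = Re (dotV (Gprim h u) u) - Re (dotV (Gprim 0 u) u).
  by rewrite add_lfunE opp_lfunE (dotBl P)// ReB.
have Ninj u : N u = 0 -> u = 0.
  move=> Nu; have [|c /andP[c0 ch]] := @mvt_segment0 _ (fun s => Re (dotV (Gprim s u) u)) (phi u u) h (ltW h0).
    by move=> x /andP[x0 xh]; apply: Gprim_derive; apply/andP; split; lra.
  rewrite -NE Nu (dot0l P)//= => e1.
  have p0 : phi u u c = 0.
    by move/esym/eqP: e1; rewrite mulf_eq0 (gt_eqF h0) orbF => /eqP.
  have := @phi_lower e c u; rewrite p0 => lo.
  have : (1 - e * (m * m)%:R) * nsqd dotV u <= 0.
    apply: lo => i j; apply: (hd c _ (i, j)); rewrite /ball/= sub0r normrN ger0_norm//.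
    by apply: le_lt_trans ch _; apply: le_lt_trans hd2 _; rewrite ltr_pdivrMr// ltr_pMr// ltr1n.
  rewrite pmulr_rle0 ?subr_gt0// => nu; apply: (dotV_def (dotV := dotV)).
  by apply/eqP; rewrite eq_le nu (nsq_ge0 P).
have k0 : lker N == 0%VS.
  by rewrite -subv0; apply/subvP => v; rewrite memv_ker => /eqP /Ninj ->; exact: mem0v.
exists ((Gam h - \1) \o N^-1)%VF => w v; pose u := (N^-1)%VF w.
have wE : w = N u by rewrite /u lker0_lfunVK.
have d1 : is_derive (0 : R) 1 (fun s => Re (dotV (Gprim (h + s) u) v)) (phi u v h).
  have d3 : is_derive (h + 0) 1 (fun s => Re (dotV (Gprim s u) v)) (phi u v (h + 0)).
    by apply: Gprim_derive; rewrite addr0; apply/andP; split; lra.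
  have d4 : is_derive (0 : R) 1 (fun s : R => h + s) 1.
    have -> : (fun s : R => h + s) = (fun s : R => s + h) by apply/funext => s; rewrite addrC.
    by apply: is_derive_eq; rewrite addr0.
  by have := is_derive1_comp (g := fun s : R => h + s) d3 d4; rewrite mulr1 addr0; exact.
have d2 : is_derive (0 : R) 1 (fun s => Re (dotV (Gprim s u) v)) (phi u v 0).
  by apply: Gprim_derive; apply/andP; split; lra.
have d3 := is_deriveB d1 d2.
have -> : Re (dotV (((Gam h - \1) \o N^-1)%VF w) v) = phi u v h - phi u v 0.
  by rewrite comp_lfunE add_lfunE opp_lfunE id_lfunE (dotBl P)// ReB /phi Gam0.
apply: (near_eq_is_derive (f := (fun s => Re (dotV (Gprim (h + s) u) v)) - (fun s => Re (dotV (Gprim s u) v)))) => //.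
near=> t; rewrite /= !fctE wE Gprim_shift//.
- by rewrite (ltW h0).
- apply/andP; split; near: t; [apply: lt_nbhsr|apply: lt_nbhsl]; lra.
Unshelve. all: by end_near. Qed.

Corollary Gam_cderive : exists D : End, forall w v,
  cderive (fun t => dotV (Gam t w) v) 0 = dotV (D w) v.
Proof.
have [D hD] := Gam_generator; exists D => w v; apply: Cext.
  by rewrite /= derive1E; have h := hD w v; rewrite derive_val.
rewrite /= derive1E Im_dotV; have h := hD w ('i *: v).
under eq_fun => t do rewrite Im_dotV.
by rewrite derive_val.
Qed.

End OneParameterGroup.

(** * Compactness of the group and measurability on the orbit *)

Section CompactSeparation.
Context {R : realType} {T : topologicalType} (A : set T) (cA : compact A) {I : Type}.
Variables (g : I -> T -> R) (f : T -> R).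
Hypotheses (cg : forall i, {within A, continuous (g i)}) (cf : {within A, continuous f})
  (gf : forall k l, A k -> A l -> (forall i, g i k = g i l) -> f k = f l).

(** Otherwise the sets [B L] of pairs that the inequalities in [L] fail to distinguish generate a
    proper filter on [A x A], and a cluster point [(k, l)] has [f k <= a < c <= f l] although no
    [g i] separates [k] from [l]. *)
Lemma compact_separation (a c : R) : a < c -> exists L : seq (I * R), forall k l, A k -> A l ->
  f k <= a -> c <= f l -> all (fun p => (g p.1 k < p.2) == (g p.1 l < p.2)) L = false.
Proof.
move=> ac; apply: contrapT => /forallNP no.
pose B (L : seq (I * R)) : set (T * T) := [set p | [/\ A p.1, A p.2, f p.1 <= a, c <= f p.2 &
  all (fun q => (g q.1 p.1 < q.2) == (g q.1 p.2 < q.2)) L]].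
have FF : Filter (filter_from [set: seq (I * R)] B).
  apply: filter_from_filter; first by exists [::].
  move=> L1 L2 _ _; exists (L1 ++ L2) => // p [a1 a2 a3 a4]; rewrite all_cat => /andP[h1 h2].
  by split; split.
have PF : ProperFilter (filter_from [set: seq (I * R)] B).
  apply: filter_from_proper => L _; have /existsNP[k /existsNP[l h]] := no L.
  exists (k, l) => /=; move: h => /not_implyP[Ak /not_implyP[Al /not_implyP[h1 /not_implyP[h2 h3]]]].
  by split => //; apply: contrapT => /negP/negbTE.
have [|[k l] [/= [Ak Al] cl]] := compact_setX cA cA PF.
  by exists [::] => // p [].
have meet L (N1 N2 : set T) : nbhs k N1 -> nbhs l N2 -> exists k' l', [/\ B L (k', l'), N1 k' & N2 l'].
  move=> h1 h2; have FB : filter_from [set: seq (I * R)] B (B L) by exists L.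
  have NN : nbhs (k, l) (N1 `*` N2) by exists (N1, N2).
  by have [[k' l'] [Bp [/= n1 n2]]] := cl _ _ FB NN; exists k', l'.
have nT (x : T) : nbhs x [set: T] by exact: (@filterT _ _ (nbhs_filter x)).
have above (h : T -> R) (x : T) (q : R) : {within A, continuous h} -> A x -> q < h x -> nbhs x [set y | A y -> q < h y].
  by move=> ch Ax qx; have := (@subspace_continuousP _ _ _ _).1 ch x Ax => /cvgr_gt/(_ _ qx).
have below (h : T -> R) (x : T) (q : R) : {within A, continuous h} -> A x -> h x < q -> nbhs x [set y | A y -> h y < q].
  by move=> ch Ax qx; have := (@subspace_continuousP _ _ _ _).1 ch x Ax => /cvgr_lt/(_ _ qx).
have fk : f k <= a.
  rewrite leNgt; apply/negP => h; have [k' [l' [[a1 _ h1 _ _] /(_ a1) h2 _]]] := meet [::] _ _ (above _ _ _ cf Ak h) (nT l).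
  by move: h1; rewrite leNgt h2.
have fl : c <= f l.
  rewrite leNgt; apply/negP => h; have [k' [l' [[_ a1 _ h1 _] _ /(_ a1) h2]]] := meet [::] _ _ (nT k) (below _ _ _ cf Al h).
  by move: h1; rewrite leNgt h2.
suff e : f k = f l by move: fl; rewrite -e leNgt (le_lt_trans fk ac).
apply: gf => // i; apply: le_anti; rewrite !leNgt -negb_or; apply/negP => /orP[] h.
(* The single inequality at the midpoint distinguishes all pairs close to [(k, l)], against [B
   [:: (i, q)]] meeting every neighbourhood. *)
- pose q := (g i k + g i l) / 2.
  have [q1 q2] : g i l < q /\ q < g i k by rewrite /q; split; lra.
  have [k' [l' [[/= a1 a2 _ _]]]] := meet [:: (i, q)] _ _ (above _ _ _ (@cg i) Ak q2) (below _ _ _ (@cg i) Al q1).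
  by rewrite /= andbT => + /(_ a1) h1 /(_ a2) h2; rewrite h2 (lt_gtF h1).
- pose q := (g i k + g i l) / 2.
  have [q1 q2] : g i k < q /\ q < g i l by rewrite /q; split; lra.
  have [k' [l' [[/= a1 a2 _ _]]]] := meet [:: (i, q)] _ _ (below _ _ _ (@cg i) Ak q1) (above _ _ _ (@cg i) Al q2).
  by rewrite /= andbT => + /(_ a1) h1 /(_ a2) h2; rewrite h1 (lt_gtF h2).
Qed.

End CompactSeparation.

Section CompactGroup.
Context {R : realType} {n : nat}.
Local Notation C := R[i].
Local Notation M := 'M[C]_n.

(** The rows of a unitary matrix are unit vectors, so [K] is closed in a compact box of entries; the
    box is built in row vectors and carried to matrices by [vec_mx]. *)
Lemma usub_compact (K : unitary_subgroup R n) : compact (K : set M).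
Proof.
pose D : set C := (fun p : R * R => (p.1 +i* p.2)%C) @` (`[-1, 1] `*` `[-1, 1]).
have cD : compact D.
  apply: continuous_compact; last by apply: compact_setX; exact: segment_compact.
  apply: continuous_subspaceT => p; apply/cvgC_ReIm; split => /=.
    exact: cvg_fst.
  exact: cvg_snd.
have cB : compact (vec_mx @` [set v : 'rV[C]_(n * n) | forall i, D (v ord0 i)] : set M).
  apply: continuous_compact; last exact: (@rV_compact C _ (fun=> D) (fun=> cD)).
  apply: continuous_subspaceT => v; apply: (@cvg_mx _ _ _ _ _ (nbhs_filter v)) => a b.
  under eq_fun => w do rewrite mxE.
  by rewrite mxE; exact: coord_continuous.
apply: (subclosed_compact (@usub_closed R n K) cB) => k Kk; exists (mxvec k); last exact: mxvecK.
move=> i; case/mxvec_indexP: i => a c; rewrite mxvecE.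
have u : cab (k a c) <= 1.
  rewrite -(@ler_pXn2r _ 2)// ?nnegrE ?cab_ge0// expr1n.
  have /unitarymxP/matrixP/(_ a a) := usub_unitary Kk; rewrite !mxE eqxx => /(congr1 (@complex.Re R)).
  rewrite Re_sum /= => <-; rewrite (bigD1 c)//= !mxE mulJ_cab /= lerDl.
  by apply: sumr_ge0 => j _; rewrite !mxE mulJ_cab /= sqr_ge0.
have r1 := le_trans (cab_Re (k a c)) u; have r2 := le_trans (cab_Im (k a c)) u.
exists (Re (k a c), Im (k a c)); last by case: (k a c).
by split; rewrite /= in_itv/= -ler_norml.
Qed.

Lemma csum_cvg (T : Type) (F : set_system T) {FF : Filter F} (I : Type) (r : seq I) (h : I -> T -> C) (l : I -> C) :
  (forall i, h i @ F --> l i) -> (fun x => \sum_(i <- r) h i x) @ F --> \sum_(i <- r) l i.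
Proof.
move=> hl; elim: r => [|i r IH].
  rewrite big_nil; under eq_fun => x do rewrite big_nil; exact: cvg_cst.
rewrite big_cons; under eq_fun => x do rewrite big_cons.
exact: (cvgD (hl i) IH).
Qed.

Lemma expm_cvg1 (X : M) : expm (t%:C *: X) @[t --> (0 : R)] --> (1%:M : M).
Proof.
apply: cvg_mx => a b.
apply: (@cvg0C_le _ _ _ _ _ _ (fun t : R => expR (`|t| * mxsum X) - 1)) => [t|].
  by rewrite mxE; apply: le_trans (expm_bound _ _ _ _) _; rewrite cab_real.
have : (fun t : R => expR (`|t| * mxsum X) - 1) @ (0 : R) --> expR (`|0 : R| * mxsum X) - 1.
  apply: cvgB; last exact: cvg_cst.
  have c1 : (fun t : R => `|t| * mxsum X) @ (0 : R) --> `|0 : R| * mxsum X.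
    by apply: cvgM; [exact: norm_continuous|exact: cvg_cst].
  exact: (cvg_comp _ _ c1 (@continuous_expR R _)).
by rewrite normr0 mul0r expR0 subrr.
Qed.

End CompactGroup.

Section BerezinMeasurable.
Context {R : realType} {n : nat} (K : unitary_subgroup R n).
Context (V : vectType R[i]) (dotV : {dot V for Num.conj}).
Local Notation C := R[i].
Local Notation End := ('End(V)).
Variables (m : nat) (b : 'I_m -> V).
Hypotheses (ob : forall i j, dotV (b i) (b j) = (i == j)%:R)
  (fb : forall v, v = \sum_i dotV v (b i) *: b i).
Variables (rho : 'M[C]_n -> End) (hrho : unitary_irrep K dotV rho).
Variables (phi0 : 'M[C]_n -> R) (hphi0 : lie_dual K phi0) (e0 : V)
  (hassoc : associated K dotV rho phi0 e0).
Local Notation orb := (orbit_space K phi0).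
Local Notation s1 := (@berezin R n K V dotV rho phi0 e0).
Let P := dotV_prehilbert dotV.

Definition bsym (A : End) (k : 'M[C]_n) : C := dotV (A (rho k e0)) (rho k e0).

Lemma bsym_cvg A k : K k -> bsym A l @[l --> within (usub K) (nbhs k)] --> bsym A k.
Proof.
move=> Kk; have [_ _ hc _ _] := hrho.
have c i : dotV (rho l e0) (b i) @[l --> within (usub K) (nbhs k)] --> dotV (rho k e0) (b i).
  exact: ((@subspace_continuousP _ _ _ _).1 (hc e0 (b i)) k Kk).
have E l : bsym A l = \sum_i \sum_j dotV (A (b i)) (b j) * (dotV (rho l e0) (b i) * (dotV (rho l e0) (b j))^*).
  rewrite /bsym {1}(fb (rho l e0)) linear_sum linear_sumlz; apply: eq_bigr => i _.
  rewrite linearZ/= linearZl_LR/= {2}(fb (rho l e0)) linear_sumr mulr_sumr.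
  by apply: eq_bigr => j _; rewrite linearZr_LR/=; ring.
rewrite E; under eq_fun => l do rewrite E.
apply: csum_cvg => i; apply: csum_cvg => j; apply: cvgM; first exact: cvg_cst.
by apply: cvgM; [exact: c|exact: cvgJ (c j)].
Qed.

Lemma bsym_continuous A : {within (usub K), continuous (fun k => Re (bsym A k))} /\
  {within (usub K), continuous (fun k => Im (bsym A k))}.
Proof.
by split; apply/subspace_continuousP => k Kk; have [] := (cvgC_ReIm _ _).1 (@bsym_cvg A k Kk).
Qed.

Lemma lie_conj X k : lie K X -> K k -> lie K (invmx k *m X *m k).
Proof.
move=> LX Kk t; rewrite expm_conj; last exact: Kunit Kk.
by apply: usubM => //; apply: usubM; [exact: usubV|exact: LX].
Qed.

Lemma lie_generator X : lie K X -> exists D : End, forall w v,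
  cderive (fun t => dotV (rho (expm (t%:C *: X)) w) v) 0 = dotV (D w) v.
Proof.
move=> LX; apply: (Gam_cderive ob fb (Gam := fun t => rho (expm (t%:C *: X)))).
- by move=> u; rewrite expm0 (rho1 hrho).
- by move=> s t u; rewrite CRD expmD (rhoM hrho)//; exact: LX.
- by move=> t u v; rewrite (rhoU hrho)//; exact: LX.
- move=> u v; have [_ _ hc _ _] := hrho; have K1 := usub1 K.
  have h : (fun k => dotV (rho k u) v) @ within (usub K) (nbhs (1%:M : 'M[C]_n)) --> dotV u v.
    by rewrite -{2}(rho1 hrho u); exact: ((@subspace_continuousP _ _ _ _).1 (hc u v) 1%:M K1).
  apply: cvg_comp h => S /= hS.
  have hn : nbhs (0 : R) [set t | K (expm (t%:C *: X)) -> S (expm (t%:C *: X))] := @expm_cvg1 _ _ X _ hS.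
  by apply: filterS hn => t ht; exact: (ht (LX t)).
Qed.

(** The value [phi0(k^-1 X k)] is [-i <drho(k^-1 X k) e0, e0>], and moving [k] to the vectors makes
    it [-i] times the symbol at [k] of the generator [D] of [rho(exp(t X))], which is continuous in
    [k]. *)
Lemma coad_lie X : lie K X -> exists D : End, forall k, K k -> coad k phi0 X = Re (- 'i * bsym D k).
Proof.
move=> LX; have [D hD] := lie_generator LX; exists D => k Kk.
have [_ hphi _] := hassoc; have LkX := lie_conj LX Kk.
have Kk' := usubV Kk.
have -> : coad k phi0 X = Re (phi0 (invmx k *m X *m k))%:C by [].
rewrite (hphi _ LkX); congr (Re (_ * _)).
suff -> : drho rho (invmx k *m X *m k) e0 = rho (invmx k) (D (rho k e0)).
  by rewrite /bsym -[LHS](rhoU hrho _ _ Kk) (rhoV' hrho).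
rewrite /drho [RHS](coord_vbasis (memvf _)); apply: eq_bigr => i _; congr (_ *: _).
(* The vector representing the coordinate form composed with [rho (invmx k)]; it turns the
   coordinatewise [drho] into derivatives of matrix coefficients. *)
pose w := \sum_j (coord (vbasis {:V}) i (rho (invmx k) (b j)))^* *: b j.
have wE x : coord (vbasis {:V}) i (rho (invmx k) x) = dotV x w.
  rewrite {1}(fb x) linear_sum linear_sum linear_sumr; apply: eq_bigr => j _.
  by rewrite linearZ/= linearZ/= (dotZr P)// CJK mulrC.
rewrite wE -hD; congr (cderive _ 0); apply/funext => t.
have Ke : K (expm (t%:C *: X)) by exact: LX.
by rewrite expm_conj ?(Kunit Kk)// (rhoM hrho _ (usubM Kk' Ke) Kk) (rhoM hrho _ Kk' Ke) wE.
Qed.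

(** On the Lie algebra by [coad_lie]. Off it, conjugates of [X] stay off it and the extension of
    [phi0] by zero makes the function vanish on [K]. *)
Lemma coad_continuous X : {within (usub K), continuous (fun k => coad k phi0 X)}.
Proof.
have [LX|nLX] := pselect (lie K X).
  have [D hD] := coad_lie LX; apply/subspace_continuousP => k Kk.
  suff : (fun l => coad l phi0 X) @ within (usub K) (nbhs k) --> coad k phi0 X by [].
  rewrite (hD k Kk).
  have c : (- 'i * bsym D l) @[l --> within (usub K) (nbhs k)] --> - 'i * bsym D k.
    by apply: cvgM; [exact: cvg_cst|exact: bsym_cvg].
  have [c' _] := (cvgC_ReIm _ _).1 c.
  apply: cvg_trans c'; apply: near_eq_cvg; rewrite near_withinE.
  by apply: filterE => l Kl; rewrite hD.
have z k : K k -> coad k phi0 X = 0.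
  move=> Kk; have [_ h] := hphi0; apply: h => L; apply: nLX.
  have := lie_conj L (usubV Kk); rewrite invmxK !mulmxA mulmxV ?mul1mx; last exact: Kunit Kk.
  by rewrite -mulmxA mulmxV ?mulmx1//; exact: Kunit Kk.
apply/subspace_continuousP => k Kk.
suff : (fun l => coad l phi0 X) @ within (usub K) (nbhs k) --> coad k phi0 X by [].
rewrite (z k Kk).
have c : (fun _ : 'M[C]_n => 0 : R) @ within (usub K) (nbhs k) --> (0 : R) by exact: cvg_cst.
apply: cvg_trans c; apply: near_eq_cvg; rewrite near_withinE.
by apply: filterE => l Kl; rewrite z.
Qed.

(** [S] may be any set of Boolean patterns, since the length of [L] leaves finitely many of them. *)
Lemma measurable_pattern (L : seq ('M[C]_n * R)) (S : set (seq bool)) :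
  measurable [set phi : orb | S [seq val phi p.1 < p.2 | p <- L]].
Proof.
elim: L S => [|[X q] L IH] S /=.
  have [h|h] := pselect (S [::]).
    by rewrite (_ : [set _ : orb | _] = setT); [exact: measurableT|apply/seteqP; split].
  by rewrite (_ : [set _ : orb | _] = set0); [exact: measurable0|apply/seteqP; split].
have mX : measurable [set phi : orb | val phi X < q].
  have := (@measurable_orb_val R n K phi0 X : measurable_fun [set: orb] _) measurableT _ (measurable_itv `]-oo, q[).
  rewrite setTI; congr measurable; apply/seteqP; split => phi /=; rewrite in_itv/=; exact.
have -> : [set phi : orb | S ((val phi X < q) :: [seq val phi p.1 < p.2 | p <- L])] =
    ([set phi : orb | val phi X < q] `&` [set phi : orb | S (true :: [seq val phi p.1 < p.2 | p <- L])]) `|`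
    (~` [set phi : orb | val phi X < q] `&` [set phi : orb | S (false :: [seq val phi p.1 < p.2 | p <- L])]).
  apply/seteqP; split => phi /=.
    by case: (val phi X < q) => h; [left|right]; split.
  by case=> -[]; [move=> -> //|move=> /negP/negbTE -> //].
apply: measurableU; apply: measurableI => //.
- exact: (IH [set s | S (true :: s)]).
- exact: measurableC.
- exact: (IH [set s | S (false :: s)]).
Qed.

(** The set [a <= F] is the intersection over [i] of measurable sets containing it and missing
    [F <= a - 1/(i+1)]; each is a condition on finitely many inequalities [phi X < q], given by
    [compact_separation] on [K]. *)
Lemma measurable_orb_fun (f : 'M[C]_n -> R) (F : orb -> R) : {within (usub K), continuous f} ->
  (forall k phi, K k -> val phi = coad k phi0 -> F phi = f k) -> measurable_fun [set: orb] F.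
Proof.
move=> cf Ff.
have sep (a c : R) : a < c -> exists2 S : set orb, measurable S &
    (forall phi, c <= F phi -> S phi) /\ (forall phi, F phi <= a -> ~ S phi).
  move=> ac; have gf k l : K k -> K l -> (forall X, coad k phi0 X = coad l phi0 X) -> f k = f l.
    move=> Kk Kl /funext e; have o : coad k phi0 \in Defs.orbit K phi0 by apply/mem_set; exists k.
    by rewrite -(Ff k (exist _ (coad k phi0) o) Kk erefl) -(Ff l (exist _ (coad k phi0) o) Kl e).
  have [L hL] := compact_separation (@usub_compact R n K) coad_continuous cf gf ac.
  pose S : set (seq bool) := [set s | exists2 l, K l & c <= f l /\ s = [seq coad l phi0 p.1 < p.2 | p <- L]].
  exists [set phi : orb | S [seq val phi p.1 < p.2 | p <- L]]; first exact: measurable_pattern.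
  split=> phi; have [k Kk pk] := orb_rep phi; rewrite (Ff k phi Kk pk) => h /=.
    by exists k => //; split => //; rewrite pk.
  case=> l Kl [cl]; rewrite pk => e; have := hL k l Kk Kl h cl => /negP; apply.
  clear -e; elim: L e => [//|p L IH] /= [-> /IH ->]; by rewrite eqxx.
apply: (measurability _ (RGenCInfty.measurableE R)) => //.
move=> _ [_ [a ->] <-]; rewrite setTI.
have d (i : nat) : a - i.+1%:R^-1 < a by rewrite ltrBlDr ltrDl invr_gt0.
have /choice[S hS] : forall i : nat, exists S : set orb, measurable S /\
    ((forall phi, a <= F phi -> S phi) /\ (forall phi, F phi <= a - i.+1%:R^-1 -> ~ S phi)).
  by move=> i; have [S mS h] := sep _ _ (d i); exists S.
rewrite (_ : _ @^-1` _ = \bigcap_i S i).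
  by apply: bigcapT_measurable => i; have [] := hS i.
apply/seteqP; split => phi /=; rewrite in_itv/= andbT.
  by move=> h i _; have [_ [h1 _]] := hS i; exact: h1.
move=> h; rewrite leNgt; apply/negP => Fa.
have [i hi] : exists i : nat, i.+1%:R^-1 < a - F phi.
  exists (Num.truncn (a - F phi)^-1); rewrite invf_plt ?posrE ?subr_gt0//.
  exact: truncnS_gt.
have [_ [_ h2]] := hS i; apply: (h2 phi); last exact: h.
by apply: ltW; rewrite ltrBrDr -ltrBrDl.
Qed.

Theorem berezin_measurable A : cmeasurable (s1 A).
Proof.
have [c1 c2] := bsym_continuous A.
split; [apply: (measurable_orb_fun c1)|apply: (measurable_orb_fun c2)] => k phi Kk pk;
  by rewrite (berezinE hrho hassoc A Kk pk).
Qed.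

End BerezinMeasurable.

Theorem proposition6p2
  (R : realType) (n : nat) (hn : (0 < n)%N) (lam : {posnum R})
  (K : unitary_subgroup R n)
  (V : vectType R[i]) (dotV : {dot V for Num.conj})
  (rho : 'M[R[i]]_n -> 'End(V)) (hrho : unitary_irrep K dotV rho)
  (phi0 : 'M[R[i]]_n -> R) (hphi0 : lie_dual K phi0)
  (e0 : V) (hassoc : associated K dotV rho phi0 e0)
  (hinj : injective (@berezin R n K V dotV rho phi0 e0))
  (nu : {finite_measure set (orbit_space K phi0) -> \bar R})
  (hnu0 : nu [set: orbit_space K phi0] <> 0%E)
  (hnu : forall k (X : set (orbit_space K phi0)), K k -> measurable X ->
    nu (coad_orbit k @^-1` X) = nu X) :
  exists W : (('cV[R[i]]_n -> V) -> 'cV[R[i]]_n -> V) ->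
             Cn R n * orbit_space K phi0 -> R[i],
    [/\ is_weyl_map lam dotV rho e0 nu W,
        forall W', is_weyl_map lam dotV rho e0 nu W' ->
          forall A, trace_class (fockV lam dotV) (fockV_dot lam dotV) A ->
            W' A = W A
      & stratonovich_weyl (fockV lam dotV) (fockV_dot lam dotV)
          (motion_group K) (@motion_inv R n) (motion_rep lam rho)
          (@motion_act R n lam K phi0) (fock_measure n lam \x nu)%E W].
Proof.
have [_ _ _ V0 _] := hrho.
have [m [b [_ ob fb]]] := onbV_exists dotV V0.
apply: (weyl_correspondence hn lam hrho hassoc hinj _ hnu0 hnu) => A.
exact: (berezin_measurable ob fb hrho hphi0 hassoc).
Qed.
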